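(* Let $A$ be a $C^*$-algebra, let $p_1$ and $p_2$ be open projections in $A^{**}$, and let $T:X(p_1,p_2)\to X(1,p_2)$ be a local linear transformation. Then the closed two-sided ideal of $A$ generated by $X(p_1,p_2)$ can be written as a (finite) direct sum $A_0\oplus A_1\oplus\dots\oplus A_n$ such that $X(p_1,p_2)=\bigoplus_{i=0}^n[X(p_1,p_2)\cap A_i]$, $A_i=\mathcal K(H_i)$ for $i>0$ (for some Hilbert spaces $H_i$), and $$T(x_0\oplus x_1\oplus\dots\oplus x_n)=t_0x_0\oplus t_1x_1\oplus\dots\oplus t_nx_n\qquad (x_i\in X(p_1,p_2)\cap A_i)$$ for some $t_0\in A_0^{**}$ and some (possibly discontinuous) linear transformations $t_i:\pi_i^{**}(p_1)H_i\to H_i$ ($i>0$), where $\pi_i$ is the irreducible representation corresponding to $A_i$.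
   Context: $A^{**}$ is the enveloping von Neumann algebra (bidual) of $A$, and for a representation $\pi$ of $A$, $\pi^{**}$ is its unique normal extension to $A^{**}$. For a closed two-sided ideal $I$ of $A$, $I^{**}$ is regarded as a direct summand of $A^{**}$. A projection $p\in A^{**}$ is open if it is the strong limit of an increasing net of positive elements of $A$. For open projections $p_1,p_2\in A^{**}$, $X(p_1,p_2)=A\cap(p_1A^{**}p_2)$; in particular $X(1,p_2)=A\cap(A^{**}p_2)$. A linear transformation $T:X(p_1,p_2)\to X(1,p_2)$ (not assumed bounded) is local if for every open projection $q\in A^{**}$ with $q\le p_2$ and every $x\in X(p_1,p_2)$, $xq=0$ implies $(Tx)q=0$. $\mathcal K(H)$ is the algebra of compact operators on $H$. The irreducible representation $\pi_i$ of $A$ on $H_i$ corresponding to the ideal $A_i=\mathcal K(H_i)$ is the unique extension to $A$ of the identity representation of $\mathcal K(H_i)$; on $A_0\oplus\dots\oplus A_n$ it is the projection onto the $i$-th summand. For $i>0$, $t_ix_i$ is the composition of $x_i$, an operator on $H_i$ with range in $\pi_i^{**}(p_1)H_i$, with $t_i$. The case $n=0$ and the case $A_0=\{0\}$ are allowed. *)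

(* Defs.v *)
From HB Require Import structures.
From mathcomp Require Import all_boot all_order all_algebra.
From mathcomp Require Import complex.
From mathcomp Require Import all_classical all_reals all_analysis.

Set Implicit Arguments.
Unset Strict Implicit.
Unset Printing Implicit Defensive.

Import Order.TTheory GRing.Theory Num.Theory.
Import numFieldNormedType.Exports.

Local Open Scope classical_set_scope.
Local Open Scope ring_scope.
Local Open Scope complex_scope.

(* Not necessarily unital C*-algebras over R[i]. *)
HB.mixin Record isCStarAlgebra (R : realType) (A : Type)
    of CompleteNormedModule R[i] A := {
  amul : A -> A -> A;
  astar : A -> A;
  amul_bilinear : bilinear_for *:%R *:%R amul;
  amulA : associative amul;
  astar_antilinear : forall (c : R[i]) (x y : A),
    astar (c *: x + y) = Num.conj c *: astar x + astar y;
  astarK : involutive astar;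
  astarM : forall x y : A, astar (amul x y) = amul (astar y) (astar x);
  norm_amul : forall x y : A, `|amul x y| <= `|x| * `|y|;
  cstar_identity : forall x : A, `|amul (astar x) x| = `|x| ^+ 2 }.

#[short(type="cstarType")]
HB.structure Definition CStarAlgebra (R : realType) :=
  {A of isCStarAlgebra R A & CompleteNormedModule R[i] A}.

(* The inner product is linear in its first variable. *)
HB.mixin Record isHilbert (R : realType) (H : Type)
    of CompleteNormedModule R[i] H := {
  inner : {dot H for @Num.conj R[i]};
  inner_norm : forall x : H, `|x| ^+ 2 = inner x x }.

#[short(type="hilbertType")]
HB.structure Definition Hilbert (R : realType) :=
  {H of isHilbert R H & CompleteNormedModule R[i] H}.

Definition dotp (R : realType) (H : hilbertType R) (x y : H) : R[i] :=
  inner x y.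

Section Linear.
Context {R : realType}.

Definition subspace_of (V : lmodType R[i]) (S : set V) : Prop :=
  S 0 /\ forall (c : R[i]) x y, S x -> S y -> S (c *: x + y).

Definition linear_on (V W : lmodType R[i]) (S : set V) (f : V -> W) : Prop :=
  forall (c : R[i]) x y, S x -> S y -> f (c *: x + y) = c *: f x + f y.

(* Internal direct sum: every element of S is in exactly one way a sum of
   elements of the subspaces S_ i, and all such sums belong to S. *)
Definition direct_sum (V : zmodType) (m : nat) (S : set V)
    (S_ : 'I_m -> set V) : Prop :=
  S = [set \sum_(i < m) x i | x in [set x : 'I_m -> V | forall i, S_ i (x i)]]
  /\ forall x : 'I_m -> V, (forall i, S_ i (x i)) ->
       \sum_(i < m) x i = 0 -> forall i, x i = 0.

End Linear.

Section Nets.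

Definition directed (I : Type) (le : I -> I -> Prop) : Prop :=
  [/\ inhabited I, forall i, le i i,
      forall i j k, le i j -> le j k -> le i k
    & forall i j, exists k, le i k /\ le j k].

Definition tails (I : Type) (le : I -> I -> Prop) : set_system I :=
  filter_from [set: I] (fun i => [set j | le i j]).

End Nets.

Section Operators.
Context {R : realType} {H : hilbertType R}.
Implicit Types S T : H -> H.

Definition bounded_op T : Prop := linear T /\ continuous T.

Definition adjoint_op S T : Prop := forall x y, dotp (S x) y = dotp x (T y).

Definition op_le S T : Prop := forall x, dotp (S x) x <= dotp (T x) x.

(* {ptws H -> H} restricted to the bounded operators is the strong operator
   topology. *)
Definition strong_closure (E : set (H -> H)) : set (H -> H) :=
  [set T | bounded_op T /\ closure (E : set {ptws H -> H}) T].

Definition strong_lim (I : Type) (le : I -> I -> Prop) (S : I -> H -> H) T :=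
  {ptws, S @ tails le --> T}.

Definition compact_op T : Prop :=
  bounded_op T /\ compact (closure (T @` [set x : H | `|x| <= 1])).

End Operators.

Section CStar.
Context {R : realType} {A : cstarType R}.

Definition positive (a : A) : Prop := exists b : A, a = amul (astar b) b.

Definition closed_ideal (I : set A) : Prop :=
  [/\ subspace_of I, closed I
    & forall a x, I x -> I (amul a x) /\ I (amul x a)].

Definition ideal_gen (E : set A) : set A := smallest closed_ideal E.

(* Positive functionals of norm one. *)
Definition state (f : A -> R[i]) : Prop :=
  [/\ scalar f, forall a, 0 <= f (amul (astar a) a),
      forall a, `|f a| <= `|a|
    & forall r : R[i], r < 1 -> exists2 a, `|a| <= 1 & r < `|f a|].

Definition representation (H : hilbertType R) (pi : A -> H -> H) : Prop :=
  [/\ forall a, bounded_op (pi a), linear pi,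
      forall a b, pi (amul a b) = pi a \o pi b
    & forall a, adjoint_op (pi a) (pi (astar a))].

Definition irreducible (H : hilbertType R) (pi : A -> H -> H) : Prop :=
  [/\ representation pi, exists x : H, x != 0
    & forall V : set H, subspace_of V -> closed V ->
        (forall a x, V x -> V (pi a x)) -> V = [set 0] \/ V = setT].

(* (H, pi) is the universal representation of A, the Hilbert direct sum over
   all states f of the GNS triples (H_f, pi_f, xi f): the vectors xi f
   implement the states, the spaces H_f = closure of (pi A)(xi f) contain xi f,
   are pairwise orthogonal, and span a dense subspace of H.  This determines
   (H, pi) up to unitary equivalence. *)
Definition universal (H : hilbertType R) (pi : A -> H -> H) : Prop :=
  representation pi /\ exists xi : (A -> R[i]) -> H,
  [/\ forall f, state f -> forall a, dotp (pi a (xi f)) (xi f) = f a,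
      forall f, state f -> closure (range (fun a => pi a (xi f))) (xi f),
      forall f g, state f -> state g -> f <> g ->
        forall a b, dotp (pi a (xi f)) (pi b (xi g)) = 0
    & forall V : set H, subspace_of V -> closed V ->
        (forall f a, state f -> V (pi a (xi f))) -> V = setT].

End CStar.

(* Below, U carries the universal representation iota of A, through which A
   is regarded as a subalgebra of A**. *)
Section Bidual.
Context {R : realType} {A : cstarType R} {U : hilbertType R}.
Variable iota : A -> U -> U.

(* I** as a strongly closed subspace of A**. *)
Definition bidual_of (I : set A) : set (U -> U) := strong_closure (iota @` I).

Definition env_vN : set (U -> U) := bidual_of [set: A].

Definition open_projection (p : U -> U) : Prop :=
  [/\ env_vN p, p \o p = p, adjoint_op p p
    & exists (I : Type) (le : I -> I -> Prop) (a : I -> A),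
      [/\ directed le, forall i, positive (a i),
          forall i j, le i j -> positive (a j - a i)
        & strong_lim le (iota \o a) p]].

(* X(p1, p2) = A ∩ p1 A** p2; X(1, p2) is the case p1 = id, the unit of A**. *)
Definition X (p1 p2 : U -> U) : set A :=
  [set x | exists2 y, env_vN y & iota x = p1 \o y \o p2].

Definition local (p1 p2 : U -> U) (T : A -> A) : Prop :=
  forall q, open_projection q -> op_le q p2 ->
  forall x, X p1 p2 x -> iota x \o q = cst 0 -> iota (T x) \o q = cst 0.

(* rho is the normal extension of pi to A**.  Only its values on env_vN
   matter. *)
Definition normal_extension (H : hilbertType R) (pi : A -> H -> H)
    (rho : (U -> U) -> H -> H) : Prop :=
  (forall a, rho (iota a) = pi a) /\
  [/\ forall S, env_vN S -> bounded_op (rho S),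
      linear_on env_vN rho,
      forall S T, env_vN S -> env_vN T -> rho (S \o T) = rho S \o rho T,
      forall S T, env_vN S -> env_vN T -> adjoint_op S T ->
        adjoint_op (rho S) (rho T)
    & forall (I : Type) (le : I -> I -> Prop) (S : I -> U -> U) T,
        directed le -> (forall i, env_vN (S i)) ->
        (forall i, adjoint_op (S i) (S i)) ->
        (forall i j, le i j -> op_le (S i) (S j)) ->
        env_vN T -> strong_lim le S T -> strong_lim le (rho \o S) (rho T)].

End Bidual.

(* Main.v *)
(* Let B = {b : b = p2 b p2}.  The range projection of b b* is open for b in B,
   so locality says that z b = 0 implies T(z) b = 0 for z in X = X(p1, p2).
   A gliding hump argument in the functional calculus of b turns this into
   T(x b) = T(x) b.  Let J be the ideal of the b in B such that T(.) b is
   bounded, and K the annihilator of J in B.  A second gliding hump shows that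
   K contains no infinite orthogonal sequence, hence K has a unit k which is a
   finite sum of minimal projections e of A.  Every such e generates an ideal
   isomorphic to K(H) with H = A e, a column space on which T acts linearly;
   this yields the maps t_i.  On {x in X : x k = 0} the map T is bounded by the
   closed graph theorem, and it is approximated by left multiplications by
   elements sum_j T(x_j) z_j* of norm at most C, which yields t_0. *)
Require Import Defs.
From HB Require Import structures.
From mathcomp Require Import all_boot all_order all_algebra.
From mathcomp Require Import complex.
From mathcomp Require Import all_classical all_reals all_analysis.
From mathcomp Require Import ring lra.

Set Implicit Arguments.
Unset Strict Implicit.
Unset Printing Implicit Defensive.

Import Order.TTheory GRing.Theory Num.Theory.
Import numFieldNormedType.Exports.

Local Open Scope classical_set_scope.
Local Open Scope ring_scope.
Local Open Scope complex_scope.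

(** * Identities of noncommutative algebras *)

(** The analysis takes place in an abstract unital C*-algebra, later the unitization of [A], where
    [X(p1, p2)] is cut out by two closed left ideals [L] and [S]. The von Neumann algebra enters
    only at the ends: range projections translate locality, strong closures receive [t_0] and the
    normal extensions. The obstacle is that [T] has no norm bound, so no identity passes to a limit
    under [T]. What replaces continuity is a right factor [w_n] which, by locality, sees a single
    term of a convergent series. A module defect [D] that is killed by some member of every
    shrinking family of annuli must live at one isolated spectral point [s], where [b] acts as a
    scalar and linearity alone finishes. The same isolation argument inside [K] produces spectral
    projections. In the bounded part the constant [C] survives because an approximant is first
    bounded as an operator between one-sided ideals, and the powers of [star c * c] then turn this
    into a norm bound. The spaces [H_i] are orbits inside the universal space, of vectors
    implementing the states [f] with [e a e = f(a) e]. *)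

(* A reflexive decision procedure for the identities of noncommutative algebras
   with scalars in a commutative ring. *)
Module AlgNorm.
Inductive sexp := SZ | SO | SV of nat | SA of sexp & sexp | SN of sexp
  | SM of sexp & sexp.
Inductive aexp := AZ | AO | AV of nat | AA of aexp & aexp | AN of aexp
  | AM of aexp & aexp | AS of sexp & aexp | AC of sexp.

Definition mulsm (a b : bool * seq nat) := (a.1 (+) b.1, a.2 ++ b.2).
(** A monomial is a sign ([true] for minus), a multiset of scalar atoms kept sorted, and a word of
    algebra atoms. Only the scalars commute, so only their list is sorted. *)
Definition mulm (a b : bool * (seq nat * seq nat)) :=
  (a.1 (+) b.1, (sort leq (a.2.1 ++ b.2.1), a.2.2 ++ b.2.2)).

Fixpoint sexpand (e : sexp) : seq (bool * seq nat) :=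
  match e with
  | SZ => [::] | SO => [:: (false, [::])] | SV n => [:: (false, [:: n])]
  | SA a b => sexpand a ++ sexpand b
  | SN a => [seq (~~ m.1, m.2) | m <- sexpand a]
  | SM a b => [seq mulsm x y | x <- sexpand a, y <- sexpand b]
  end.
Definition liftm (m : bool * seq nat) : bool * (seq nat * seq nat) :=
  (m.1, (sort leq m.2, [::])).
Fixpoint expand (e : aexp) : seq (bool * (seq nat * seq nat)) :=
  match e with
  | AZ => [::] | AO => [:: (false, ([::], [::]))]
  | AV n => [:: (false, ([::], [:: n]))]
  | AA a b => expand a ++ expand b
  | AN a => [seq (~~ m.1, m.2) | m <- expand a]
  | AM a b => [seq mulm x y | x <- expand a, y <- expand b]
  | AS s a => [seq mulm x y | x <- map liftm (sexpand s), y <- expand a]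
  | AC s => map liftm (sexpand s)
  end.
(** The argument [n] is fuel, taken to be the length of the list; each monomial is paired greedily
    with an opposite one. *)
Fixpoint cancel n (l : seq (bool * (seq nat * seq nat))) : bool :=
  match n, l with
  | _, [::] => true
  | 0, _ => false
  | n.+1, m :: l => let m' := (~~ m.1, m.2) in
      (m' \in l) && cancel n (rem m' l)
  end.
Definition check a b := let l := expand (AA a (AN b)) in cancel (size l) l.

Section Eval.
Context {K : comNzRingType} {B : algType K}.
Variables (es : seq K) (ea : seq B).

Fixpoint seval e : K :=
  match e with
  | SZ => 0 | SO => 1 | SV n => nth 0 es n
  | SA a b => seval a + seval b | SN a => - seval a
  | SM a b => seval a * seval b
  end.
Fixpoint eval e : B :=
  match e with
  | AZ => 0 | AO => 1 | AV n => nth 0 ea n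
  | AA a b => eval a + eval b | AN a => - eval a
  | AM a b => eval a * eval b | AS s a => seval s *: eval a
  | AC s => (seval s)%:A
  end.
Definition evsm (m : bool * seq nat) : K :=
  (-1) ^+ m.1 * \prod_(i <- m.2) nth 0 es i.
Definition evm (m : bool * (seq nat * seq nat)) : B :=
  ((-1) ^+ m.1 * \prod_(i <- m.2.1) nth 0 es i) *:
    \prod_(i <- m.2.2) nth 0 ea i.

Lemma evm_opp m : evm (~~ m.1, m.2) = - evm m.
Proof. by rewrite /evm /= -scaleNr; case: m.1; rewrite /= ?expr0 ?expr1 mulN1r mul1r ?opprK. Qed.
Lemma evm_mul a b : evm (mulm a b) = evm a * evm b.
Proof.
rewrite /evm /mulm /= -scalerAr -scalerAl scalerA big_cat; congr (_ *: _).
rewrite (perm_big (a.2.1 ++ b.2.1)) ?perm_sort//= big_cat /= signr_addb.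
by rewrite mulrACA [RHS]mulrC.
Qed.
Lemma evm_lift m : evm (liftm m) = (evsm m)%:A.
Proof. by rewrite /evm /evsm /= big_nil (perm_big m.2) ?perm_sort. Qed.
Lemma sexpandP e : seval e = \sum_(m <- sexpand e) evsm m.
Proof.
elim: e => [||n|a IHa b IHb|a IHa|a IHa b IHb] /=.
- by rewrite big_nil.
- by rewrite big_seq1 /evsm big_nil mulr1.
- by rewrite big_seq1 /evsm big_seq1 mul1r.
- by rewrite big_cat IHa IHb.
- rewrite IHa big_map -sumrN; apply: eq_bigr => m _; rewrite /evsm /= -mulNr.
  by case: m.1; rewrite /= ?expr0 ?expr1 ?opprK.
- rewrite IHa IHb big_allpairs_dep mulr_suml; apply: eq_bigr => x _.
  rewrite mulr_sumr; apply: eq_bigr => y _.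
  by rewrite /evsm /= signr_addb big_cat mulrACA.
Qed.
Lemma expandP e : eval e = \sum_(m <- expand e) evm m.
Proof.
elim: e => [||n|a IHa b IHb|a IHa|a IHa b IHb|s a IHa|s] /=.
- by rewrite big_nil.
- by rewrite big_seq1 /evm !big_nil mulr1 scale1r.
- by rewrite big_seq1 /evm big_nil big_seq1 mulr1 scale1r.
- by rewrite big_cat IHa IHb.
- by rewrite IHa big_map -sumrN; apply: eq_bigr => m _; rewrite evm_opp.
- rewrite IHa IHb big_allpairs_dep mulr_suml; apply: eq_bigr => x _.
  by rewrite mulr_sumr; apply: eq_bigr => y _; rewrite evm_mul.
- rewrite IHa big_allpairs_dep big_map sexpandP scaler_suml; apply: eq_bigr => x _.
  rewrite scaler_sumr; apply: eq_bigr => y _.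
  by rewrite evm_mul evm_lift -scalerAl mul1r.
- rewrite big_map sexpandP scaler_suml; apply: eq_bigr => x _.
  by rewrite evm_lift.
Qed.
Lemma cancelP n l : cancel n l -> \sum_(m <- l) evm m = 0.
Proof.
elim: n l => [|n IH] [|m l] //=; rewrite ?big_nil// => /andP[ml /IH h].
rewrite big_cons (perm_big _ (perm_to_rem ml)) big_cons /= h evm_opp addr0.
by rewrite subrr.
Qed.
Lemma checkP a b : check a b -> eval a = eval b.
Proof.
by move/cancelP; rewrite -expandP /= => /eqP; rewrite subr_eq0 => /eqP.
Qed.
End Eval.

(** The inner [match constr:(Set)] runs [constr_eq] or [unify] only for its success or failure,
    inside a tactic that must return a term. *)
Ltac inl x l := lazymatch l with
  | nil => constr:(false) | ?y :: ?l' =>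
    match constr:(Set) with
    | _ => let _ := match constr:(Set) with _ => first [constr_eq x y | unify x y] end in constr:(true)
    | _ => inl x l' end end.
Ltac addl x l := let b := inl x l in
  lazymatch b with true => l | false => constr:(x :: l) end.
Ltac idx x l := lazymatch l with
  | ?y :: ?l' => match constr:(Set) with
    | _ => let _ := match constr:(Set) with _ => first [constr_eq x y | unify x y] end in constr:(0%N)
    | _ => let n := idx x l' in constr:(S n) end end.
Ltac satoms e l := lazymatch e with
  | GRing.zero => l | GRing.one _ => l
  | GRing.add ?a ?b => let l := satoms a l in satoms b l
  | GRing.opp ?a => satoms a l
  | GRing.mul ?a ?b => let l := satoms a l in satoms b l
  | _ => addl e l end.
Ltac sreify e l := lazymatch e with
  | GRing.zero => constr:(SZ) | GRing.one _ => constr:(SO)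
  | GRing.add ?a ?b => let a := sreify a l in let b := sreify b l in constr:(SA a b)
  | GRing.opp ?a => let a := sreify a l in constr:(SN a)
  | GRing.mul ?a ?b => let a := sreify a l in let b := sreify b l in constr:(SM a b)
  | _ => let n := idx e l in constr:(SV n) end.
Ltac atoms e s l := lazymatch e with
  | GRing.zero => constr:((s, l)) | GRing.one _ => constr:((s, l))
  | GRing.add ?a ?b => let p := atoms a s l in
      lazymatch p with (?s, ?l) => atoms b s l end
  | GRing.opp ?a => atoms a s l
  | GRing.mul ?a ?b => let p := atoms a s l in
      lazymatch p with (?s, ?l) => atoms b s l end
  | GRing.scale ?c ?a => let s := satoms c s in atoms a s l
  | _ => let l := addl e l in constr:((s, l)) end.
Ltac reify e s l := lazymatch e with
  | GRing.zero => constr:(AZ) | GRing.one _ => constr:(AO)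
  | GRing.add ?a ?b => let a := reify a s l in let b := reify b s l in constr:(AA a b)
  | GRing.opp ?a => let a := reify a s l in constr:(AN a)
  | GRing.mul ?a ?b => let a := reify a s l in let b := reify b s l in constr:(AM a b)
  | GRing.scale ?c ?a => let c := sreify c s in let a := reify a s l in constr:(AS c a)
  | _ => let n := idx e l in constr:(AV n) end.
Ltac solve K B x y :=
  let p := atoms x (@nil K) (@nil B) in
  lazymatch p with (?s, ?l) =>
    let p := atoms y s l in
    lazymatch p with (?s, ?l) =>
      let a := reify x s l in let b := reify y s l in
      exact (@checkP _ _ s l a b (erefl true : check a b = true)) end end.
End AlgNorm.
Ltac alg R := lazymatch goal with
  |- @eq ?T ?x ?y => AlgNorm.solve (R[i]) T x y end.

(** * Unital C*-algebras *)

(** The norm takes values in [R] rather than [R[i]], so that linear arithmetic over the reals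
    applies to it, and completeness is stated for sequences. The instance used for the theorem is
    the unitization [uni A]. *)
HB.mixin Record isUCStar (R : realType) (B : Type) of GRing.Algebra R[i] B := {
  star : B -> B;
  nm : B -> R;
  starD : {morph star : x y / x + y};
  starZ : forall (c : R[i]) x, star (c *: x) = Num.conj c *: star x;
  starM : forall x y, star (x * y) = star y * star x;
  starK : involutive star;
  nmD : forall x y, nm (x + y) <= nm x + nm y;
  nmZ : forall (c : R[i]) x, nm (c *: x) = complex.Re `|c| * nm x;
  nmM : forall x y, nm (x * y) <= nm x * nm y;
  nmC : forall x, nm (star x * x) = nm x ^+ 2;
  nm0_eq0 : forall x, nm x = 0 -> x = 0;
  nm_complete : forall u : nat -> B,
    (forall e : R, 0 < e -> exists N, forall m n, (N <= m)%N -> (N <= n)%N ->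
       nm (u m - u n) < e) ->
    exists l, forall e : R, 0 < e -> exists N, forall n, (N <= n)%N ->
       nm (u n - l) < e }.

#[short(type="ucstarType")]
HB.structure Definition UCStar (R : realType) :=
  {B of isUCStar R B & GRing.Algebra R[i] B}.

Section UCBasics.
Context {R : realType} {B : ucstarType R}.
Implicit Types (x y z : B) (c d : R[i]) (r t : R).

Definition sa x := star x = x.

Lemma normcC r : `|r%:C| = `|r|%:C.
Proof. by rewrite normc_def /= expr0n /= addr0 sqrtr_sqr. Qed.

Lemma CrD r t : (r + t)%:C = r%:C + t%:C :> R[i].
Proof. exact: (rmorphD (real_complex R)). Qed.
Lemma CrN r : (- r)%:C = - r%:C :> R[i].
Proof. exact: (rmorphN (real_complex R)). Qed.
Lemma CrB r t : (r - t)%:C = r%:C - t%:C :> R[i].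
Proof. exact: (rmorphB (real_complex R)). Qed.
Lemma CrM r t : (r * t)%:C = r%:C * t%:C :> R[i].
Proof. exact: (rmorphM (real_complex R)). Qed.
Lemma Cr1 : 1%:C = 1 :> R[i].
Proof. by []. Qed.
Lemma star0 : star (0 : B) = 0.
Proof. by apply: (addrI (star 0)); rewrite -starD !addr0. Qed.
Lemma starN x : star (- x) = - star x.
Proof. by apply: (addrI (star x)); rewrite -starD !addrN star0. Qed.
Lemma starB x y : star (x - y) = star x - star y.
Proof. by rewrite starD starN. Qed.
Lemma star1 : star (1 : B) = 1.
Proof. by rewrite -[LHS]mulr1 -[X in _ * X](starK 1) -starM mulr1 starK. Qed.
Lemma conjrC r : Num.conj (r%:C : R[i]) = r%:C.
Proof. by apply/CrealP; rewrite complex_real. Qed.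
Lemma starZr r x : star (r%:C *: x) = r%:C *: star x.
Proof. by rewrite starZ conjrC. Qed.
Lemma nm0 : nm (0 : B) = 0.
Proof. by rewrite -(scale0r (0 : B)) nmZ normr0 mul0r. Qed.
Lemma nmZr r x : nm (r%:C *: x) = `|r| * nm x.
Proof. by rewrite nmZ normcC. Qed.
Lemma nmN x : nm (- x) = nm x.
Proof. by rewrite -scaleN1r nmZ normrN normr1 mul1r. Qed.
Lemma nm_ge0 x : 0 <= nm x.
Proof.
by have := nmD x (- x); rewrite subrr nm0 nmN => ?; lra.
Qed.
Lemma nmB x y : nm (x - y) = nm (y - x).
Proof. by rewrite -nmN opprB. Qed.
Lemma nm_star x : nm (star x) = nm x.
Proof.
have H y : nm y <= nm (star y).
  have := nm_ge0 y; rewrite le_eqVlt => /orP[/eqP<-|y0]; first exact: nm_ge0.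
  by rewrite -(ler_pM2r y0) -expr2 -nmC nmM.
by apply/le_anti; rewrite H -{2}(starK x) H.
Qed.
Lemma nmC' x : nm (x * star x) = nm x ^+ 2.
Proof. by rewrite -{1}(starK x) nmC nm_star. Qed.
Lemma nmsa x : sa x -> nm (x * x) = nm x ^+ 2.
Proof. by move=> sx; rewrite -nmC sx. Qed.
Lemma star_eq0 x : star x * x = 0 -> x = 0.
Proof.
by move=> h; apply: nm0_eq0; apply/eqP; rewrite -sqrf_eq0 -nmC h nm0.
Qed.
Lemma star_eq0' x : x * star x = 0 -> x = 0.
Proof. by move=> h; rewrite -[x]starK (@star_eq0 (star x)) ?star0 ?starK. Qed.
Lemma nm1_le : nm (1 : B) <= 1.
Proof.
have := nmC (1 : B); rewrite star1 mulr1 expr2 => /eqP.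
rewrite -{1}[nm 1]mulr1 -subr_eq0 -mulrBr mulf_eq0 subr_eq0.
by move=> /orP[/eqP->|/eqP<-].
Qed.
Lemma nmX x n : nm x <= 1 -> nm (x ^+ n) <= 1.
Proof.
move=> x1; elim: n => [|n IH]; first by rewrite expr0 nm1_le.
rewrite exprS (le_trans (nmM _ _))// -(mulr1 1) ler_pM ?nm_ge0//.
Qed.
Lemma nm_sum I (s : seq I) (P : pred I) (F : I -> B) :
  nm (\sum_(i <- s | P i) F i) <= \sum_(i <- s | P i) nm (F i).
Proof.
elim/big_ind2 : _ => [|a u b v ha hb|//]; first by rewrite nm0.
by rewrite (le_trans (nmD _ _))// lerD.
Qed.
Lemma star_sum I (s : seq I) (P : pred I) (F : I -> B) :
  star (\sum_(i <- s | P i) F i) = \sum_(i <- s | P i) star (F i).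
Proof. by rewrite (big_morph star starD star0). Qed.

Lemma sa0 : sa 0. Proof. exact: star0. Qed.
Lemma sa1 : sa 1. Proof. exact: star1. Qed.
Lemma saD x y : sa x -> sa y -> sa (x + y).
Proof. by move=> hx hy; rewrite /sa starD hx hy. Qed.
Lemma saN x : sa x -> sa (- x).
Proof. by move=> hx; rewrite /sa starN hx. Qed.
Lemma saB x y : sa x -> sa y -> sa (x - y).
Proof. by move=> hx hy; rewrite /sa starB hx hy. Qed.
Lemma saZ r x : sa x -> sa (r%:C *: x).
Proof. by move=> hx; rewrite /sa starZr hx. Qed.
Lemma saM x y : sa x -> sa y -> x * y = y * x -> sa (x * y).
Proof. by move=> hx hy xy; rewrite /sa starM hx hy. Qed.
Lemma sastar x : sa (star x * x).
Proof. by rewrite /sa starM starK. Qed.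

Definition lim_to (u : nat -> B) l := forall e : R, 0 < e ->
  exists N, forall n, (N <= n)%N -> nm (u n - l) < e.

Definition nclosed (S : B -> Prop) := forall x,
  (forall e : R, 0 < e -> exists2 y, S y & nm (x - y) < e) -> S x.

Lemma nm_small x : (forall e : R, 0 < e -> nm x <= e) -> x = 0.
Proof.
move=> h; apply: nm0_eq0; apply/le_anti; rewrite nm_ge0 andbT.
by apply/ler_addgt0Pl => e e0; rewrite addr0 h.
Qed.

Lemma lim_closed (S : B -> Prop) u l : nclosed S -> (forall n, S (u n)) ->
  lim_to u l -> S l.
Proof.
move=> cS Su ul; apply: cS => e e0; have [N hN] := ul _ e0.
by exists (u N) => //; rewrite nmB hN.
Qed.

Lemma lim_uniq u l l' : lim_to u l -> lim_to u l' -> l = l'.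
Proof.
move=> h h'; apply/subr0_eq/nm_small => e e0.
have e2 : 0 < e / 2 by rewrite divr_gt0.
have [N hN] := h _ e2; have [N' hN'] := h' _ e2.
have -> : l - l' = (u (maxn N N') - l') - (u (maxn N N') - l).
  by alg R.
rewrite (le_trans (nmD _ _))// nmN (splitr e) lerD// ltW//.
  by rewrite hN'// leq_maxr.
by rewrite hN// leq_maxl.
Qed.
End UCBasics.

(** * Square roots by iteration *)

Section Sqrt.
Context {R : realType} {B : ucstarType R}.
Implicit Types (x y z g h : B) (c : R[i]) (r t : R).

(** Whatever is built from [h] by limits of polynomials stays in each such set that contains [h]
    and, if needed, [1]. Applied to commutants this yields commutation, applied to [rmult L] it
    yields membership. *)
Definition csub (S : B -> Prop) := [/\ nclosed S,
  forall x y, S x -> S y -> S (x + y), forall x y, S x -> S y -> S (x * y)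
  & forall c x, S x -> S (c *: x)].

Lemma csub0 S x : csub S -> S x -> S 0.
Proof. by case=> _ _ _ h /(h 0); rewrite scale0r. Qed.
Lemma csubN S x : csub S -> S x -> S (- x).
Proof. by case=> _ _ _ h /(h (-1)); rewrite scaleN1r. Qed.
Lemma csubB S x y : csub S -> S x -> S y -> S (x - y).
Proof. by move=> cS Sx Sy; case: (cS) => _ h _ _; apply: h => //; apply: csubN. Qed.

Lemma csub_comm y : csub (fun x => x * y = y * x).
Proof.
split.
- move=> x h; apply/subr0_eq/nm_small => e e0.
  have e' : 0 < e / (2 * (1 + nm y)).
    by rewrite divr_gt0// mulr_gt0// ltr_pwDl// nm_ge0.
  have [z zy xz] := h _ e'.
  have -> : x * y - y * x = (x - z) * y - y * (x - z).
    by rewrite mulrBl mulrBr zy; alg R.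
  rewrite (le_trans (nmD _ _))// nmN.
  rewrite (le_trans (lerD (nmM _ _) (nmM _ _)))//.
  have y0 := nm_ge0 y.
  have : nm (x - z) * nm y <= e / (2 * (1 + nm y)) * (1 + nm y).
    by apply: ler_pM => //; rewrite ?nm_ge0 ?(ltW xz)// lerDr.
  rewrite invfM mulrA -[X in _ <= X]mulrA mulVf ?mulr1 ?lt0r_neq0 ?ltr_pwDl//.
  by rewrite (mulrC (nm y)); lra.
- by move=> x z hx hz; rewrite mulrDl hx hz mulrDr.
- by move=> x z hx hz; rewrite -mulrA hz mulrA hx mulrA.
- by move=> c x hx; rewrite -scalerAl hx scalerAr.
Qed.

Lemma mono_cauchy (c : nat -> R) M : (forall n, c n <= c n.+1) ->
  (forall n, c n <= M) -> forall e : R, 0 < e ->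
  exists N, forall n, (N <= n)%N -> c n - c N < e.
Proof.
move=> cS cM e e0.
have hs : has_sup (range c).
  by split; [exists (c 0%N), 0%N|exists M => _ [n _ <-]].
have [_ [N _ <-] hN] := sup_adherent e0 hs.
exists N => n Nn; have : c n <= sup (range c).
  by apply: sup_ubound; [case: hs|exists n].
by lra.
Qed.

Definition half : R[i] := (2^-1 : R)%:C.
Lemma halfD : half + half = 1.
Proof.
rewrite /half -rmorphD (_ : 2^-1 + 2^-1 = 1) ?rmorph1//.
by rewrite [RHS](splitr 1) mul1r.
Qed.

(** The iterates converge to [1 - sqrt (1 - g)], a fixed point of [r = (g + r^2) / 2]. The real
    sequence [cseq] is the case [g = 1]; it majorizes the norms and the increments. *)
Fixpoint rseq g n : B :=
  if n is n.+1 then half *: (g + rseq g n * rseq g n) else 0.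
Fixpoint cseq n : R := if n is n.+1 then (1 + cseq n ^+ 2) / 2 else 0.

Lemma rseqS g n : rseq g n.+1 = half *: (g + rseq g n * rseq g n).
Proof. by []. Qed.
Lemma cseq_ge0 n : 0 <= cseq n.
Proof. by elim: n => //= n IH; have := sqr_ge0 (cseq n); lra. Qed.
Lemma cseq_le1 n : cseq n <= 1.
Proof.
elim: n => [|n IH] /=; first exact: ler01.
by have := cseq_ge0 n; nra.
Qed.
Lemma cseqS n : cseq n <= cseq n.+1.
Proof. by rewrite /=; have := sqr_ge0 (cseq n - 1); nra. Qed.

Lemma rseq_le g n : nm g <= 1 -> nm (rseq g n) <= cseq n.
Proof.
move=> g1; elim: n => [|n IH] /=; first by rewrite nm0.
rewrite nmZr gtr0_norm ?invr_gt0// mulrC ler_pM2r ?invr_gt0//.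
rewrite (le_trans (nmD _ _))// lerD// (le_trans (nmM _ _))// expr2.
by rewrite ler_pM ?nm_ge0.
Qed.
Lemma rseq_csub S g n : csub S -> S g -> S (rseq g n).
Proof.
move=> cS Sg; case: (cS) => _ hD hM hZ; elim: n => [|n IH] /=.
  exact: csub0 cS Sg.
by apply: (hZ); apply: (hD) => //; apply: hM.
Qed.
Lemma rseq_sa g n : sa g -> sa (rseq g n).
Proof.
move=> sg; elim: n => [|n IH]; first exact: sa0.
by apply/saZ/saD => //; rewrite /sa starM IH.
Qed.
Lemma rseq_comm g m n : rseq g m * rseq g n = rseq g n * rseq g m.
Proof.
apply: (rseq_csub _ (csub_comm _)) => //; apply/esym.
by apply: (rseq_csub _ (csub_comm _)).
Qed.
(** The iterates commute, so the difference of two squares factors: [r_{n+2} - r_{n+1}] is half of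
    [r_{n+1} - r_n] times [r_{n+1} + r_n]. The sequence [cseq] satisfies the same recursion. *)
Lemma rseq_diff g n : nm g <= 1 ->
  nm (rseq g n.+1 - rseq g n) <= cseq n.+1 - cseq n.
Proof.
move=> g1; elim: n => [|n IH].
  rewrite /= mulr0 addr0 subr0 nmZr gtr0_norm ?invr_gt0// expr0n/=; lra.
have -> : rseq g n.+2 - rseq g n.+1 =
    half *: ((rseq g n.+1 - rseq g n) * (rseq g n.+1 + rseq g n)).
  rewrite mulrDr !mulrBl (rseq_comm g n.+1 n).
  by rewrite (rseqS g n.+1) {3}(rseqS g n); alg R.
have -> : cseq n.+2 - cseq n.+1 =
    2^-1 * ((cseq n.+1 - cseq n) * (cseq n.+1 + cseq n)).
  by rewrite (_ : cseq n.+2 = (1 + cseq n.+1 ^+ 2) / 2)// {2}/cseq -/(cseq n); field.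
rewrite nmZr gtr0_norm ?invr_gt0// ler_pM2l ?invr_gt0//.
rewrite (le_trans (nmM _ _))// ler_pM ?nm_ge0//.
by rewrite (le_trans (nmD _ _))// lerD ?rseq_le.
Qed.
Lemma rseq_diff' g n k : nm g <= 1 ->
  nm (rseq g (n + k) - rseq g n) <= cseq (n + k) - cseq n.
Proof.
move=> g1; elim: k => [|k IH]; first by rewrite addn0 !subrr nm0.
rewrite addnS.
have -> : rseq g (n + k).+1 - rseq g n = (rseq g (n + k).+1 - rseq g (n + k)) +
   (rseq g (n + k) - rseq g n) by alg R.
rewrite (le_trans (nmD _ _))//.
have := rseq_diff (n + k) g1; move: IH; lra.
Qed.

Lemma sqrt1 g : nm g <= 1 -> exists r : B, [/\ sa g -> sa r, nm r <= 1,
  (1 - r) * (1 - r) = 1 - g & forall S, csub S -> S g -> S r].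
Proof.
move=> g1.
have [|r rl] := @nm_complete R B (rseq g).
  move=> e e0; have e2 : 0 < e / 2 by rewrite divr_gt0.
  have [N hN] := mono_cauchy cseqS cseq_le1 e2; exists N => m n Nm Nn.
  have H k : (N <= k)%N -> nm (rseq g k - rseq g N) < e / 2.
    by move=> Nk; rewrite -(subnKC Nk) (le_lt_trans (rseq_diff' _ _ g1))// subnKC// hN.
  have -> : rseq g m - rseq g n = (rseq g m - rseq g N) - (rseq g n - rseq g N).
    by alg R.
  by rewrite (le_lt_trans (nmD _ _))// nmN (splitr e) ltrD ?H.
have cl S : nclosed S -> (forall n, S (rseq g n)) -> S r.
  by move=> cS Sn; apply: lim_closed cS Sn rl.
have r1 : nm r <= 1.
  apply: (cl (fun x => nm x <= 1)) => [x hx|n].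
    apply/ler_addgt0Pl => e e0; have [y y1 xy] := hx _ e0.
    by rewrite -(subrK y x) (le_trans (nmD _ _))// lerD// ltW.
  by rewrite (le_trans (rseq_le _ g1)) ?cseq_le1.
exists r; split => //.
- move=> sg; apply: (cl sa) => [x hx|n]; last exact: rseq_sa.
  apply/subr0_eq/nm_small => e e0; have e2 : 0 < e / 2 by rewrite divr_gt0.
  have [y sy xy] := hx _ e2.
  have -> : star x - x = star (x - y) - (x - y) by rewrite starB sy; alg R.
  rewrite (le_trans (nmD _ _))// nmN nm_star; lra.
- apply/subr0_eq/nm_small => e e0.
  have e2 : 0 < e / 6 by rewrite divr_gt0.
  have [N hN] := rl _ e2.
  have h1 := hN N (leqnn _); have h2 := hN N.+1 (leqnSn _).
  set s := rseq g N in h1; set s' := rseq g N.+1 in h2.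
  have s'E : s' + s' = g + s * s.
    by rewrite /s' /= -/s -scalerDl halfD scale1r.
  have s1 : nm s <= 1 by rewrite (le_trans (rseq_le _ g1)) ?cseq_le1.
  have -> : (1 - r) * (1 - r) - (1 - g) = (s' - r) + (s' - r) -
     ((s - r) * s + r * (s - r)).
    rewrite (_ : _ + _ - _ = (s' + s') - r - r - (s * s - r * r)); last by alg R.
    by rewrite s'E; alg R.
  have a1 : nm ((s - r) * s) <= nm (s - r).
    by rewrite (le_trans (nmM _ _))// ler_piMr ?nm_ge0.
  have a2 : nm (r * (s - r)) <= nm (s - r).
    by rewrite (le_trans (nmM _ _))// ler_piMl ?nm_ge0.
  rewrite (le_trans (nmD _ _))// nmN.
  have := nmD (s' - r) (s' - r); have := nmD ((s - r) * s) (r * (s - r)).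
  lra.
- move=> S cS Sg; apply: cl; first by case: cS.
  by move=> n; apply: rseq_csub.
Qed.
End Sqrt.

(** * Positive elements *)

Section Pos.
Context {R : realType} {B : ucstarType R}.
Implicit Types (x y z g h : B) (c : R[i]) (r t : R).

Lemma halfE x : half *: (x + x) = x.
Proof. by rewrite scalerDr -scalerDl halfD scale1r. Qed.

(** Positivity is expressed by the norm instead of the spectrum: for self-adjoint [h] it says that
    [h] lies in a ball of radius [t] around [t]. Sums and closures are then easy; products and
    [star x * x] need square roots. *)
Definition Pos h := sa h /\ exists2 t : R, 0 <= t & nm (t%:C%:A - h) <= t.

Lemma sac t : sa (t%:C%:A : B).
Proof. by apply/saZ/sa1. Qed.
Lemma nmc t : nm (t%:C%:A : B) <= `|t|.
Proof. by rewrite nmZr ler_piMr// nm1_le. Qed.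

Lemma Pos_sa h : Pos h -> sa h. Proof. by case. Qed.

Lemma Pos0 : Pos 0.
Proof. by split; [exact: sa0|exists 0 => //; rewrite subr0 (le_trans (nmc _))// normr0]. Qed.
Lemma Pos1 : Pos 1.
Proof.
split; first exact: sa1.
by exists 1 => //; rewrite scale1r subrr nm0.
Qed.
Lemma PosD x y : Pos x -> Pos y -> Pos (x + y).
Proof.
move=> [sx [t t0 ht]] [sy [s s0 hs]]; split; first exact: saD.
exists (t + s); first exact: addr_ge0.
have -> : (t + s)%:C%:A - (x + y) = (t%:C%:A - x) + (s%:C%:A - y).
  by rewrite CrD; alg R.
by rewrite (le_trans (nmD _ _))// lerD.
Qed.
Lemma PosZ r x : 0 <= r -> Pos x -> Pos (r%:C *: x).
Proof.
move=> r0 [sx [t t0 ht]]; split; first exact: saZ.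
exists (r * t); first exact: mulr_ge0.
have -> : (r * t)%:C%:A - r%:C *: x = r%:C *: (t%:C%:A - x).
  by rewrite CrM; alg R.
by rewrite nmZr ger0_norm// ler_wpM2l.
Qed.
Lemma Posc r : 0 <= r -> Pos r%:C%:A.
Proof. by move=> r0; apply: PosZ => //; exact: Pos1. Qed.
Lemma Pos_sub_nm x t : sa x -> nm x <= t -> Pos (t%:C%:A - x).
Proof.
move=> sx xt; split; first by apply: saB => //; exact: sac.
exists t; first exact: le_trans (nm_ge0 _) xt.
by rewrite (_ : _ - _ = x)//; alg R.
Qed.

Definition ii : R[i] := 'i.
Lemma iiM : ii * ii = -1.
Proof. by rewrite /ii; simpc. Qed.
Lemma iiC : Num.conj ii = - ii.
Proof. by rewrite /ii; apply/eqP; rewrite eq_complex /= oppr0 !eqxx. Qed.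
Lemma star_ii x : star (ii *: x) = - (ii *: star x).
Proof. by rewrite starZ iiC scaleNr. Qed.
Lemma ii_nm x : nm (ii *: x) = nm x.
Proof. by rewrite nmZ normc_def /= expr0n expr1n add0r sqrtr1 mul1r. Qed.

(** With [u = h + i k] the C*-identity gives the norm of [h^2 + k^2] as the square of that of [u],
    and [h], [k] are the real and imaginary parts of [u]. This takes the place of spectral radius
    arguments. *)
Lemma norm_cartesian h k : sa h -> sa k -> h * k = k * h ->
  nm h ^+ 2 <= nm (h * h + k * k) /\ nm k ^+ 2 <= nm (h * h + k * k).
Proof.
move=> sh sk hk.
set u := h + ii *: k.
have su : star u = h - ii *: k by rewrite starD star_ii sh sk.
have uu : star u * u = h * h + k * k.
  rewrite su /u (_ : _ * _ = h * h + ii *: (h * k - k * h) - (ii * ii) *: (k * k)).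
    by rewrite hk subrr scaler0 iiM; alg R.
  by alg R.
rewrite -uu nmC.
have hu : nm h <= nm u.
  have -> : h = half *: (u + star u).
    by rewrite su (_ : u + _ = h + h) ?halfE// /u; alg R.
  rewrite nmZr gtr0_norm ?invr_gt0//; have := nmD u (star u).
  by rewrite nm_star; lra.
have ku : nm k <= nm u.
  rewrite -(ii_nm k).
  have -> : ii *: k = half *: (u - star u).
    by rewrite su (_ : u - _ = ii *: k + ii *: k) ?halfE// /u; alg R.
  rewrite nmZr gtr0_norm ?invr_gt0//; have := nmD u (- star u).
  by rewrite nmN nm_star; lra.
by split; rewrite ler_pXn2r// nnegrE nm_ge0.
Qed.

(** After scaling to [g] of norm [1], the root [1 - r] of [1 - g^2] satisfies [g^2 + (1 - r)^2 = 1],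
    so [norm_cartesian] bounds [1 - g^2] by [1]. *)
Lemma Pos_sqr h : sa h -> Pos (h * h).
Proof.
move=> sh; split; first exact: saM.
have [->|h0] := eqVneq h 0.
  by rewrite mul0r; case: Pos0.
have n0 : 0 < nm h.
  by rewrite lt_neqAle nm_ge0 andbT eq_sym; apply: contraNneq h0 => /nm0_eq0 ->.
pose t : R := (nm h)^-1; pose g := t%:C *: h.
have sg : sa g by apply: saZ.
have g1 : nm g = 1 by rewrite nmZr gtr0_norm ?invr_gt0// mulVf ?gt_eqF.
have gg1 : nm (g * g) <= 1 by rewrite (le_trans (nmM _ _))// g1 mulr1.
have [r [sr _ rE rS]] := sqrt1 gg1.
have hr : g * r = r * g.
  by apply/esym/(rS _ (csub_comm g)); rewrite mulrA.
have := norm_cartesian sg (saB sa1 (sr (saM sg sg erefl))).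
case; first by rewrite mulrBr mulrBl mulr1 mul1r hr.
rewrite rE (_ : _ + _ = 1); last by alg R.
move=> _; rewrite -nmsa; last exact: saB sa1 (sr (saM sg sg erefl)).
rewrite rE => H.
have E : (nm h ^+ 2)%:C%:A - h * h = (nm h ^+ 2)%:C *: (1 - g * g).
  rewrite /g -scalerAl -scalerAr scalerA scalerBr scalerA.
  by rewrite -!CrM /= (_ : nm h ^+ 2 * (t * t) = 1) ?scale1r// /t; field; rewrite gt_eqF.
exists (nm h ^+ 2); first exact: exprn_ge0 (ltW n0).
rewrite E nmZr ger0_norm ?exprn_ge0 ?nm_ge0// ler_piMr ?exprn_ge0 ?nm_ge0//.
exact: le_trans H nm1_le.
Qed.

Lemma Pos_sqrt h : Pos h -> exists k : B, [/\ Pos k, k * k = h &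
  forall S, csub S -> S 1 -> S h -> S k].
Proof.
move=> [sh [t]]; rewrite le_eqVlt => /orP[/eqP<-|t0].
  rewrite scale0r sub0r nmN => h0.
  have -> : h = 0 by apply: nm0_eq0; apply/le_anti; rewrite h0 nm_ge0.
  exists 0; split; [exact: Pos0|by rewrite mulr0|].
  by move=> S cS S1 _; apply: csub0 cS S1.
move=> ht; pose g : B := (t^-1)%:C *: (t%:C%:A - h).
have g1 : nm g <= 1.
  by rewrite nmZr gtr0_norm ?invr_gt0// mulrC ler_pdivrMr// mul1r.
have gE : h = t%:C *: (1 - g).
  rewrite /g scalerBr scalerA -CrM divff ?gt_eqF// Cr1 scale1r; alg R.
have [r [sr r1 rE rS]] := sqrt1 g1.
exists ((Num.sqrt t)%:C *: (1 - r)); split.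
- apply: PosZ (sqrtr_ge0 _) _; rewrite -[X in Pos (X - r)]scale1r -Cr1.
  by apply: Pos_sub_nm => //; apply/sr/saZ/saB => //; exact: sac.
- rewrite -scalerAl -scalerAr scalerA rE -CrM -expr2 sqr_sqrtr ?(ltW t0)//.
- move=> S cS S1 Sh; case: (cS) => _ SD SM SZ.
  apply: (SZ); apply: csubB => //; apply: rS => //; apply: (SZ).
  by apply: csubB => //; apply: SZ.
Qed.

Lemma PosM x y : Pos x -> Pos y -> x * y = y * x -> Pos (x * y).
Proof.
move=> px py xy.
have [a [/Pos_sa sa_ aa aS]] := Pos_sqrt px; have [b [/Pos_sa sb bb bS]] := Pos_sqrt py.
have ay : a * y = y * a by apply: (aS _ (csub_comm y)); rewrite ?mul1r ?mulr1.
have ab : b * a = a * b.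
  by apply: (bS _ (csub_comm a)); rewrite ?mul1r ?mulr1.
have -> : x * y = (a * b) * (a * b).
  by rewrite -aa -bb !mulrA -(mulrA a b a) ab !mulrA.
by apply: Pos_sqr; rewrite /sa starM sa_ sb ab.
Qed.

Lemma Pos_conj x y : sa y -> Pos x -> x * y = y * x -> Pos (y * x * y).
Proof.
move=> sy px xy; rewrite -mulrA xy mulrA; apply: PosM => //.
  exact: Pos_sqr.
by rewrite -mulrA -xy mulrA -xy mulrA.
Qed.

Lemma PosX x n : Pos x -> Pos (x ^+ n).
Proof.
move=> px; elim: n => [|n IH]; first exact: Pos1.
by rewrite exprS; apply: PosM => //; rewrite -exprS -exprSr.
Qed.

(** The square roots [a] of [h] and [b] of [- h] commute and [a^2 + b^2 = 0], so [norm_cartesian]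
    kills [a]. *)
Lemma Pos_anti h : Pos h -> Pos (- h) -> h = 0.
Proof.
move=> p1 p2.
have [a [/Pos_sa sa_ aa aS]] := Pos_sqrt p1; have [b [/Pos_sa sb bb bS]] := Pos_sqrt p2.
have ah : a * - h = - h * a.
  by rewrite -aa mulrN mulNr mulrA.
have ab : b * a = a * b.
  by apply: (bS _ (csub_comm a)); rewrite ?mul1r ?mulr1.
have [] := norm_cartesian sa_ sb (esym ab).
rewrite aa bb subrr nm0 => + _.
rewrite -nmsa// aa => h0; apply: nm0_eq0; apply/le_anti.
by rewrite h0 nm_ge0.
Qed.

Lemma Pos_nm x t : Pos x -> Pos (t%:C%:A - x) -> 0 <= t -> nm x <= t.
Proof.
move=> px py t0.
have xc : x * t%:C%:A = t%:C%:A * x by rewrite -scalerAl -scalerAr mulr1 mul1r.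
have p : Pos ((t ^+ 2)%:C%:A - x * x).
  have -> : (t ^+ 2)%:C%:A - x * x = t%:C *: (t%:C%:A - x) + x * (t%:C%:A - x).
    rewrite mulrBr xc expr2 CrM; alg R.
  apply: PosD; first exact: PosZ.
  by apply: PosM => //; rewrite mulrBr mulrBl xc.
have [a [/Pos_sa sa_ aa aS]] := Pos_sqrt p.
have ax : a * x = x * a.
  apply: (aS _ (csub_comm x)); rewrite ?mul1r ?mulr1//; alg R.
have [+ _] := norm_cartesian (Pos_sa px) sa_ (esym ax).
rewrite aa (_ : x * x + _ = (t ^+ 2)%:C%:A); last by alg R.
move=> H; have := le_trans H (nmc _).
rewrite ger0_norm ?exprn_ge0// ler_pXn2r// ?nnegrE ?nm_ge0//.
Qed.

Lemma Pos_le x y : Pos x -> Pos (y - x) -> nm x <= nm y.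
Proof.
move=> px pyx; apply: Pos_nm (nm_ge0 _) => //.
have -> : (nm y)%:C%:A - x = ((nm y)%:C%:A - y) + (y - x) by alg R.
apply: PosD => //; apply: Pos_sub_nm => //.
by rewrite -(subrK x y); apply: saD; apply: Pos_sa.
Qed.

Lemma Pos_closed : nclosed Pos.
Proof.
move=> x hx.
have sx : sa x.
  apply/subr0_eq/nm_small => e e0; have e2 : 0 < e / 2 by rewrite divr_gt0.
  have [y [sy _] xy] := hx _ e2.
  have -> : star x - x = star (x - y) - (x - y) by rewrite starB sy; alg R.
  rewrite (le_trans (nmD _ _))// nmN nm_star; lra.
(* Each positive [y] near [x] comes with a constant of its own, but any [t] above [nm y] serves it;
   [nm x + 1] is such a [t] for all [y] within distance [1]. *)
split=> //; exists (nm x + 1); first by rewrite addr_ge0 ?nm_ge0.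
apply/ler_addgt0Pl => e e0.
have e2 : 0 < Num.min 1 (e / 2) by rewrite lt_min ltr01 divr_gt0.
have [y py] := hx _ e2; rewrite lt_min => /andP[xy1 xy].
have ny : nm y <= nm x + 1.
  rewrite -(subrK x y) (le_trans (nmD _ _))// addrC lerD2l ltW// nmB//.
have -> : (nm x + 1)%:C%:A - x = ((nm x + 1)%:C%:A - y) - (x - y) by alg R.
have := @Pos_sub_nm _ _ (Pos_sa py) ny.
move=> pq; have := Pos_nm pq _ (le_trans (nm_ge0 _) ny).
rewrite (_ : (nm x + 1)%:C%:A - _ = y); last by alg R.
move=> /(_ py) H; rewrite (le_trans (nmD _ _))// nmN; lra.
Qed.
End Pos.

(** * Positivity of [star x * x] *)

Section Kaplansky.
Context {R : realType} {B : ucstarType R}.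
Implicit Types (x y z g h : B) (c : R[i]) (r t : R).

Lemma ler_natM_eq0 (a b : R) : 0 <= a -> (forall n : nat, n%:R * a <= b) -> a = 0.
Proof.
move=> a0 H; apply/le_anti; rewrite a0 andbT leNgt; apply/negP => a_gt0.
have := archi_boundP (divr_ge0 (le_trans (mulr_ge0 (ler0n _ 1) a0) (H 1%N)) a0).
by rewrite ltr_pdivrMr// ltNge H.
Qed.

Lemma Pos_cst1 x : Pos x -> nm x <= 1 -> Pos (1 - x) /\ nm (1 - x) <= 1.
Proof.
move=> px x1; have p : Pos (1 - x).
  rewrite -[X in Pos (X - x)]scale1r -Cr1; apply: Pos_sub_nm => //.
  exact: Pos_sa.
split=> //; apply: Pos_nm ler01 => //.
by rewrite Cr1 scale1r opprB addrC subrK.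
Qed.

(** For a small multiple [z] of [x] put [q = - star z * z] and [p = z * star z]; then
    [(1 - p)^m z = z (1 + q)^m]. The left side stays bounded because [0 <= p <= 1], while
    [(1 + q)^m >= 1 + m q] makes [m] times the norm of [q^2] bounded. Hence [q = 0]. *)
Lemma neg_star_eq0 x : Pos (- (star x * x)) -> Pos (x * star x) -> x = 0.
Proof.
pose Q := - (star x * x); rewrite -/Q => pQ pP.
pose t : R := (1 + nm x)^-1.
have n0 := nm_ge0 x.
have t0 : 0 < t by rewrite invr_gt0; lra.
pose z := t%:C *: x.
have z1 : nm z <= 1.
  by rewrite nmZr gtr0_norm// mulrC ler_pdivrMr; lra.
suff : z = 0.
  move/(congr1 nm); rewrite nm0 nmZr => /eqP; rewrite mulf_eq0 normr_eq0 gt_eqF//=.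
  by move=> /eqP /nm0_eq0.
have zz : star z * z = - ((t * t)%:C *: Q).
  by rewrite /z starZr -scalerAl -scalerAr scalerA -CrM /Q scalerN opprK.
have zz' : z * star z = (t * t)%:C *: (x * star x).
  by rewrite /z starZr -scalerAl -scalerAr scalerA -CrM.
have tt : 0 <= t * t by rewrite mulr_ge0// ltW.
have {pQ} := PosZ tt pQ; have {pP} := PosZ tt pP.
rewrite -zz'; set q := _ *: Q in zz *; set p := z * _ => pp pq.
have p1 : nm p <= 1.
  by rewrite (le_trans (nmM _ _))// nm_star mulr_ile1 ?nm_ge0.
have [_ np] := Pos_cst1 pp p1.
have E m : (1 - p) ^+ m * z = z * (1 + q) ^+ m.
  elim: m => [|m IH]; first by rewrite !expr0 mulr1 mul1r.
  rewrite exprSr exprS -mulrA (_ : (1 - p) * z = z * (1 + q)).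
    by rewrite !mulrA IH -!mulrA -exprSr -exprS.
  rewrite /p mulrDr mulrBl -mulrA zz; alg R.
have qm m : nm (q * (1 + q) ^+ m) <= 1.
  have -> : q * (1 + q) ^+ m = - (star z * (z * (1 + q) ^+ m)).
    by rewrite mulrA zz mulNr opprK.
  rewrite nmN -E (le_trans (nmM _ _))// nm_star mulr_ile1 ?nm_ge0//.
  by rewrite (le_trans (nmM _ _))// mulr_ile1 ?nm_ge0// nmX.
have pq1 : Pos (1 + q) by apply: PosD => //; exact: Pos1.
have low m : Pos ((1 + q) ^+ m - 1 - m%:R%:C *: q) /\
   GRing.comm q ((1 + q) ^+ m - 1 - m%:R%:C *: q).
  elim: m => [|m [IH IH']].
    rewrite expr0 subrr scale0r subr0; split; [exact: Pos0|exact: commr0].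
  have -> : (1 + q) ^+ m.+1 - 1 - m.+1%:R%:C *: q =
    ((1 + q) ^+ m - 1 - m%:R%:C *: q) * (1 + q) + m%:R%:C *: (q * q).
    rewrite exprSr -natr1 CrD Cr1; alg R.
  split.
    apply: PosD; last by apply/PosZ; [exact: ler0n|apply/Pos_sqr/Pos_sa].
    by apply: PosM => //; apply: (commrD (commr1 _)); apply/commr_sym.
  apply: commrD; first by apply: commrM => //; apply: commrD; [exact: commr1|].
  by rewrite /GRing.comm; alg R.
have mq (m : nat) : m%:R * nm (q * q) <= 1.
  apply: le_trans (qm m).
  rewrite -[X in X * _]ger0_norm ?ler0n// -nmZr; apply: Pos_le.
    by apply/PosZ; [exact: ler0n|apply/Pos_sqr/Pos_sa].
  rewrite (_ : _ - _ = q + q * ((1 + q) ^+ m - 1 - m%:R%:C *: q)); last by alg R.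
  by apply: PosD => //; have [] := low m; move=> *; apply: PosM.
have := ler_natM_eq0 (nm_ge0 _) mq.
rewrite (nmsa (Pos_sa pq)) => /eqP; rewrite sqrf_eq0 => /eqP/nm0_eq0 q0.
by apply: star_eq0; rewrite zz q0 oppr0.
Qed.

(** With [k] the square root of [h^2], the element [b = k - h] is twice the negative part of [h].
    For [c = x b] both [- star c * c = b k b] and [c * star c = (u^2 + v^2) / 2 + b k b] are
    positive, so [c = 0] by [neg_star_eq0], and this forces [b = 0], that is [h = k]. *)
Lemma Pos_star x : Pos (star x * x).
Proof.
pose h := star x * x; rewrite -/h.
have sh : sa h by exact: sastar.
have [k [pk kk kS]] := Pos_sqrt (Pos_sqr sh).
have kh : k * h = h * k.
  by apply: (kS _ (csub_comm h)); rewrite ?mul1r ?mulr1 ?mulrA.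
pose b := k - h; pose a := k + h.
have sk := Pos_sa pk.
have sb : sa b by exact: saB.
have ab : a * b = 0 by rewrite /a /b mulrDl !mulrBr kk kh; alg R.
have bbb : b * b * b = b * k * b + b * k * b.
  rewrite (_ : _ + _ = b * (a + b) * b); last by rewrite /a /b; alg R.
  rewrite (_ : b * (a + b) * b = b * (a * b) + b * b * b); last by alg R.
  by rewrite ab mulr0 add0r.
pose c := x * b.
have cc : star c * c = - (b * k * b).
  rewrite (_ : _ * _ = b * h * b); last by rewrite /c starM sb /h; alg R.
  have -> : b * h * b = half *: ((b * a) * b - b * b * b).
    rewrite -[LHS]halfE /a /b; congr (_ *: _); alg R.
  rewrite (_ : b * a * b = b * (a * b)); last by alg R.
  by rewrite ab mulr0 sub0r bbb scalerN halfE.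
have pQ : Pos (b * k * b) by apply: Pos_conj => //; rewrite /b mulrBl mulrBr kh.
have pP : Pos (c * star c).
  pose u := c + star c; pose v := ii *: (c - star c).
  have su : sa u by rewrite /sa /u starD starK addrC.
  have sv : sa v by rewrite /sa /v star_ii starB starK -scalerN opprB.
  have -> : c * star c = half *: (u * u + v * v) + b * k * b.
    rewrite -(opprK (b * k * b)) -cc /v -!scalerAl -!scalerAr scalerA iiM.
    by rewrite -[in LHS](halfE (c * star c)) -[in RHS](halfE (star c * c)) /u; alg R.
  apply: PosD => //; apply: PosZ; first by rewrite invr_ge0.
  by apply: PosD; exact: Pos_sqr.
have c0 : c = 0 by apply: neg_star_eq0 => //; rewrite cc opprK.
have /eqP bkb : b * k * b = 0 by rewrite -[LHS]opprK -cc c0 mulr0 oppr0.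
have b3 : b * b * b = 0 by rewrite bbb (eqP bkb) addr0.
have b2 : b * b = 0.
  by apply: star_eq0; rewrite starM sb (mulrA (b * b)) b3 mul0r.
have b0 : b = 0 by apply: star_eq0; rewrite sb.
by rewrite -(subr0_eq b0).
Qed.

Lemma Pos_star' x : Pos (x * star x).
Proof. by rewrite -{1}(starK x); exact: Pos_star. Qed.

Lemma Pos_cong x y : Pos x -> Pos (star y * x * y).
Proof.
move=> /Pos_sqrt[k [/Pos_sa sk <- _]].
rewrite -mulrA -mulrA mulrA -[X in _ * X * _]sk -starM; exact: Pos_star.
Qed.
End Kaplansky.

(** * Functional calculus *)

Section PolyCalculus.
Context {R : realType} {B : ucstarType R}.
Implicit Types (b x y z : B) (c : R[i]) (r t : R) (p q : {poly R}).

Definition pe b p : B := horner_alg b (map_poly (real_complex R) p).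

Lemma peD b p q : pe b (p + q) = pe b p + pe b q.
Proof. by rewrite /pe !rmorphD. Qed.
Lemma peN b p : pe b (- p) = - pe b p.
Proof. by rewrite /pe !rmorphN. Qed.
Lemma peM b p q : pe b (p * q) = pe b p * pe b q.
Proof. by rewrite /pe !rmorphM. Qed.
Lemma peC b r : pe b r%:P = r%:C%:A.
Proof. by rewrite /pe map_polyC horner_algC. Qed.
Lemma peX b : pe b 'X = b.
Proof. by rewrite /pe map_polyX horner_algX. Qed.
Lemma pe_comm b p q : pe b p * pe b q = pe b q * pe b p.
Proof. by rewrite -!peM mulrC. Qed.
Lemma pe_csub b S : csub S -> S 1 -> S b -> forall p, S (pe b p).
Proof.
move=> cS S1 Sb; case: (cS) => _ SD SM SZ; elim/poly_ind => [|p r IH].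
  by rewrite -polyC0 peC scale0r; apply: csub0 cS S1.
by rewrite peD peM peX peC; apply: (SD); [apply: (SM)|apply: (SZ)].
Qed.
Lemma pe_sa b p : sa b -> sa (pe b p).
Proof.
move=> sb; elim/poly_ind: p => [|p r IH].
  by rewrite -polyC0 peC; apply: sac.
rewrite peD peM peX peC; apply: saD; last exact: sac.
by apply: saM => //; have := pe_comm b p 'X; rewrite peX.
Qed.

(** The remainder modulo the real quadratic is a real polynomial of degree at most one with a
    nonreal root, hence zero. *)
Lemma complex_root_dvdp p (u v : R) : v != 0 ->
  root (map_poly (real_complex R) p) (u +i* v) ->
  exists q, p = q * (('X - u%:P) ^+ 2 + (v ^+ 2)%:P).
Proof.
move=> v0 rp; set d := _ + _.
have sd : size d = 3%N.
  rewrite /d size_polyDl size_exp_XsubC// size_polyC.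
  by case: (_ == 0).
have md : (size (p %% d)%R <= 2)%N by rewrite -ltnS -sd ltn_modp -size_poly_gt0 sd.
exists (p %/ d); rewrite {1}(divp_eq p d) -[RHS]addr0; congr (_ + _).
have : root (map_poly (real_complex R) (p %% d)) (u +i* v).
  move: rp; rewrite {1}(divp_eq p d) rmorphD rmorphM /root hornerD hornerM.
  rewrite (_ : (map_poly _ d).[_] = 0) ?mulr0 ?add0r//.
  rewrite /d rmorphD rmorphXn rmorphB /= map_polyX !map_polyC /=.
  rewrite hornerD horner_exp !hornerE /=; simpc.
  by apply/eqP; rewrite eq_complex /= !expr2; apply/andP; split; apply/eqP; ring.
set m := p %% d in md *.
have -> : m = (m`_0)%:P + m`_1%N *: 'X.
  apply/polyP => i; rewrite coefD coefZ coefC coefX.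
  case: i => [|[|i]] /=; rewrite ?mulr0 ?mulr1 ?addr0 ?add0r//.
  by rewrite nth_default// (leq_trans md).
rewrite rmorphD /= map_polyC map_polyZ map_polyX /root !hornerE /= eq_complex /=.
rewrite !mul0r !addr0 !add0r => /andP[/eqP h1 /eqP h2].
have m1 : m`_1%N = 0.
  by apply/eqP; move/eqP: h2; rewrite mulf_eq0 (negPf v0) orbF.
move: h1; rewrite m1 mul0r subr0 addr0 => ->.
by rewrite scale0r addr0.
Qed.

(** Induction on the degree, splitting off a root. A nonreal root yields a sum of squares; a real
    root lies outside [[-1, 1]] and yields a linear factor that is positive at [b] up to sign
    because [b] is a contraction. Products of commuting positive elements are positive. *)
Lemma Pos_pe_gt0 b p : sa b -> nm b <= 1 ->
  (forall t, -1 <= t <= 1 -> 0 < p.[t]) -> Pos (pe b p).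
Proof.
move=> sb b1; have [n] := ubnP (size p); elim: n p => // n IH p /ltnSE szp pp.
have p0 : p != 0.
  apply/eqP => p0; have /(_ _)/[!p0] := pp 0; rewrite horner0 ltxx => H.
  by have : false by apply: H; rewrite ler01 oppr_le0 ler01.
have [sp|sp] := leqP (size p) 1%N.
  move: pp; rewrite (size1_polyC sp) peC => pp; apply: Posc; apply: ltW.
  by have := pp 0; rewrite hornerC; apply; rewrite ler01 oppr_le0 ler01.
have [|z rz] := @closed_rootP _ (map_poly (real_complex R) p) _.
  by rewrite size_map_poly; apply: contraTneq sp => ->.
case: z rz => u v rz.
have [v0|v0] := eqVneq v 0; last first.
  have [q pE] := complex_root_dvdp v0 rz.
  pose d : {poly R} := ('X - u%:P) ^+ 2 + (v ^+ 2)%:P.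
  have dv t : d.[t] = (t - u) ^+ 2 + v ^+ 2 by rewrite !hornerE.
  have d0 t : 0 < d.[t] by rewrite dv ltr_wpDl ?sqr_ge0// exprn_even_gt0.
  have sd : size d = 3%N.
    rewrite /d size_polyDl size_exp_XsubC// size_polyC.
    by case: (_ == 0).
  rewrite pE peM; apply: PosM; last exact: pe_comm.
    apply: IH => [|t ht].
      have q0 : q != 0 by apply: contraNneq p0 => q0; rewrite pE q0 mul0r.
      have : size p = (size q).+2.
        rewrite pE size_mul ?sd//; first by rewrite !addnS addn0.
        by rewrite -size_poly_eq0 sd.
      by move=> E; rewrite E in szp; rewrite (leq_trans _ szp).
    by have := pp _ ht; rewrite pE hornerM -/d pmulr_lgt0.
  rewrite peD expr2 peM peC; apply: PosD; last exact/Posc/sqr_ge0.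
  exact/Pos_sqr/pe_sa.
rewrite {}v0 in rz.
have ru : root p u.
  move: rz; rewrite (_ : u +i* 0 = u%:C)// fmorph_root//.
have /factor_theorem[q pE] := ru.
have q0 : q != 0 by apply: contraNneq p0 => q0; rewrite pE q0 mul0r.
have sq : size p = (size q).+1.
  by rewrite pE size_mul ?polyXsubC_eq0// size_XsubC addnS /= addn1.
have u1 : ~~ (-1 <= u <= 1).
  by apply/negP => /pp; rewrite (rootP ru) ltxx.
rewrite sq in szp.
have [ul|ul] := ltP u (-1).
  rewrite pE peM; apply: PosM; last exact: pe_comm.
    apply: IH => // t /andP[t1 t2].
    have := pp t; rewrite pE hornerM t1 t2 => /(_ erefl).
    rewrite pmulr_lgt0// !hornerE; lra.
  rewrite peD peN peX peC.
  have -> : b - u%:C%:A = (1%:C%:A - - b) + (- u - 1)%:C%:A.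
    rewrite CrB CrN; alg R.
  apply: PosD; last by apply: Posc; lra.
  by apply: Pos_sub_nm; rewrite ?nmN//; exact: saN.
have {}ul : 1 < u by move: u1; rewrite ul /= ltNge.
rewrite pE -mulrNN peM; apply: PosM; last exact: pe_comm.
  apply: IH => [|t /andP[t1 t2]]; first by rewrite size_polyN.
  have := pp t; rewrite pE hornerM t1 t2 => /(_ erefl).
  rewrite nmulr_lgt0 ?hornerE ?oppr_gt0//; lra.
rewrite opprB peD peN peX peC.
have -> : u%:C%:A - b = (1%:C%:A - b) + (u - 1)%:C%:A.
  rewrite CrB; alg R.
apply: PosD; last by apply: Posc; lra.
exact: Pos_sub_nm.
Qed.

Lemma Pos_pe b p : sa b -> nm b <= 1 ->
  (forall t, -1 <= t <= 1 -> 0 <= p.[t]) -> Pos (pe b p).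
Proof.
move=> sb b1 pp; apply: Pos_closed => e e0.
exists (pe b (p + (e / 2)%:P)).
  apply: Pos_pe_gt0 => // t ht; rewrite !hornerE ltr_wpDl ?pp//.
  by rewrite divr_gt0.
rewrite peD opprD addrA subrr add0r nmN peC (le_lt_trans (nmc _))//.
by rewrite gtr0_norm; lra.
Qed.

Lemma pe_nm b p (M : R) : sa b -> nm b <= 1 -> 0 <= M ->
  (forall t, -1 <= t <= 1 -> `|p.[t]| <= M) -> nm (pe b p) <= M.
Proof.
move=> sb b1 M0 pM.
rewrite -(ler_pXn2r (isT : (0 < 2)%N)) ?nnegrE ?nm_ge0// -nmsa; last exact: pe_sa.
apply: Pos_nm (exprn_ge0 _ M0); first exact/Pos_sqr/pe_sa.
rewrite -(peC b) -peM -peN -peD; apply: Pos_pe => // t ht.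
rewrite !hornerE subr_ge0 -expr2 -(real_normK (num_real p.[t])).
by rewrite ler_pXn2r ?nnegrE// pM.
Qed.
End PolyCalculus.

(** * Uniform approximation by polynomials on [-1, 1] *)

Section Approximable.
Context {R : realType}.
Implicit Types (p q : {poly R}) (g h : R -> R) (t e : R).

Definition near p g e := forall t, -1 <= t <= 1 -> `|p.[t] - g t| <= e.
(** This class is stable under the algebraic and the lattice operations, which covers the piecewise
    linear functions used as cutoffs and slices. *)
Definition apx g := forall e, 0 < e -> exists p, near p g e.

Lemma poly_bounded p : exists2 K : R, 0 < K &
  forall t, -1 <= t <= 1 -> `|p.[t]| <= K.
Proof.
elim/poly_ind: p => [|p r [K K0 pK]].
  by exists 1 => // t _; rewrite horner0 normr0.
exists (K + `|r|); first by rewrite ltr_pwDl.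
move=> t ht; rewrite !hornerE (le_trans (ler_normD _ _))// lerD2r normrM.
by rewrite -[K]mulr1 ler_pM ?pK// ler_norml.
Qed.

Lemma apx_bounded g : apx g -> exists2 K : R, 0 < K &
  forall t, -1 <= t <= 1 -> `|g t| <= K.
Proof.
move=> /(_ 1 ltr01)[p pg]; have [K K0 pK] := poly_bounded p.
exists (K + 1); first by rewrite addr_gt0.
move=> t ht; have -> : g t = p.[t] - (p.[t] - g t) by ring.
by rewrite (le_trans (ler_normB _ _))// lerD ?pK ?pg.
Qed.

Lemma apx_cst r : apx (fun=> r).
Proof. by move=> e e0; exists r%:P => t _; rewrite hornerC subrr normr0 ltW. Qed.
Lemma apx_id : apx id.
Proof. by move=> e e0; exists 'X => t _; rewrite hornerX subrr normr0 ltW. Qed.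
Lemma apxD g h : apx g -> apx h -> apx (fun t => g t + h t).
Proof.
move=> ag ah e e0; have e2 : 0 < e / 2 by rewrite divr_gt0.
have [p pg] := ag _ e2; have [q qh] := ah _ e2; exists (p + q) => t ht.
rewrite hornerD opprD addrACA (le_trans (ler_normD _ _))//.
by rewrite (splitr e) lerD ?pg ?qh.
Qed.
Lemma near_mul g h p q Kp Kh e1 e2 : 0 <= e1 -> 0 <= e2 ->
  (forall t, -1 <= t <= 1 -> `|p.[t]| <= Kp) ->
  (forall t, -1 <= t <= 1 -> `|h t| <= Kh) ->
  near p g e1 -> near q h e2 -> near (p * q) (fun t => g t * h t) (Kp * e2 + e1 * Kh).
Proof.
move=> e10 e20 hp hh pg qh t ht; rewrite hornerM.
have -> : p.[t] * q.[t] - g t * h t =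
  p.[t] * (q.[t] - h t) + (p.[t] - g t) * h t by ring.
rewrite (le_trans (ler_normD _ _))// !normrM lerD// ler_pM ?hp ?qh ?pg ?hh//.
Qed.
Lemma apxM g h : apx g -> apx h -> apx (fun t => g t * h t).
Proof.
move=> ag ah e e0; have e2 : 0 < e / 2 by rewrite divr_gt0.
have [Kh Kh0 hKh] := apx_bounded ah.
have [p pg] := ag _ (divr_gt0 e2 Kh0); have [K K0 pK] := poly_bounded p.
have [q qh] := ah _ (divr_gt0 e2 K0); exists (p * q).
move=> t ht.
have := near_mul (ltW (divr_gt0 e2 Kh0)) (ltW (divr_gt0 e2 K0)) pK hKh pg qh ht.
by rewrite (mulrC K) !divfK ?gt_eqF// -splitr.
Qed.
Lemma apxZ r g : apx g -> apx (fun t => r * g t).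
Proof. exact/apxM/apx_cst. Qed.
Lemma apxN g : apx g -> apx (fun t => - g t).
Proof. by move=> /(apxZ (-1)); under eq_fun do rewrite mulN1r. Qed.
Lemma apxB g h : apx g -> apx h -> apx (fun t => g t - h t).
Proof. by move=> ag /apxN; apply: apxD. Qed.

(** The increment of [cseq] at [n] is [(1 - cseq n)^2 / 2], so small increments force values close
    to [1]. *)
Lemma cseq_lim (e : R) : 0 < e -> exists n, 1 - cseq n < e.
Proof.
move=> e0; have e2 : 0 < e ^+ 2 / 2 by rewrite divr_gt0// exprn_gt0.
have [N /(_ N.+1 (leqnSn _)) /= H] :=
  mono_cauchy (@cseqS R) (@cseq_le1 R) e2.
exists N; have := @cseq_le1 R N; have := @cseq_ge0 R N; nra.
Qed.

(** The iteration [rseq] for [g = 1 - t^2]; thus [1 - rpoly n] tends to the square root of [t^2],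
    the absolute value, with an error controlled by [cseq] uniformly in [t]. *)
Fixpoint rpoly n : {poly R} :=
  if n is n.+1 then 2^-1 *: (1 - 'X ^+ 2 + rpoly n ^+ 2) else 0.

Lemma rpoly_bound n t : -1 <= t <= 1 ->
  [/\ 0 <= (rpoly n).[t], (rpoly n).[t] <= cseq n,
      (rpoly n).[t] <= 1 - `|t| & 1 - `|t| - (rpoly n).[t] <= 1 - cseq n].
Proof.
move=> ht; have t1 : `|t| <= 1 by rewrite ler_norml.
have t0 := normr_ge0 t.
elim: n => [|n [h1 h2 h3 h4]] /=; first by rewrite horner0; split; lra.
have c1 := @cseq_le1 R n.
rewrite !hornerE -(real_normK (num_real t)); set r := (rpoly n).[t] in h1 h2 h3 h4 *.
set s := `|t| in t1 t0 h3 h4 *; set c := cseq n in h2 h4 c1 *.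
split; nra.
Qed.

Lemma poly_abs (e : R) : 0 < e -> exists p, near p Num.norm e.
Proof.
move=> e0; have [n hn] := cseq_lim e0; exists (1 - rpoly n) => t ht.
have [h1 h2 h3 h4] := rpoly_bound n ht.
by rewrite !hornerE ger0_norm; lra.
Qed.

Lemma apx_abs g : apx g -> apx (fun t => `|g t|).
Proof.
move=> ag e e0; have e2 : 0 < e / 2 by rewrite divr_gt0.
have [p pg] := ag _ e2; have [K K0 pK] := poly_bounded p.
have [q qa] := poly_abs (divr_gt0 e2 K0).
(* The polynomial [q] approximates the absolute value only on [[-1, 1]], so [p] is divided by its
   bound [K] before composing and the result is multiplied by [K]. *)
exists (K *: (q \Po (K^-1 *: p))) => t ht.
rewrite !hornerE horner_comp !hornerE.
have := qa (K^-1 * p.[t]); rewrite -ler_norml normrM gtr0_norm ?invr_gt0//.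
rewrite mulrC ler_pdivrMr// mul1r pK// mulrC => /(_ erefl).
rewrite ler_pdivlMr//.
have := pg t ht; set u := q.[_]; set v := `|p.[t]|; move=> h1 h2.
have h3 : `|K * u - v| <= e / 2.
  have -> : K * u - v = (u - K^-1 * v) * K by field; rewrite gt_eqF.
  by rewrite normrM (gtr0_norm K0).
have h4 : `|v - `|g t| | <= e / 2 by rewrite (le_trans (ler_dist_dist _ _)).
have -> : K * u - `|g t| = (K * u - v) + (v - `|g t|) by ring.
by rewrite (le_trans (ler_normD _ _))// (splitr e) lerD.
Qed.
Lemma maxE (x y : R) : Num.max x y = 2^-1 * (x + y + `|x - y|).
Proof. by case: (lerP y x) => ?; lra. Qed.
Lemma minE (x y : R) : Num.min x y = 2^-1 * (x + y - `|x - y|).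
Proof. by case: (lerP y x) => ?; lra. Qed.
Lemma apx_max g h : apx g -> apx h -> apx (fun t => Num.max (g t) (h t)).
Proof.
move=> ag ah; under eq_fun do rewrite maxE.
by apply: apxZ; apply: apxD; [exact: apxD|apply: apx_abs; exact: apxB].
Qed.
Lemma apx_min g h : apx g -> apx h -> apx (fun t => Num.min (g t) (h t)).
Proof.
move=> ag ah; under eq_fun do rewrite minE.
by apply: apxZ; apply: apxB; [exact: apxD|apply: apx_abs; exact: apxB].
Qed.
End Approximable.

(** * Continuous functional calculus of a self-adjoint contraction *)

Section Calculus.
Context {R : realType} {B : ucstarType R}.
Implicit Types (b x y z : B) (c : R[i]) (r t e : R) (p q : {poly R}) (g h : R -> R).

(** The value is pinned down by the estimate itself, so no approximating sequence has to be chosen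
    in the definition of [fc]. *)
Definition fcs b g : set B :=
  [set m | forall e, 0 < e -> forall p, near p g e -> nm (pe b p - m) <= e].
Definition fc b g : B := xget 0 (fcs b g).

Lemma near_nm b p q g e1 e2 : sa b -> nm b <= 1 -> 0 <= e1 -> 0 <= e2 ->
  near p g e1 -> near q g e2 -> nm (pe b p - pe b q) <= e1 + e2.
Proof.
move=> sb b1 e10 e20 pg qg; rewrite -peN -peD; apply: pe_nm => //.
  exact: addr_ge0.
move=> t ht; rewrite !hornerE.
have -> : p.[t] - q.[t] = (p.[t] - g t) - (q.[t] - g t) by ring.
by rewrite (le_trans (ler_normB _ _))// lerD ?pg ?qg.
Qed.

Lemma invS_small e : 0 < e -> exists N : nat, forall n, (N <= n)%N -> n.+1%:R^-1 < e.
Proof.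
move=> e0; exists (Num.bound e^-1) => n Nn.
rewrite invf_plt ?posrE// (lt_le_trans (archi_boundP _))// ?invr_ge0 ?(ltW e0)//.
by rewrite ler_nat (leq_trans Nn).
Qed.

Lemma fcP b g : sa b -> nm b <= 1 -> apx g -> fcs b g (fc b g).
Proof.
move=> sb b1 ag; apply: xgetPex.
have /choice[u hu] : forall n, exists p, near p g (n.+1%:R^-1).
  by move=> n; apply: ag; rewrite invr_gt0.
have inv0 n : 0 <= (n.+1%:R^-1 : R) by rewrite invr_ge0.
have [|m um] := @nm_complete R B (fun n => pe b (u n)).
  move=> e e0; have e2 : 0 < e / 2 by rewrite divr_gt0.
  have [N hN] := invS_small e2; exists N => m n Nm Nn.
  rewrite (le_lt_trans (near_nm sb b1 _ _ (hu m) (hu n)))//.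
  by rewrite (splitr e) ltrD ?hN.
exists m => e e0 p pg; apply/ler_addgt0Pl => d d0.
have d2 : 0 < d / 2 by rewrite divr_gt0.
have [N hN] := invS_small d2; have [M hM] := um _ d2.
pose n := maxn N M.
have -> : pe b p - m = (pe b p - pe b (u n)) + (pe b (u n) - m) by alg R.
rewrite (le_trans (nmD _ _))//.
have h1 := near_nm sb b1 (ltW e0) (inv0 n) pg (hu n).
rewrite [d]splitr [in leRHS]addrC addrA lerD ?(ltW (hM n (leq_maxr _ _)))//.
by rewrite (le_trans h1)// lerD2l ltW// hN// leq_maxl.
Qed.

Section Fixb.
Variables (b : B) (sb : sa b) (b1 : nm b <= 1).

Lemma fc_uniq g m : (forall e, 0 < e -> exists2 p, near p g e & nm (pe b p - m) <= e) ->
  fc b g = m.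
Proof.
move=> H.
have ag : apx g by move=> e /H[p pg _]; exists p.
apply/subr0_eq/nm_small => e e0; have e2 : 0 < e / 2 by rewrite divr_gt0.
have [p pg pm] := H _ e2; have := fcP sb b1 ag e2 pg => pf.
have -> : fc b g - m = (pe b p - m) - (pe b p - fc b g) by alg R.
by rewrite (le_trans (nmD _ _))// nmN (splitr e) lerD.
Qed.

Lemma fc_approx g e : apx g -> 0 < e ->
  exists2 p, near p g e & nm (pe b p - fc b g) <= e.
Proof. by move=> ag e0; have [p pg] := ag _ e0; exists p => //; apply: fcP pg. Qed.

Lemma fc_poly p : fc b (fun t => p.[t]) = pe b p.
Proof.
apply: fc_uniq => e e0; exists p; last by rewrite subrr nm0 ltW.
by move=> t _; rewrite subrr normr0 ltW.
Qed.
Lemma fcC r : fc b (fun=> r) = r%:C%:A.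
Proof.
rewrite -(peC b) -fc_poly; congr fc; apply/funext => t.
by rewrite hornerC.
Qed.
Lemma fcX : fc b id = b.
Proof.
rewrite -[RHS](peX b) -fc_poly; congr fc; apply/funext => t.
by rewrite hornerX.
Qed.
Lemma fc_ext g h : (forall t, -1 <= t <= 1 -> g t = h t) -> fc b g = fc b h.
Proof.
move=> gh; rewrite /fc; congr xget; apply/seteqP; split => m hm e e0 p pg.
  by apply: hm => // t ht; rewrite gh ?pg.
by apply: hm => // t ht; rewrite -gh ?pg.
Qed.
Lemma fcD g h : apx g -> apx h -> fc b (fun t => g t + h t) = fc b g + fc b h.
Proof.
move=> ag ah; apply: fc_uniq => e e0; have e2 : 0 < e / 2 by rewrite divr_gt0.
have [p pg pm] := fc_approx ag e2; have [q qh qm] := fc_approx ah e2.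
exists (p + q) => [t ht|].
  rewrite hornerD opprD addrACA (le_trans (ler_normD _ _))//.
  by rewrite (splitr e) lerD ?pg ?qh.
rewrite peD opprD addrACA (le_trans (nmD _ _))//.
by rewrite (splitr e) lerD.
Qed.
Lemma fc_csub S g : csub S -> S 1 -> S b -> apx g -> S (fc b g).
Proof.
move=> cS S1 Sb ag; case: (cS) => + _ _ _; apply => e e0.
have e2 : 0 < e / 2 by rewrite divr_gt0.
have [p _ pm] := fc_approx ag e2; exists (pe b p); first exact: pe_csub.
by rewrite nmB (le_lt_trans pm)//; lra.
Qed.
Lemma fc_sa g : apx g -> sa (fc b g).
Proof.
move=> ag; apply/subr0_eq/nm_small => e e0.
have e2 : 0 < e / 2 by rewrite divr_gt0.
have [p _ pm] := fc_approx ag e2.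
have -> : star (fc b g) - fc b g = (pe b p - fc b g) - star (pe b p - fc b g).
  by rewrite starB (pe_sa _ sb); alg R.
rewrite (le_trans (nmD _ _))// nmN nm_star; lra.
Qed.
Lemma fc_nm g (M : R) : apx g -> 0 <= M ->
  (forall t, -1 <= t <= 1 -> `|g t| <= M) -> nm (fc b g) <= M.
Proof.
move=> ag M0 gM; apply/ler_addgt0Pl => e e0.
have e2 : 0 < e / 2 by rewrite divr_gt0.
have [p pg pm] := fc_approx ag e2.
have -> : fc b g = pe b p - (pe b p - fc b g) by alg R.
rewrite (le_trans (nmD _ _))// nmN.
suff : nm (pe b p) <= M + e / 2 by lra.
apply: pe_nm => //; first by rewrite addr_ge0// ltW.
move=> t ht; have -> : p.[t] = g t + (p.[t] - g t) by ring.
by rewrite (le_trans (ler_normD _ _))// lerD ?pg ?gM.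
Qed.
Lemma fcM g h : apx g -> apx h -> fc b (fun t => g t * h t) = fc b g * fc b h.
Proof.
move=> ag ah; apply/subr0_eq/nm_small => e e0.
have agh := apxM ag ah.
have e3 : 0 < e / 3 by rewrite divr_gt0.
have [Kh Kh0 hKh] := apx_bounded ah.
pose d1 := e / 6 / Kh; have d10 : 0 < d1 by rewrite !divr_gt0.
have [p pg pm] := fc_approx ag d10; have [K K0 pK] := poly_bounded p.
pose d2 := e / 6 / K; have d20 : 0 < d2 by rewrite !divr_gt0.
have [q qh qm] := fc_approx ah d20.
have := fcP sb b1 agh e3 (p := p * q).
have F : near (p * q) (fun t => g t * h t) (e / 3).
  move=> t ht; have := near_mul (ltW d10) (ltW d20) pK hKh pg qh ht.
  rewrite (mulrC K) !divfK ?gt_eqF//; lra.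
move=> /(_ F) H.
have -> : fc b (fun t => g t * h t) - fc b g * fc b h =
  pe b p * (pe b q - fc b h) + (pe b p - fc b g) * fc b h -
  (pe b (p * q) - fc b (fun t => g t * h t)) by rewrite peM; alg R.
rewrite (le_trans (nmD _ _))// nmN.
have a1 : nm (pe b p * (pe b q - fc b h)) <= e / 6.
  rewrite (le_trans (nmM _ _))//.
  have -> : e / 6 = K * d2 by rewrite /d2 (mulrC K) divfK ?gt_eqF.
  by rewrite ler_pM ?nm_ge0// pe_nm ?(ltW K0).
have a2 : nm ((pe b p - fc b g) * fc b h) <= e / 6.
  rewrite (le_trans (nmM _ _))//.
  have -> : e / 6 = d1 * Kh by rewrite /d1 divfK ?gt_eqF.
  by rewrite ler_pM ?nm_ge0// fc_nm ?(ltW Kh0).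
have := nmD (pe b p * (pe b q - fc b h)) ((pe b p - fc b g) * fc b h); lra.
Qed.
Lemma fcZ r g : apx g -> fc b (fun t => r * g t) = r%:C *: fc b g.
Proof. by move=> ag; rewrite fcM ?fcC ?mulr_algl//; exact: apx_cst. Qed.
Lemma fcN g : apx g -> fc b (fun t => - g t) = - fc b g.
Proof.
move=> ag; rewrite -scaleN1r -[-1 in RHS]/(- 1%:C) -CrN -fcZ//.
by congr fc; apply/funext => t; rewrite mulN1r.
Qed.
Lemma fcB g h : apx g -> apx h -> fc b (fun t => g t - h t) = fc b g - fc b h.
Proof. by move=> ag ah; rewrite fcD ?fcN//; exact: apxN. Qed.
Lemma fc_comm g h : apx g -> apx h -> fc b g * fc b h = fc b h * fc b g.
Proof.
move=> ag ah; rewrite -!fcM//; apply: fc_ext => t _; exact: mulrC.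
Qed.
Lemma fc0 g : (forall t, -1 <= t <= 1 -> g t = 0) -> fc b g = 0.
Proof. by move=> g0; rewrite (fc_ext g0) fcC scale0r. Qed.
Lemma fcM0 g h : apx g -> apx h -> (forall t, -1 <= t <= 1 -> g t * h t = 0) ->
  fc b g * fc b h = 0.
Proof. by move=> ag ah gh; rewrite -fcM// fc0. Qed.

Lemma fc_eigen g s y : apx g -> -1 <= s <= 1 -> b * y = s%:C *: y ->
  fc b g * y = (g s)%:C *: y.
Proof.
move=> ag hs by_; apply/subr0_eq/nm_small => e e0.
have y0 := nm_ge0 y; have y1 : 0 < nm y + 1 by lra.
have e2 : 0 < e / 2 / (nm y + 1) by rewrite !divr_gt0.
have [p pg pm] := fc_approx ag e2.
have E : pe b p * y = (p.[s])%:C *: y.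
  elim/poly_ind: p {pg pm} => [|p r IH].
    by rewrite horner0 -polyC0 peC !scale0r mul0r.
  rewrite peD peM peX peC mulrDl -mulrA by_ -scalerAr IH !hornerE CrD CrM.
  alg R.
have -> : fc b g * y - (g s)%:C *: y =
  (p.[s] - g s)%:C *: y - (pe b p - fc b g) * y.
  by rewrite mulrBl E CrB; alg R.
rewrite (le_trans (nmD _ _))// nmN nmZr.
have H : e / 2 / (nm y + 1) * nm y <= e / 2.
  by rewrite -mulrA ler_piMr ?divr_ge0 ?(ltW e0)// mulrC ler_pdivrMr//; lra.
have h1 : `|p.[s] - g s| * nm y <= e / 2 / (nm y + 1) * nm y.
  by rewrite ler_wpM2r// pg.
have h2 := nmM (pe b p - fc b g) y.
have h3 : nm (pe b p - fc b g) * nm y <= e / 2 / (nm y + 1) * nm y.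
  by rewrite ler_wpM2r.
lra.
Qed.
End Fixb.
End Calculus.

(** * Annuli *)

Section Series.
Context {R : realType} {B : ucstarType R}.
Implicit Types (x y z : B).

Lemma limD (u v : nat -> B) l m : lim_to u l -> lim_to v m ->
  lim_to (fun n => u n + v n) (l + m).
Proof.
move=> ul vm e e0; have e2 : 0 < e / 2 by rewrite divr_gt0.
have [N hN] := ul _ e2; have [M hM] := vm _ e2; exists (maxn N M) => n.
rewrite geq_max => /andP[/hN h1 /hM h2].
by rewrite opprD addrACA (le_lt_trans (nmD _ _))// (splitr e) ltrD.
Qed.
Lemma lim_mulr (u : nat -> B) l y : lim_to u l -> lim_to (fun n => u n * y) (l * y).
Proof.
move=> ul e e0; have y0 := nm_ge0 y; have y1 : 0 < nm y + 1 by lra.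
have [N hN] := ul _ (divr_gt0 e0 y1); exists N => n /hN h.
rewrite -mulrBl (le_lt_trans (nmM _ _))//.
move: h; rewrite ltr_pdivlMr// => h; apply: le_lt_trans h.
by rewrite ler_wpM2l ?nm_ge0//; lra.
Qed.
Lemma lim_mull (u : nat -> B) l y : lim_to u l -> lim_to (fun n => y * u n) (y * l).
Proof.
move=> ul e e0; have y0 := nm_ge0 y; have y1 : 0 < nm y + 1 by lra.
have [N hN] := ul _ (divr_gt0 e0 y1); exists N => n /hN h.
rewrite -mulrBr (le_lt_trans (nmM _ _))// mulrC.
move: h; rewrite ltr_pdivlMr// => h; apply: le_lt_trans h.
by rewrite ler_wpM2l ?nm_ge0//; lra.
Qed.
Lemma lim_eventually (u : nat -> B) l N : (forall n, (N <= n)%N -> u n = l) ->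
  lim_to u l.
Proof. by move=> h e e0; exists N => n /h ->; rewrite subrr nm0. Qed.
Lemma lim_nm (u : nat -> B) l C : lim_to u l -> (forall n, nm (u n) <= C) -> nm l <= C.
Proof.
move=> ul uC; apply/ler_addgt0Pl => e /ul[N /(_ N (leqnn _)) h].
have -> : l = u N - (u N - l) by alg R.
by rewrite (le_trans (nmD _ _))// nmN addrC lerD// ltW.
Qed.

Lemma geo_sum n : \sum_(k < n) (2^-1 : R) ^+ k = 2 - 2 * 2^-1 ^+ n.
Proof.
elim: n => [|n IH]; first by rewrite big_ord0 expr0; lra.
by rewrite big_ord_recr /= IH exprS; lra.
Qed.

Lemma series_lim (v : nat -> B) : (forall k, nm (v k) <= 2^-1 ^+ k) ->
  exists z, lim_to (fun n => \sum_(k < n) v k) z.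
Proof.
move=> hv; pose c n : R := \sum_(k < n) 2^-1 ^+ k.
have pos k : 0 <= (2^-1 : R) ^+ k by rewrite exprn_ge0.
have cS n : c n <= c n.+1 by rewrite /c big_ord_recr /= lerDl.
have c2 n : c n <= 2 by rewrite /c geo_sum; have := pos n; lra.
have H n k : nm (\sum_(i < n + k) v i - \sum_(i < n) v i) <= c (n + k)%N - c n.
  elim: k => [|k IH]; first by rewrite addn0 !subrr nm0.
  rewrite addnS /c !big_ord_recr /= -/(c _) -/(c _) addrAC (le_trans (nmD _ _))//.
  by rewrite addrAC lerD// hv.
apply: nm_complete => e e0; have e2 : 0 < e / 2 by rewrite divr_gt0.
have [N hN] := mono_cauchy cS c2 e2; exists N => m n Nm Nn.
have K k : (N <= k)%N -> nm (\sum_(i < k) v i - \sum_(i < N) v i) < e / 2.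
  by move=> Nk; rewrite -(subnKC Nk) (le_lt_trans (H _ _))// subnKC// hN.
have -> : \sum_(k < m) v k - \sum_(k < n) v k =
  (\sum_(k < m) v k - \sum_(k < N) v k) - (\sum_(k < n) v k - \sum_(k < N) v k).
  by alg R.
by rewrite (le_lt_trans (nmD _ _))// nmN (splitr e) ltrD ?K.
Qed.
End Series.

(** * Annuli around a point of the spectrum *)

Section Isolated.
Context {R : realType} {B : ucstarType R}.
Implicit Types (x y z D : B) (g h : R -> R) (r t e s : R).

Definition ramp r d t : R := Num.min 1 (Num.max 0 ((t - r) / d)).
Lemma apx_ramp r d : apx (ramp r d).
Proof.
apply: apx_min; [exact: apx_cst|apply: apx_max; first exact: apx_cst].
under eq_fun do rewrite mulrC.
by apply/apxZ/apxB; [exact: apx_id|exact: apx_cst].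
Qed.
Lemma ramp0 r d t : 0 < d -> t <= r -> ramp r d t = 0.
Proof.
move=> d0 tr; rewrite /ramp max_l ?min_r ?ler01//.
by rewrite ler_pdivrMr// mul0r; lra.
Qed.
Lemma ramp1 r d t : 0 < d -> r + d <= t -> ramp r d t = 1.
Proof.
move=> d0 tr; have h : 1 <= (t - r) / d by rewrite ler_pdivlMr// mul1r; lra.
by rewrite /ramp max_r ?(le_trans ler01)// min_l.
Qed.
Lemma ramp_ge0 r d t : 0 <= ramp r d t.
Proof. by rewrite /ramp le_min ler01 le_max lexx. Qed.
Lemma ramp_le1 r d t : ramp r d t <= 1.
Proof. by rewrite /ramp ge_min lexx. Qed.

(* [h] lives on the annulus [eta <= |t - s| <= eps]; consecutive annuli are
   separated enough to leave room for the cutoffs of [annulus_unit]. *)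
Definition annuli s (eta eps : nat -> R) (h : nat -> R -> R) :=
  forall n, [/\ 0 < eta n, eta n <= eps n, eps n.+1 <= eta n / 2, apx (h n) &
    forall t, `|t - s| < eta n \/ eps n < `|t - s| -> h n t = 0].

Definition no_annuli (b D : B) := forall s eta eps (h : nat -> R -> R), annuli s eta eps h ->
  exists n, D * fc b (h n) = 0.

(** Let [s] be the supremum of the [r] such that [D] kills all functions of [b] supported to the
    left of [r]; then [D] survives on functions supported arbitrarily close to [s]. If it also
    survived on every punctured neighbourhood of [s], surviving functions at shrinking scales would
    contradict [no_annuli]. So near [s] only the value at [s] matters, and [(t - s) h(t)] is
    killed. *)
Lemma isolated_point b D : sa b -> nm b <= 1 -> D <> 0 -> no_annuli b D ->
  exists s h, [/\ -1 <= s <= 1, apx h, D * fc b h <> 0 &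
    D * fc b h * b = s%:C *: (D * fc b h)].
Proof.
move=> sb b1 D0 HD.
pose E := [set r | forall h, apx h -> (forall t, r <= t -> h t = 0) -> D * fc b h = 0].
have Em1 : E (-1).
  by move=> h ah h0; rewrite fc0 ?mulr0// => t /andP[/h0].
have E1 r : E r -> r <= 1.
  move=> Er; rewrite leNgt; apply/negP => r1; apply: D0.
  have r10 : 0 < r - 1 by lra.
  have ah : apx (fun t => 1 - ramp 1 (r - 1) t).
    by apply: apxB; [exact: apx_cst|exact: apx_ramp].
  have := Er _ ah; rewrite (@fc_ext _ _ b _ (fun=> 1)) ?fcC ?scale1r ?mulr1//.
    by apply=> t rt; rewrite ramp1 ?subrr// addrC subrK.
  by move=> t /andP[_ t1]; rewrite ramp0 ?subr0.
have hs : has_sup E by split; [exists (-1)|exists 1 => r /E1].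
pose s := sup E.
have s1 : -1 <= s <= 1.
  by rewrite sup_ubound ?sup_le_ub//; [exists (-1)|case: hs].
have P e : 0 < e -> exists h, [/\ apx h, forall t, e <= `|t - s| -> h t = 0 &
    D * fc b h <> 0].
  move=> e0; have e2 : 0 < e / 2 by rewrite divr_gt0.
  have [r Er rs] := sup_adherent e2 hs.
  have : ~ E (s + e / 2).
    by move=> /(sup_ubound (proj2 hs)); rewrite -/s; lra.
  move=> /existsNP[h0 /not_implyP[ah0 /not_implyP[h00 Dh0]]].
  pose k t := ramp (s - e) (e / 2) t.
  have ak : apx k by exact: apx_ramp.
  have a1k : apx (fun t => 1 - k t) by apply: apxB => //; exact: apx_cst.
  exists (fun t => h0 t * k t); split; first exact: apxM.
    move=> t; have [ts|ts] := leP s t.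
      rewrite ger0_norm ?subr_ge0// => et; rewrite h00 ?mul0r//; lra.
    rewrite ltr0_norm ?subr_lt0// => et; rewrite /k ramp0 ?mulr0//; lra.
  move=> Dk; apply: Dh0.
  have -> : fc b h0 = fc b (fun t => h0 t * (1 - k t)) + fc b (fun t => h0 t * k t).
    rewrite -fcD//; try exact: apxM.
    by congr fc; apply/funext => t; ring.
  rewrite mulrDr Dk addr0; apply: Er; first exact: apxM.
  move=> t rt; rewrite /k ramp1 ?subrr ?mulr0//; rewrite -/s in rs; lra.
have [[e e0 He]|Hn] := pselect (exists2 e : R, 0 < e & forall h (eta : R), apx h -> 0 < eta ->
    (forall t, `|t - s| < eta \/ e < `|t - s| -> h t = 0) -> D * fc b h = 0).
  have [h [ah he Dh]] := P _ e0; exists s, h; split => //.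
  apply/subr0_eq.
  have ats : apx (fun t => t - s) by apply: apxB; [exact: apx_id|exact: apx_cst].
  have -> : D * fc b h * b - s%:C *: (D * fc b h) = D * fc b (fun t => h t * (t - s)).
    rewrite (@fcM _ _ b _ _ h (fun t => t - s))// (@fcB _ _ b _ _ id (fun=> s))//; last exact: apx_cst.
    by rewrite fcX// fcC//; alg R.
    exact: apx_id.
  have [K K0 hK] := apx_bounded ah.
  apply: nm_small => d d0; have D1 : 0 < nm D + 1 by have := nm_ge0 D; lra.
  pose eta := d / (nm D + 1) / K.
  have eta0 : 0 < eta by rewrite !divr_gt0.
  (* The function [phi] vanishes within distance [eta] of [s], so [D] kills [h * phi]. What remains
     of [t - s] is clipped at [eta], and [eta] is chosen to make its contribution at most [d]. *)
  pose phi t := (t - s) - Num.max (- eta) (Num.min eta (t - s)).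
  have aclip : apx (fun t => Num.max (- eta) (Num.min eta (t - s))).
    apply: apx_max; first exact: apx_cst.
    by apply: apx_min => //; exact: apx_cst.
  have aphi : apx phi by exact: apxB.
  have D0' : D * fc b (fun t => h t * phi t) = 0.
    apply: (He _ eta) => //; first exact: apxM.
    move=> t [ht|ht]; last by rewrite he ?mul0r// ltW.
    rewrite /phi; move: ht; rewrite ltr_norml => /andP[h1 h2].
    by rewrite min_r ?(ltW h2)// max_r ?(ltW h1)// subrr mulr0.
  have -> : D * fc b (fun t => h t * (t - s)) =
     D * fc b (fun t => h t * Num.max (- eta) (Num.min eta (t - s))).
    rewrite -[RHS]add0r -D0' -mulrDr -fcD//; try exact: apxM.
    by congr (_ * fc _ _); apply/funext => t; rewrite /phi; ring.
  rewrite (le_trans (nmM _ _))//.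
  have : nm (fc b (fun t => h t * Num.max (- eta) (Num.min eta (t - s)))) <= K * eta.
    apply: fc_nm => //; [exact: apxM|by rewrite mulr_ge0 ?ltW|move=> t ht].
    rewrite normrM ler_pM ?hK// ler_norml le_max lexx /= ge_max ge_min lexx /=.
    by rewrite andbT; lra.
  have -> : K * eta = d / (nm D + 1) by rewrite /eta (mulrC K) divfK ?gt_eqF.
  move=> H.
  apply: (@le_trans _ _ ((nm D + 1) * (d / (nm D + 1)))).
    by rewrite ler_pM ?nm_ge0//; lra.
  by rewrite (mulrC (nm D + 1)) divfK ?gt_eqF.
exfalso.
have Q e : exists he : (R -> R) * R, 0 < e -> [/\ apx he.1, 0 < he.2 <= e,
    (forall t, `|t - s| < he.2 \/ e < `|t - s| -> he.1 t = 0) & D * fc b he.1 <> 0].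
  have [e0|e0] := pselect (0 < e); last by exists (id, 0).
  apply: contrapT => Hno; apply: Hn; exists e => // h eta ah eta0 hh.
  apply: contrapT => Dh; apply: Hno; exists (h, Num.min eta e) => _; split => //=.
    by rewrite lt_min eta0 e0 ge_min lexx orbT.
  by move=> t; rewrite lt_min => -[/andP[? _]|?]; apply: hh; [left|right].
have [F hF] := choice Q.
(* Each outer radius is half the preceding inner radius, as [annuli] demands. All members are
   functions that [D] does not kill, against [no_annuli]. *)
pose eps := fix eps n : R := if n is n.+1 then (F (eps n)).2 / 2 else 1.
have eps0 n : 0 < eps n.
  by elim: n => [|n /hF[_ /andP[IH _] _ _]] /=; rewrite ?ltr01 ?divr_gt0.
have [|n] := HD s (fun n => (F (eps n)).2) eps (fun n => (F (eps n)).1).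
  by move=> n; have [h1 /andP[h2 h2'] h3 _] := hF _ (eps0 n); split.
by have [_ _ _] := hF _ (eps0 n).
Qed.

(** For positive radii it equals [1] on the annulus [eta <= |t - s| <= eps] and vanishes for
    [|t - s| <= eta / 2] and for [|t - s| >= 2 eps]. The halving in [annuli] makes it vanish on all
    other annuli. *)
Definition cutoff s eta eps t : R :=
  ramp (eta / 2) (eta / 2) `|t - s| * (1 - ramp eps eps `|t - s|).
Lemma apx_comp_dist s g : (forall r d, g = ramp r d -> apx (fun t => g `|t - s|)).
Proof.
move=> r d ->; apply: apx_min; [exact: apx_cst|apply: apx_max; first exact: apx_cst].
under eq_fun do rewrite mulrC.
apply/apxZ/apxB; last exact: apx_cst.
by apply/apx_abs/apxB; [exact: apx_id|exact: apx_cst].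
Qed.
Lemma apx_cutoff s eta eps : apx (cutoff s eta eps).
Proof.
apply: apxM; first exact: (apx_comp_dist _ erefl).
by apply: apxB; [exact: apx_cst|exact: (apx_comp_dist _ erefl)].
Qed.
Lemma cutoff_bound s eta eps t : `|cutoff s eta eps t| <= 1.
Proof.
rewrite /cutoff normrM mulr_ile1 ?normr_ge0//.
  by rewrite ger0_norm ?ramp_ge0 ?ramp_le1.
by rewrite ger0_norm ?subr_ge0 ?ramp_le1// gerBl ramp_ge0.
Qed.
Lemma annulus_unit s eta eps (h : nat -> R -> R) n t : annuli s eta eps h ->
  cutoff s (eta n) (eps n) t * h n t = h n t.
Proof.
move=> /(_ n)[e0 p0 _ _ h0].
have [ht|ht] := ltP `|t - s| (eta n); first by rewrite h0 ?mulr0//; left.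
have [ht'|ht'] := ltP (eps n) `|t - s|; first by rewrite h0 ?mulr0//; right.
by rewrite /cutoff ramp1 ?divr_gt0 ?ramp0 ?subr0 ?mul1r//; lra.
Qed.
Lemma annuli_mono s eta eps (h : nat -> R -> R) m n : annuli s eta eps h -> (m < n)%N ->
  eps n <= eta m / 2.
Proof.
move=> ha; elim: n => // n IH; rewrite ltnS leq_eqVlt => /orP[/eqP->|/IH mn].
  by have [] := ha n.
by have [? ? ? _ _] := ha n; lra.
Qed.
Lemma annulus_disjoint s eta eps (h : nat -> R -> R) m n t : annuli s eta eps h -> m != n ->
  cutoff s (eta n) (eps n) t * h m t = 0.
Proof.
move=> ha; have [n0 n1 n2 _ hn] := ha n; have [m0 m1 m2 _ hm] := ha m.
rewrite neq_ltn => /orP[|] /(annuli_mono ha) H.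
  have [ht|ht] := ltP `|t - s| (eta m); first by rewrite hm ?mulr0//; left.
  by rewrite /cutoff (@ramp1 (eps n)) ?subrr ?mulr0 ?mul0r//; lra.
have [ht|ht] := ltP (eps m) `|t - s|; first by rewrite hm ?mulr0//; right.
by rewrite /cutoff ramp0 ?mul0r ?divr_gt0//; lra.
Qed.
End Isolated.

(** * Local maps *)

Section Core.
Context {R : realType} {B : ucstarType R}.
Implicit Types (x y z b : B) (c : R[i]) (r t : R).

Record left_ideal (L : B -> Prop) : Prop := LeftIdeal {
  lid_closed : nclosed L;
  lid0 : L 0;
  lidD : forall x y, L x -> L y -> L (x + y);
  lidM : forall b x, L x -> L (b * x) }.

Lemma lidZ L c x : left_ideal L -> L x -> L (c *: x).
Proof. by move=> idL Lx; rewrite -mulr_algl; apply: (lidM idL). Qed.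
Lemma lidN L x : left_ideal L -> L x -> L (- x).
Proof. by move=> idL Lx; rewrite -mulN1r; apply: (lidM idL). Qed.
Lemma lidB L x y : left_ideal L -> L x -> L y -> L (x - y).
Proof. by move=> idL Lx Ly; apply: (lidD idL) => //; apply: (lidN idL). Qed.

(* X = L ∩ R, where the right ideal R is given by its left ideal of adjoints. *)
Record local_map (L S : B -> Prop) (T : B -> B) : Prop := LocalMap {
  lm_L : left_ideal L;
  lm_S : left_ideal S;
  lm_maps : forall x, L x -> S (star x) -> L (T x);
  lm_lin : forall c x y, L x -> S (star x) -> L y -> S (star y) ->
    T (c *: x + y) = c *: T x + T y;
  lm_local : forall x b, L x -> S (star x) -> L b -> L (star b) ->
    x * b = 0 -> T x * b = 0 }.

Variables (L S : B -> Prop) (T : B -> B).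
Hypothesis lT : local_map L S T.
Let idL := lm_L lT.
Let idS := lm_S lT.

Definition Xs x := L x /\ S (star x).
(** The hereditary subalgebra attached to [L]; for the left ideal of [p2] it is the algebra of the
    elements fixed by [p2] on both sides. *)
Definition B2 b := L b /\ L (star b).
(** Functions of an element of [L] that do not vanish at [0], such as [1], may lie outside [L]; as
    right factors they nevertheless preserve [L]. *)
Definition rmult n := forall x, L x -> L (x * n).

Lemma Xs0 : Xs 0. Proof. by split; rewrite ?star0; apply: lid0. Qed.
Lemma XsD x y : Xs x -> Xs y -> Xs (x + y).
Proof. by move=> [? ?] [? ?]; split; rewrite ?starD; apply: lidD. Qed.
Lemma XsZ c x : Xs x -> Xs (c *: x).
Proof. by move=> [? ?]; split; rewrite ?starZ; apply: lidZ. Qed.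
Lemma XsN x : Xs x -> Xs (- x).
Proof. by move=> [? ?]; split; rewrite ?starN; apply: lidN. Qed.
Lemma XsB x y : Xs x -> Xs y -> Xs (x - y).
Proof. by move=> hx hy; apply: XsD => //; apply: XsN. Qed.
Lemma XsM x n : Xs x -> rmult n -> Xs (x * n).
Proof. by move=> [? ?] nM; split; [exact: nM|rewrite starM; apply: lidM]. Qed.
Lemma Xs_sum n (F : nat -> B) : (forall k, Xs (F k)) -> Xs (\sum_(k < n) F k).
Proof.
move=> XF; elim: n => [|n IH]; first by rewrite big_ord0; exact: Xs0.
by rewrite big_ord_recr; apply: XsD.
Qed.
Lemma Xs_closed : nclosed Xs.
Proof.
move=> x hx; split.
  by apply: (lid_closed idL) => e /hx[y [? ?] ?]; exists y.
apply: (lid_closed idS) => e /hx[y [? ?] ?]; exists (star y) => //.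
by rewrite -starB nm_star.
Qed.

Lemma rmult_L n : L n -> rmult n.
Proof. by move=> Ln x Lx; apply: (lidM idL). Qed.
Lemma rmult1 : rmult 1. Proof. by move=> x; rewrite mulr1. Qed.
Lemma rmult_csub : csub rmult.
Proof.
split=> [n hn x Lx|m n hm hn x Lx|m n hm hn x Lx|c n hn x Lx].
- apply: (lid_closed idL) => e e0; have x0 := nm_ge0 x.
  have x1 : 0 < nm x + 1 by lra.
  have [m Mm nm_] := hn _ (divr_gt0 e0 x1); exists (x * m); first exact: Mm.
  rewrite -mulrBr (le_lt_trans (nmM _ _))// mulrC.
  move: nm_; rewrite ltr_pdivlMr// => h; apply: le_lt_trans h.
  by rewrite ler_wpM2l ?nm_ge0//; lra.
- by rewrite mulrDr; apply: (lidD idL); [exact: hm|exact: hn].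
- by rewrite mulrA; apply/hn/hm.
- by rewrite -scalerAr; apply/(lidZ _ idL)/hn.
Qed.

Lemma T0 : T 0 = 0.
Proof.
have [h1 h2] := Xs0; have := lm_lin lT 1 h1 h2 h1 h2.
by rewrite scaler0 scale1r addr0 -{1}[T 0]addr0 => /addrI <-.
Qed.
Lemma TD x y : Xs x -> Xs y -> T (x + y) = T x + T y.
Proof. by move=> [? ?] [? ?]; rewrite -{1}(scale1r x) (lm_lin lT) ?scale1r. Qed.
Lemma TZ c x : Xs x -> T (c *: x) = c *: T x.
Proof.
move=> [? ?]; have [? ?] := Xs0.
by rewrite -[c *: x]addr0 (lm_lin lT)// T0 addr0.
Qed.
Lemma TN x : Xs x -> T (- x) = - T x.
Proof. by move=> hx; rewrite -scaleN1r TZ// scaleN1r. Qed.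
Lemma TB x y : Xs x -> Xs y -> T (x - y) = T x - T y.
Proof. by move=> hx hy; rewrite TD ?TN//; exact: XsN. Qed.
Lemma TL x : Xs x -> L (T x).
Proof. by case=> *; exact: (lm_maps lT). Qed.
Lemma T_sum n (F : nat -> B) : (forall k, Xs (F k)) ->
  T (\sum_(k < n) F k) = \sum_(k < n) T (F k).
Proof.
move=> XF; elim: n => [|n IH]; first by rewrite !big_ord0 T0.
by rewrite !big_ord_recr TD ?IH//; apply: Xs_sum.
Qed.

Lemma B2_star y : L y -> B2 (star y * y).
Proof. by move=> Ly; rewrite /B2 sastar; split; apply: (lidM idL). Qed.
Lemma cancel_star y z : z * (star y * y) = 0 -> z * star y = 0.
Proof.
move=> h; apply: star_eq0'; rewrite starM starK mulrA -(mulrA z) h mul0r//.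
Qed.

(** Locality is assumed only for right factors in [B2]. For [y = T z * n] the factor
    [n * (star y * y)] lies in [B2], and [y * star y * y = 0] forces [y = 0]. *)
Lemma T_local' z n : Xs z -> rmult n -> rmult (star n) -> z * n = 0 -> T z * n = 0.
Proof.
move=> Xz Mn Mn' zn; pose y := T z * n.
have Ly : L y by apply/Mn/TL.
have [b1 b2] := B2_star Ly.
have : T z * (n * (star y * y)) = 0.
  case: (Xz) => ? ?; apply: (lm_local lT) => //.
  - exact: (lidM idL).
  - by rewrite starM sastar; apply: Mn'.
  - by rewrite mulrA zn mul0r.
rewrite mulrA => /cancel_star h; apply: star_eq0'; exact: h.
Qed.

(** If every [n] failed, one could take [x n] of norm [2^-n] with [T (x n * a n) * w n] very large
    and form [z = sum_k x k * a k]. Since [a m * w n = 0] for [m != n], locality gives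
    [T z * w n = T (x n * a n) * w n], so the norm of [T z] exceeds every integer. *)
Lemma gliding (w a : nat -> B) :
  (forall n, rmult (w n)) -> (forall n, rmult (star (w n))) ->
  (forall n, rmult (a n)) -> (forall n, nm (a n) <= 1) ->
  (forall m n, m != n -> a m * w n = 0) ->
  exists n, exists C : R, forall x, Xs x -> nm (T (x * a n) * w n) <= C * nm x.
Proof.
move=> Mw Mw' Ma a1 aw; apply: contrapT => Hno.
have H n (C : R) : exists x, Xs x /\ C * nm x < nm (T (x * a n) * w n).
  apply: contrapT => h; apply: Hno; exists n, C => x Xx.
  by rewrite leNgt; apply/negP => hlt; apply: h; exists x.
have H' n : exists x, [/\ Xs x, nm x = 2^-1 ^+ n &
    n%:R * (nm (w n) + 1) < nm (T (x * a n) * w n)].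
  (* The factor [2 ^+ n] pays for rescaling [x] to norm [2^-n]; the [+ 1] avoids a division by the
     norm of [w n], which may be zero. *)
  have [x [Xx hx]] := H n (2 ^+ n * (n%:R * (nm (w n) + 1))).
  have x0 : 0 < nm x.
    rewrite lt_neqAle nm_ge0 andbT; apply/eqP => x0; move: hx.
    by rewrite (nm0_eq0 _ (esym x0)) mul0r T0 mul0r !nm0 mulr0 ltxx.
  pose k : R := 2^-1 ^+ n / nm x.
  have k0 : 0 < k by rewrite divr_gt0// exprn_gt0.
  exists (k%:C *: x); split; first exact: XsZ.
    by rewrite nmZr gtr0_norm// /k divfK ?gt_eqF.
  rewrite -scalerAl TZ; last exact: XsM.
  rewrite -scalerAl nmZr gtr0_norm// -ltr_pdivrMl//.
  rewrite (_ : k^-1 * _ = 2 ^+ n * (n%:R * (nm (w n) + 1)) * nm x)//.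
  by rewrite /k invf_div exprVn invrK; ring.
have [x hx] := choice H'.
have [|z zl] := @series_lim R B (fun k => x k * a k).
  move=> k; have [_ <- _] := hx k.
  by rewrite (le_trans (nmM _ _))// ler_piMr ?nm_ge0.
have Xxa k : Xs (x k * a k) by apply: XsM => //; have [] := hx k.
have Xz : Xs z by apply: lim_closed Xs_closed _ zl => n; exact: (@Xs_sum n (fun k => x k * a k)).
have E n : T z * w n = T (x n * a n) * w n.
  apply/subr0_eq; rewrite -mulrBl -TB//; apply: T_local' => //; first exact: XsB.
  apply: lim_uniq (lim_mulr _ (limD zl _)) _.
    exact: (@lim_eventually _ _ (fun=> - (x n * a n)) _ 0).
  apply: (@lim_eventually _ _ _ _ n.+1) => m nm_.
  rewrite mulrBl mulr_suml (bigD1 (Ordinal nm_))//= big1 ?addr0 ?subrr// => i.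
  by rewrite -val_eqE /= => ni; rewrite -mulrA aw ?mulr0.
have F (n : nat) : n%:R * 1 <= nm (T z).
  have [_ _ h] := hx n; have w0 := nm_ge0 (w n).
  rewrite mulr1 -(ler_pM2r (_ : 0 < nm (w n) + 1)); last lra.
  rewrite (le_trans (ltW h))// -E (le_trans (nmM _ _))//.
  by rewrite ler_wpM2l ?nm_ge0//; lra.
by have /eqP := ler_natM_eq0 ler01 F; rewrite oner_eq0.
Qed.

(** In the expansion of [s * star s] only neighbouring indices meet, so there are at most [3 m]
    nonzero terms. The norm of the sum grows like the square root of [m] instead of [m]. *)
Lemma row_sum (D : nat -> B) (K : R) :
  (forall i j, (i.+1 < j)%N -> D i * star (D j) = 0) ->
  (forall j, nm (D j) <= K) ->
  forall m, nm (\sum_(j < m) D j) ^+ 2 <= 3 * m%:R * K ^+ 2.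
Proof.
move=> D0 DK; have K0 : 0 <= K := le_trans (nm_ge0 _) (DK 0%N).
elim=> [|m IH]; first by rewrite big_ord0 nm0 expr0n /= mulr0 mul0r.
set s := \sum_(j < m) D j in IH.
have hs : nm (s * star (D m)) <= K ^+ 2.
  rewrite /s; case: m {IH s} => [|m].
    by rewrite big_ord0 mul0r nm0 exprn_ge0.
  rewrite big_ord_recr /= mulrDl mulr_suml big1 ?add0r; last first.
    by move=> i _; rewrite D0// ltnS.
  by rewrite (le_trans (nmM _ _))// nm_star expr2 ler_pM ?nm_ge0.
rewrite big_ord_recr /= -/s -nmC'.
have -> : (s + D m) * star (s + D m) =
   s * star s + (s * star (D m) + (star (s * star (D m)) + D m * star (D m))).
  by rewrite starM starK starD; alg R.
rewrite (le_trans (nmD _ _))// nmC' -[m.+1%:R]natr1 mulrDr mulr1 mulrDl lerD//.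
have h1 := nmD (s * star (D m)) (star (s * star (D m)) + D m * star (D m)).
have h2 := nmD (star (s * star (D m))) (D m * star (D m)).
have h3 : nm (D m * star (D m)) <= K ^+ 2.
  by rewrite nmC' ler_pXn2r ?nnegrE ?nm_ge0.
rewrite nm_star in h2; lra.
Qed.

(** The [j]-th horizontal slice, of height [d], of the function [t + 1]. On [[-1, 1]] the first [n]
    slices add up to [t + 1] when [n d = 2]. *)
Definition step d (j : nat) t : R := Num.min d (Num.max 0 (t + 1 - j%:R * d)).
Lemma apx_step d j : apx (step d j).
Proof.
apply: apx_min; [exact: apx_cst|apply: apx_max; first exact: apx_cst].
apply: apxB; last exact: apx_cst.
by apply: apxD; [exact: apx_id|exact: apx_cst].
Qed.
Lemma step_sum d n t : 0 <= d ->
  \sum_(j < n) step d j t = Num.min (n%:R * d) (Num.max 0 (t + 1)).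
Proof.
move=> d0; elim: n => [|n IH].
  by rewrite big_ord0 mul0r min_l// le_max lexx.
rewrite big_ord_recr /= IH /step -natr1 mulrDl mul1r.
have : 0 <= n%:R * d by rewrite mulr_ge0.
set a := n%:R * d => a0.
by case: (lerP 0 (t + 1)) => ?; case: (lerP 0 (t + 1 - a)) => ?;
  (repeat case: lerP => ?); lra.
Qed.

Lemma fc_sum b (F : nat -> R -> R) n : sa b -> nm b <= 1 -> (forall j, apx (F j)) ->
  apx (fun t => \sum_(j < n) F j t) /\
  fc b (fun t => \sum_(j < n) F j t) = \sum_(j < n) fc b (F j).
Proof.
move=> sb b1 aF; elim: n => [|n [aS IH]].
  by under eq_fun do rewrite big_ord0; rewrite big_ord0 fcC// scale0r; split=> //; exact: apx_cst.
rewrite (_ : (fun t => _) = fun t => \sum_(j < n) F j t + F n t).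
  by rewrite big_ord_recr /= -IH fcD//; split=> //; exact: apxD.
by apply/funext => t; rewrite big_ord_recr.
Qed.

(** The element [b + 1] is cut into [n] slices of height [d = 2 / n]. The defect of each slice has
    norm at most [K d], and slices at least two apart have orthogonal defects, so by [row_sum] the
    square of the norm of the total is at most [12 K^2 / n]. The scalar [1] contributes no
    defect. *)
Lemma bounded_module b x g (C : R) : sa b -> nm b <= 1 -> L b -> Xs x -> apx g ->
  (forall x, Xs x -> nm (T x * fc b g) <= C * nm x) ->
  (T (x * b) - T x * b) * fc b g = 0.
Proof.
move=> sb b1 Lb Xx ag Tw; set w := fc b g.
have Mf h : apx h -> rmult (fc b h).
  by apply: fc_csub => //; [exact: rmult_csub|exact: rmult1|exact: rmult_L].
have Mf' h : apx h -> rmult (star (fc b h)) by move=> ah; rewrite fc_sa//; exact: Mf.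
have C0 : 0 <= C * nm x := le_trans (nm_ge0 _) (Tw x Xx).
pose D d j := T (x * fc b (step d j)) * w - T x * fc b (step d j) * w.
pose K := C * nm x + nm (T x) * nm w.
have K0 : 0 <= K by rewrite addr_ge0// mulr_ge0 ?nm_ge0.
have step_nm d j : 0 < d -> nm (fc b (step d j)) <= d.
  move=> d0; apply: fc_nm => //; [exact: apx_step|exact: ltW|move=> t _].
  by rewrite /step ger0_norm ?ge_min ?lexx// le_min le_max lexx ltW.
have DK d j : 0 < d -> nm (D d j) <= K * d.
  move=> d0; rewrite (le_trans (nmD _ _))// nmN mulrDl lerD//.
    have := Tw _ (XsM Xx (Mf _ (apx_step d j))).
    have Cge : 0 <= C \/ nm x = 0.
      have := nm_ge0 x; rewrite le_eqVlt => /orP[/eqP<-|x0]; [by right|left].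
      by rewrite -(pmulr_lge0 _ x0).
    case: Cge => [C_ge0|x0].
      move=> h; apply: le_trans h _; rewrite -mulrA ler_wpM2l//.
      by rewrite (le_trans (nmM _ _))// ler_wpM2l ?nm_ge0// step_nm.
    by rewrite (nm0_eq0 _ x0) mul0r T0 mul0r nm0 mulr0 mul0r.
  rewrite (le_trans (nmM _ _))// mulrAC ler_wpM2r ?nm_ge0//.
  by rewrite (le_trans (nmM _ _))// ler_wpM2l ?nm_ge0// step_nm.
have D0 d i j : 0 < d -> (i.+1 < j)%N -> D d i * star (D d j) = 0.
  (* The ramp [ph] vanishes up to [(i + 1) d - 1] and equals [1] from [(i + 2) d - 1] on. Where it
     is nonzero, slice [i] has its full height; where it is below [1], slice [j] is still zero
     because [j >= i + 2]. Locality then gives [D d i * ph = 0] and [D d j * (1 - ph) = 0]. *)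
  move=> d0 ij; pose r : R := i.+1%:R * d - 1.
  pose ph t := ramp r d t.
  have aph : apx ph by exact: apx_ramp.
  have ij' : i.+2%:R * d <= j%:R * d by rewrite ler_pM2r// ler_nat.
  have rE : r + d = i.+2%:R * d - 1 by rewrite /r -[i.+2%:R]natr1; ring.
  have rE' : r = i%:R * d + d - 1 by rewrite /r -natr1; ring.
  have cw h : apx h -> w * fc b h = fc b h * w by move=> ah; exact: fc_comm.
  have as_ k : apx (step d k) by exact: apx_step.
  have D1 : D d i * fc b ph = 0.
    have kf : fc b (step d i) * fc b ph = d%:C *: fc b ph.
      rewrite -fcM// -fcZ//; apply: fc_ext => t _; have [tr|rt] := leP t r.
        by rewrite /ph ramp0// !mulr0.
      rewrite /step (_ : Num.min _ _ = d)//.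
      by rewrite max_r ?min_l//; lra.
    have Xi := XsM Xx (Mf _ (as_ i)).
    have e2 : T (x * fc b (step d i)) * fc b ph = d%:C *: (T x * fc b ph).
      apply/subr0_eq; rewrite scalerAl -TZ// -mulrBl -TB//; last exact: XsZ.
      apply: T_local'; [by apply: XsB => //; exact: XsZ|exact: Mf|exact: Mf'|].
      by rewrite mulrBl -mulrA kf -scalerAl -scalerAr subrr.
    rewrite /D mulrBl -!mulrA !cw// !mulrA e2 -(mulrA (T x)) kf -scalerAr.
    by rewrite subrr.
  have D2 : D d j * (1 - fc b ph) = 0.
    have -> : 1 - fc b ph = fc b (fun t => 1 - ph t).
      by rewrite fcB ?fcC ?scale1r//; exact: apx_cst.
    have a1 : apx (fun t => 1 - ph t) by apply: apxB => //; exact: apx_cst.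
    have e1 : fc b (step d j) * fc b (fun t => 1 - ph t) = 0.
      apply: fcM0 => // t _; have [tr|rt] := leP (r + d) t.
        by rewrite /ph ramp1// subrr mulr0.
      rewrite /step (_ : Num.min _ _ = 0) ?mul0r//.
      by rewrite max_l ?min_r ?(ltW d0)//; lra.
    rewrite /D mulrBl -!mulrA !cw// !mulrA.
    rewrite -(mulrA (T x)) e1 mulr0 mul0r subr0 T_local' ?mul0r//.
    - by apply: XsM => //; exact: Mf.
    - exact: Mf.
    - exact: Mf'.
    - by rewrite -mulrA e1 mulr0.
  have D3 : D d j = D d j * fc b ph.
    by apply/subr0_eq; rewrite -[X in X - _]mulr1 -mulrBr.
  by rewrite D3 starM fc_sa// mulrA D1 mul0r.
have E n : (0 < n)%N -> \sum_(j < n) D (2 / n%:R) j = (T (x * b) - T x * b) * w.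
  move=> n0; set d := 2 / n%:R.
  have n0' : 0 < n%:R :> R by rewrite ltr0n.
  have d0 : 0 < d by rewrite divr_gt0.
  have SE : \sum_(j < n) fc b (step d j) = b + 1.
    have [_ <-] := @fc_sum b (step d) n sb b1 (apx_step d).
    rewrite (@fc_ext _ _ _ _ (fun t => id t + 1)).
      by rewrite fcD// ?fcX// ?fcC ?scale1r//; [exact: apx_id|exact: apx_cst].
    move=> t /andP[t1 t2]; rewrite step_sum ?(ltW d0)// /d mulrC divfK ?gt_eqF//.
    by rewrite max_r ?min_r//=; lra.
  rewrite sumrB -!mulr_suml -mulr_sumr SE -(@T_sum n (fun j => x * fc b (step d j))).
    rewrite -mulr_sumr SE !mulrDr !mulr1 TD//; last by apply: XsM => //; exact: rmult_L.
    by alg R.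
  by move=> k; apply: XsM => //; apply/Mf/apx_step.
have : nm ((T (x * b) - T x * b) * w) ^+ 2 = 0.
  apply: (@ler_natM_eq0 _ _ (12 * K ^+ 2)) => [|[|n]].
  - by rewrite exprn_ge0 ?nm_ge0.
  - by rewrite mul0r mulr_ge0 ?exprn_ge0.
  have d0 : 0 < 2 / n.+1%:R :> R by rewrite divr_gt0.
  have := row_sum (fun i j => @D0 _ i j d0) (fun j => @DK _ j d0) n.+1.
  rewrite E// => h; rewrite mulrC -ler_pdivlMr ?ltr0n//; apply: le_trans h _.
  rewrite le_eqVlt; apply/orP; left; apply/eqP.
  by field.
by move=> /eqP; rewrite sqrf_eq0 => /eqP/nm0_eq0.
Qed.

(** By [gliding] and [bounded_module] the defect [D = T (x b) - T x b] is killed by a member of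
    every family of annuli. Were it nonzero, some nonzero [D1 = D h(b)] would satisfy [D1 b = s D1].
    Then [x b - s x] annihilates [star D1], locality gives [D * star D1 = 0], and
    [D1 * star D1 = h(s) D * star D1] vanishes too. *)
Lemma T_module_sa b x : sa b -> nm b <= 1 -> L b -> Xs x -> T (x * b) = T x * b.
Proof.
move=> sb b1 Lb Xx; apply/subr0_eq; set D := _ - _.
apply: contrapT => D0.
have Mf h : apx h -> rmult (fc b h).
  by apply: fc_csub => //; [exact: rmult_csub|exact: rmult1|exact: rmult_L].
have Mf' h : apx h -> rmult (star (fc b h)) by move=> ah; rewrite fc_sa//; exact: Mf.
have Xxb : Xs (x * b) by apply: XsM => //; exact: rmult_L.
have LD : L D.
  by apply: lidB => //; [exact: TL|apply/(rmult_L Lb)/TL].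
have [|s [h [hs ah Dh Ds]]] := @isolated_point _ _ b D sb b1 D0.
  move=> s eta eps h ha.
  have ahn n : apx (h n) by have [] := ha n.
  pose a n := fc b (cutoff s (eta n) (eps n)).
  have aa n : apx (cutoff s (eta n) (eps n)) by exact: apx_cutoff.
  have [||||m n mn|n [C hC]] := @gliding (fun n => fc b (h n)) a.
  - by move=> n; exact: Mf.
  - by move=> n; exact: Mf'.
  - by move=> n; exact: Mf.
  - by move=> n; apply: fc_nm => // t _; exact: cutoff_bound.
  - by apply: fcM0 => // t _; rewrite (annulus_disjoint _ ha)// eq_sym.
  exists n; apply: (bounded_module (C := C)) => // y Xy.
  rewrite (_ : T y * _ = T (y * a n) * fc b (h n)); first exact: hC.
  have Xya : Xs (y * a n) by apply: XsM => //; exact: Mf.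
  apply/subr0_eq; rewrite -mulrBl -TB//; apply: T_local'; rewrite ?mulrBl.
  - exact: XsB.
  - exact: Mf.
  - exact: Mf'.
  rewrite -mulrA -fcM// (@fc_ext _ _ _ _ (h n)) ?subrr// => t _.
  exact: annulus_unit ha.
set D1 := D * fc b h in Dh Ds.
have LD1 : L D1 by exact: Mf.
have bD : b * star D1 = s%:C *: star D1.
  by rewrite -{1}sb -starM Ds starZr.
have Xz : Xs (x * b - s%:C *: x) by apply: XsB => //; exact: XsZ.
have [b21 b22] := B2_star LD1.
have : T (x * b - s%:C *: x) * (star D1 * D1) = 0.
  case: (Xz) => ? ?; apply: (lm_local lT) => //.
  by rewrite mulrA mulrBl -mulrA bD -scalerAl -scalerAr subrr mul0r.
move=> /cancel_star; rewrite TB ?TZ//; last exact: XsZ.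
rewrite mulrBl -scalerAl => /subr0_eq h1.
have DD : D * star D1 = 0.
  by rewrite /D mulrBl h1 -mulrA bD -scalerAr subrr.
apply: Dh; apply: star_eq0'.
by rewrite {1}/D1 -mulrA (fc_eigen sb b1 ah hs bD) -scalerAr DD scaler0.
Qed.

Lemma T_module b x : L b -> L (star b) -> Xs x -> T (x * b) = T x * b.
Proof.
suff H y : sa y -> L y -> Xs x -> T (x * y) = T x * y.
  move=> Lb Lb' Xx.
  pose u := b + star b; pose v := ii *: (b - star b).
  have su : sa u by rewrite /sa /u starD starK addrC.
  have sv : sa v by rewrite /sa /v star_ii starB starK -scalerN opprB.
  have Lu : L u by exact: (lidD idL).
  have Lv : L v by apply: lidZ => //; exact: lidB.
  have -> : b = half *: (u + (- ii) *: v).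
    rewrite /v scalerA mulNr iiM opprK scale1r -[LHS]halfE /u; congr (_ *: _).
    by alg R.
  have Xu : Xs (x * u) by apply: XsM => //; exact: rmult_L.
  have Xv : Xs (x * v) by apply: XsM => //; exact: rmult_L.
  rewrite -!scalerAr mulrDr -scalerAr TZ ?TD ?TZ ?H//; try exact: XsZ.
    by alg R.
  by apply: XsD => //; exact: XsZ.
move=> sy Ly Xx; have y0 := nm_ge0 y; pose k : R := (nm y + 1)^-1.
have k0 : 0 < k by rewrite invr_gt0; lra.
have Lk : L (k%:C *: y) by exact: lidZ.
have Mk : nm (k%:C *: y) <= 1.
  by rewrite nmZr gtr0_norm// mulrC ler_pdivrMr; lra.
have := T_module_sa (saZ k sy) Mk Lk Xx.
rewrite -!scalerAr TZ; last by apply: XsM => //; exact: rmult_L.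
move=> /(congr1 (fun z => (k^-1)%:C *: z)); rewrite !scalerA -CrM.
by rewrite mulVf ?gt_eqF// !scale1r.
Qed.
End Core.

(** * The closed graph theorem *)

Section ClosedGraph.
Context {R : realType} {B : ucstarType R}.
Implicit Types (x y z : B) (r e : R).
Variables (P : B -> Prop) (T : B -> B).
Hypothesis P_closed : nclosed P.
Hypothesis P0 : P 0.
Hypothesis P_lin : forall (c : R[i]) x y, P x -> P y -> P (c *: x + y).
Hypothesis T_lin : forall (c : R[i]) x y, P x -> P y -> T (c *: x + y) = c *: T x + T y.
Hypothesis T_graph : forall u y, (forall n : nat, P (u n)) -> lim_to u 0 ->
  lim_to (T \o u) y -> y = 0.

Let PZ (c : R[i]) x : P x -> P (c *: x).
Proof. by move=> Px; rewrite -[_ *: _]addr0; apply: P_lin. Qed.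
Let PD x y : P x -> P y -> P (x + y).
Proof. by move=> Px Py; rewrite -(scale1r x); apply: P_lin. Qed.
Let PB x y : P x -> P y -> P (x - y).
Proof. by move=> Px Py; apply: PD => //; rewrite -scaleN1r; apply: PZ. Qed.
Let T0' : T 0 = 0.
Proof.
have := T_lin 1 P0 P0; rewrite scaler0 scale1r addr0.
by rewrite -{1}[T 0]addr0 => /addrI <-.
Qed.
Let TZ' (c : R[i]) x : P x -> T (c *: x) = c *: T x.
Proof. by move=> Px; rewrite -[_ *: x]addr0 T_lin// T0' addr0. Qed.
Let TB' x y : P x -> P y -> T (x - y) = T x - T y.
Proof.
move=> Px Py; rewrite -(scale1r x) T_lin// ?scale1r; last by rewrite -scaleN1r; apply: PZ.
by rewrite -scaleN1r TZ'// scaleN1r.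
Qed.

(* The Baire category argument, by nested balls. *)
Lemma graph_ball : exists n : nat, exists x, exists r : R, [/\ P x, 0 < r &
  forall z, P z -> nm (z - x) < r -> forall e, 0 < e ->
    exists z', [/\ P z', nm (z - z') < e & nm (T z') <= n%:R]].
Proof.
apply: contrapT => Hno.
have H (n : nat) (a : B * R) : exists b : B * R, P a.1 -> 0 < a.2 ->
   [/\ P b.1, 0 < b.2, nm (b.1 - a.1) + b.2 <= a.2, b.2 < n.+1%:R^-1 &
     forall z, P z -> nm (z - b.1) <= b.2 -> n%:R < nm (T z)].
  have [Pa|] := pselect (P a.1 /\ 0 < a.2); last by move=> h; exists a => ? ?; exfalso; apply: h.
  case: Pa => Pa a0.
  have : ~ forall z, P z -> nm (z - a.1) < a.2 -> forall e, 0 < e ->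
    exists z', [/\ P z', nm (z - z') < e & nm (T z') <= n%:R].
    by move=> h; apply: Hno; exists n, a.1, a.2.
  move=> /existsNP[z /not_implyP[Pz /not_implyP[za /existsNP[e /not_implyP[e0 he]]]]].
  pose m : R := Num.min (n.+1%:R^-1) (Num.min e (a.2 - nm (z - a.1))).
  have m0 : 0 < m by rewrite !lt_min invr_gt0 ltr0Sn e0 subr_gt0 za.
  have := lexx m; rewrite {2}/m !le_min => /and3P[m1 m2 m3].
  exists (z, m / 2) => _ _ /=; split => //; try lra.
    by apply: lt_le_trans m1; lra.
  move=> w Pw zw; rewrite ltNge; apply/negP => Tw; apply: he; exists w.
  by split => //; rewrite nmB; lra.
have [F hF] := choice (fun na : nat * (B * R) => H na.1 na.2).
pose s := fix s n : B * R := if n is n.+1 then F (n, s n) else (0, 1).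
have s0 n : P (s n).1 /\ 0 < (s n).2.
  by elim: n => [|n [h1 h2]] //=; have [] := hF (n, s n) h1 h2.
have sS n := hF (n, s n) (s0 n).1 (s0 n).2.
have nest n k : nm ((s (n + k)%N).1 - (s n).1) + (s (n + k)%N).2 <= (s n).2.
  elim: k => [|k IH]; first by rewrite addn0 subrr nm0 add0r.
  rewrite addnS; have [_ _ h _ _] := sS (n + k)%N; rewrite -/(s (n + k).+1) in h.
  have -> : (s (n + k).+1).1 - (s n).1 =
    ((s (n + k).+1).1 - (s (n + k)%N).1) + ((s (n + k)%N).1 - (s n).1) by alg R.
  have := nmD ((s (n + k).+1).1 - (s (n + k)%N).1) ((s (n + k)%N).1 - (s n).1).
  by move=> h'; simpl in h; lra.
have [|x xl] := @nm_complete R B (fun n => (s n).1).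
  move=> e e0; have e2 : 0 < e / 2 by rewrite divr_gt0.
  have [N hN] := invS_small e2; exists N.+1.
  have [_ _ _ h _] := sS N; have hh : (s N.+1).2 < e / 2 := lt_trans h (hN N (leqnn _)).
  have K k : (N.+1 <= k)%N -> nm ((s k).1 - (s N.+1).1) < e / 2.
    move=> Nk; have := nest N.+1 (k - N.+1)%N; rewrite subnKC//.
    by have [_ ?] := s0 k; lra.
  move=> m n Nm Nn.
  have -> : (s m).1 - (s n).1 = ((s m).1 - (s N.+1).1) - ((s n).1 - (s N.+1).1).
    by alg R.
  by rewrite (le_lt_trans (nmD _ _))// nmN (splitr e) ltrD ?K.
have Px : P x by apply: lim_closed P_closed _ xl => n; have [] := s0 n.
have Tx n : n%:R < nm (T x).
  have [_ _ _ _] := sS n; apply => //.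
  apply/ler_addgt0Pl => e /xl[N hN].
  have h1 := hN (n.+1 + N)%N (leq_addl _ _); have h2 := nest n.+1 N.
  have [_ h3] := s0 (n.+1 + N)%N.
  have -> : x - (s n.+1).1 = ((s (n.+1 + N)%N).1 - (s n.+1).1) - ((s (n.+1 + N)%N).1 - x).
    by alg R.
  rewrite (le_trans (nmD _ _))// nmN; simpl in *; lra.
have := archi_boundP (nm_ge0 (T x)).
by rewrite ltNge (ltW (Tx _)).
Qed.

Lemma graph_approx : exists2 M : R, 0 <= M & forall z, P z -> forall e, 0 < e ->
  exists z', [/\ P z', nm (z - z') < e & nm (T z') <= M * nm z].
Proof.
have [n [x [r [Px r0 H]]]] := graph_ball.
have H2 z : P z -> nm z < r -> forall e, 0 < e ->
    exists z', [/\ P z', nm (z - z') < e & nm (T z') <= 2 * n%:R].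
  move=> Pz zr e e0; have e2 : 0 < e / 2 by rewrite divr_gt0.
  have [||z1 [P1 h1 T1]] := H (x + z) _ _ _ e2; first exact: PD.
    by rewrite (_ : x + z - x = z)//; alg R.
  have [||z2 [P2 h2 T2]] := H x _ _ _ e2 => //; first by rewrite subrr nm0.
  exists (z1 - z2); split; first exact: PB.
    have -> : z - (z1 - z2) = (x + z - z1) - (x - z2) by alg R.
    by rewrite (le_lt_trans (nmD _ _))// nmN (splitr e) ltrD.
  by rewrite TB'// (le_trans (nmD _ _))// nmN; lra.
(* Differences move the ball of [graph_ball] to the origin and double its bound to [2 n]; elements
   are then scaled to norm [r / 2]. *)
exists (4 * n%:R / r); first by rewrite divr_ge0 ?mulr_ge0 ?(ltW r0).
move=> z Pz e e0; have := nm_ge0 z; rewrite le_eqVlt => /orP[/eqP z0|z0].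
  by exists 0; split=> //; rewrite ?subr0 -?z0 ?mulr0 ?T0' ?nm0.
pose l : R := r / 2 / nm z; have l0 : 0 < l by rewrite !divr_gt0.
have [|||w [Pw hw Tw]] := H2 (l%:C *: z) _ _ (l * e); first exact: PZ.
- by rewrite nmZr gtr0_norm// /l divfK ?gt_eqF//; lra.
- exact: mulr_gt0.
have lK : l^-1%:C * l%:C = 1 :> R[i] by rewrite -CrM mulVf ?gt_eqF.
exists (l^-1%:C *: w); split; first exact: PZ.
  have -> : z - l^-1%:C *: w = l^-1%:C *: (l%:C *: z - w).
    by rewrite scalerBr scalerA lK scale1r.
  by rewrite nmZr gtr0_norm ?invr_gt0// ltr_pdivrMl.
rewrite TZ'// nmZr gtr0_norm ?invr_gt0// ler_pdivrMl//.
apply: le_trans Tw _; rewrite le_eqVlt; apply/orP; left; apply/eqP.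
by rewrite /l; field; rewrite !gt_eqF.
Qed.

(** Successive approximation: each residual [y n] is approximated with an error at most
    [a 2^-(n+1)], so the residuals tend to [0] and the images of the corrections form a convergent
    series. [T_graph], applied to the residuals, identifies its sum with [T z]. *)
Lemma closed_graph : exists2 C : R, 0 <= C & forall x, P x -> nm (T x) <= C * nm x.
Proof.
have [M M0 H] := graph_approx; exists (2 * M); first by rewrite mulr_ge0.
move=> z Pz; have := nm_ge0 z; rewrite le_eqVlt => /orP[/eqP z0|z0].
  by rewrite (nm0_eq0 _ (esym z0)) T0' nm0 mulr0.
set a := nm z in z0 *.
have pw k : 0 < a * (2^-1 : R) ^+ k by rewrite mulr_gt0// exprn_gt0.
have H' (ky : nat * B) : exists z', P ky.2 -> [/\ P z',
    nm (ky.2 - z') < a * 2^-1 ^+ ky.1.+1 & nm (T z') <= M * nm ky.2].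
  have [Py|nPy] := pselect (P ky.2); last by exists 0.
  by have [z' hz'] := H _ Py _ (pw ky.1.+1); exists z'.
have [F hF] := choice H'.
pose y := fix y n : B := if n is n.+1 then y n - F (n, y n) else z.
have Py n : P (y n).
  by elim: n => //= n IH; apply: PB => //; have [] := hF (n, y n) IH.
have ny n : nm (y n) <= a * 2^-1 ^+ n.
  case: n => [|n]; first by rewrite expr0 mulr1.
  by have [_ /ltW] := hF (n, y n) (Py n).
pose v n := T (F (n, y n)).
have nv n : nm (v n) <= M * a * 2^-1 ^+ n.
  have [_ _ h] := hF (n, y n) (Py n); apply: le_trans h _.
  by rewrite -mulrA ler_wpM2l// ny.
have Ty n : T (y n) = T z - \sum_(k < n) v k.
  elim: n => [|n IH]; first by rewrite big_ord0 subr0.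
  rewrite big_ord_recr /= TB'//; last by have [] := hF (n, y n) (Py n).
  by rewrite IH /v; alg R.
pose l : R := (M * a + 1)^-1.
have Ma : 0 <= M * a by rewrite mulr_ge0// ltW.
have l0 : 0 < l by rewrite invr_gt0; lra.
have lK : l^-1%:C * l%:C = 1 :> R[i] by rewrite -CrM mulVf ?gt_eqF.
have [k|w wl] := @series_lim _ _ (fun k => l%:C *: v k).
  have p0 : 0 < (2^-1 : R) ^+ k by rewrite exprn_gt0.
  rewrite nmZr gtr0_norm// (le_trans (ler_wpM2l (ltW l0) (nv k)))//.
  by rewrite mulrA ler_piMl ?(ltW p0)// mulrC ler_pdivrMr; lra.
have sl : lim_to (fun n => \sum_(k < n) v k) (l^-1%:C *: w).
  rewrite -mulr_algl; have := lim_mull (l^-1%:C%:A) wl.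
  move=> h e /h[N hN]; exists N => n /hN.
  by rewrite -scaler_sumr !mulr_algl scalerA lK scale1r.
have w0 : T z - l^-1%:C *: w = 0.
  apply: (T_graph Py).
    move=> e e0.
    have [N hN] := invS_small (divr_gt0 e0 z0); exists N => n Nn.
    rewrite subr0 (le_lt_trans (ny n))// -ltr_pdivlMl// mulrC.
    apply: le_lt_trans (hN n Nn); rewrite exprVn lef_pV2 ?posrE ?exprn_gt0 ?ltr0Sn//.
    by rewrite -natrX ler_nat ltn_expl.
  move=> e /sl[N hN]; exists N => n /hN.
  rewrite /comp Ty (_ : _ - _ - (_ - _) = - (\sum_(k < n) v k - l^-1%:C *: w)) ?nmN//.
  by alg R.
rewrite (subr0_eq w0); apply: lim_nm sl _ => n.
rewrite (le_trans (nm_sum _ _ _))//.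
apply: (@le_trans _ _ (\sum_(k < n) M * a * 2^-1 ^+ k)).
  by apply: ler_sum => k _; exact: nv.
rewrite -mulr_sumr geo_sum.
have p0 : 0 <= (2^-1 : R) ^+ n by rewrite exprn_ge0.
by rewrite -[2 * M * a]mulrA [leRHS]mulrC ler_wpM2l//; lra.
Qed.
End ClosedGraph.

(** * The singular ideal of a local map *)

Section Structure.
Context {R : realType} {B : ucstarType R}.
Implicit Types (x y z b e f : B) (c : R[i]) (r t : R).
Variables (L S : B -> Prop) (T : B -> B).
Hypothesis lT : local_map L S T.
Let idL := lm_L lT.
Let idS := lm_S lT.
Let X := Xs L S.

Lemma XsL x b : X x -> L b -> X (x * b).
Proof. by move=> Xx Lb; apply: (XsM lT) => //; exact: (rmult_L lT). Qed.
Lemma TM x b : X x -> L b -> L (star b) -> T (x * b) = T x * b.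
Proof. by move=> *; exact: (T_module lT). Qed.

(* The separating space of T. *)
Definition sep y := exists u : nat -> B,
  [/\ forall n, X (u n), lim_to u 0 & lim_to (T \o u) y].
(* Jid is the ideal of the b such that x |-> T x * b is bounded, by the closed
   graph theorem; all the discontinuity of T lives on its annihilator Kid. *)
Definition Jid b := B2 L b /\ forall y, sep y -> y * b = 0.
Definition Kid b := B2 L b /\ forall j, Jid j -> b * j = 0.

Lemma B2_sym b : B2 L b -> B2 L (star b).
Proof. by case=> ? ?; split; rewrite ?starK. Qed.
Lemma B2_M b b' : B2 L b -> B2 L b' -> B2 L (b * b').
Proof. by move=> [? ?] [? ?]; split; rewrite ?starM; apply: (lidM idL). Qed.
Lemma B2_mid b x b' : B2 L b -> B2 L b' -> B2 L (b * x * b').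
Proof. by move=> [? ?] [? ?]; split; rewrite ?starM; do ?apply: (lidM idL). Qed.
Lemma B2_D b b' : B2 L b -> B2 L b' -> B2 L (b + b').
Proof. by move=> [? ?] [? ?]; split; rewrite ?starD; apply: (lidD idL). Qed.
Lemma B2_Z c b : B2 L b -> B2 L (c *: b).
Proof. by move=> [? ?]; split; rewrite ?starZ; apply: lidZ. Qed.

Lemma sep_L y : sep y -> L y.
Proof.
case=> u [Xu _ uy]; apply: lim_closed (lid_closed idL) _ uy => n.
by apply: (TL lT); exact: Xu.
Qed.
Lemma sep_M y b : sep y -> B2 L b -> sep (y * b).
Proof.
move=> [u [Xu u0 uy]] [Lb Lb']; exists (fun n => u n * b); split.
- by move=> n; exact: XsL.
- by rewrite -(mul0r b); exact: lim_mulr.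
- move=> e /(lim_mulr b uy)[N hN]; exists N => n /hN.
  by rewrite /= TM.
Qed.
Lemma J_star j : Jid j -> Jid (star j).
Proof.
move=> [Bj hj]; split; first exact: B2_sym.
move=> y sy; apply: star_eq0'.
by rewrite starM starK mulrA hj ?mul0r//; apply: sep_M => //; exact: B2_sym.
Qed.
Lemma J_left j b : Jid j -> B2 L b -> Jid (b * j).
Proof.
move=> [Bj hj] Bb; split; first exact: B2_M.
by move=> y sy; rewrite mulrA hj//; exact: sep_M.
Qed.
Lemma K_left b b' : Kid b -> B2 L b' -> Kid (b' * b).
Proof.
move=> [Bb hb] Bb'; split; first exact: B2_M.
by move=> j Jj; rewrite -mulrA hb ?mulr0.
Qed.
Lemma K_right b b' : Kid b -> B2 L b' -> Kid (b * b').
Proof.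
move=> [Bb hb] Bb'; split; first exact: B2_M.
by move=> j Jj; rewrite -mulrA hb//; exact: J_left.
Qed.
Lemma K_star b : Kid b -> Kid (star b).
Proof.
move=> [Bb hb]; split; first exact: B2_sym.
move=> j Jj; apply: star_eq0; rewrite starM starK.
by rewrite -mulrA hb ?mulr0//; apply: J_left => //; exact: B2_sym.
Qed.
Lemma K_D b b' : Kid b -> Kid b' -> Kid (b + b').
Proof.
move=> [Bb hb] [Bb' hb']; split; first exact: B2_D.
by move=> j Jj; rewrite mulrDl hb ?hb' ?addr0.
Qed.
Lemma K_Z c b : Kid b -> Kid (c *: b).
Proof.
move=> [Bb hb]; split; first exact: B2_Z.
by move=> j Jj; rewrite -scalerAl hb ?scaler0.
Qed.
Lemma K_N b : Kid b -> Kid (- b).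
Proof. by move=> Kb; rewrite -scaleN1r; exact: K_Z. Qed.
Lemma K_B b b' : Kid b -> Kid b' -> Kid (b - b').
Proof. by move=> Kb Kb'; apply: K_D => //; exact: K_N. Qed.
Lemma K_0 : Kid 0.
Proof.
split; first by split; rewrite ?star0; exact: lid0.
by move=> j _; rewrite mul0r.
Qed.
Lemma KJ b : Kid b -> Jid b -> b = 0.
Proof.
by move=> [_ hb] Jb; apply: star_eq0'; apply: hb; exact: J_star.
Qed.
Lemma K_mid b x b' : Kid b -> Kid b' -> Kid (b * x * b').
Proof.
move=> [Bb hb] [Bb' hb']; split; first exact: B2_mid.
by move=> j Jj; rewrite -mulrA hb' ?mulr0.
Qed.
Lemma sep_K y : sep y -> Kid (star y * y).
Proof.
move=> sy; split; first by apply: (B2_star lT); exact: sep_L.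
by move=> j [_ hj]; rewrite -mulrA hj ?mulr0.
Qed.

Lemma bounded_J b (C : R) : B2 L b ->
  (forall x, X x -> nm (T x * b) <= C * nm x) -> Jid b.
Proof.
move=> Bb hC; split=> // y [u [Xu u0 uy]].
apply: lim_uniq (lim_mulr b uy) _ => e e0.
have C1 : 0 < `|C| + 1 by rewrite ltr_wpDl.
have [N hN] := u0 _ (divr_gt0 e0 C1); exists N => n /hN.
rewrite !subr0 ltr_pdivlMr// /= => h; apply: le_lt_trans (hC _ (Xu n)) _.
apply: le_lt_trans h; rewrite mulrC ler_wpM2l ?nm_ge0//.
by rewrite (le_trans (ler_norm _))// lerDl.
Qed.

(** The gliding hump with [w = b] and [a] the normalized [b] makes [T] bounded against [a n * b n]
    for some [n]. This product lies in [Jid] and in [Kid], hence is zero, and [b n] is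
    self-adjoint. *)
Lemma K_orth (b : nat -> B) : (forall n, Kid (b n)) -> (forall n, sa (b n)) ->
  (forall m n, m != n -> b m * b n = 0) -> exists n, b n = 0.
Proof.
move=> Kb sb bb.
have b0 n : 0 < nm (b n) + 1 by have := nm_ge0 (b n); lra.
pose a n := ((nm (b n) + 1)^-1)%:C *: b n.
have Lb n : L (b n) by have [[]] := Kb n.
have La n : L (a n) by exact: lidZ.
have Mb n : rmult L (b n) by exact: (rmult_L lT).
have Ma n : rmult L (a n) by exact: (rmult_L lT).
have [||||m n mn|n [C hC]] := @gliding _ _ _ _ _ lT b a => //.
- by move=> n; rewrite sb.
- move=> n; rewrite nmZr gtr0_norm ?invr_gt0// mulrC ler_pdivrMr//; lra.
- by rewrite /a -scalerAl bb ?scaler0.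
exists n.
have Kbb : Kid (a n * b n).
  by apply: K_right; [exact: K_Z|split; rewrite ?sb].
have : a n * b n = 0.
  apply: KJ => //; apply: (@bounded_J _ C); first by case: Kbb.
  move=> x Xx; rewrite mulrA -TM//; first exact: hC.
  by rewrite /a starZr sb; exact: lidZ.
rewrite /a -scalerAl => /eqP; rewrite scaler_eq0 => /orP[|/eqP h].
  by rewrite (inj_eq (@complexI R)) invr_eq0 gt_eqF.
by apply: star_eq0; rewrite sb.
Qed.

Definition proj e := sa e /\ e * e = e.

Lemma nm_proj e : proj e -> e <> 0 -> nm e = 1.
Proof.
move=> [se ee] e0; have : nm e * nm e = nm e by rewrite -expr2 -nmsa// ee.
move/eqP; rewrite -{3}[nm e]mulr1 -subr_eq0 -mulrBr mulf_eq0 subr_eq0.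
by move=> /orP[/eqP/nm0_eq0//|/eqP].
Qed.
Lemma proj_scalar e x c : proj e -> e <> 0 -> x * star x = c *: e ->
  c = (nm x ^+ 2)%:C.
Proof.
move=> pe e0 xx; have [se ee] := pe.
have px := Pos_star' x.
have : nm x ^+ 2 = complex.Re `|c| by rewrite -nmC' xx nmZ nm_proj// mulr1.
have rc : Num.conj c = c.
  have := Pos_sa px; rewrite xx /sa starZ se => /eqP.
  by rewrite -subr_eq0 -scalerBl scaler_eq0 => /orP[|/eqP//]; rewrite subr_eq0 => /eqP.
have [r cr] : exists r : R, c = r%:C.
  exists (complex.Re c); case: c rc {px xx} => a b' /= /eqP.
  rewrite eq_complex /= eqxx /= => /eqP bb; congr (_ +i* _); lra.
rewrite cr normcC /= => nr; congr _%:C; rewrite nr.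
have [r0|r0] := leP 0 r; first by rewrite ger0_norm.
exfalso; move: nr; rewrite ltr0_norm// => nr.
have x0 : x = 0.
  apply: star_eq0'; apply: Pos_anti => //; rewrite xx cr -scaleNr -CrN.
  by apply: PosZ; [lra|rewrite -ee -{1}se; exact: Pos_star].
by move: nr; rewrite x0 nm0 expr0n /=; lra.
Qed.

(** [isolated_point] is applied with [D = d], a multiple of [b]: the elements [d h_n(d)] of a family
    of annuli are orthogonal in [Kid], so one of them vanishes by [K_orth]. The resulting
    [D1 = d h(d)] satisfies [d D1 = s D1], hence [D1^2 = g(s) D1] with [g(s)] nonzero, and is a
    multiple of a projection. *)
Lemma proj_below b : Kid b -> sa b -> b <> 0 -> exists e : B, exists t : R,
  [/\ proj e, Kid e, e <> 0, t != 0 & b * e = t%:C *: e].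
Proof.
move=> Kb0 sb0 b00; have n0 := nm_ge0 b.
pose k : R := (nm b + 1)^-1; have k0 : 0 < k by rewrite invr_gt0; lra.
pose d := k%:C *: b.
have Kd : Kid d by exact: K_Z.
have sd : sa d by exact: saZ.
have d1 : nm d <= 1 by rewrite nmZr gtr0_norm// mulrC ler_pdivrMr; lra.
have bE : b = k^-1%:C *: d by rewrite scalerA -CrM mulVf ?gt_eqF// scale1r.
have d0 : d <> 0 by move=> d0; apply: b00; rewrite bE d0 scaler0.
have dc h : apx h -> d * fc d h = fc d h * d.
  by move=> ah; have := fc_comm sd d1 (@apx_id R) ah; rewrite fcX.
have Mf h : apx h -> rmult L (fc d h).
  apply: fc_csub => //; [exact: (rmult_csub lT)|exact: rmult1|].
  by apply: (rmult_L lT); case: Kd => -[].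
have sdf h : apx h -> sa (d * fc d h).
  by move=> ah; apply: saM; [exact: sd|exact: fc_sa|exact: dc].
have Kdf h : apx h -> Kid (d * fc d h).
  move=> ah; have Ld : L (d * fc d h) by apply: Mf => //; case: Kd => -[].
  split; first by split => //; rewrite sdf.
  by move=> j Jj; case: Kd => _ hd; rewrite dc// -mulrA hd ?mulr0.
have [|s [h [hs ah Dh Ds]]] := @isolated_point _ _ d d sd d1 d0.
  move=> s eta eps h ha.
  have ahn n : apx (h n) by have [] := ha n.
  apply: (@K_orth (fun n => d * fc d (h n))) => [n|n|m n mn].
  - exact: Kdf.
  - exact: sdf.
  have -> : d * fc d (h m) * (d * fc d (h n)) = d * (fc d (h m) * d) * fc d (h n).
    by alg R.
  rewrite -dc// (_ : _ * _ = d * d * (fc d (h m) * fc d (h n))); last by alg R.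
  rewrite fcM0 ?mulr0// => t _.
  by rewrite -(annulus_unit n t ha) mulrA (mulrC (h m t)) (annulus_disjoint t ha mn) mul0r.
set D1 := d * fc d h in Dh Ds.
have sD : sa D1 by exact: sdf.
have dD : d * D1 = s%:C *: D1 by rewrite -Ds /D1 -mulrA -dc.
pose g t := t * h t.
have ag : apx g by apply: apxM => //; exact: apx_id.
have D1E : D1 = fc d g by rewrite /g fcM// ?fcX//; exact: apx_id.
have DD : D1 * D1 = (g s)%:C *: D1 by rewrite {1}D1E (fc_eigen sd d1 ag hs dD).
have gs0 : g s != 0.
  apply/eqP => gs; apply: Dh; apply: star_eq0.
  by rewrite sD DD gs scale0r.
have s0 : s != 0 by apply: contraNneq gs0 => ->; rewrite /g mul0r.
exists ((g s)^-1%:C *: D1), (k^-1 * s); split.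
- split; first exact: saZ.
  rewrite -scalerAl -scalerAr DD !scalerA -!CrM; congr (_%:C *: _).
  by rewrite -mulrA mulVf ?mulr1.
- by apply: K_Z; exact: Kdf.
- move/eqP; rewrite scaler_eq0 => /orP[|/eqP//].
  by rewrite (inj_eq (@complexI R)) invr_eq0 (negPf gs0).
- by rewrite mulf_neq0// invr_neq0// gt_eqF.
- rewrite -scalerAr {1}bE -scalerAl dD !scalerA -!CrM; congr (_%:C *: _); ring.
Qed.

Definition minproj e := [/\ proj e, Kid e, e <> 0 &
  forall x, exists c, e * x * e = c *: e].

(** A corner that is not scalar contains a self-adjoint [c] that is no real multiple of [e]. A
    projection [f] obtained from [c] lies below [e], and [f = e] would give [c = t e]. *)
Lemma split_proj e : proj e -> Kid e -> e <> 0 -> ~ minproj e ->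
  exists f, [/\ proj f, Kid f, f <> 0, e * f = f & f <> e].
Proof.
move=> [se ee] Ke e0 ne.
have [x hx] : exists x, ~ exists c, e * x * e = c *: e.
  apply: contrapT => h; apply: ne; split => // x.
  by apply: contrapT => hx; apply: h; exists x.
have [c [sc ce hc]] : exists c : B, [/\ sa c, e * c * e = c & forall r : R, c <> r%:C *: e].
  apply: contrapT => h; apply: hx.
  have H y : sa y -> e * y * e = y -> exists r : R, y = r%:C *: e.
    move=> sy ey; apply: contrapT => hr; apply: h; exists y; split=> // r yr.
    by apply: hr; exists r.
  pose w := e * x * e.
  pose u := w + star w; pose v := ii *: (w - star w).
  have ew : e * w * e = w.
    rewrite /w (_ : e * (e * x * e) * e = (e * e) * x * (e * e)); last by alg R.
    by rewrite ee.
  have ew' : e * star w * e = star w by rewrite -{2}ew (starM (e * w)) (starM e) se mulrA.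
  have [||r ur] := H u; first by rewrite /sa /u starD starK addrC.
    by rewrite /u mulrDr mulrDl ew ew'.
  have [||r' vr] := H v; first by rewrite /sa /v star_ii starB starK -scalerN opprB.
    by rewrite /v -scalerAr -scalerAl mulrBr mulrBl ew ew'.
  exists (half * (r%:C + (- ii) * r'%:C)); rewrite -/w.
  rewrite -scalerA scalerDl -scalerA -ur -vr /v scalerA mulNr iiM opprK scale1r.
  by rewrite -[LHS]halfE /u; congr (_ *: _); alg R.
have Kc : Kid c by rewrite -ce; exact: K_mid.
have c0 : c <> 0 by move=> c0; apply: (hc 0); rewrite c0 scale0r.
have ec : e * c = c by rewrite -ce !mulrA ee.
have [f [t [[sf ff] Kf f0 t0 cf]]] := proj_below Kc sc c0.
have fE : f = t^-1%:C *: (c * f) by rewrite cf scalerA -CrM mulVf// scale1r.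
exists f; split => //.
  by rewrite fE -scalerAr mulrA ec.
move=> fe; apply: (hc t); rewrite -fe -cf fe.
by rewrite -{2}ce -mulrA ee ce.
Qed.

(** Otherwise repeated splitting gives a strictly decreasing sequence of projections, whose
    successive differences are nonzero and orthogonal, against [K_orth]. *)
Lemma minproj_below e : proj e -> Kid e -> e <> 0 ->
  exists2 f, minproj f & e * f = f.
Proof.
move=> pe Ke e0; apply: contrapT => Hno.
pose G f := [/\ proj f, Kid f, f <> 0 & e * f = f].
have H f : exists g, G f -> [/\ G g, f * g = g & g <> f].
  have [Gf|nG] := pselect (G f); last by exists 0.
  have [pf Kf f0 ef] := Gf.
  have [|g [pg Kg g0 fg gf]] := split_proj pf Kf f0.
    by move=> mf; apply: Hno; exists f.
  by exists g => _; split => //; split => //; rewrite -fg mulrA ef.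
have [F hF] := choice H.
pose s n := iter n F e.
have Gs n : G (s n).
  elim: n => [|n IH] /=; last by have [] := hF _ IH.
  by split => //; case: pe.
have sm m k : s m * s (m + k.+1)%N = s (m + k.+1)%N.
  elim: k => [|k IH]; first by rewrite addn1; have [] := hF _ (Gs m).
  have [_ h _] := hF _ (Gs (m + k.+1)%N).
  by rewrite addnS /= -h mulrA IH.
pose d n := s n - s n.+1.
have sas n : sa (s n) by have [[]] := Gs n.
have ss n : s n * s n = s n by have [[]] := Gs n.
have sd n : sa (d n) by apply: saB; exact: sas.
have lt m n : (m < n)%N -> d m * d n = 0.
  have E (p q : nat) : (p <= q)%N -> s p * s q = s q.
    rewrite leq_eqVlt => /orP[/eqP->//|pq]; rewrite -(subnKC pq) addSnnS; exact: sm.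
  move=> mn; rewrite /d mulrBl !mulrBr (E _ _ (ltnW mn)) (E m n.+1 (leqW (ltnW mn))).
  by rewrite (E m.+1 n mn) (E m.+1 n.+1 (leqW mn)) subrr.
have [|||n] := @K_orth d => //.
- by move=> n; apply: K_B; [have [] := Gs n|have [] := Gs n.+1].
- move=> m n; rewrite neq_ltn => /orP[/lt//|/lt h].
  by rewrite -[LHS]starK starM !sd h star0.
by have [_ _ h] := hF _ (Gs n); move=> /subr0_eq /esym.
Qed.

Fixpoint orth_family (s : seq B) : Prop :=
  if s is f :: s then [/\ minproj f, forall g, g \in s -> g * f = 0 & orth_family s]
  else True.
Definition psum (s : seq B) : B := \sum_(f <- s) f.

Lemma orth_minproj s f : orth_family s -> f \in s -> minproj f.
Proof.
elim: s => //= g s IH [mg _ os]; rewrite inE => /orP[/eqP->//|fs].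
exact: IH.
Qed.
Lemma psum_sa s : orth_family s -> sa (psum s).
Proof.
elim: s => [|g s IH] /=; first by rewrite /psum big_nil => _; exact: sa0.
by move=> [[[sg _] _ _ _] _ /IH h]; rewrite /psum big_cons; apply: saD.
Qed.
Lemma psum_K s : orth_family s -> Kid (psum s).
Proof.
elim: s => [|g s IH] /=; first by rewrite /psum big_nil => _; exact: K_0.
by move=> [[_ Kg _ _] _ /IH h]; rewrite /psum big_cons; apply: K_D.
Qed.
Lemma psum_l s f : orth_family s -> f \in s -> f * psum s = f.
Proof.
elim: s => //= g s IH [[[sg gg] _ _ _] sg0 os]; rewrite /psum big_cons -/(psum s) mulrDr inE.
move=> /orP[/eqP->|fs]; last by rewrite sg0// add0r IH.
rewrite gg /psum mulr_sumr big_seq big1 ?addr0// => h hs.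
have [[sh _] _ _ _] := orth_minproj os hs.
by rewrite -[LHS]starK starM sg sh sg0// star0.
Qed.
Lemma psum_r s f : orth_family s -> f \in s -> psum s * f = f.
Proof.
move=> os fs; have [[sf _] _ _ _] := orth_minproj os fs.
by rewrite -[LHS]starK starM sf psum_sa// psum_l// sf.
Qed.

(** If no finite family works, [a = b - b k] is nonzero for the current sum [k], and a minimal
    projection obtained from [star a * a] is orthogonal to [k]. Adding it forever contradicts
    [K_orth]. *)
Lemma K_unit : exists2 s, orth_family s & forall b, Kid b -> b * psum s = b.
Proof.
apply: contrapT => Hno.
have H s : exists f, orth_family s -> orth_family (f :: s).
  have [os|no] := pselect (orth_family s); last by exists 0.
  have [b Kb hb] : exists2 b, Kid b & b * psum s <> b.
    apply: contrapT => h; apply: Hno; exists s => // b Kb.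
    by apply: contrapT => hb; apply: h; exists b.
  pose k := psum s; pose a := b - b * k.
  have kk : k * k = k.
    by rewrite {2 3}/k /psum mulr_sumr; apply: eq_big_seq => f; exact: psum_r.
  have Kk : Kid k by exact: psum_K.
  have Ka : Kid a by apply: K_B => //; apply: K_right => //; case: Kk.
  have ak : a * k = 0 by rewrite /a mulrBl -mulrA kk subrr.
  have Kaa : Kid (star a * a) by apply: K_right; [exact: K_star|case: Ka].
  have aa0 : star a * a <> 0.
    by move=> /star_eq0 /subr0_eq /esym.
  have [e [t [[se ee] Ke e0 t0 he]]] := proj_below Kaa (sastar a) aa0.
  have ke : k * e = 0.
    have -> : e = t^-1%:C *: (star a * a * e) by rewrite he scalerA -CrM mulVf// scale1r.
    rewrite -scalerAr !mulrA (_ : k * star a = 0) ?mul0r ?scaler0//.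
    by rewrite -[LHS]starK starM starK psum_sa// ak star0.
  have [|f mf ef] := minproj_below _ Ke e0; first by [].
  exists f => _; split => // g gs.
  by rewrite -(psum_l os gs) -mulrA -ef (mulrA _ e) ke mul0r mulr0.
have [F hF] := choice H.
pose s n := iter n (fun s => F s :: s) [::].
have os n : orth_family (s n) by elim: n => //= n; exact: hF.
have ms m n : (m < n)%N -> F (s m) \in s n.
  elim: n => // n IH; rewrite ltnS leq_eqVlt => /orP[/eqP->|/IH h] /=.
    by rewrite inE eqxx.
  by rewrite inE h orbT.
have mf n : minproj (F (s n)) by have [] := hF _ (os n).
have lt m n : (m < n)%N -> F (s m) * F (s n) = 0.
  by move=> mn; have [_ h _] := hF _ (os n); apply/h/ms.
have sF n : sa (F (s n)) by have [[]] := mf n.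
have [|||n] := @K_orth (fun n => F (s n)) => //.
- by move=> n; have [] := mf n.
- move=> m n; rewrite neq_ltn => /orP[/lt//|/lt h].
  by rewrite -[LHS]starK starM !sF h star0.
by have [] := mf n.
Qed.

Fixpoint inequivalent (s : seq B) : Prop :=
  if s is f :: s then [/\ minproj f, forall g, g \in s -> forall x, g * x * f = 0
    & inequivalent s] else True.

(** One projection is kept from each equivalence class. If [e x f] is nonzero for minimal [e] and
    [f], then [w = f (star x) e] satisfies [w * star w = c f] with [c] the square of its norm, so
    [w] rescaled is a partial isometry carrying [e] to [f]. *)
Lemma representatives (s : seq B) : (forall f, f \in s -> minproj f) ->
  exists2 r : seq B, inequivalent r & forall f, f \in s -> exists e x : B, e \in r /\ f = x * e * star x.
Proof.
elim: s => [|f s IH] hs; first by exists [::].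
have [|r ir hr] := IH; first by move=> g gs; apply: hs; rewrite inE gs orbT.
have mf : minproj f by apply: hs; rewrite inE eqxx.
have [[sf ff] Kf f0 hf] := mf.
have [h|h] := pselect (forall g, g \in r -> forall x, g * x * f = 0).
  exists (f :: r) => // g; rewrite inE => /orP[/eqP->|/hr[e [x [er fe]]]].
    by exists f, 1; rewrite inE eqxx star1 mul1r mulr1.
  by exists e, x; rewrite inE er orbT.
exists r => // g; rewrite inE => /orP[/eqP->|/hr//].
have {h}[e [er [x ex]]] : exists e, e \in r /\ exists x, e * x * f <> 0.
  apply: contrapT => hn; apply: h => e er x; apply: contrapT => ex.
  by apply: hn; exists e; split => //; exists x.
have [[se ee] _ _ _] : minproj e.
  elim: (r) ir er => //= a r' IHr [ma _ ir]; rewrite inE => /orP[/eqP->//|].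
  exact: IHr.
pose w := f * star x * e.
have [c hc] := hf (star x * e * x).
have ww : w * star w = c *: f.
  rewrite /w !starM starK sf se -hc (_ : _ * _ = f * star x * (e * e) * x * f).
    by rewrite ee; alg R.
  by alg R.
have w0 : w <> 0.
  by move=> w0; apply: ex; rewrite -[LHS]starK (starM (e * x)) (starM e) sf se mulrA -/w w0 star0.
have n0 : nm w != 0 by apply/eqP => /nm0_eq0.
have cE := proj_scalar (conj sf ff) f0 ww.
exists e, ((nm w)^-1%:C *: (f * star x)); split => //.
rewrite starZr -!scalerAl -scalerAr scalerA -CrM.
have -> : f * star x * e * star (f * star x) = w * star w.
  by rewrite /w !starM starK se -{1}ee; alg R.
rewrite ww cE scalerA -CrM (_ : _ * _ = 1) ?scale1r//.
by field.
Qed.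

(** The graph is closed on [x k = 0]: a limit [y] of images of a null sequence there satisfies
    [y k = 0] by the module property, whereas [star y * y] lies in [Kid] and is therefore fixed by
    [k]. *)
Lemma bounded_off s : orth_family s -> (forall b, Kid b -> b * psum s = b) ->
  exists2 C : R, 0 <= C & forall x, X x -> x * psum s = 0 -> nm (T x) <= C * nm x.
Proof.
move=> os hs; set k := psum s.
have Kk : Kid k by exact: psum_K.
have [[Lk Lk'] _] := Kk.
pose P x := X x /\ x * k = 0.
have [|||||C C0 hC] := @closed_graph _ _ P T.
- move=> x hx; split; first by apply: (Xs_closed lT) => e /hx[y [? _] ?]; exists y.
  apply: nm_small => e e0; have k0 := nm_ge0 k; have k1 : 0 < nm k + 1 by lra.
  have [y [_ yk] xy] := hx _ (divr_gt0 e0 k1).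
  have -> : x * k = (x - y) * k by rewrite mulrBl yk subr0.
  rewrite (le_trans (nmM _ _))//; move: xy; rewrite ltr_pdivlMr// => h.
  apply: le_trans (ltW h); rewrite ler_wpM2l ?nm_ge0//; lra.
- by split; [exact: (Xs0 lT)|rewrite mul0r].
- move=> c x y [Xx xk] [Xy yk]; split; first by apply: (XsD lT) => //; exact: (XsZ lT).
  by rewrite mulrDl -scalerAl xk yk scaler0 addr0.
- move=> c x y [[? ?] _] [[? ?] _]; exact: (lm_lin lT).
- move=> u y hu u0 uy.
  have sy : sep y by exists u; split=> // n; have [] := hu n.
  have yk : y * k = 0.
    apply: lim_uniq (lim_mulr k uy) _; apply: (@lim_eventually _ _ _ _ 0) => n _ /=.
    by have [Xn nk] := hu n; rewrite -TM// nk (T0 lT).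
  apply: star_eq0; rewrite -(hs _ (sep_K sy)).
  by rewrite -mulrA yk mulr0.
by exists C => // x Xx xk; apply: hC.
Qed.

(** If [e] annihilated all of [X], then [T x * e = T (x * e) = 0] would be bounded and [e] would lie
    in both [Jid] and [Kid]. The lemma places each atom in the ideal generated by [X]. *)
Lemma K_nontrivial e : Kid e -> e <> 0 -> exists2 x, X x & x * e <> 0.
Proof.
move=> Ke e0; apply: contrapT => Hno; apply: e0; apply: KJ => //.
have [[Le Le'] _] := Ke.
apply: (@bounded_J _ 0); first by case: Ke.
move=> x Xx; rewrite -TM// (_ : x * e = 0) ?(T0 lT) ?nm0 ?mul0r//.
by apply: contrapT => h; apply: Hno; exists x.
Qed.
End Structure.

(** * Approximate left multipliers *)

Section Decay.
Context {R : realType} {B : ucstarType R}.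
Implicit Types (x y z h : B) (t : R).

Lemma ler_bernoulli t n : 0 <= t -> 1 + n%:R * t <= (1 + t) ^+ n.
Proof.
move=> t0; elim: n => [|n IH]; first by rewrite mul0r addr0 expr0.
rewrite exprS -natr1; have n0 : 0 <= n%:R :> R by [].
have p0 : 0 <= (1 + t) ^+ n by rewrite exprn_ge0//; lra.
have : 0 <= n%:R * t by rewrite mulr_ge0.
by set a := _ ^+ n in IH p0 *; nra.
Qed.

(* The C*-identity turns the growth of the powers of H into its norm. *)
Lemma power_trick (P : B -> Prop) (H : B) (N : R) (zs : seq (B * B)) :
  sa H -> 0 <= N -> H = \sum_(z <- zs) z.1 * star z.2 ->
  (forall z : B * B, z \in zs -> P z.1) ->
  (forall z, P z -> P (H * z) /\ nm (H * z) <= N * nm z) -> nm H <= N.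
Proof.
move=> sH N0 HE Pz PH; pose M := \sum_(z <- zs) nm z.1 * nm z.2.
have M0 : 0 <= M by apply: sumr_ge0 => z _; rewrite mulr_ge0 ?nm_ge0.
have Hz n z : P z -> P (H ^+ n * z) /\ nm (H ^+ n * z) <= N ^+ n * nm z.
  move=> Pz'; elim: n => [|n [IH1 IH2]]; first by rewrite !expr0 !mul1r.
  have [h1 h2] := PH _ IH1; rewrite exprS -mulrA; split => //.
  by rewrite (le_trans h2)// exprS -mulrA ler_wpM2l.
have HM n : nm (H ^+ n.+1) <= N ^+ n * M.
  rewrite exprSr {2}HE mulr_sumr (le_trans (nm_sum _ _ _))// /M mulr_sumr.
  rewrite !big_seq ler_sum// => z zz; rewrite mulrA (le_trans (nmM _ _))//.
  rewrite nm_star mulrA ler_wpM2r ?nm_ge0//.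
  by have [_] := Hz n _ (Pz _ zz).
have H2 j : nm (H ^+ (2 ^ j)) = nm H ^+ (2 ^ j).
  elim: j => [|j IH]; first by rewrite expn0 !expr1.
  have sj n : sa (H ^+ n).
    elim: n => [|n IHn]; first by rewrite expr0; exact: sa1.
    by rewrite exprS; apply: saM => //; rewrite -exprS -exprSr.
  by rewrite expnS mulnC exprM expr2 nmsa// IH -exprM.
rewrite leNgt; apply/negP => NH.
move: N0; rewrite le_eqVlt => /orP[/eqP N0|N0].
  have := HM 1%N; rewrite expr2 nmsa// -N0 expr1 mul0r => h.
  have : 0 < nm H ^+ 2 by rewrite exprn_gt0// -{1}(_ : N = 0)// -N0.
  by rewrite ltNge h.
pose t := nm H / N - 1.
have t0 : 0 < t by rewrite subr_gt0 ltr_pdivlMr// mul1r.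
have : t = 0.
  apply: (@ler_natM_eq0 _ _ (M / N)) => [|j]; first exact: ltW.
  have h : nm H ^+ (2 ^ j) <= N ^+ (2 ^ j).-1 * M.
    by rewrite -H2 -{1}(prednK (_ : 0 < 2 ^ j)%N) ?expn_gt0.
  have h' : (1 + t) ^+ (2 ^ j) <= M / N.
    rewrite /t addrC subrK expr_div_n ler_pdivrMr ?exprn_gt0//.
    rewrite (le_trans h)// -[in leRHS](prednK (_ : 0 < 2 ^ j)%N) ?expn_gt0//.
    by rewrite exprS mulrA divfK ?gt_eqF// mulrC.
  have hb := ler_bernoulli (2 ^ j) (ltW t0).
  apply: le_trans h'; apply: le_trans hb.
  by rewrite ler_wpDl// ler_pM2r// ler_nat ltnW// ltn_expl.
by move=> t00; rewrite t00 ltxx in t0.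
Qed.

Lemma comm_1BX h n : h * (1 - h) ^+ n = (1 - h) ^+ n * h.
Proof.
by apply: commrX; apply: commrB; [exact: commr1|].
Qed.
Lemma geoB h n : h * (\sum_(i < n) (1 - h) ^+ i) = 1 - (1 - h) ^+ n.
Proof.
elim: n => [|n IH]; first by rewrite big_ord0 mulr0 expr0 subrr.
rewrite big_ord_recr /= mulrDr IH exprS; alg R.
Qed.

(** The positive elements [h (1 - h)^i] decrease in [i], and the first [n + 1] of them sum to
    [1 - (1 - h)^(n+1)], of norm at most [1]. *)
Lemma decay h n : Pos h -> nm h <= 1 -> n.+1%:R * nm (h * (1 - h) ^+ n) <= 1.
Proof.
move=> ph h1; have [p1 _] := Pos_cst1 ph h1.
have pX i : Pos ((1 - h) ^+ i) by exact: PosX.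
have nX i : nm ((1 - h) ^+ i) <= 1 by apply: nmX; have [] := Pos_cst1 ph h1.
have hc i : h * (1 - h) ^+ i = (1 - h) ^+ i * h := comm_1BX h i.
have ph' i : Pos (h * (1 - h) ^+ i) by apply: PosM.
have [_ le1] := Pos_cst1 (pX n.+1) (nX n.+1).
apply: le_trans le1; rewrite -geoB -[X in X * _]ger0_norm ?ler0n// -nmZr.
apply: Pos_le; first by apply: PosZ => //; rewrite ler0n.
have -> : h * \sum_(i < n.+1) (1 - h) ^+ i - n.+1%:R%:C *: (h * (1 - h) ^+ n) =
   \sum_(i < n.+1) (h * (1 - h) ^+ i - h * (1 - h) ^+ n).
  rewrite mulr_sumr sumrB; congr (_ - _).
  rewrite sumr_const card_ord -[RHS]scaler_nat; congr (_ *: _).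
  by rewrite (rmorph_nat (real_complex R)).
elim/big_ind: _ => [||i _]; [exact: Pos0|exact: PosD|].
have -> : h * (1 - h) ^+ i - h * (1 - h) ^+ n =
   h * (1 - h) ^+ i * (1 - (1 - h) ^+ (n - i)).
  by rewrite mulrBr mulr1 -mulrA -exprD subnKC// -ltnS.
have [p2 _] := Pos_cst1 (pX (n - i)%N) (nX (n - i)%N).
apply: PosM => //; apply: commrB; first exact: commr1.
by apply: commr_sym; apply: commrM; [apply/commr_sym/comm_1BX|rewrite /GRing.comm -!exprD addnC].
Qed.

(** Conjugating [k x (star x) <= h] by [(1 - h)^n] reduces to [decay]. Thus [(1 - h)^n x] tends to
    zero at a rate that depends on [x] only through [k]. *)
Lemma decay2 x h (k : R) n : Pos h -> nm h <= 1 -> 0 < k ->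
  Pos (h - k%:C *: (x * star x)) ->
  n.+1%:R * (k * nm ((1 - h) ^+ n * x) ^+ 2) <= 1.
Proof.
move=> ph h1 k0 hx; have sh := Pos_sa ph.
have s1 : sa ((1 - h) ^+ n).
  by apply/Pos_sa/PosX; have [] := Pos_cst1 ph h1.
have [p1 n1] := Pos_cst1 ph h1.
apply: le_trans (decay n ph h1).
rewrite ler_pM2l ?ltr0Sn// -nmC' starM s1 -{1}(gtr0_norm k0) -nmZr.
have -> : k%:C *: ((1 - h) ^+ n * x * (star x * (1 - h) ^+ n)) =
  (1 - h) ^+ n * (k%:C *: (x * star x)) * (1 - h) ^+ n by alg R.
have E : (1 - h) ^+ n * h * (1 - h) ^+ n = h * (1 - h) ^+ n * (1 - h) ^+ n.
  by rewrite -comm_1BX.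
apply: (@le_trans _ _ (nm ((1 - h) ^+ n * h * (1 - h) ^+ n))).
  apply: Pos_le.
    rewrite -{1}s1; apply: Pos_cong; apply: PosZ; [exact: ltW|exact: Pos_star'].
  rewrite (_ : _ - _ = star ((1 - h) ^+ n) * (h - k%:C *: (x * star x)) * (1 - h) ^+ n).
    exact: Pos_cong.
  by rewrite s1; alg R.
rewrite E (le_trans (nmM _ _))// ler_piMr ?nm_ge0//; exact: nmX.
Qed.
End Decay.

(** * Approximation of a bounded local map by left multiplications *)

Section Bounded.
Context {R : realType} {B : ucstarType R}.
Implicit Types (x y z b e f : B) (c : R[i]) (r t : R).
Variables (L S : B -> Prop) (T : B -> B) (k : B) (C : R).
Hypothesis lT : local_map L S T.
Hypothesis k_central : forall b, B2 L b -> b * k = k * b.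
Hypothesis C0 : 0 <= C.
Hypothesis T_bound : forall x, Xs L S x -> x * k = 0 -> nm (T x) <= C * nm x.
Let idL := lm_L lT.

Definition X0 x := Xs L S x /\ x * k = 0.

Lemma X0D x y : X0 x -> X0 y -> X0 (x + y).
Proof.
by move=> [? h] [? h']; split; [exact: (XsD lT)|rewrite mulrDl h h' addr0].
Qed.
Lemma X0Z c x : X0 x -> X0 (c *: x).
Proof.
by move=> [? h]; split; [exact: (XsZ lT)|rewrite -scalerAl h scaler0].
Qed.
Lemma X0B x y : X0 x -> X0 y -> X0 (x - y).
Proof. by move=> hx hy; apply: X0D => //; rewrite -scaleN1r; exact: X0Z. Qed.
Lemma X0_0 : X0 0.
Proof. by split; [exact: (Xs0 lT)|rewrite mul0r]. Qed.
Lemma X0M x b : X0 x -> B2 L b -> X0 (x * b).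
Proof.
move=> [Xx h] Bb; split; first by apply: (XsL lT) => //; case: Bb.
by rewrite -mulrA k_central// mulrA h mul0r.
Qed.
Lemma B2_starM y z : L y -> L z -> B2 L (star y * z).
Proof. by move=> Ly Lz; split; rewrite ?starM ?starK; apply: (lidM idL). Qed.
Lemma X0L x : X0 x -> L x. Proof. by move=> [[]]. Qed.
Lemma TL0 x : X0 x -> L (T x). Proof. by move=> [Xx _]; exact: (TL lT). Qed.
Lemma TX0 x b : X0 x -> B2 L b -> T (x * b) = T x * b.
Proof. by move=> [Xx _] [? ?]; exact: (TM lT). Qed.

(** For [x] and [y] in [L] the product [star x * y] lies in [B2], so the module property moves it
    out of [T] although [y] alone need not lie in [B2]. *)
Lemma T_row (xs : seq B) y : (forall x, x \in xs -> X0 x) -> L y ->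
  Xs L S (\sum_(x <- xs) x * star x * y) /\
  T (\sum_(x <- xs) x * star x * y) = \sum_(x <- xs) T x * star x * y.
Proof.
move=> + Ly; elim: xs => [|x s IH] hs.
  by rewrite !big_nil (T0 lT); split=> //; exact: (Xs0 lT).
have [|Xr Tr] := IH; first by move=> z zs; apply: hs; rewrite inE zs orbT.
have Xx : X0 x by apply: hs; rewrite inE eqxx.
have Bxy : B2 L (star x * y) by apply: B2_starM => //; exact: X0L.
have [Xxy _] := X0M Xx Bxy.
rewrite !big_cons -!mulrA (TD lT)//; split; first exact: (XsD lT).
by rewrite -Tr TX0.
Qed.

(** With [h] a normalized sum of the [x * star x] and [q] the partial geometric series of [1 - h],
    the element [c] satisfies [c z = T (h q z)], and [h q = 1 - (1 - h)^m] is nearly a left unit for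
    the given elements. As operators, [c] from [X0] to [L] and its adjoint from [L] to [X0] are
    bounded by [C]; [power_trick] on [X0] turns the bound for [star c * c] into one for its norm. *)
Lemma approx_multiplier (xs : seq B) (e : R) : (forall x, x \in xs -> X0 x) -> 0 < e ->
  exists c : B, exists zs : seq (B * B),
  [/\ c = \sum_(z <- zs) T z.1 * star z.2,
      forall z : B * B, z \in zs -> X0 z.1 /\ X0 z.2, nm c <= C &
      forall x, x \in xs -> nm (c * x - T x) <= e].
Proof.
move=> Xxs e0.
pose M := \sum_(x <- xs) nm x ^+ 2; have M0 : 0 <= M by apply: sumr_ge0 => x _; exact: sqr_ge0.
pose kp : R := (1 + M)^-1; have kp0 : 0 < kp by rewrite invr_gt0; lra.
pose h := kp%:C *: \sum_(x <- xs) x * star x.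
have ph : Pos h.
  apply: PosZ; first exact: ltW.
  by elim/big_ind: _ => [||x _]; [exact: Pos0|exact: PosD|exact: Pos_star'].
have h1 : nm h <= 1.
  rewrite nmZr gtr0_norm// mulrC ler_pdivrMr ?mul1r; last by lra.
  rewrite (le_trans (nm_sum _ _ _))// (@le_trans _ _ M)//; last by lra.
  by apply: ler_sum => x _; rewrite nmC'.
have [p1 n1] := Pos_cst1 ph h1.
have hx x : x \in xs -> Pos (h - kp%:C *: (x * star x)).
  move=> xxs; rewrite /h -scalerBr; apply: PosZ; first exact: ltW.
  rewrite (perm_big _ (perm_to_rem xxs)) big_cons addrC addKr.
  by elim/big_ind: _ => [||y _]; [exact: Pos0|exact: PosD|exact: Pos_star'].
have [m hm] : exists m : nat, forall x, x \in xs -> C * nm ((1 - h) ^+ m * x) <= e.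
  have C1 : 0 < C + 1 by rewrite ltr_wpDl.
  have ec : 0 < kp * (e / (C + 1)) ^+ 2 by rewrite mulr_gt0// exprn_gt0// divr_gt0.
  have [m hm] := invS_small ec; exists m => x /hx xh.
  have := decay2 m ph h1 kp0 xh; set w := nm _ => hw.
  have w0 : 0 <= w by exact: nm_ge0.
  have h2 : w < e / (C + 1).
    rewrite -(ltr_pXn2r (isT : (0 < 2)%N)) ?nnegrE// ?divr_ge0 ?ltW//.
    rewrite -(ltr_pM2l kp0); apply: le_lt_trans (hm m (leqnn _)).
    by rewrite -[leRHS]mulr1 ler_pdivlMl ?ltr0Sn.
  move: h2; rewrite ltr_pdivlMr// => h2; lra.
pose q := \sum_(i < m) (1 - h) ^+ i.
have sh i : sa ((1 - h) ^+ i) by apply/Pos_sa/PosX.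
have sq : sa q.
  by rewrite /sa /q star_sum; apply: eq_bigr => i _; exact: sh.
have hX z : X0 z -> X0 (h * z).
  move=> Xz; rewrite /h -scalerAl mulr_suml; apply: X0Z.
  rewrite big_seq; elim/big_ind: _ => [||x xs_]; [exact: X0_0|exact: X0D|].
  by rewrite -mulrA; apply: X0M; [exact: Xxs|apply: B2_starM; apply: X0L => //; exact: Xxs].
have qX z : X0 z -> X0 (q * z).
  move=> Xz; rewrite /q mulr_suml; elim/big_ind: _ => [||i _]; [exact: X0_0|exact: X0D|].
  elim: (i : nat) => [|n IH]; first by rewrite expr0 mul1r.
  by rewrite exprS -mulrA mulrBl mul1r; apply: X0B => //; exact: hX.
pose c := \sum_(x <- xs) T x * star (kp%:C *: (q * x)).
have cz z : X0 z -> c * z = T (h * q * z).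
  move=> Xz; have [Xr Tr] := T_row Xxs (X0L (qX _ Xz)).
  have -> : h * q * z = kp%:C *: \sum_(x <- xs) x * star x * (q * z).
    by rewrite -mulr_suml /h -mulrA -scalerAl.
  rewrite (TZ lT)// Tr /c mulr_suml scaler_sumr; apply: eq_bigr => x _.
  by rewrite starZr starM sq; alg R.
have u1 : nm (h * q) <= 1.
  rewrite /q geoB; have := Pos_cst1 (PosX m p1) (nmX m n1); by case.
have uX z : X0 z -> X0 (h * q * z) by move=> Xz; rewrite -mulrA; apply/hX/qX.
have cC z : X0 z -> nm (c * z) <= C * nm z.
  move=> Xz; rewrite cz//; have [Xu uk] := uX _ Xz.
  rewrite (le_trans (T_bound Xu uk))// ler_wpM2l// (le_trans (nmM _ _))//.
  by rewrite ler_piMl ?nm_ge0.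
have cX y : L y -> X0 (star c * y).
  move=> Ly; rewrite /c star_sum mulr_suml big_seq.
  elim/big_ind: _ => [||x xs_]; [exact: X0_0|exact: X0D|].
  rewrite starM starK -mulrA; apply: X0M; first by apply/X0Z/qX/Xxs.
  by apply: B2_starM => //; apply/TL0/Xxs.
(* The C*-identity writes the square of the norm of [star c * y] as the norm of
   [star y * (c * (star c * y))], to which [cC] applies because [star c * y] lies in [X0]. *)
have cC' y : L y -> nm (star c * y) <= C * nm y.
  move=> Ly; have := nm_ge0 (star c * y); rewrite le_eqVlt => /orP[/eqP<-|n0].
    by rewrite mulr_ge0 ?nm_ge0.
  rewrite -(ler_pM2r n0) -expr2 -nmC starM starK -mulrA (le_trans (nmM _ _))//.
  rewrite nm_star (mulrC C) -mulrA ler_wpM2l ?nm_ge0//; exact/cC/cX.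
exists c, [seq (x, kp%:C *: (q * x)) | x <- xs]; split.
- by rewrite big_map.
- by move=> _ /mapP[x /Xxs Xx ->] /=; split => //; apply/X0Z/qX.
- rewrite -(ler_pXn2r (isT : (0 < 2)%N)) ?nnegrE ?nm_ge0// -nmC.
  apply: (@power_trick _ _ X0 _ _ [seq (star c * T x, kp%:C *: (q * x)) | x <- xs]).
  + exact: sastar.
  + exact: exprn_ge0.
  + by rewrite big_map {2}/c mulr_sumr; apply: eq_bigr => x _; rewrite mulrA.
  + by move=> _ /mapP[x /Xxs Xx ->] /=; apply/cX/TL0.
  + move=> z Xz; have Lcz : L (c * z) by rewrite cz//; apply/TL0/uX.
    rewrite -mulrA; split; first exact: cX.
    by rewrite (le_trans (cC' _ Lcz))// expr2 -mulrA ler_wpM2l// cC.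
- move=> x xxs; have Xx := Xxs _ xxs.
  rewrite cz// -(TB lT); [|by have [] := uX _ Xx|by case: Xx].
  apply: le_trans (hm _ xxs).
  have E : h * q * x - x = - ((1 - h) ^+ m * x) by rewrite /q geoB; alg R.
  have [Xu uk] := X0B (uX _ Xx) Xx.
  by rewrite (le_trans (T_bound Xu uk))// E nmN.
Qed.

(** Here [h] is a multiple of [star x * x], so [T (x h q) = T x h q] has [x] as its last factor,
    while [x - x h q = x (1 - h)^m] is small. Thus [T x] stays in every closed left ideal containing
    [x], which keeps it in its summand. *)
Lemma T_closure x (e : R) : X0 x -> 0 < e -> exists b, nm (T x - b * x) <= e.
Proof.
move=> Xx e0; pose a := star x * x.
have n0 := nm_ge0 x; have m0 : 0 <= nm x ^+ 2 by exact: sqr_ge0.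
pose kp : R := (1 + nm x ^+ 2)^-1; have kp0 : 0 < kp by rewrite invr_gt0; lra.
pose h := kp%:C *: a.
have ph : Pos h by apply: PosZ; [exact: ltW|exact: Pos_star].
have h1 : nm h <= 1.
  by rewrite nmZr gtr0_norm// mulrC ler_pdivrMr ?mul1r ?nmC; lra.
have [p1 n1] := Pos_cst1 ph h1.
have Bh : B2 L h by exact: (B2_Z lT _ (B2_starM (X0L Xx) (X0L Xx))).
have ha : Pos (h - kp%:C *: (star x * star (star x))).
  by rewrite starK subrr; exact: Pos0.
have C1 : 0 < C + 1 by rewrite ltr_wpDl.
have ec : 0 < kp * (e / (C + 1)) ^+ 2 by rewrite mulr_gt0// exprn_gt0// divr_gt0.
have [m hm] := invS_small ec.
have := decay2 m ph h1 kp0 ha; set w := nm _ => hw.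
have sm : sa ((1 - h) ^+ m) by apply/Pos_sa/PosX.
have wE : w = nm (x * (1 - h) ^+ m) by rewrite -nm_star starM sm.
have w0 : 0 <= w by exact: nm_ge0.
have h2 : w < e / (C + 1).
  rewrite -(ltr_pXn2r (isT : (0 < 2)%N)) ?nnegrE// ?divr_ge0 ?ltW//.
  rewrite -(ltr_pM2l kp0); apply: le_lt_trans (hm m (leqnn _)).
  by rewrite -[leRHS]mulr1 ler_pdivlMl ?ltr0Sn.
pose q := \sum_(i < m) (1 - h) ^+ i.
have hq : h * q = 1 - (1 - h) ^+ m by exact: geoB.
have qh : q * h = h * q.
  rewrite /q mulr_suml mulr_sumr; apply: eq_bigr => i _; exact/esym/comm_1BX.
have Bhq : B2 L (h * q).
  have [Lh Lh'] := Bh; split; first by rewrite -qh; apply: (lidM idL).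
  rewrite starM; have -> : star q = q.
    by rewrite /q star_sum; apply: eq_bigr => i _; apply/Pos_sa/PosX.
  by apply: (lidM idL).
exists (T x * q * (kp%:C *: star x)).
have -> : T x * q * (kp%:C *: star x) * x = T x * (h * q).
  by rewrite -qh /h /a; alg R.
rewrite -TX0// -(TB lT); [|by case: Xx|by have [] := X0M Xx Bhq].
have [Xu uk] := X0B Xx (X0M Xx Bhq).
rewrite (le_trans (T_bound Xu uk))//.
have -> : x - x * (h * q) = x * (1 - h) ^+ m by rewrite hq; alg R.
rewrite -wE; move: h2; rewrite ltr_pdivlMr// => h2; lra.
Qed.
End Bounded.

(** * The unitization *)

Section RealNorm.
Context {R : realType}.
Implicit Types (c : R[i]) (r e : R).

Lemma ge0_ReE c : 0 <= c -> c = (complex.Re c)%:C.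
Proof. by case: c => a b; rewrite lecE /= => /andP[/eqP -> _]. Qed.
Lemma lt0_ReE c : 0 < c -> c = (complex.Re c)%:C /\ 0 < complex.Re c.
Proof.
move=> c0; have E := ge0_ReE (ltW c0); split=> //.
by move: c0; rewrite E ltcR.
Qed.

Context {V : normedModType R[i]}.
Implicit Types (x y z : V).
Definition rn x : R := complex.Re `|x|.
Lemma rnE x : `|x| = (rn x)%:C.
Proof. by rewrite -ge0_ReE. Qed.
Lemma rn_ge0 x : 0 <= rn x.
Proof. by rewrite -lecR -rnE; exact: normr_ge0. Qed.
Lemma rnD x y : rn (x + y) <= rn x + rn y.
Proof. by rewrite -lecR CrD -!rnE ler_normD. Qed.
Lemma rnZ c x : rn (c *: x) = complex.Re `|c| * rn x.
Proof.
apply: (@complexI R); by rewrite CrM -!rnE normrZ -ge0_ReE.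
Qed.
Lemma rnZr r x : rn (r%:C *: x) = `|r| * rn x.
Proof. by rewrite rnZ normcC. Qed.
Lemma rn0 : rn 0 = 0. Proof. by rewrite /rn normr0. Qed.
Lemma rnN x : rn (- x) = rn x. Proof. by rewrite /rn normrN. Qed.
Lemma rnB x y : rn (x - y) = rn (y - x). Proof. by rewrite -rnN opprB. Qed.
Lemma rn_eq0 x : rn x = 0 -> x = 0.
Proof. by move=> x0; apply/eqP; rewrite -normr_eq0 rnE x0. Qed.
Lemma rn_le x r : (rn x <= r) = (`|x| <= r%:C).
Proof. by rewrite rnE lecR. Qed.
Lemma rn_lt x r : (rn x < r) = (`|x| < r%:C).
Proof. by rewrite rnE ltcR. Qed.
Lemma rn_small x : (forall e, 0 < e -> rn x <= e) -> x = 0.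
Proof.
move=> h; apply: rn_eq0; apply/le_anti; rewrite rn_ge0 andbT.
by apply/ler_addgt0Pl => e e0; rewrite addr0 h.
Qed.
Definition rlim (u : nat -> V) l := forall e : R, 0 < e ->
  exists N, forall n, (N <= n)%N -> rn (u n - l) < e.
Lemma closure_rn (S : set V) x :
  closure S x <-> forall e : R, 0 < e -> exists2 y, S y & rn (x - y) < e.
Proof.
split=> [cx e e0|h].
  have [|y [Sy xy]] := cx (ball x e%:C).
    by apply: nbhsx_ballx; rewrite ltcR.
  by exists y => //; rewrite rn_lt; move: xy; rewrite -ball_normE.
move=> A /nbhs_ballP[e /lt0_ReE[eE e0] xA].
have [y Sy xy] := h _ e0; exists y; split=> //; apply: xA.
by rewrite -ball_normE /= eE -rn_lt.
Qed.
Lemma closed_rn (S : set V) : closed S <->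
  forall x, (forall e : R, 0 < e -> exists2 y, S y & rn (x - y) < e) -> S x.
Proof.
split=> [cS x h|h]; first by apply: cS; apply/closure_rn.
by move=> x /closure_rn; apply: h.
Qed.
Lemma closed_rlim (S : set V) u l : closed S -> (forall n, S (u n)) -> rlim u l -> S l.
Proof.
move=> /closed_rn cS Su ul; apply: cS => e /ul[N /(_ N (leqnn _))].
by rewrite rnB; exists (u N).
Qed.
End RealNorm.

Lemma rn_complete {R : realType} {V : completeNormedModType R[i]} (u : nat -> V) :
  (forall e : R, 0 < e -> exists N, forall m n, (N <= m)%N -> (N <= n)%N ->
     rn (u m - u n) < e) -> exists l, rlim u l.
Proof.
move=> uC; have : cvg (u @ \oo).
  apply: cauchy_cvg; apply/cauchy_ballP => e /lt0_ReE[eE e0].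
  have [N hN] := uC _ e0.
  have NN : (u @ \oo) [set x | exists2 n, (N <= n)%N & x = u n].
    by exists N => // n /= Nn; exists n.
  near=> p; rewrite eE -ball_normE /= -rn_lt.
  have [m Nm ->] : [set x | exists2 n, (N <= n)%N & x = u n] p.1.
    by near: p; apply: cvg_fst.
  have [n Nn ->] : [set x | exists2 n, (N <= n)%N & x = u n] p.2.
    by near: p; apply: cvg_snd.
  exact: hN.
move=> /cvg_ex[l ul]; exists l => e e0.
have := @cvgr_distC_lt _ _ _ _ _ _ _ ul e%:C; rewrite ltcR => /(_ _ e0)[N _ hN].
by exists N => n /hN; rewrite rn_lt.
Unshelve. all: end_near. Qed.

Lemma real_complete {R : realType} (u : nat -> R) : (forall e : R, 0 < e -> exists N, forall m n : nat,
    (N <= m)%N -> (N <= n)%N -> `|u m - u n| < e) ->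
  exists l : R, forall e : R, 0 < e -> exists N, forall n, (N <= n)%N -> `|u n - l| < e.
Proof.
move=> uC; have : cvg (u @ \oo).
  apply: cauchy_cvg; apply/cauchy_ballP => e e0.
  have [N hN] := uC _ e0.
  have NN : (u @ \oo) [set x | exists2 n, (N <= n)%N & x = u n].
    by exists N => // n /= Nn; exists n.
  near=> p; rewrite -ball_normE /=.
  have [m Nm ->] : [set x | exists2 n, (N <= n)%N & x = u n] p.1.
    by near: p; apply: cvg_fst.
  have [n Nn ->] : [set x | exists2 n, (N <= n)%N & x = u n] p.2.
    by near: p; apply: cvg_snd.
  exact: hN.
move=> /cvg_ex[l ul]; exists l => e e0.
have := @cvgr_distC_lt _ _ _ _ _ _ _ ul e => /(_ _ e0)[N _ hN].
by exists N => n /hN.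
Unshelve. all: end_near. Qed.

Section Unitization.
Context {R : realType} {A : cstarType R}.
Implicit Types (a b y : A) (c l m : R[i]).

Lemma amulDl a b y : amul (a + b) y = amul a y + amul b y.
Proof. have := (@amul_bilinear R A).1 y 1 a b; rewrite scale1r => ->.
by congr (_ + _); exact: scale1r. Qed.
Lemma amulDr a b y : amul a (b + y) = amul a b + amul a y.
Proof. have := (@amul_bilinear R A).2 a 1 b y; rewrite scale1r => ->.
by congr (_ + _); exact: scale1r. Qed.
Lemma amul0l y : amul (0 : A) y = 0.
Proof. by apply: (addrI (amul 0 y)); rewrite -amulDl !addr0. Qed.
Lemma amul0r y : amul y (0 : A) = 0.
Proof. by apply: (addrI (amul y 0)); rewrite -amulDr !addr0. Qed.
Lemma amulZl c a y : amul (c *: a) y = c *: amul a y.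
Proof. by have := (@amul_bilinear R A).1 y c a 0; rewrite amul0l !addr0. Qed.
Lemma amulZr c a y : amul a (c *: y) = c *: amul a y.
Proof. by have := (@amul_bilinear R A).2 a c y 0; rewrite amul0r !addr0. Qed.
Lemma astarD a b : astar (a + b) = astar a + astar b.
Proof. by have := astar_antilinear 1 a b; rewrite rmorph1 !scale1r. Qed.
Lemma astar0 : astar (0 : A) = 0.
Proof. by apply: (addrI (astar 0)); rewrite -astarD !addr0. Qed.
Lemma astarZ c a : astar (c *: a) = Num.conj c *: astar a.
Proof. by rewrite -[c *: a]addr0 astar_antilinear astar0 addr0. Qed.
Lemma rn_amul a b : rn (amul a b) <= rn a * rn b.
Proof. by rewrite -lecR CrM -!rnE norm_amul. Qed.
Lemma rn_cstar a : rn (amul (astar a) a) = rn a ^+ 2.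
Proof. by apply: (@complexI R); rewrite expr2 CrM -!rnE -expr2 cstar_identity. Qed.

End Unitization.

Record uni (R : realType) (A : cstarType R) := Uni { usc : R[i]; uvec : A }.

(** * The unitization as a unital C*-algebra *)

Section UniInstances.
Context {R : realType} {A : cstarType R}.
Implicit Types (x y z : uni A) (a b : A) (c l m : R[i]).

Lemma uniE x y : usc x = usc y -> uvec x = uvec y -> x = y.
Proof. by case: x y => [l a] [m b] /= -> ->. Qed.
Lemma uni_pairK : cancel (fun x : uni A => (usc x, uvec x)) (fun p => Uni p.1 p.2).
Proof. by case. Qed.
HB.instance Definition _ := Choice.copy (uni A) (can_type uni_pairK).

Definition uadd x y := Uni (usc x + usc y) (uvec x + uvec y).
Definition uopp x := Uni (- usc x) (- uvec x).
Definition umul x y := Uni (usc x * usc y)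
  (usc x *: uvec y + usc y *: uvec x + amul (uvec x) (uvec y)).
Definition uscale c x := Uni (c * usc x) (c *: uvec x).
Fact uaddA : associative uadd.
Proof. by move=> x y z; apply: uniE; rewrite /= addrA. Qed.
Fact uaddC : commutative uadd.
Proof. by move=> x y; apply: uniE; rewrite /= addrC. Qed.
Fact uadd0 : left_id (Uni 0 0) uadd.
Proof. by move=> x; apply: uniE; rewrite /= add0r. Qed.
Fact uaddN : left_inverse (Uni 0 0) uopp uadd.
Proof. by move=> x; apply: uniE; rewrite /= addNr. Qed.
HB.instance Definition _ := GRing.isZmodule.Build (uni A) uaddA uaddC uadd0 uaddN.

Fact umulA : associative umul.
Proof.
move=> [l a] [m b] [n c]; apply: uniE; rewrite /= ?mulrA//.
rewrite !amulDl !amulDr !amulZl !amulZr !scalerDr !scalerA amulA.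
rewrite (mulrC n l) (mulrC n m).
by rewrite !addrA [LHS](ACl (1*2*4*6*3*5*7)).
Qed.
Fact umul1 : left_id (Uni 1 0) umul.
Proof.
by case=> l a; apply: uniE; rewrite /= ?mul1r// scale1r scaler0 amul0l !addr0.
Qed.
Fact umulr1 : right_id (Uni 1 0) umul.
Proof.
by case=> l a; apply: uniE; rewrite /= ?mulr1// scale1r scaler0 amul0r add0r addr0.
Qed.
Fact umulDl : left_distributive umul uadd.
Proof.
move=> [l a] [m b] [n c]; apply: uniE; rewrite /= ?mulrDl//.
by rewrite amulDl !scalerDl scalerDr !addrA [LHS](ACl (1*3*5*2*4*6)).
Qed.
Fact umulDr : right_distributive umul uadd.
Proof.
move=> [l a] [m b] [n c]; apply: uniE; rewrite /= ?mulrDr//.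
by rewrite amulDr !scalerDl scalerDr !addrA [LHS](ACl (1*3*5*2*4*6)).
Qed.
Fact uni10 : Uni 1 0 != 0 :> uni A.
Proof. by apply/eqP => /(congr1 (@usc _ _)) /= /eqP; rewrite oner_eq0. Qed.
HB.instance Definition _ := GRing.Zmodule_isNzRing.Build (uni A)
  umulA umul1 umulr1 umulDl umulDr uni10.
Fact uscaleA c l x : uscale c (uscale l x) = uscale (c * l) x.
Proof. by apply: uniE; rewrite /= ?mulrA ?scalerA. Qed.
Fact uscale1 : left_id 1 uscale.
Proof. by move=> x; apply: uniE; rewrite /= ?mul1r ?scale1r. Qed.
Fact uscaleDr : right_distributive uscale +%R.
Proof. by move=> c x y; apply: uniE; rewrite /= ?mulrDr ?scalerDr. Qed.
Fact uscaleDl x : {morph uscale^~ x : c l / c + l}.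
Proof. by move=> c l; apply: uniE; rewrite /= ?mulrDl ?scalerDl. Qed.
HB.instance Definition _ := GRing.Zmodule_isLmodule.Build R[i] (uni A)
  uscaleA uscale1 uscaleDr uscaleDl.
Fact uscaleAl c x y : c *: (x * y) = c *: x * y.
Proof.
apply: uniE; rewrite /= ?mulrA// !scalerDr !scalerA amulZl.
by rewrite (mulrC c (usc y)).
Qed.
HB.instance Definition _ := GRing.Lmodule_isLalgebra.Build R[i] (uni A) uscaleAl.
Fact uscaleAr c x y : c *: (x * y) = x * (c *: y).
Proof.
apply: uniE => /=; first exact: mulrCA.
rewrite !scalerDr !scalerA amulZr.
by rewrite (mulrC c (usc x)).
Qed.
HB.instance Definition _ := GRing.Lalgebra_isAlgebra.Build R[i] (uni A) uscaleAr.

Lemma uscZ c x : usc (c *: x) = c * usc x. Proof. by []. Qed.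
Lemma uscM x y : usc (x * y) = usc x * usc y. Proof. by []. Qed.

Definition act x (y : A) : A := usc x *: y + amul (uvec x) y.
Lemma actD x z (y : A) : act (x + z) y = act x y + act z y.
Proof. by rewrite /act /= scalerDl amulDl addrACA. Qed.
Lemma actM x z (y : A) : act (x * z) y = act x (act z y).
Proof.
rewrite /act /= !amulDl !amulZl !scalerDr amulDr amulZr !scalerA amulA.
by rewrite !addrA; congr (_ + _ + _); rewrite addrAC.
Qed.
Lemma actZ c x (y : A) : act (c *: x) y = c *: act x y.
Proof. by rewrite /act /= scalerDr !scalerA amulZl. Qed.
Lemma actZr c x (y : A) : act x (c *: y) = c *: act x y.
Proof. by rewrite /act scalerDr amulZr !scalerA mulrC. Qed.
Definition ustar x := Uni (Num.conj (usc x)) (astar (uvec x)).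
Lemma act_star x (y : A) : amul (astar (act x y)) (act x y) =
  amul (astar y) (act (ustar x * x) y).
Proof.
rewrite actM {1}/act /= astarD astarZ astarM amulDl amulZl.
have -> (z : A) : act (ustar x) z = Num.conj (usc x) *: z + amul (astar (uvec x)) z by [].
by move: (act x y) => z; rewrite amulDr amulZr amulA.
Qed.

Definition acset x : set R := [set rn (act x y) | y in [set y : A | rn y <= 1]].
Definition opn x : R := sup (acset x).
Lemma act_le x (y : A) : rn (act x y) <= (complex.Re `|usc x| + rn (uvec x)) * rn y.
Proof. by rewrite mulrDl (le_trans (rnD _ _))// rnZ lerD// rn_amul. Qed.
Lemma cabs_ge0 c : 0 <= complex.Re `|c|.
Proof. by rewrite -lecR -ge0_ReE//; exact: normr_ge0. Qed.
Lemma acset_sup x : has_sup (acset x).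
Proof.
split; first by exists (rn (act x 0)); exists 0 => //=; rewrite rn0 ler01.
exists (complex.Re `|usc x| + rn (uvec x)) => _ [y /= y1 <-].
by rewrite (le_trans (act_le _ _))// ler_piMr// addr_ge0 ?rn_ge0 ?cabs_ge0.
Qed.
Lemma opn_le x (y : A) : rn (act x y) <= opn x * rn y.
Proof.
have := rn_ge0 y; rewrite le_eqVlt => /orP[/eqP y0|y0].
  by rewrite (rn_eq0 (esym y0)) /act scaler0 amul0r addr0 rn0 mulr0.
rewrite mulrC -ler_pdivrMl// -{1}(gtr0_norm (_ : 0 < (rn y)^-1)) ?invr_gt0//.
rewrite -rnZr -actZr; apply: sup_ubound; first by case: (acset_sup x).
exists ((rn y)^-1%:C *: y) => //=.
by rewrite rnZr gtr0_norm ?invr_gt0// mulVf ?gt_eqF.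
Qed.
Lemma opn_lub x (c : R) : 0 <= c -> (forall y : A, rn (act x y) <= c * rn y) -> opn x <= c.
Proof.
move=> c0 h; apply: sup_le_ub; first by case: (acset_sup x).
by move=> _ [y /= y1 <-]; rewrite (le_trans (h y))// ler_piMr.
Qed.
Lemma opn_ge0 x : 0 <= opn x.
Proof.
apply: (@le_trans _ _ (rn (act x 0))); first exact: rn_ge0.
by apply: sup_ubound; [case: (acset_sup x)|exists 0 => //=; rewrite rn0 ler01].
Qed.
(** The operator norm of left multiplication on [A] is degenerate when [A] already has a unit; the
    maximum with the modulus of the scalar part gives a C*-norm in every case. *)
Definition unm x : R := Num.max (complex.Re `|usc x|) (opn x).

Lemma cabsD c l : complex.Re `|c + l| <= complex.Re `|c| + complex.Re `|l|.
Proof. by rewrite -lecR CrD -!ge0_ReE// ler_normD. Qed.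
Lemma cabsM c l : complex.Re `|c * l| = complex.Re `|c| * complex.Re `|l|.
Proof. by apply: (@complexI R); rewrite CrM -!ge0_ReE// normrM. Qed.
Lemma cabs_conj c : complex.Re `|Num.conj c| = complex.Re `|c|.
Proof. by rewrite norm_conjC. Qed.

Fact unmD x y : unm (x + y) <= unm x + unm y.
Proof.
rewrite ge_max; apply/andP; split.
  by rewrite (le_trans (cabsD _ _))// lerD// le_max lexx.
apply: opn_lub => [|z]; first by rewrite addr_ge0// le_max opn_ge0 orbT.
rewrite actD (le_trans (rnD _ _))// mulrDl lerD// (le_trans (opn_le _ _))//.
  by rewrite ler_wpM2r ?rn_ge0// le_max lexx orbT.
by rewrite ler_wpM2r ?rn_ge0// le_max lexx orbT.
Qed.
Fact unmZ c x : unm (c *: x) = complex.Re `|c| * unm x.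
Proof.
have H (d : R[i]) z : opn (d *: z) <= complex.Re `|d| * opn z.
  apply: opn_lub => [|y]; first by rewrite mulr_ge0 ?cabs_ge0 ?opn_ge0.
  by rewrite actZ rnZ -mulrA ler_wpM2l ?cabs_ge0// opn_le.
rewrite /unm uscZ cabsM maxr_pMr ?cabs_ge0//; congr (Num.max _ _).
apply/le_anti/andP; split; first exact: H.
have [->|c0] := eqVneq c 0.
  by rewrite normr0 mul0r opn_ge0.
have c1 : 0 < complex.Re `|c| by rewrite -ltcR -ge0_ReE// normr_gt0.
rewrite -ler_pdivlMl// {1}(_ : x = c^-1 *: (c *: x)); last first.
  by rewrite scalerA mulVf ?scale1r.
rewrite (le_trans (H _ _))//.
suff -> : complex.Re `|c^-1| = (complex.Re `|c|)^-1 by [].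
apply: (mulIf (lt0r_neq0 c1)).
by rewrite mulVf ?gt_eqF// -cabsM mulVf// normr1.
Qed.
Fact unmM x y : unm (x * y) <= unm x * unm y.
Proof.
have h x' : 0 <= unm x' by rewrite le_max opn_ge0 orbT.
rewrite ge_max; apply/andP; split.
  by rewrite uscM cabsM ler_pM ?cabs_ge0// le_max lexx.
apply: opn_lub => [|z]; first by rewrite mulr_ge0.
rewrite actM (le_trans (opn_le _ _))// -mulrA ler_pM ?opn_ge0 ?rn_ge0//.
  by rewrite le_max lexx orbT.
by rewrite (le_trans (opn_le _ _))// ler_wpM2r ?rn_ge0// le_max lexx orbT.
Qed.
Fact opnC x : opn x ^+ 2 <= opn (ustar x * x).
Proof.
have h := opn_ge0 (ustar x * x).
rewrite -(sqr_sqrtr h) ler_pXn2r ?nnegrE ?sqrtr_ge0 ?opn_ge0//.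
apply: opn_lub => [|y]; first exact: sqrtr_ge0.
rewrite -(ler_pXn2r (isT : (0 < 2)%N)) ?nnegrE ?mulr_ge0 ?rn_ge0 ?sqrtr_ge0//.
rewrite exprMn sqr_sqrtr// -rn_cstar act_star (le_trans (rn_amul _ _))//.
have -> : rn (astar y) = rn y.
  have H (a : A) : rn a <= rn (astar a).
    have := rn_ge0 a; rewrite le_eqVlt => /orP[/eqP<-|a0]; first exact: rn_ge0.
    by rewrite -(ler_pM2r a0) -expr2 -rn_cstar rn_amul.
  by apply/le_anti; rewrite H -{2}(astarK y) H.
by rewrite mulrC expr2 mulrA ler_wpM2r ?rn_ge0// opn_le.
Qed.
Fact ustarM x y : ustar (x * y) = ustar y * ustar x.
Proof.
apply: uniE => /=; first by rewrite rmorphM mulrC.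
by rewrite !astarD !astarZ astarM (addrC (_ *: _)).
Qed.
Fact ustarK : involutive ustar.
Proof. by move=> x; apply: uniE; rewrite /= ?conjCK ?astarK. Qed.
Fact unmC x : unm (ustar x * x) = unm x ^+ 2.
Proof.
have h x' : 0 <= unm x' by rewrite le_max opn_ge0 orbT.
have H y : unm y ^+ 2 <= unm (ustar y * y).
  rewrite {1}/unm; case: (leP (complex.Re `|usc y|) (opn y)) => _.
    by rewrite (le_trans (opnC y))// le_max lexx orbT.
  by rewrite expr2 -{1}cabs_conj -cabsM le_max lexx.
have H' y : unm y <= unm (ustar y).
  have := h y; rewrite le_eqVlt => /orP[/eqP<-//|y0].
  by rewrite -(ler_pM2r y0) -expr2 (le_trans (H _))// unmM.
have E : unm (ustar x) = unm x by apply/le_anti; rewrite H' -{2}(ustarK x) H'.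
by apply/le_anti; rewrite H andbT (le_trans (unmM _ _))// E expr2.
Qed.
(** Testing the left multiplication on the adjoint of [a = uvec x] recovers the square of the norm
    of [a], up to the scalar part. Definiteness and completeness of [unm] follow from this control
    of the components. *)
Lemma uvec_le x : rn (uvec x) <= complex.Re `|usc x| + opn x.
Proof.
set a := uvec x; have := rn_ge0 a; rewrite le_eqVlt => /orP[/eqP<-|a0].
  by rewrite addr_ge0 ?cabs_ge0 ?opn_ge0.
have sE : rn (astar a) = rn a.
  have H (b : A) : rn b <= rn (astar b).
    have := rn_ge0 b; rewrite le_eqVlt => /orP[/eqP<-|b0]; first exact: rn_ge0.
    by rewrite -(ler_pM2r b0) -expr2 -rn_cstar rn_amul.
  by apply/le_anti; rewrite H -{2}(astarK a) H.
rewrite -(ler_pM2r a0) -expr2 -{1}sE -rn_cstar astarK mulrDl.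
have -> : amul a (astar a) = act x (astar a) - usc x *: astar a.
  by rewrite /act addrC addKr.
by rewrite (le_trans (rnD _ _))// rnN rnZ sE addrC lerD// -sE opn_le.
Qed.
Fact unm0 x : unm x = 0 -> x = 0.
Proof.
move=> x0.
have h1 : complex.Re `|usc x| = 0.
  by apply/le_anti; rewrite cabs_ge0 andbT -x0 le_max lexx.
have h2 : opn x = 0 by apply/le_anti; rewrite opn_ge0 andbT -x0 le_max lexx orbT.
apply: uniE => /=.
  by apply/eqP; rewrite -normr_eq0 (ge0_ReE (normr_ge0 _)) h1.
apply: rn_eq0; apply/le_anti; rewrite rn_ge0 andbT.
by have := uvec_le x; rewrite h1 h2 addr0.
Qed.
Lemma cabs_Re c : `|complex.Re c| <= complex.Re `|c|.
Proof.
case: c => a b; rewrite normc_def /= -sqrtr_sqr ler_sqrt ?addr_ge0 ?sqr_ge0//.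
by rewrite lerDl sqr_ge0.
Qed.
Lemma cabs_Im c : `|complex.Im c| <= complex.Re `|c|.
Proof.
case: c => a b; rewrite normc_def /= -sqrtr_sqr ler_sqrt ?addr_ge0 ?sqr_ge0//.
by rewrite lerDr sqr_ge0.
Qed.
Lemma cabs_le c : complex.Re `|c| <= `|complex.Re c| + `|complex.Im c|.
Proof.
have {1}-> : c = (complex.Re c)%:C + ii * (complex.Im c)%:C.
  by case: c => a b; rewrite /ii; simpc.
rewrite (le_trans (cabsD _ _))// cabsM !normcC (_ : complex.Re `|ii| = 1).
  by rewrite mul1r.
by rewrite normc_def /= expr0n expr1n add0r sqrtr1.
Qed.
Fact unm_complete (u : nat -> uni A) :
  (forall e : R, 0 < e -> exists N, forall m n : nat, (N <= m)%N -> (N <= n)%N ->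
     unm (u m - u n) < e) ->
  exists l : uni A, forall e : R, 0 < e -> exists N, forall n, (N <= n)%N -> unm (u n - l) < e.
Proof.
move=> uC.
have le1 x : complex.Re `|usc x| <= unm x by rewrite le_max lexx.
have le2 x : rn (uvec x) <= unm x + unm x.
  by rewrite (le_trans (uvec_le x))// lerD// le_max lexx orbT.
have [|a ha] := @rn_complete _ A (fun n => uvec (u n)).
  move=> e e0; have [N hN] := uC _ (divr_gt0 e0 (ltr0Sn _ 1)); exists N => m n Nm Nn.
  by rewrite (le_lt_trans (le2 (u m - u n)))// (splitr e) ltrD ?hN.
have [|r hr] := @real_complete R (fun n => complex.Re (usc (u n))).
  move=> e e0; have [N hN] := uC _ e0; exists N => m n Nm Nn.
  apply: le_lt_trans (hN m n Nm Nn); apply: le_trans (le1 _); apply: le_trans (cabs_Re _).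
  by rewrite /= raddfB.
have [|s hs] := @real_complete R (fun n => complex.Im (usc (u n))).
  move=> e e0; have [N hN] := uC _ e0; exists N => m n Nm Nn.
  apply: le_lt_trans (hN m n Nm Nn); apply: le_trans (le1 _); apply: le_trans (cabs_Im _).
  by rewrite /= raddfB.
exists (Uni (r +i* s) a) => e e0; have e3 : 0 < e / 3 by rewrite divr_gt0.
have [N1 h1] := ha _ e3; have [N2 h2] := hr _ e3; have [N3 h3] := hs _ e3.
exists (maxn N1 (maxn N2 N3)) => n; rewrite !geq_max => /and3P[/h1 k1 /h2 k2 /h3 k3].
set x := u n - _.
have k4 : complex.Re `|usc x| < e / 3 + e / 3.
  by rewrite (le_lt_trans (cabs_le _))// /x /= !raddfB /= ltrD.
rewrite gt_max; apply/andP; split; first by apply: lt_trans k4 _; lra.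
apply: (@le_lt_trans _ _ (complex.Re `|usc x| + rn (uvec x))); last first.
  by rewrite /x /= in k1 k4 *; lra.
by apply: opn_lub => [|y]; [rewrite addr_ge0 ?cabs_ge0 ?rn_ge0|exact: act_le].
Qed.
Fact ustarD : {morph ustar : x y / x + y}.
Proof. by move=> x y; apply: uniE; rewrite /= ?rmorphD ?astarD. Qed.
Fact ustarZ c x : ustar (c *: x) = Num.conj c *: ustar x.
Proof. by apply: uniE; rewrite /= ?rmorphM ?astarZ. Qed.
HB.instance Definition _ := isUCStar.Build R (uni A) ustarD ustarZ ustarM ustarK
  unmD unmZ unmM unmC unm0 unm_complete.

Definition jn (a : A) : uni A := Uni 0 a.
Lemma jnD a b : jn (a + b) = jn a + jn b.
Proof. by apply: uniE; rewrite /= ?addr0. Qed.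
Lemma jnZ c a : jn (c *: a) = c *: jn a.
Proof. by apply: uniE; rewrite /= ?mulr0. Qed.
Lemma jnM a b : jn (amul a b) = jn a * jn b.
Proof. by apply: uniE; rewrite /= ?mulr0// !scale0r !add0r. Qed.
Lemma jn_star a : jn (astar a) = star (jn a).
Proof. by apply: uniE; rewrite /= ?rmorph0. Qed.
Lemma jn_inj a b : jn a = jn b -> a = b.
Proof. by move/(congr1 (@uvec _ _)). Qed.
Lemma jn_nm a : nm (jn a) = rn a.
Proof.
have u0 : complex.Re `|usc (jn a)| = 0 by rewrite normr0.
have -> : nm (jn a) = opn (jn a).
  by rewrite -[LHS]/(unm _) /unm u0 max_r ?opn_ge0.
apply/le_anti/andP; split.
  by apply: opn_lub => [|y]; [exact: rn_ge0|rewrite /act /= scale0r add0r rn_amul].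
by have := uvec_le (jn a); rewrite u0 add0r.
Qed.
Lemma usc_jn x : usc x = 0 -> x = jn (uvec x).
Proof. by move=> x0; apply: uniE. Qed.
Lemma usc_le x : complex.Re `|usc x| <= nm x.
Proof. by rewrite le_max lexx. Qed.
Lemma jn0 : jn 0 = 0. Proof. by []. Qed.
End UniInstances.

(** * States *)

Section HahnBanach.
Context {R : realType} {V : lmodType R[i]}.
Implicit Types (v w x : V) (r s t : R).
Variables (p : V -> R).
Hypothesis pD : forall v w, p (v + w) <= p v + p w.
Hypothesis pZ : forall r v, 0 <= r -> p (r%:C *: v) = r * p v.

Let p0 : p 0 = 0.
Proof. by rewrite -(scale0r 0) (@pZ 0) ?mul0r. Qed.

(** Partial functionals are encoded by their graphs. The last clause is conditional so that the
    empty graph, the union of the empty chain in Zorn's lemma, qualifies. *)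
Definition dominated (x0 : V) (G : set (V * R)) := [/\
  forall v r, G (v, r) -> r <= p v,
  forall v r w s t, G (v, r) -> G (w, s) -> G (t%:C *: v + w, t * r + s) &
  forall g, G g -> G (x0, p x0)].

Let pN v : - p (- v) <= p v.
Proof. by have := pD v (- v); rewrite subrr p0; lra. Qed.

Let line x0 : dominated x0 [set g | exists t, g = (t%:C *: x0, t * p x0)].
Proof.
split=> [v r [t [-> ->]]|v r w s t [a [-> ->]] [b [-> ->]]|g _].
- have [t0|t0] := leP 0 t; first by rewrite pZ.
  have -> : t%:C *: x0 = (- t)%:C *: (- x0) by rewrite CrN scalerN scaleNr opprK.
  by rewrite pZ; [have := pN x0; nra|lra].
- by exists (t * a + b); rewrite CrD CrM scalerDl scalerA mulrDl mulrA.
- by exists 1; rewrite scale1r mul1r.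
Qed.

Lemma hahn_banach x0 : exists f : V -> R, [/\ forall v w, f (v + w) = f v + f w,
  forall r v, f (r%:C *: v) = r * f v, forall v, f v <= p v & f x0 = p x0].
Proof.
have [|G [[Gp GL G0] Gmax]] := @Zorn_bigcup _ (dominated x0).
  move=> F FP totF; split.
  - by move=> v r [X FX Xvr]; have [h _ _] := FP _ FX; apply: h.
  - move=> v r w s t [X FX Xv] [Y FY Yw].
    have [XY|YX] := totF _ _ FX FY.
      by exists Y => //; have [_ h _] := FP _ FY; apply: h => //; apply: XY.
    by exists X => //; have [_ h _] := FP _ FX; apply: h => //; apply: YX.
  - by move=> g [X FX Xg]; exists X => //; have [_ _ h] := FP _ FX; apply: h Xg.
(* A maximal graph without this point is empty by the last clause of [dominated], and the line
   through [x0] would extend it. *)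
have Gx : G (x0, p x0).
  apply: contrapT => nG; apply: (Gmax _ _ (line x0)); split.
    by move=> g /G0.
  by move=> /(_ (x0, p x0)) h; apply/nG/h; exists 1; rewrite scale1r mul1r.
have G00 : G (0, 0).
  have := GL _ _ _ _ (- 1) Gx Gx.
  by rewrite CrN scaleN1r addNr mulN1r addNr.
have Guniq v r s : G (v, r) -> G (v, s) -> r = s.
  move=> h1 h2; apply/le_anti/andP; split.
    have := Gp _ _ (GL _ _ _ _ (- 1) h2 h1); rewrite CrN scaleN1r addNr p0; lra.
  have := Gp _ _ (GL _ _ _ _ (- 1) h1 h2); rewrite CrN scaleN1r addNr p0; lra.
have dom v : exists r, G (v, r).
  apply: contrapT => nv.
  (* The value at [v] of an extension must lie between all [s - p (w - v)] and all [p (w + v) - s];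
     the supremum of the former is taken. *)
  pose S := [set a | exists w s, G (w, s) /\ a = s - p (w - v)].
  have up w s a : G (w, s) -> S a -> a <= p (w + v) - s.
    move=> Gw [w' [s' [Gw' ->]]].
    have := Gp _ _ (GL _ _ _ _ 1 Gw Gw'); rewrite scale1r mul1r.
    have -> : w + w' = (w + v) + (w' - v) by rewrite addrACA subrr addr0.
    have := pD (w + v) (w' - v); lra.
  have hS : has_sup S.
    split; first by exists (0 - p (0 - v)), 0, 0.
    by exists (p (0 + v) - 0) => a; apply: up.
  pose al := sup S.
  have h1 w s : G (w, s) -> s - p (w - v) <= al.
    by move=> Gw; apply: sup_ubound; [case: hS|exists w, s].
  have h2 w s : G (w, s) -> al <= p (w + v) - s.
    by move=> Gw; apply: sup_le_ub; [case: hS|move=> a; apply: up].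
  have GZ w s t : G (w, s) -> G (t%:C *: w, t * s).
    by move=> Gw; have := GL _ _ _ _ t Gw G00; rewrite !addr0.
  pose G' := [set g : V * R | exists w s t, G (w, s) /\ g = (w + t%:C *: v, s + t * al)].
  apply: (Gmax G').
    split; first by move=> [w s] Gw; exists w, s, 0; rewrite scale0r mul0r !addr0.
    move=> /(_ (v, al)) h; apply: nv; exists al; apply: h.
    by exists 0, 0, 1; rewrite scale1r mul1r !add0r.
  split.
  - move=> _ _ [w [s [t [Gw [-> ->]]]]].
    have [t0|t0|t0] := ltgtP 0 t.
    + have := h2 _ _ (GZ _ _ t^-1 Gw).
      have -> : w + t%:C *: v = t%:C *: (t^-1%:C *: w + v).
        by rewrite scalerDr scalerA -CrM divff ?gt_eqF// scale1r.
      rewrite (pZ _ (ltW t0)) => h.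
      have : t * al <= t * (p (t^-1%:C *: w + v) - t^-1 * s) by rewrite ler_pM2l.
      by rewrite mulrBr mulrA divff ?gt_eqF// mul1r; lra.
    + have t0' : 0 < - t by lra.
      have := h1 _ _ (GZ _ _ (- t)^-1 Gw).
      have -> : w + t%:C *: v = (- t)%:C *: ((- t)^-1%:C *: w - v).
        by rewrite scalerDr scalerA -CrM divff ?gt_eqF// scale1r CrN scaleNr scalerN opprK.
      rewrite (pZ _ (ltW t0')) => h.
      have : (- t) * ((- t)^-1 * s - p ((- t)^-1%:C *: w - v)) <= (- t) * al by rewrite ler_pM2l.
      by rewrite mulrBr mulrA divff ?gt_eqF// mul1r; lra.
    + by rewrite -t0 scale0r mul0r !addr0; exact: Gp.
  - move=> _ _ _ _ c [w [s [t [Gw [-> ->]]]]] [w' [s' [t' [Gw' [-> ->]]]]].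
    exists (c%:C *: w + w'), (c * s + s'), (c * t + t'); split; first exact: GL.
    congr (_, _); last by ring.
    by rewrite scalerDr CrD CrM scalerDl scalerA addrACA.
  - by move=> _ _; exists x0, (p x0), 0; rewrite scale0r mul0r !addr0.
have [f hf] := choice dom; exists f; split.
- move=> v w; apply: Guniq (hf _) _.
  by have := GL _ _ _ _ 1 (hf v) (hf w); rewrite scale1r mul1r.
- move=> r v; apply: Guniq (hf _) _.
  by have := GL _ _ _ _ r (hf v) G00; rewrite !addr0.
- by move=> v; apply/Gp/hf.
- exact: Guniq (hf _) Gx.
Qed.
End HahnBanach.

(** * Positive functionals *)

Section States.
Context {R : realType} {B : ucstarType R}.
Implicit Types (x y : B) (r t : R).

Definition re x := half *: (x + star x).
Lemma sa_re x : sa (re x).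
Proof. by rewrite /re; apply: saZ; rewrite /sa starD starK addrC. Qed.
Lemma reD x y : re (x + y) = re x + re y.
Proof. by rewrite /re starD -scalerDr addrACA. Qed.
Lemma reZ r x : re (r%:C *: x) = r%:C *: re x.
Proof. by rewrite /re starZr -scalerDr !scalerA mulrC. Qed.
Lemma re_sa x : sa x -> re x = x.
Proof. by move=> sx; rewrite /re sx halfE. Qed.
Lemma re_nm x : nm (re x) <= nm x.
Proof.
rewrite nmZr gtr0_norm ?invr_gt0//; have := nmD x (star x); rewrite nm_star; lra.
Qed.

Definition pset x : set R := [set t | Pos (t%:C%:A - re x)].
(** The least [t] with [re x <= t], that is the top of the spectrum of the real part. It is
    sublinear, and a real functional below it is automatically positive and contractive. *)
Definition gauge x : R := inf (pset x).
Lemma pset_nm x : pset x (nm x).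
Proof. exact: Pos_sub_nm (sa_re x) (re_nm x). Qed.
Lemma pset_lb x t : pset x t -> - nm x <= t.
Proof.
move=> Pt; rewrite leNgt; apply/negP => tx.
have P1 : Pos ((nm x)%:C%:A - - re x) by apply: Pos_sub_nm; rewrite ?nmN ?re_nm//; exact/saN/sa_re.
have := PosD Pt P1; rewrite (_ : _ + _ = - (- (t + nm x))%:C%:A).
  move=> h; have t0 : 0 < - (t + nm x) by lra.
  have := Pos_anti (Posc (ltW t0)) h => /eqP; rewrite scaler_eq0 oner_eq0 orbF.
  by rewrite (inj_eq (@complexI R)) gt_eqF.
by rewrite CrN CrD; alg R.
Qed.
Lemma pset_inf x : has_inf (pset x).
Proof.
split; first by exists (nm x); exact: pset_nm.
by exists (- nm x) => t; exact: pset_lb.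
Qed.
Lemma gauge_le x t : pset x t -> gauge x <= t.
Proof. by move=> Pt; apply: inf_lbound => //; case: (pset_inf x). Qed.
Lemma gauge_nm x : gauge x <= nm x.
Proof. exact/gauge_le/pset_nm. Qed.
Lemma pset_gauge x : pset x (gauge x).
Proof.
rewrite /pset /=; apply: Pos_closed => e e0.
have [t Pt te] := inf_adherent e0 (pset_inf x).
exists (t%:C%:A - re x) => //.
have -> : (gauge x)%:C%:A - re x - (t%:C%:A - re x) = (gauge x - t)%:C%:A.
  by rewrite CrB; alg R.
rewrite (le_lt_trans (nmc _))//; have := gauge_le Pt; rewrite -/(gauge x) in te.
by move=> h; rewrite ler0_norm; lra.
Qed.
Lemma gaugeD x y : gauge (x + y) <= gauge x + gauge y.
Proof.
apply: gauge_le; rewrite /pset /= reD CrD.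
have := PosD (pset_gauge x) (pset_gauge y); congr Pos; alg R.
Qed.
Lemma gaugeZ_le r x : 0 <= r -> gauge (r%:C *: x) <= r * gauge x.
Proof.
move=> r0; apply: gauge_le; rewrite /pset /= reZ CrM.
have := PosZ r0 (pset_gauge x); congr Pos; alg R.
Qed.
Lemma gaugeZ r x : 0 <= r -> gauge (r%:C *: x) = r * gauge x.
Proof.
rewrite le_eqVlt => /orP[/eqP<-|r0].
  rewrite scale0r mul0r; apply/le_anti/andP; split.
    by rewrite (le_trans (gauge_nm _))// nm0.
  by have := pset_lb (pset_gauge 0); rewrite nm0 oppr0.
apply/le_anti/andP; split; first exact/gaugeZ_le/ltW.
rewrite -ler_pdivlMl// {1}(_ : x = r^-1%:C *: (r%:C *: x)).
  by apply: gaugeZ_le; rewrite invr_ge0 ltW.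
by rewrite scalerA -CrM mulVf ?gt_eqF// scale1r.
Qed.
Lemma gauge_Posn x : Pos x -> gauge (- x) <= 0.
Proof.
move=> px; apply: gauge_le; rewrite /pset /= scale0r sub0r.
by rewrite re_sa ?opprK//; apply/saN/Pos_sa.
Qed.
Lemma gauge_gt0 x : Pos x -> x <> 0 -> 0 < gauge x.
Proof.
move=> px x0; rewrite ltNge; apply/negP => g0; apply: x0; apply: Pos_anti => //.
have sx := Pos_sa px; have := pset_gauge x; rewrite /pset /= re_sa// => h.
have g0' : 0 <= - gauge x by lra.
have := PosD (Posc g0') h; congr Pos.
by rewrite CrN; alg R.
Qed.

(** Hahn-Banach gives a real functional [f] below [gauge] with [f x = gauge x > 0]. It vanishes on
    skew-adjoint elements, whose gauge is at most zero, so the complexification [f(y) - i f(i y)] is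
    positive; a rotation by a phase gives the norm bound. *)
Lemma exists_state x : Pos x -> x <> 0 -> exists F : B -> R[i],
  [/\ forall (c : R[i]) y z, F (c *: y + z) = c * F y + F z,
      forall y, 0 <= F (star y * y), forall y, `|F y| <= (nm y)%:C & F x != 0].
Proof.
move=> px x0; have [f [fD fZ fp fx]] := hahn_banach gaugeD gaugeZ x.
have f0 : f 0 = 0 by rewrite -(scale0r 0) (fZ 0) mul0r.
have fN y : f (- y) = - f y by rewrite -scaleN1r -[-1]/(- 1%:C) -CrN fZ mulN1r.
have f_im y : star y = - y -> f y = 0.
  move=> sy; have g0 z : star z = - z -> gauge z <= 0.
    move=> sz; apply: gauge_le; rewrite /pset /= scale0r /re sz subrr scaler0 subr0.
    exact: Pos0.
  apply/le_anti/andP; split; first exact: le_trans (fp _) (g0 _ sy).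
  rewrite -oppr_le0 -fN; apply: le_trans (fp _) (g0 _ _).
  by rewrite starN sy.
have f_re y : f y = f (re y).
  rewrite -[in LHS](subrK (re y) y) fD (_ : f (y - re y) = 0) ?add0r//.
  apply: f_im; rewrite starB (sa_re y) opprB.
  have rr : re y + re y = y + star y by rewrite /re -scalerDr halfE.
  by rewrite -[star y](addKr y) -rr; alg R.
have fpos y : Pos y -> 0 <= f y.
  by move=> /gauge_Posn h; rewrite -oppr_le0 -fN (le_trans (fp _)).
pose F y : R[i] := (f y) +i* (- f (ii *: y)).
have FD y z : F (y + z) = F y + F z.
  by rewrite /F fD scalerDr fD opprD; simpc.
have FZ (c : R[i]) y : F (c *: y) = c * F y.
  case: c => a b.
  have E : (a +i* b) *: y = a%:C *: y + b%:C *: (ii *: y).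
    rewrite scalerA -scalerDl; congr (_ *: _).
    by rewrite /ii; simpc.
  have iii : ii *: (ii *: y) = - y by rewrite scalerA iiM scaleN1r.
  have iiE : ii *: ((a +i* b) *: y) = a%:C *: (ii *: y) + b%:C *: (- y).
    rewrite E scalerDr !scalerA !(mulrC ii) -!scalerA iii.
    by [].
  rewrite /F iiE E !fD !fZ fN; simpc; congr (_ +i* _); ring.
have FE y : `|F y| <= (nm y)%:C.
  have [->|Fy0] := eqVneq (F y) 0; first by rewrite normr0 lecR nm_ge0.
  pose w := `|F y| / F y.
  have w1 : `|w| = 1 by rewrite normrM normfV normr_id divff// normr_eq0.
  have Fw : F (w *: y) = `|F y| by rewrite FZ divfK.
  have -> : `|F y| = (f (w *: y))%:C.
    by rewrite -Fw; apply: etrans (ge0_ReE _) _ => //; rewrite Fw.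
  rewrite lecR (le_trans (fp _))// (le_trans (gauge_nm _))// nmZ w1 mul1r//.
exists F; split => //.
- by move=> c y z; rewrite FD FZ.
- move=> y; have py := Pos_star y.
  have : f (ii *: (star y * y)) = 0.
    by apply: f_im; rewrite star_ii sastar.
  by move=> h; rewrite /F h oppr0 lecE /= eqxx fpos.
- apply/eqP => /(congr1 (@complex.Re _)) /=; rewrite fx => g0.
  by have := gauge_gt0 px x0; rewrite g0 ltxx.
Qed.
End States.

Section StatesA.
Context {R : realType} {A : cstarType R}.

(** The functional on the unitization may have a smaller norm on [A], so it is divided by the norm
    [N] of its restriction; [N] is positive because the functional is nonzero at
    [star (jn a) * jn a]. *)
Lemma state_separates (a : A) : a <> 0 -> exists2 f : A -> R[i], state f &
  f (amul (astar a) a) != 0.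
Proof.
move=> a0.
have ja : star (jn a) * jn a <> 0.
  by move=> /star_eq0 h; apply: a0; apply: jn_inj.
have [F [Flin Fpos Fle F0]] := exists_state (Pos_star (jn a)) ja.
pose N := sup [set complex.Re `|F (jn b)| | b in [set b : A | rn b <= 1]].
have Fle' (b : A) : complex.Re `|F (jn b)| <= rn b.
  by rewrite -jn_nm -lecR -ge0_ReE// Fle.
have hs : has_sup [set complex.Re `|F (jn b)| | b in [set b : A | rn b <= 1]].
  split; first by exists (complex.Re `|F (jn 0)|), 0 => //=; rewrite rn0 ler01.
  by exists 1 => _ [b /= b1 <-]; rewrite (le_trans (Fle' b)).
have FZ (c : R[i]) y : F (c *: y) = c * F y.
  have F00 : F 0 = 0.
    have := Flin 1 0 0; rewrite scaler0 addr0 mul1r => /eqP.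
    by rewrite -subr_eq0 opprD addNKr oppr_eq0 => /eqP.
  by have := Flin c y 0; rewrite addr0 F00 addr0.
have FN (b : A) : complex.Re `|F (jn b)| <= N * rn b.
  have := rn_ge0 b; rewrite le_eqVlt => /orP[/eqP b0|b0].
    by rewrite -b0 mulr0 b0.
  rewrite mulrC -ler_pdivrMl//; apply: sup_ubound; first by case: hs.
  exists ((rn b)^-1%:C *: b).
    by rewrite /= rnZr gtr0_norm ?invr_gt0// mulVf ?gt_eqF.
  by rewrite jnZ FZ cabsM normcC gtr0_norm ?invr_gt0.
have jE (b : A) : jn (amul (astar b) b) = star (jn b) * jn b.
  by rewrite jnM jn_star.
have N0 : 0 < N.
  rewrite ltNge; apply/negP => N0; move/eqP: F0; apply.
  apply/eqP; rewrite -normr_eq0 (ge0_ReE (normr_ge0 _)) -jE.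
  suff -> : complex.Re `|F (jn (amul (astar a) a))| = 0 by [].
  apply/le_anti/andP; split; last exact: cabs_ge0.
  by rewrite (le_trans (FN _))// mulr_le0_ge0 ?rn_ge0.
exists (fun b => N^-1%:C * F (jn b)); last first.
  by rewrite mulf_neq0 ?jE// (inj_eq (@complexI R)) invr_eq0 gt_eqF.
split.
- by move=> c x y /=; rewrite jnD jnZ Flin; rewrite mulrDr mulrCA.
- move=> b; rewrite jE mulr_ge0 ?Fpos// lecR invr_ge0 ltW//.
- move=> b.
  have H : `|N^-1%:C * F (jn b)| = (N^-1 * complex.Re `|F (jn b)|)%:C.
    rewrite [LHS]ge0_ReE; last exact: normr_ge0.
    by rewrite cabsM normcC gtr0_norm ?invr_gt0.
  by apply: (@le_trans _ _ (rn b)%:C); rewrite ?rnE// [leLHS]H lecR ler_pdivrMl.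
- move=> r; rewrite ltcE /= => /andP[/eqP ri r1].
  have rE : r = (complex.Re r)%:C by case: r ri {r1} => u v /= <-.
  have e0 : 0 < N - complex.Re r * N by rewrite subr_gt0 gtr_pMl.
  have [_ [b /= b1 <-] hb] := sup_adherent e0 hs.
  rewrite -/N opprB addrC subrK in hb.
  exists b; first by rewrite -(rn_le b 1).
  have H : `|N^-1%:C * F (jn b)| = (N^-1 * complex.Re `|F (jn b)|)%:C.
    rewrite [LHS]ge0_ReE; last exact: normr_ge0.
    by rewrite cabsM normcC gtr0_norm ?invr_gt0.
  by rewrite [ltRHS]H rE ltcR ltr_pdivlMl// mulrC.
Qed.
End StatesA.

(** * Hilbert spaces *)

Section Hilbert.
Context {R : realType} {H : hilbertType R}.
Implicit Types (x y z w v : H) (c : R[i]) (r t e : R).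

Lemma dotpC x y : dotp x y = Num.conj (dotp y x).
Proof.
by have := hermitian_subproof (s := @inner R H) x y; rewrite expr0 mul1r.
Qed.
Lemma dotp_conj x y : Num.conj (dotp y x) = dotp x y.
Proof. by rewrite -dotpC. Qed.
Lemma dotpDl x y z : dotp (x + y) z = dotp x z + dotp y z.
Proof. exact: linearDl. Qed.
Lemma dotpZl c x z : dotp (c *: x) z = c * dotp x z.
Proof. exact: linearZl_LR. Qed.
Lemma dotp0l z : dotp 0 z = 0.
Proof. by rewrite -(scale0r 0) dotpZl mul0r. Qed.
Lemma dotpNl x z : dotp (- x) z = - dotp x z.
Proof. by rewrite -scaleN1r dotpZl mulN1r. Qed.
Lemma dotpBl x y z : dotp (x - y) z = dotp x z - dotp y z.
Proof. by rewrite dotpDl dotpNl. Qed.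
Lemma dotpDr x y z : dotp z (x + y) = dotp z x + dotp z y.
Proof. by rewrite dotpC dotpDl rmorphD; congr (_ + _); exact: dotp_conj. Qed.
Lemma dotpZr c x z : dotp z (c *: x) = Num.conj c * dotp z x.
Proof. by rewrite dotpC dotpZl rmorphM; congr (_ * _); exact: dotp_conj. Qed.
Lemma dotp0r z : dotp z 0 = 0.
Proof. by rewrite dotpC dotp0l rmorph0. Qed.
Lemma dotpNr x z : dotp z (- x) = - dotp z x.
Proof. by rewrite dotpC dotpNl rmorphN; congr (- _); exact: dotp_conj. Qed.
Lemma dotpBr x y z : dotp z (x - y) = dotp z x - dotp z y.
Proof. by rewrite dotpDr dotpNr. Qed.
Lemma dotpp x : dotp x x = (rn x ^+ 2)%:C.
Proof. by rewrite -[LHS]inner_norm rnE expr2 -CrM. Qed.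
Lemma dotpp_eq0 x : dotp x x = 0 -> x = 0.
Proof.
rewrite dotpp => /(@complexI R _ 0)/eqP; rewrite sqrf_eq0 => /eqP.
exact: rn_eq0.
Qed.
Lemma conjMC c : c * Num.conj c = (complex.Re `|c| ^+ 2)%:C.
Proof. by rewrite -normCK expr2 CrM -!ge0_ReE. Qed.

Lemma Cr_inj r t : r%:C = t%:C :> R[i] -> r = t.
Proof. by case. Qed.

Lemma rn_sub_proj z w : w <> 0 ->
  rn (z - (dotp z w / dotp w w) *: w) ^+ 2 =
  rn z ^+ 2 - complex.Re `|dotp z w| ^+ 2 / rn w ^+ 2.
Proof.
move=> w0; have n0 : rn w ^+ 2 != 0.
  by rewrite sqrf_eq0; apply/eqP => /rn_eq0.
have wr : Num.conj (dotp z w / dotp w w) = dotp w z / dotp w w.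
  rewrite rmorphM; congr (_ * _); first exact: dotp_conj.
  by rewrite fmorphV; congr (_^-1); exact: dotp_conj.
apply: Cr_inj; rewrite -dotpp dotpBl !dotpBr !dotpZl !dotpZr wr.
rewrite CrB (CrM (complex.Re _ ^+ 2)) -(conjMC (dotp z w)) dotp_conj.
rewrite (_ : ((rn w ^+ 2)^-1)%:C = (dotp w w)^-1); last first.
  by rewrite dotpp (fmorphV (real_complex R)).
rewrite -(dotpp z); have : dotp w w != 0 by rewrite dotpp (inj_eq (@complexI R)).
by move=> h; field.
Qed.

Lemma cauchy_schwarz x y : complex.Re `|dotp x y| <= rn x * rn y.
Proof.
have [->|/eqP y0] := eqVneq y 0; first by rewrite dotp0r normr0 rn0 mulr0.
have n0 : 0 < rn y.
  by rewrite lt_neqAle rn_ge0 andbT eq_sym; apply/eqP => /rn_eq0.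
rewrite -(ler_pXn2r (isT : (0 < 2)%N)) ?nnegrE ?mulr_ge0 ?rn_ge0 ?cabs_ge0//.
rewrite exprMn -ler_pdivrMr ?exprn_gt0// -subr_ge0 -rn_sub_proj//.
exact: sqr_ge0.
Qed.

Lemma parallelogram x y :
  rn (x + y) ^+ 2 + rn (x - y) ^+ 2 = 2 * (rn x ^+ 2 + rn y ^+ 2).
Proof.
apply: Cr_inj; rewrite CrD CrM [in RHS]CrD Cr1 (CrD (rn x ^+ 2)) -!dotpp dotpBl !dotpDl !dotpBr !dotpDr.
ring.
Qed.

Section Projection.
Variable V : set H.
Hypotheses (sV : subspace_of V) (cV : closed V).

Lemma subspD x y : V x -> V y -> V (x + y).
Proof. by move=> Vx Vy; rewrite -(scale1r x); apply: sV.2. Qed.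
Lemma subspZ c x : V x -> V (c *: x).
Proof. by move=> Vx; rewrite -[_ *: _]addr0; apply: sV.2 => //; exact: sV.1. Qed.

Lemma projection x : exists2 v, V v & forall w, V w -> dotp (x - v) w = 0.
Proof.
pose E := [set rn (x - v) ^+ 2 | v in V].
have hE : has_inf E.
  split; first by exists (rn (x - 0) ^+ 2), 0 => //; exact: sV.1.
  by exists 0 => _ [v _ <-]; exact: sqr_ge0.
pose d := inf E.
have dle v : V v -> d <= rn (x - v) ^+ 2.
  by move=> Vv; apply: inf_lbound; [case: hE|exists v].
have /choice[u hu] : forall n : nat, exists v, V v /\ rn (x - v) ^+ 2 < d + n.+1%:R^-1.
  move=> n; have [//|_ [v Vv <-] h] := @inf_adherent _ E n.+1%:R^-1 _ hE.
  by exists v.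
have uu m n : rn (u m - u n) ^+ 2 <= 2 * (m.+1%:R^-1 + n.+1%:R^-1).
  have [Vm hm] := hu m; have [Vn hn] := hu n.
  have := parallelogram (x - u m) (x - u n).
  have -> : x - u m - (x - u n) = - (u m - u n) by rewrite !opprB addrC addrA subrK.
  rewrite rnN.
  have -> : x - u m + (x - u n) = 2%:C *: (x - half *: (u m + u n)).
    have -> : half = 2^-1 %:C :> R[i] by [].
    rewrite scalerBr scalerA -CrM divff// Cr1 scale1r.
    rewrite (_ : 2%:C = 1 + 1 :> R[i]); last by rewrite CrD Cr1.
    by rewrite scalerDl scale1r addrACA opprD.
  rewrite rnZr ger0_norm// exprMn.
  have := dle _ (subspZ half (subspD Vm Vn)).
  move: hm hn; set a := m.+1%:R^-1; set b := n.+1%:R^-1; lra.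
have [|v uv] := @rn_complete _ H u.
  move=> e e0; have e4 : 0 < e ^+ 2 / 4 by rewrite divr_gt0// exprn_gt0.
  have [N hN] := invS_small e4; exists N => m n Nm Nn.
  rewrite -(ltr_pXn2r (isT : (0 < 2)%N)) ?nnegrE ?rn_ge0 ?ltW//.
  apply: le_lt_trans (uu m n) _; have := hN m Nm; have := hN n Nn.
  by set a := m.+1%:R^-1; set b := n.+1%:R^-1; lra.
have Vv : V v by apply: closed_rlim cV _ uv => n; have [] := hu n.
exists v => // w Vw.
have [->|/eqP w0] := eqVneq w 0; first by rewrite dotp0r.
have dv : rn (x - v) ^+ 2 <= d.
  have h e : 0 < e -> rn (x - v) <= Num.sqrt (d + e) + e.
    move=> e0; have [N1 h1] := uv _ e0; have [N2 h2] := invS_small e0.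
    pose n := maxn N1 N2; have [_ hn] := hu n.
    have -> : x - v = (x - u n) + (u n - v) by rewrite addrA subrK.
    rewrite (le_trans (rnD _ _))// lerD//; last by rewrite ltW// h1// leq_maxl.
    rewrite -[rn _]ger0_norm ?rn_ge0// -sqrtr_sqr ler_sqrt.
      by rewrite (le_trans (ltW hn))// lerD2l ltW// h2// leq_maxr.
    have : 0 <= rn (x - u n) ^+ 2 by exact: sqr_ge0.
    by have := h2 n (leq_maxr _ _); move: hn; set a := n.+1%:R^-1; lra.
  apply/ler_addgt0Pl => e e0; rewrite leNgt; apply/negP => lt.
  have dn0 : 0 <= d by apply: lb_le_inf; [case: hE|move=> _ [z _ <-]; exact: sqr_ge0].
  set a := rn (x - v) in h lt.
  have a0 : 0 <= a by exact: rn_ge0.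
  (* From [(a - f)^2 <= d + f] one gets [a^2 <= d + f (2 a + 1)], so any small [f] with
     [f (2 a + 4) <= e] closes the gap. *)
  pose f := Num.min 1 (e / (2 * a + 4)).
  have f0 : 0 < f by rewrite lt_min ltr01 divr_gt0//; lra.
  have f1 : f <= 1 by rewrite ge_min lexx.
  have f2 : f * (2 * a + 4) <= e by rewrite -ler_pdivlMr ?ge_min ?lexx ?orbT//; lra.
  have := h _ f0; rewrite -lerBlDr => hf.
  have s0 : 0 <= d + f by lra.
  have [af|af] := leP (a - f) 0.
    have : a ^+ 2 <= f ^+ 2 by rewrite ler_pXn2r ?nnegrE//; lra.
    by nra.
  have : (a - f) ^+ 2 <= d + f.
    by rewrite -[leRHS]sqr_sqrtr// ler_pXn2r ?nnegrE ?sqrtr_ge0// ltW.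
  by nra.
(* Adding to [v] the component of [x - v] along [w] would lower the distance unless that component
   is zero. *)
have Vc : V (v + (dotp (x - v) w / dotp w w) *: w) by apply: subspD => //; exact: subspZ.
have := dle _ Vc; rewrite opprD addrA rn_sub_proj// => h.
have n0 : 0 < rn w ^+ 2.
  by rewrite exprn_gt0// lt_neqAle rn_ge0 andbT eq_sym; apply/eqP => /rn_eq0.
have h' : complex.Re `|dotp (x - v) w| ^+ 2 / rn w ^+ 2 <= 0 by lra.
move: h'; rewrite ler_pdivrMr// mul0r => h'.
have /eqP : complex.Re `|dotp (x - v) w| ^+ 2 = 0.
  by apply/le_anti; rewrite h' sqr_ge0.
rewrite sqrf_eq0 => /eqP h0; apply/eqP; rewrite -normr_eq0.
by rewrite (ge0_ReE (normr_ge0 _)) h0.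
Qed.
End Projection.

Lemma riesz (phi : H -> R[i]) (C : R) :
  (forall c x y, phi (c *: x + y) = c * phi x + phi y) ->
  (forall x, complex.Re `|phi x| <= C * rn x) ->
  exists y, forall x, phi x = dotp x y.
Proof.
move=> lin bd.
have phi0 : phi 0 = 0.
  have := lin 1 0 0; rewrite scaler0 addr0 mul1r => /eqP.
  by rewrite -subr_eq0 opprD addNKr oppr_eq0 => /eqP.
have phiZ c x : phi (c *: x) = c * phi x by rewrite -[c *: x]addr0 lin phi0 addr0.
have phiD x y : phi (x + y) = phi x + phi y by rewrite -{1}(scale1r x) lin mul1r.
have phiB x y : phi (x - y) = phi x - phi y by rewrite phiD -scaleN1r phiZ mulN1r.
have [[u u0]|h] := pselect (exists u, phi u <> 0); last first.
  exists 0 => x; rewrite dotp0r; apply: contrapT => px; apply: h; by exists x.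
pose K := [set x | phi x = 0].
have sK : subspace_of K.
  by split=> // c x y; rewrite /K /= lin => -> ->; rewrite mulr0 addr0.
have cK : closed K.
  apply/closed_rn => x hx; rewrite /K /=; apply/eqP; rewrite -normr_eq0.
  rewrite (ge0_ReE (normr_ge0 _)) (_ : complex.Re _ = 0)//.
  apply/le_anti; rewrite cabs_ge0 andbT; apply/ler_addgt0Pl => e e0; rewrite addr0.
  have C1 : 0 < `|C| + 1 by rewrite ltr_wpDl.
  have [y Ky xy] := hx _ (divr_gt0 e0 C1).
  rewrite -[phi x]subr0 -{1}Ky -phiB (le_trans (bd _))//.
  move: xy; rewrite ltr_pdivlMr// mulrC => h; apply: le_trans (ltW h).
  by rewrite ler_wpM2r ?rn_ge0// (le_trans (ler_norm _))// lerDl.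
have [v Kv hv] := projection sK cK u.
pose z := u - v; have pz : phi z = phi u by rewrite phiB Kv subr0.
have z0 : dotp z z != 0.
  apply/eqP => /dotpp_eq0 z0; apply: u0; by rewrite -pz z0.
have pu : phi u != 0 by apply/eqP.
exists ((Num.conj (phi u) / dotp z z) *: z) => x.
have Kx : K (x - (phi x / phi u) *: z).
  by rewrite /K /= phiB phiZ pz divfK// subrr.
have := hv _ Kx; rewrite dotpC -/z dotpBl dotpZl => /eqP.
rewrite fmorph_eq0 subr_eq0 => /eqP E.
have zr : Num.conj (Num.conj (phi u) / dotp z z) = phi u / dotp z z.
  rewrite rmorphM; congr (_ * _); first exact: conjCK.
  rewrite fmorphV; congr (_^-1); exact: dotp_conj.
rewrite dotpZr E zr.
by field; rewrite pu z0.
Qed.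

Lemma bounded_opP (T : H -> H) : bounded_op T <->
  linear T /\ exists2 C : R, 0 < C & forall x, rn (T x) <= C * rn x.
Proof.
split=> [[lT cT]|[lT [C C0 hC]]]; split=> //.
  have T0 : T 0 = 0.
    by have := lT (-1) 0 0; rewrite scaler0 addr0 scaleN1r addNr.
  have TZ c x : T (c *: x) = c *: T x by rewrite -[c *: x]addr0 lT T0 addr0.
  have := cT 0 (ball (T 0) 1) (nbhsx_ballx _ _ ltr01).
  move=> /nbhs_ballP[d /lt0_ReE[dE d0] hd].
  have hd' x : rn x < complex.Re d -> rn (T x) < 1.
    move=> xd; have := hd x; rewrite -!ball_normE /= T0 !sub0r !normrN rn_lt; apply.
    by rewrite dE -rn_lt.
  exists (2 / complex.Re d); first by rewrite divr_gt0.
  move=> x; have := rn_ge0 x; rewrite le_eqVlt => /orP[/eqP x0|x0].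
    by rewrite (rn_eq0 (esym x0)) T0 rn0 mulr0.
  pose k := complex.Re d / 2 / rn x.
  have k0 : 0 < k by rewrite !divr_gt0.
  have := hd' (k%:C *: x); rewrite TZ !rnZr gtr0_norm// => h.
  have : k * rn (T x) < 1 by apply: h; rewrite /k divfK ?gt_eqF//; lra.
  rewrite -ltr_pdivlMl// mulr1 => /ltW h'; apply: le_trans h' _.
  by rewrite le_eqVlt; apply/orP; left; apply/eqP; rewrite /k; field; rewrite !gt_eqF.
move=> x B /nbhs_ballP[e /lt0_ReE[eE e0] hB]; apply/nbhs_ballP.
exists (complex.Re e / C)%:C; first by rewrite /= ltcR divr_gt0.
move=> y; rewrite -ball_normE /= -rn_lt => xy; apply: hB; rewrite -ball_normE /=.
have -> : T x - T y = T (x - y) by rewrite addrC -scaleN1r -lT scaleN1r addrC.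
rewrite eE -rn_lt (le_lt_trans (hC _))//.
by move: xy; rewrite ltr_pdivlMr// mulrC.
Qed.

Section Linear.
Variable T : H -> H.
Hypothesis lT : linear T.
Lemma lin0 : T 0 = 0.
Proof. by have := lT (-1) 0 0; rewrite scaler0 addr0 scaleN1r addNr. Qed.
Lemma linD x y : T (x + y) = T x + T y.
Proof. by rewrite -{1}(scale1r x) lT scale1r. Qed.
Lemma linZ c x : T (c *: x) = c *: T x.
Proof. by rewrite -[c *: x]addr0 lT lin0 addr0. Qed.
Lemma linB x y : T (x - y) = T x - T y.
Proof. by rewrite linD -scaleN1r linZ scaleN1r. Qed.
Lemma lin_sum I (s : seq I) (F : I -> H) :
  T (\sum_(i <- s) F i) = \sum_(i <- s) T (F i).
Proof. by rewrite (big_morph T linD lin0). Qed.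
End Linear.
End Hilbert.

(** * Closed subspaces as Hilbert spaces *)

Record csubspace (R : realType) (H : hilbertType R) := CSubspace {
  cspace :> set H;
  cspace_subspace : subspace_of cspace;
  cspace_closed : closed cspace }.

(** The representation spaces arise as closed subspaces of [U], while each summand must be given a
    [hilbertType] of its own; this type carries the structure inherited from the ambient space. *)
Record subhilbert (R : realType) (H : hilbertType R) (V : csubspace H) :=
  SubHilbert { sv : H; svP : cspace V sv }.

Section SubHilbert.
Context {R : realType} {H : hilbertType R} {V : csubspace H}.
Notation W := (subhilbert V).
Implicit Types (x y z : W) (c : R[i]).

Lemma sv_inj : injective (@sv _ _ V).
Proof.
case=> [x Vx] [y Vy] /= xy; move: Vy; rewrite -xy => Vy.
by congr SubHilbert; exact: Prop_irrelevance.
Qed.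
Lemma svD_subproof x y : cspace V (sv x + sv y).
Proof. by apply: subspD; [exact: cspace_subspace|exact: svP..]. Qed.
Lemma svZ_subproof c x : cspace V (c *: sv x).
Proof. by apply: subspZ; [exact: cspace_subspace|exact: svP]. Qed.
Lemma svN_subproof x : cspace V (- sv x).
Proof. by rewrite -scaleN1r; exact: svZ_subproof. Qed.

Definition subh_add x y : W := SubHilbert (svD_subproof x y).
Definition subh_scale c x : W := SubHilbert (svZ_subproof c x).
Definition subh_opp x : W := SubHilbert (svN_subproof x).
Definition subh_0 : W := SubHilbert (cspace_subspace V).1.

HB.instance Definition _ := gen_eqMixin W.
HB.instance Definition _ := gen_choiceMixin W.
Lemma subh_addA : associative subh_add.
Proof. by move=> x y z; apply: sv_inj; rewrite /= addrA. Qed.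
Lemma subh_addC : commutative subh_add.
Proof. by move=> x y; apply: sv_inj; rewrite /= addrC. Qed.
Lemma subh_add0 : left_id subh_0 subh_add.
Proof. by move=> x; apply: sv_inj; rewrite /= add0r. Qed.
Lemma subh_addN : left_inverse subh_0 subh_opp subh_add.
Proof. by move=> x; apply: sv_inj; rewrite /= addNr. Qed.
HB.instance Definition _ := GRing.isZmodule.Build W subh_addA subh_addC subh_add0 subh_addN.
Lemma subh_scaleA c d x : subh_scale c (subh_scale d x) = subh_scale (c * d) x.
Proof. by apply: sv_inj; rewrite /= scalerA. Qed.
Lemma subh_scale1 : left_id 1 subh_scale.
Proof. by move=> x; apply: sv_inj; rewrite /= scale1r. Qed.
Lemma subh_scaleDr : right_distributive subh_scale +%R.
Proof. by move=> c x y; apply: sv_inj; rewrite /= scalerDr. Qed.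
Lemma subh_scaleDl x : {morph subh_scale^~ x : c d / c + d}.
Proof. by move=> c d; apply: sv_inj; rewrite /= scalerDl. Qed.
HB.instance Definition _ := GRing.Zmodule_isLmodule.Build R[i] W
  subh_scaleA subh_scale1 subh_scaleDr subh_scaleDl.

Lemma svD x y : sv (x + y) = sv x + sv y. Proof. by []. Qed.
Lemma svZ c x : sv (c *: x) = c *: sv x. Proof. by []. Qed.
Lemma svN x : sv (- x) = - sv x. Proof. by []. Qed.

Definition subh_norm x : R[i] := `|sv x|.
Lemma subh_normD x y : subh_norm (x + y) <= subh_norm x + subh_norm y.
Proof. exact: ler_normD. Qed.
Lemma subh_normZ c x : subh_norm (c *: x) = `|c| * subh_norm x.
Proof. exact: normrZ. Qed.
Lemma subh_norm_eq0 x : subh_norm x = 0 -> x = 0.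
Proof. by move=> /eqP; rewrite normr_eq0 => /eqP x0; apply: sv_inj. Qed.
HB.instance Definition _ := Lmodule_isNormed.Build R[i] W
  subh_normD subh_normZ subh_norm_eq0.

Lemma rn_sv x : rn (sv x) = rn x. Proof. by []. Qed.

Lemma subh_complete (F : set_system W) : ProperFilter F -> cauchy F -> cvg F.
Proof.
move=> FF Fc.
have : cvg (@sv _ _ V @ F).
  apply: cauchy_cvg; apply: cauchy_exP => e e0.
  have [x Fx] := (cauchyP F).1 Fc e e0; exists (sv x).
  by rewrite /fmap /=; apply: filterS Fx => y; rewrite -!ball_normE.
move=> /cvg_ex[l hl].
have Vl : cspace V l.
  apply: (cspace_closed (c := V)) => B /hl FB.
  by have [x Bx] := @filter_ex _ F _ _ FB; exists (sv x); split=> //; exact: svP.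
apply/cvg_ex; exists (SubHilbert Vl) => B /nbhs_ballP[e e0 hB].
have := hl _ (nbhsx_ballx l e e0); rewrite /fmap /=.
move=> FB; apply: (@filterS _ F _ (@sv _ _ V @^-1` ball l e)) FB => x.
by rewrite /= -ball_normE => h; apply: hB; rewrite -ball_normE.
Qed.
HB.instance Definition _ := Uniform_isComplete.Build W subh_complete.

Definition subh_inner x y : R[i] := dotp (sv x) (sv y).
Lemma subh_inner_bilinear : bilinear_for
  ( *%R : GRing.Scale.law R[i] R[i]) (Num.conj \; *%R : GRing.Scale.law _ _) subh_inner.
Proof.
split=> z c x y.
  by rewrite /subh_inner /= dotpDl dotpZl.
by rewrite /subh_inner /= dotpDr dotpZr.
Qed.
HB.instance Definition _ := bilinear_isBilinear.Build R[i] W W R[i] _ _ subh_inner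
  subh_inner_bilinear.
Lemma subh_hermitian x y : subh_inner x y = (-1) ^+ false * Num.conj (subh_inner y x).
Proof. by rewrite expr0 mul1r; exact: dotpC. Qed.
HB.instance Definition _ := isHermitianSesquilinear.Build R[i] W false _ subh_inner
  subh_hermitian.
Lemma subh_dot x : x != 0 -> 0 < subh_inner x x.
Proof.
move=> x0; rewrite /subh_inner dotpp ltcR exprn_gt0// lt_neqAle rn_ge0 andbT eq_sym.
by apply/eqP => h; move/eqP: x0; apply; apply: sv_inj; exact: rn_eq0.
Qed.
HB.instance Definition _ := isDotProduct.Build R[i] W subh_inner subh_dot.
Lemma subh_inner_norm x : `|x| ^+ 2 = subh_inner x x.
Proof. exact: inner_norm. Qed.
HB.instance Definition _ := isHilbert.Build R W subh_inner_norm.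

Lemma dotp_sv x y : dotp (sv x) (sv y) = dotp x y.
Proof. by []. Qed.
End SubHilbert.

(** * Compact operators *)

Section Compact.
Context {R : realType} {H : hilbertType R}.
Implicit Types (x y z w v : H) (c : R[i]) (r t e C : R) (S T : H -> H).

Lemma real_net e : 0 < e ->
  exists s : seq R, forall a, `|a| <= 1 -> exists2 y, y \in s & `|a - y| <= e.
Proof.
move=> e0; have [N hN] := invS_small e0.
have Ne := ltW (hN N (leqnn _)).
exists [seq k%:R / N.+1%:R - 1 | k <- iota 0 (2 * N.+1).+1] => a; rewrite ler_norml => /andP[a1 a2].
have n0 : (0 : R) < N.+1%:R by [].
have p0 : 0 <= (a + 1) * N.+1%:R by rewrite mulr_ge0// -lerBlDr sub0r.
have /andP[k1 k2] := truncn_itv p0.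
move: k1 k2; set k := Num.truncn _ => k1 k2.
exists (k%:R / N.+1%:R - 1).
  apply/mapP; exists k => //; rewrite mem_iota add0n ltnS /= -(ler_nat R) (le_trans k1)// natrM.
  by rewrite ler_pM2r// -lerBrDr (le_trans a2)// lerBrDr.
apply: le_trans Ne; move: k1 k2; rewrite -ler_pdivrMr// -(ltr_pdivlMr _ _ n0).
rewrite -(natr1 k) mulrDl mul1r; set m := N.+1%:R^-1; set q := k%:R * m => k1 k2.
by rewrite ler_norml; apply/andP; split; lra.
Qed.

Lemma disc_net e : 0 < e ->
  exists s : seq R[i], forall c, complex.Re `|c| <= 1 ->
    exists2 d, d \in s & complex.Re `|c - d| <= e.
Proof.
move=> e0; have [s hs] := real_net (divr_gt0 e0 (ltr0Sn _ 1)).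
exists [seq p +i* q | p <- s, q <- s] => c c1.
have [p sp hp] := hs _ (le_trans (cabs_Re c) c1).
have [q sq hq] := hs _ (le_trans (cabs_Im c) c1).
exists (p +i* q); first by apply: allpairs_f.
rewrite (le_trans (cabs_le _))// [leRHS](splitr e).
by apply: lerD; [move: hp|move: hq]; case: (c).
Qed.

Definition tot_bounded T : Prop := forall e, 0 < e ->
  exists s : seq H, forall x, rn x <= 1 -> exists2 y, y \in s & rn (T x - y) <= e.

Lemma tot_boundedD S T : tot_bounded S -> tot_bounded T ->
  tot_bounded (fun x => S x + T x).
Proof.
move=> tS tT e e0; have e2 := divr_gt0 e0 (ltr0Sn _ 1).
have [s hs] := tS _ e2; have [t ht] := tT _ e2.
exists [seq p + q | p <- s, q <- t] => x x1.
have [y sy hy] := hs x x1; have [z tz hz] := ht x x1.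
exists (y + z); first exact: allpairs_f.
by rewrite opprD addrACA (le_trans (rnD _ _))// [leRHS](splitr e) lerD.
Qed.
Lemma tot_bounded_compr S T C : (forall c x, T (c *: x) = c *: T x) -> 0 < C ->
  (forall x, rn (S x) <= C * rn x) -> tot_bounded T -> tot_bounded (T \o S).
Proof.
move=> TZ C0 hS tT e e0; have [s hs] := tT _ (divr_gt0 e0 C0).
exists [seq C%:C *: y | y <- s] => x x1.
have Cx : rn (C^-1%:C *: S x) <= 1.
  rewrite rnZr gtr0_norm ?invr_gt0// ler_pdivrMl// (le_trans (hS _))//.
  by rewrite ler_wpM2l// ltW.
have [y sy hy] := hs _ Cx; exists (C%:C *: y); first exact: map_f.
have -> : (T \o S) x = C%:C *: T (C^-1%:C *: S x).
  by rewrite TZ scalerA -CrM divff ?gt_eqF// Cr1 scale1r.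
by rewrite -scalerBr rnZr gtr0_norm// mulrC -ler_pdivlMr.
Qed.
Lemma tot_bounded_compl S T C : (forall x y, S (x - y) = S x - S y) -> 0 < C ->
  (forall x, rn (S x) <= C * rn x) -> tot_bounded T -> tot_bounded (S \o T).
Proof.
move=> SB C0 hS tT e e0; have [s hs] := tT _ (divr_gt0 e0 C0).
exists [seq S y | y <- s] => x x1; have [y sy hy] := hs x x1.
exists (S y); first exact: map_f.
by rewrite -SB (le_trans (hS _))// mulrC -ler_pdivlMr.
Qed.
Lemma tot_bounded_lim T : (forall e, 0 < e -> exists2 S, tot_bounded S &
  forall x, rn x <= 1 -> rn (T x - S x) <= e) -> tot_bounded T.
Proof.
move=> h e e0; have e2 := divr_gt0 e0 (ltr0Sn _ 1).
have [S tS hS] := h _ e2; have [s hs] := tS _ e2.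
exists s => x x1; have [y sy hy] := hs x x1; exists y => //.
have -> : T x - y = (T x - S x) + (S x - y) by rewrite addrA subrK.
by rewrite (le_trans (rnD _ _))// [leRHS](splitr e) lerD// hS.
Qed.
Lemma tot_bounded_rank1 v T : (forall x, exists c, T x = c *: v) ->
  (forall x, rn (T x) <= rn x) -> tot_bounded T.
Proof.
move=> Tv T1 e e0.
have [v0|v0] := eqVneq v 0.
  exists [:: 0] => x _; exists 0; first by rewrite inE.
  by have [c ->] := Tv x; rewrite v0 scaler0 subr0 rn0 ltW.
have n0 : 0 < rn v by rewrite lt_neqAle rn_ge0 andbT eq_sym; apply: contraNN v0 => /eqP/rn_eq0 ->.
have [s hs] := disc_net e0.
exists [seq c / (rn v)%:C *: v | c <- s] => x x1; have [c Tx] := Tv x.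
have := le_trans (T1 x) x1; rewrite Tx rnZ => cv.
have [|d sd hd] := hs (c * (rn v)%:C).
  by rewrite cabsM normcC (gtr0_norm n0).
exists (d / (rn v)%:C *: v); first by apply/mapP; exists d.
have vn0 : (rn v)%:C != 0 :> R[i] by rewrite -rnE normr_eq0.
rewrite -scalerBl rnZ.
have -> : c - d / (rn v)%:C = (c * (rn v)%:C - d) * (rn v)^-1%:C.
  by rewrite (fmorphV (real_complex R)) mulrBl mulfK.
by rewrite cabsM normcC (@gtr0_norm _ (rn v)^-1) ?invr_gt0// divfK ?gt_eqF.
Qed.

(** Compactness gives the finite nets directly. Conversely, a finite net puts, for every radius,
    some ball in a given ultrafilter on the closed image, so the ultrafilter is Cauchy and converges
    by completeness. *)
Lemma compact_opP T : compact_op T <-> bounded_op T /\ tot_bounded T.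
Proof.
split=> -[bT]; [rewrite compact_cover => cT|move=> tT]; split=> //.
  move=> e e0.
  have := cT H setT (fun y => ball y e%:C).
  case.
  - by move=> y _; exact: ball_open.
  - move=> x _; exists x => //; by apply: ballxx; rewrite ltcR.
  move=> D _ hD; exists (finmap.enum_fset D) => x x1.
  have /hD[y Dy xy] : closure (T @` [set x : H | `|x| <= 1]) (T x).
    by apply: subset_closure; exists x => //=; rewrite rnE lecR.
  exists y => //; move: xy; rewrite -ball_normE /= distrC -rn_lt => /ltW; exact.
rewrite compact_ultra => F FU FB.
set B := T @` _ in FB *.
have Fc : cauchy F.
  apply: cauchy_exP => e /lt0_ReE[eE e0].
  have [s hs] := tT _ (divr_gt0 e0 (ltr0Sn _ 2)).
  have : F [set x | exists2 y, y \in s & ball y e x].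
    apply: filterS FB => x /closure_rn/(_ _ (divr_gt0 e0 (ltr0Sn _ 2)))[_ [z /= z1 <-] xz].
    have [|y sy hy] := hs z; first by rewrite rn_le.
    exists y => //; rewrite -ball_normE /= eE -rn_lt rnB.
    have -> : x - y = (x - T z) + (T z - y) by rewrite addrA subrK.
    rewrite (le_lt_trans (rnD _ _))//; move: xz hy.
    by set a := rn (x - _); set b := rn (_ - y); lra.
  elim: s {hs} => [|y s IH] Fs.
    by have [x []] := filter_ex Fs.
  have [Fy|Fy] := in_ultra_setVsetC (ball y e) FU; first by exists y.
  apply: IH; apply: filterS (filterI Fs Fy) => x [[z]].
  by rewrite inE => /orP[/eqP ->|sz zx _]; [|exists z].
have : cvg F by exact: cauchy_cvg.
move=> /cvg_ex[l Fl].
exists l; split=> //; apply: closed_closure => A /Fl FA.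
by have [x []] := filter_ex (filterI FB FA); exists x.
Qed.

Definition rank_sum (s : seq (H * H)) x : H := \sum_(p <- s) dotp x p.1 *: p.2.

Lemma rank_sumD s x y c : rank_sum s (c *: x + y) = c *: rank_sum s x + rank_sum s y.
Proof.
rewrite /rank_sum scaler_sumr -big_split; apply: eq_bigr => p _.
by rewrite dotpDl dotpZl scalerDl scalerA.
Qed.

(* If F fixes s and z = y - F y, then 1 - F' = (1 - |z><z| / <z,z>)(1 - F)
   defines an F' fixing s and y. *)
Lemma finite_rank_fix (s : seq H) : exists f, (forall x, rn (x - rank_sum f x) <= rn x) /\
  forall y, y \in s -> rank_sum f y = y.
Proof.
elim: s => [|y s [f [f1 fs]]].
  by exists [::]; split=> // x; rewrite /rank_sum big_nil subr0.
pose z := y - rank_sum f y.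
have [z0|/eqP z0] := eqVneq z 0.
  exists f; split=> // w; rewrite inE => /orP[/eqP ->|/fs//].
  by apply/esym/subr0_eq.
have [a ha] : exists a, forall x, dotp (x - rank_sum f x) z = dotp x a.
  apply: (@riesz _ _ _ (rn z)) => [c u v|x].
    rewrite -dotpZl -dotpDl; congr (dotp _ z).
    by rewrite rank_sumD scalerBr opprD addrACA.
  by rewrite (le_trans (cauchy_schwarz _ _))// mulrC ler_wpM2l// rn_ge0.
have E x : x - rank_sum ((a, (dotp z z)^-1 *: z) :: f) x =
  (x - rank_sum f x) - (dotp (x - rank_sum f x) z / dotp z z) *: z.
  by rewrite /rank_sum big_cons -/(rank_sum f x) /= -ha scalerA opprD addrCA addrC.
exists ((a, (dotp z z)^-1 *: z) :: f); split=> [x|w ws].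
  rewrite E; apply: le_trans (f1 x); rewrite -(ler_pXn2r (isT : (0 < 2)%N)) ?nnegrE ?rn_ge0//.
  by rewrite rn_sub_proj// gerBl divr_ge0 ?sqr_ge0.
apply/esym/subr0_eq; rewrite E; move: ws; rewrite inE => /orP[/eqP ->|/fs ->].
  rewrite -/z divff ?scale1r ?subrr//; by apply/eqP => /dotpp_eq0.
by rewrite subrr dotp0l mul0r scale0r subr0.
Qed.

(** Take a finite net of the image and a finite rank [F] fixing it with [1 - F] contractive. Then
    [T x - F (T x)] equals [(1 - F)(T x - y)] for a net point [y] near [T x]. *)
Lemma compact_op_approx T : compact_op T -> forall e, 0 < e ->
  exists s, forall x, rn x <= 1 -> rn (T x - rank_sum s x) <= e.
Proof.
move=> /compact_opP[/bounded_opP[lT [C C0 hC]] tT] e e0.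
have [s hs] := tT _ e0; have [f [f1 fs]] := finite_rank_fix s.
have [g hg] : exists g, forall x, rank_sum f (T x) = rank_sum g x.
  elim: f {f1 fs} => [|[p q] f [g hg]]; first by exists [::] => x; rewrite /rank_sum !big_nil.
  have [a ha] : exists a, forall x, dotp (T x) p = dotp x a.
    apply: (@riesz _ _ _ (C * rn p)) => [c u v|x].
      by rewrite lT dotpDl dotpZl.
    by rewrite (le_trans (cauchy_schwarz _ _))// mulrAC ler_wpM2r// rn_ge0.
  by exists ((a, q) :: g) => x; rewrite /rank_sum !big_cons ha -/(rank_sum f _) hg.
exists g => x x1; rewrite -hg; have [y sy hy] := hs x x1.
have E : rank_sum f (T x - y) = rank_sum f (T x) - y.
  by rewrite addrC -scaleN1r rank_sumD fs// scaleN1r addrC.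
apply: le_trans hy; apply: le_trans (f1 _).
by rewrite E opprB addrA subrK.
Qed.
End Compact.

(** * The strong operator topology *)

Section StrongTopology.
Context {R : realType} {H : hilbertType R}.
Implicit Types (x y z w v : H) (c : R[i]) (r t e C : R) (S T : H -> H).

Lemma pointwise_finite (F : set_system (H -> H)) S (us : seq H) e : Filter F ->
  (forall u, (fun T => T u) @ F --> S u) -> 0 < e ->
  F [set T | forall u, u \in us -> rn (S u - T u) < e].
Proof.
move=> FF FS e0; elim: us => [|v us IH].
  by apply: filterS (@filterT _ F _) => T _ u; rewrite in_nil.
have /(_ _)h := FS v (ball (S v) e%:C).
have {h} : F [set T | ball (S v) e%:C (T v)].
  by apply: h; apply: nbhsx_ballx; rewrite ltcR.
move=> h; apply: filterS2 h IH => T /=; rewrite -ball_normE /= -rn_lt => h1 h2 u.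
by rewrite inE => /orP[/eqP->//|]; exact: h2.
Qed.

Lemma strong_closureP (E : set (H -> H)) S : strong_closure E S <->
  bounded_op S /\ forall (us : seq H) e, 0 < e ->
    exists2 T, E T & forall u, u \in us -> rn (S u - T u) < e.
Proof.
split=> -[bS hS]; split=> //.
  move=> us e e0.
  have FF : Filter (nbhs (S : {ptws H -> H})) by exact: nbhs_filter.
  have := pointwise_finite us FF (fun u => (pointwise_cvgP S FF).1 (@cvg_refl _ _) u) e0.
  by move=> /hS[T [ET hT]]; exists T.
pose G (p : seq H * R) := [set T | E T /\ forall u, u \in p.1 -> rn (S u - T u) < p.2].
pose F := filter_from [set p : seq H * R | 0 < p.2] G.
have FF : ProperFilter F.
  apply: filter_from_proper; last first.
    by move=> [us e] /= e0; have [T ET hT] := hS us e e0; exists T.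
  apply: filter_from_filter; first by exists ([::], 1) => /=.
  move=> [us e] [vs d] /= e0 d0; exists (us ++ vs, Num.min e d); first by rewrite /= lt_min e0.
  move=> T [/= ET hT]; split; split=> // u uu; apply: lt_le_trans (hT u _) _;
    by rewrite ?mem_cat ?uu ?orbT// ge_min lexx ?orbT.
have FS : {ptws, F --> S}.
  apply/pointwise_cvgP => v A /nbhs_ballP[e /lt0_ReE[eE e0] hA].
  exists ([:: v], complex.Re e) => //= T [_ /(_ v)].
  rewrite inE eqxx => /(_ isT) h; apply: hA; rewrite -ball_normE /= eE -rn_lt.
  exact: h.
move=> A /FS FA; have FE : F E by exists ([::], 1) => //= T [].
have [T [? ?]] := filter_ex (filterI FE FA); by exists T.
Qed.

Lemma strong_limP (I : Type) (le : I -> I -> Prop) (S : I -> H -> H) T :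
  directed le -> strong_lim le S T <->
  forall u e, 0 < e -> exists i, forall j, le i j -> rn (S j u - T u) < e.
Proof.
move=> [[i0] lexx ltr dir]; rewrite /strong_lim.
have FF : ProperFilter (tails le).
  apply: filter_from_proper; last by move=> i _; exists i; exact: lexx.
  apply: filter_from_filter; first by exists i0.
  move=> i j _ _; have [k [ik jk]] := dir i j; exists k => //= l kl; split; exact: ltr kl.
rewrite pointwise_cvgP; split=> h u.
  move=> e e0; have /(_ e%:C)hb := @nbhsx_ballx _ _ (T u).
  have := h u (ball (T u) e%:C); rewrite /fmap /= => /(_ _)[|i _ hi].
    by apply: hb; rewrite ltcR.
  by exists i => j /hi; rewrite -ball_normE /= rnB -rn_lt.
move=> A /nbhs_ballP[e /lt0_ReE[eE e0] hA].
have [i hi] := h u _ e0; exists i => //= j /hi hj; apply: hA.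
by rewrite -ball_normE /= eE -rn_lt rnB.
Qed.

Record orth_proj (V : set H) (q : H -> H) : Prop := OrthProj {
  op_lin : linear q;
  op_le1 : forall x, rn (q x) <= rn x;
  op_in : forall x, V (q x);
  op_id : forall x, V x -> q x = x;
  op_orth : forall x w, V w -> dotp (x - q x) w = 0 }.


Lemma orth_proj_ex (V : set H) : subspace_of V -> closed V -> exists q, orth_proj V q.
Proof.
move=> sV cV.
have /choice[q hq] : forall x, exists v, V v /\ forall w, V w -> dotp (x - v) w = 0.
  by move=> x; have [v Vv hv] := projection sV cV x; exists v.
have Vq x : V (q x) by have [] := hq x.
have oq x w : V w -> dotp (x - q x) w = 0 by have [_] := hq x; apply.
have uq x v : V v -> (forall w, V w -> dotp (x - v) w = 0) -> q x = v.
  move=> Vv hv; apply/subr0_eq/dotpp_eq0.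
  have Vd : V (q x - v) by apply: subspD => //; rewrite -scaleN1r; exact: subspZ.
  have -> : dotp (q x - v) (q x - v) = dotp (x - v) (q x - v) - dotp (x - q x) (q x - v).
    rewrite -dotpBl; congr (dotp _ _).
    by rewrite opprB [RHS]addrC addrA subrK.
  by rewrite hv// oq// subrr.
have n1 x : rn (q x) <= rn x.
  rewrite -(ler_pXn2r (isT : (0 < 2)%N)) ?nnegrE ?rn_ge0//.
  have -> : rn x ^+ 2 = rn (x - q x) ^+ 2 + rn (q x) ^+ 2.
    apply: Cr_inj; rewrite CrD -!dotpp.
    have E : dotp (x - q x) (q x) = 0 by exact: oq.
    have E' : dotp (q x) (x - q x) = 0 by rewrite dotpC E conjC0.
    move: E E'; set d := x - q x => E E'.
    have -> : dotp x x = dotp (d + q x) (d + q x) by rewrite subrK.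
    by rewrite (dotpDl d) !(dotpDr d) -/d E E' addr0 add0r.
  by rewrite lerDr sqr_ge0.
exists q; split=> //.
  move=> c x y; apply: uq; first by apply: sV.2.
  move=> w Vw; rewrite opprD addrACA -scalerBr dotpDl dotpZl !oq//.
  by rewrite mulr0 addr0.
by move=> x Vx; apply: uq => // w _; rewrite subrr dotp0l.
Qed.

Lemma orth_proj_idem V q : orth_proj V q -> q \o q = q.
Proof. by move=> hq; apply/funext => x; apply: (op_id hq); exact: (op_in hq). Qed.
Lemma orth_proj_sa V q : orth_proj V q -> adjoint_op q q.
Proof.
move=> hq x y.
have E : dotp (q x) (y - q y) = 0 by rewrite dotpC (op_orth hq) ?conjC0//; exact: (op_in hq).
have E' : dotp (x - q x) (q y) = 0 by apply: (op_orth hq); exact: (op_in hq).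
transitivity (dotp (q x) (q y)).
  by apply/eqP; rewrite -subr_eq0 -dotpBr E.
by apply/eqP; rewrite eq_sym -subr_eq0 -dotpBl E'.
Qed.
Lemma orth_proj_bounded V q : orth_proj V q -> bounded_op q.
Proof.
move=> hq; apply/bounded_opP; split; first exact: (op_lin hq).
by exists 1 => // x; rewrite mul1r; exact: (op_le1 hq).
Qed.
End StrongTopology.

(** * Range projections *)

Section Representation.
Context {R : realType} {A : cstarType R} {U : hilbertType R}.
Variable iota : A -> U -> U.
Hypothesis rep : representation iota.
Implicit Types (a b : A) (x y z : uni A) (u v w : U) (c : R[i]) (r t e C : R).

Lemma io_bounded a : bounded_op (iota a). Proof. by case: rep. Qed.
Lemma io_linear a : linear (iota a). Proof. by case: (io_bounded a). Qed.
Lemma io_lin c a b u : iota (c *: a + b) u = c *: iota a u + iota b u.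
Proof. by case: rep => _ h _ _; rewrite h. Qed.
Lemma ioM a b u : iota (amul a b) u = iota a (iota b u).
Proof. by case: rep => _ _ h _; rewrite h. Qed.
Lemma io_star a u v : dotp (iota a u) v = dotp u (iota (astar a) v).
Proof. by case: rep => _ _ _; apply. Qed.
Lemma io_star' a u v : dotp (iota (astar a) u) v = dotp u (iota a v).
Proof. by rewrite io_star astarK. Qed.
Lemma ioD a b u : iota (a + b) u = iota a u + iota b u.
Proof. by rewrite -{1}(scale1r a) io_lin scale1r. Qed.
Lemma io0 u : iota 0 u = 0.
Proof. by have := io_lin (-1) 0 0 u; rewrite scaler0 addr0 scaleN1r addNr. Qed.
Lemma ioZ c a u : iota (c *: a) u = c *: iota a u.
Proof. by rewrite -[c *: a]addr0 io_lin io0 addr0. Qed.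
Lemma ioB a b u : iota (a - b) u = iota a u - iota b u.
Proof. by rewrite ioD -scaleN1r ioZ scaleN1r. Qed.
Lemma io_sum I (s : seq I) (F : I -> A) u :
  iota (\sum_(i <- s) F i) u = \sum_(i <- s) iota (F i) u.
Proof. by rewrite (big_morph (iota^~ u) (fun a b => ioD a b u) (io0 u)). Qed.

Definition ext x u : U := usc x *: u + iota (uvec x) u.

Lemma ext_jn a u : ext (jn a) u = iota a u.
Proof. by rewrite /ext scale0r add0r. Qed.
Lemma ext1 u : ext 1 u = u.
Proof. by rewrite /ext scale1r io0 addr0. Qed.
Lemma ext_scal c u : ext c%:A u = c *: u.
Proof. by rewrite /ext /= mulr1 scaler0 io0 addr0. Qed.
Lemma extD x y u : ext (x + y) u = ext x u + ext y u.
Proof. by rewrite /ext /= scalerDl ioD addrACA. Qed.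
Lemma extZ c x u : ext (c *: x) u = c *: ext x u.
Proof. by rewrite /ext /= ioZ scalerDr scalerA. Qed.
Lemma extB x y u : ext (x - y) u = ext x u - ext y u.
Proof. by rewrite extD -scaleN1r extZ scaleN1r. Qed.
Lemma extM x y u : ext (x * y) u = ext x (ext y u).
Proof.
rewrite /ext /= !ioD !ioZ ioM (linD (io_linear _)) (linZ (io_linear _)).
rewrite scalerDr scalerA -!addrA; congr (_ + _).
Qed.
Lemma ext_linear x : linear (ext x).
Proof.
move=> c u v; rewrite /ext (io_linear _) !scalerDr !scalerA [_ * c]mulrC addrACA.
by rewrite -scalerA.
Qed.
Lemma ext_star x u v : dotp (ext x u) v = dotp u (ext (star x) v).
Proof. by rewrite /ext /= dotpDl dotpDr dotpZl dotpZr conjCK io_star. Qed.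

Lemma ext_Pos x u : Pos x -> 0 <= dotp (ext x u) u.
Proof.
move=> /Pos_sqrt[s [/Pos_sa ss <- _]].
by rewrite extM ext_star ss dotpp lecR sqr_ge0.
Qed.
Lemma ext_le x u : rn (ext x u) <= nm x * rn u.
Proof.
rewrite -(ler_pXn2r (isT : (0 < 2)%N)) ?nnegrE ?mulr_ge0 ?rn_ge0 ?nm_ge0//.
have h : Pos ((nm x ^+ 2)%:C%:A - star x * x).
  by apply: Pos_sub_nm; [apply: Pos_sa; exact: Pos_star|rewrite nmC].
have := ext_Pos u h; rewrite extB ext_scal extM dotpBl dotpZl [X in _ - X]ext_star starK.
by rewrite !dotpp -CrM -CrB lecR subr_ge0 exprMn.
Qed.
Lemma io_le a u : rn (iota a u) <= rn a * rn u.
Proof. by rewrite -ext_jn -jn_nm; exact: ext_le. Qed.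


Lemma positive_jn a : Pos (jn a) -> positive a.
Proof.
move=> /Pos_sqrt[s [/Pos_sa ss sE _]].
have s0 : usc s = 0.
  have /(congr1 (@usc _ _)) := sE; rewrite uscM => /eqP.
  by rewrite mulf_eq0 orbb => /eqP.
exists (uvec s); apply: jn_inj; rewrite jnM jn_star -usc_jn// ss.
by rewrite -sE.
Qed.

Lemma directed_nat : directed (fun m n : nat => (m <= n)%N).
Proof.
split=> //; first exact: (inhabits 0%N).
  by move=> i j k; exact: leq_trans.
by move=> i j; exists (maxn i j); rewrite leq_maxl leq_maxr.
Qed.

Lemma env_iota a : env_vN iota (iota a).
Proof.
apply/strong_closureP; split; first exact: io_bounded.
by move=> us e e0; exists (iota a); [exists a|move=> u _; rewrite subrr rn0].
Qed.

(* The spectral approximation 1 - (1 - a)^n increases to the range projection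
   of a. *)
Lemma range_projection a : positive a -> exists2 q, open_projection iota q &
  orth_proj (closure (range (iota a))) q.
Proof.
move=> [d aE].
(* Rescaling [d] changes neither the range of [iota a] nor the projection onto its closure; the
   bound keeps the powers of [1 - h] contractive. *)
wlog d1 : a d aE / rn d <= 1.
  move=> W; have n0 : 0 < rn d + 1 by rewrite ltr_wpDl// rn_ge0.
  pose k : R[i] := ((rn d + 1)^-1)%:C.
  have k0 : k != 0 by rewrite (inj_eq (@complexI R)) invr_eq0 gt_eqF.
  have kk : Num.conj k * k != 0 by rewrite mulf_neq0// fmorph_eq0.
  have [|q hq hV] := W _ (k *: d) erefl.
    rewrite rnZr gtr0_norm ?invr_gt0// ler_pdivrMl// mulr1 lerDl//.
  exists q => //; suff E : range (iota a) = range (iota (amul (astar (k *: d)) (k *: d))) by rewrite E.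
  rewrite astarZ amulZl amulZr -aE scalerA; apply/seteqP; split=> _ [u _ <-].
    exists ((Num.conj k * k)^-1 *: u) => //.
    by rewrite ioZ (linZ (io_linear _)) scalerA divff// scale1r.
  by exists ((Num.conj k * k) *: u) => //; rewrite ioZ (linZ (io_linear _)).
pose h := jn a.
have hE : h = star (jn d) * jn d by rewrite /h aE jnM jn_star.
have ph : Pos h by rewrite hE; exact: Pos_star.
have h1 : nm h <= 1.
  by rewrite hE nmC jn_nm expr_le1// rn_ge0.
have [p1 n1] := Pos_cst1 ph h1.
have nX i : nm ((1 - h) ^+ i) <= 1 by apply: nmX.
have hc i : h * (1 - h) ^+ i = (1 - h) ^+ i * h := comm_1BX h i.
pose V := closure (range (iota a)).
have sV : subspace_of V.
  split.
    by apply: subset_closure; exists 0 => //; rewrite (lin0 (io_linear _)).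
  move=> c v w /closure_rn hv /closure_rn hw; apply/closure_rn => e e0.
  have c0 : 0 < complex.Re `|c| + 1 by rewrite ltr_wpDl// cabs_ge0.
  have [_ [v' _ <-] h1'] := hv _ (divr_gt0 (divr_gt0 e0 (ltr0Sn _ 1)) c0).
  have [_ [w' _ <-] h2'] := hw _ (divr_gt0 e0 (ltr0Sn _ 1)).
  exists (iota a (c *: v' + w')); first by exists (c *: v' + w').
  rewrite (io_linear a) opprD addrACA -scalerBr (le_lt_trans (rnD _ _))// rnZ.
  move: h1'; rewrite ltr_pdivlMr//; set p := rn (v - _); set q := rn (w - _) in h2' *.
  have : 0 <= p by exact: rn_ge0.
  by have := cabs_ge0 c; set k := complex.Re `|c|; nra.
have cV : closed V by exact: closed_closure.
have [q hq] := orth_proj_ex sV cV; exists q => //.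
pose g n := 1 - (1 - h) ^+ n.
(* [1 - (1 - h)^n] is a polynomial in [h] without constant term, so it comes from an element [b n]
   of [A], as openness of [q] requires. *)
have g0 n : usc (g n) = 0.
  rewrite /g; elim: n => [|n IH]; first by rewrite expr0 subrr.
  have -> : 1 - (1 - h) ^+ n.+1 = (1 - (1 - h) ^+ n) + h * (1 - h) ^+ n.
    by rewrite exprS mulrBl mul1r opprB addrA addrAC.
  by rewrite -[LHS]/(usc _ + usc _) IH add0r uscM mul0r.
pose b n := uvec (g n).
have bE n : jn (b n) = g n by rewrite /b -usc_jn.
have aw w : (forall v, V v -> dotp w v = 0) -> iota a w = 0.
  move=> hw; apply: dotpp_eq0; rewrite io_star.
  have -> : astar a = a by rewrite aE astarM astarK.
  by apply: hw; apply: subset_closure; eexists.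
have extw w n : (forall v, V v -> dotp w v = 0) -> ext ((1 - h) ^+ n) w = w.
  move=> /aw hw; elim: n => [|n IH]; first by rewrite expr0 ext1.
  by rewrite exprS extM IH extB ext1 ext_jn hw subr0.
have pg i j : (i <= j)%N -> positive (b j - b i).
  move=> ij; apply: positive_jn.
  have -> : jn (b j - b i) = (1 - h) ^+ i * (1 - (1 - h) ^+ (j - i)).
    rewrite -scaleN1r jnD jnZ !bE scaleN1r /g opprB addrC addrA subrK.
    by rewrite mulrBr mulr1 -exprD subnKC.
  apply: PosM; first exact: PosX.
    by have [] := Pos_cst1 (PosX (j - i) p1) (nX _).
  by apply: commrB; [exact: commr1|rewrite /GRing.comm -!exprD addnC].
have bq : strong_lim (fun m n : nat => (m <= n)%N) (iota \o b) q.
  apply/(strong_limP (iota \o b) q directed_nat).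
  move=> u e e0; have e2 := divr_gt0 e0 (ltr0Sn _ 1).
  have [_ [v _ <-] hv] := (closure_rn _ _).1 (op_in hq u) _ e2.
  have v1 : 0 < rn v + 1 by rewrite ltr_wpDl// rn_ge0.
  have [N hN] := invS_small (divr_gt0 e2 v1).
  exists N => j Nj; rewrite /= -ext_jn bE.
  have -> : ext (g j) u - q u = - ext ((1 - h) ^+ j) (q u).
    have -> : ext (g j) u = ext (g j) (q u + (u - q u)) by rewrite addrC subrK.
    rewrite /g extB ext1 (linD (ext_linear _)) (extw (u - q u)).
      by rewrite opprD addrACA subrr addr0 addrAC subrr sub0r.
    by move=> w Vw; exact: (op_orth hq).
  rewrite rnN -[q u](subrK (iota a v)) (linD (ext_linear _)).
  rewrite (le_lt_trans (rnD _ _))// [ltRHS](splitr e) ltr_leD//.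
    by rewrite (le_lt_trans (ext_le _ _))// (le_lt_trans _ hv)// ler_piMl ?rn_ge0.
  rewrite -ext_jn -extM -hc (le_trans (ext_le _ _))//.
  have := decay j ph h1; have := hN j Nj; have := rn_ge0 v.
  rewrite ltr_pdivlMr//.
  have : 0 < j.+1%:R :> R by [].
  move: (nm_ge0 (h * (1 - h) ^+ j)); set p := nm _; set k := j.+1%:R => p0 k0 v0 h2 h3.
  have : p <= k^-1 by rewrite -(ler_pM2l k0) divff ?gt_eqF.
  move=> /(ler_wpM2r v0) h4; have m0 : 0 < k^-1 by rewrite invr_gt0.
  by move: h2 h4 m0; set m := k^-1; lra.
split.
- apply/strong_closureP; split; first exact: orth_proj_bounded hq.
  move=> us e e0; have hb := (strong_limP (iota \o b) q directed_nat).1 bq.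
  have [N hN] : exists N, forall u, u \in us -> rn (q u - iota (b N) u) < e.
    suff [N hN] : exists N, forall u, u \in us -> forall n, (N <= n)%N -> rn (q u - iota (b n) u) < e.
      by exists N => u uu; apply: hN.
    elim: us => [|u us [N hN]]; first by exists 0%N.
    have [M hM] := hb u e e0.
    exists (maxn N M) => v; rewrite inE => /orP[/eqP ->|vu] n; rewrite geq_max => /andP[? ?].
      by rewrite rnB; exact: hM.
    exact: hN.
  by exists (iota (b N)) => //; exists (b N).
- exact: orth_proj_idem hq.
- exact: orth_proj_sa hq.
- exists nat, (fun m n => (m <= n)%N), b; split=> //.
  + exact: directed_nat.
  + move=> i; have := pg 0%N i (leq0n i).
    have -> : b 0%N = 0 by rewrite /b /g expr0 subrr.
    by rewrite subr0.
Qed.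
End Representation.

(** * Local maps in the universal representation *)

Section Locality.
Context {R : realType} {A : cstarType R} {U : hilbertType R}.
Variable iota : A -> U -> U.
Hypothesis univ : universal iota.
Let rep : representation iota := univ.1.
Implicit Types (a b : A) (x y z : uni A) (u v w : U) (c : R[i]) (r t e C : R).

Lemma io_inj a : (forall u, iota a u = 0) -> a = 0.
Proof.
move=> a0; apply: contrapT => /state_separates[f sf /eqP]; apply.
have [_ [xi [h _ _ _]]] := univ.
by rewrite -h// (ioM rep) a0 (lin0 (io_linear rep _)) dotp0l.
Qed.

Lemma dotp_ext u v : (forall w, dotp u w = dotp v w) -> u = v.
Proof.
by move=> h; apply/subr0_eq/dotpp_eq0; rewrite dotpBl h subrr.
Qed.

Definition right_fixed (p : U -> U) : set A := [set a | forall u, iota a (p u) = iota a u].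

Section Projections.
Variable p : U -> U.
Hypothesis hp : open_projection iota p.

Lemma open_proj_linear : linear p.
Proof. by case: hp => /strong_closureP[[]]. Qed.
Lemma open_proj_idem u : p (p u) = p u.
Proof. by case: hp => _ pp _ _; rewrite -{3}pp. Qed.
Lemma open_proj_sa u v : dotp (p u) v = dotp u (p v).
Proof. by case: hp => _ _ + _; apply. Qed.
Lemma left_fixed a : (forall u, p (iota a u) = iota a u) <-> right_fixed p (astar a).
Proof.
split=> h u; apply: dotp_ext => w.
  by rewrite !(io_star' rep) open_proj_sa h.
by rewrite open_proj_sa !(io_star rep) h.
Qed.

(** The left ideal [A ∩ A** p] seen inside the unitization; the scalar part has to vanish. It
    supplies [L] for [p2] and [S] for [p1]. *)
Definition fixed_ideal : uni A -> Prop := fun x => usc x = 0 /\ right_fixed p (uvec x).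

Lemma fixed_left_ideal : left_ideal fixed_ideal.
Proof.
split.
- move=> x hx; have x0 : usc x = 0.
    apply/eqP; rewrite -normr_eq0 (ge0_ReE (normr_ge0 _)).
    rewrite (_ : complex.Re _ = 0)//; apply/le_anti; rewrite cabs_ge0 andbT.
    apply/ler_addgt0Pl => e /hx[y [y0 _] xy]; rewrite addr0.
    have -> : usc x = usc (x - y) by rewrite /= y0 subr0.
    exact: le_trans (usc_le _) (ltW xy).
  split=> // u; apply/subr0_eq/rn_small => e e0.
  have K0 : 0 < rn (p u) + rn u + 1 by have := rn_ge0 (p u); have := rn_ge0 u; lra.
  have [y [y0 yp] xy] := hx _ (divr_gt0 e0 K0).
  have E v : iota (uvec x) v = ext iota (x - y) v + iota (uvec y) v.
    by rewrite (extB rep) /ext x0 y0 !scale0r !add0r subrK.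
  rewrite !E yp opprD addrACA subrr addr0 (le_trans (rnD _ _))// rnN.
  have := ext_le rep (x - y) u; have := ext_le rep (x - y) (p u).
  move: xy; rewrite ltr_pdivlMr//; set m := nm _.
  by have := nm_ge0 (x - y); rewrite -/m; lra.
- by split=> // u; rewrite !(io0 rep).
- move=> x y [x0 hx] [y0 hy]; split; first by rewrite /= x0 y0 addr0.
  by move=> u; rewrite /= !(ioD rep) hx hy.
- move=> b x [x0 hx]; split; first by rewrite uscM x0 mulr0.
  by move=> u; rewrite /= x0 scale0r addr0 !(ioD rep) !(ioM rep) !(ioZ rep) hx.
Qed.
End Projections.

Variables p1 p2 : U -> U.
Hypotheses (hp1 : open_projection iota p1) (hp2 : open_projection iota p2).

Lemma XP a : X iota p1 p2 a <->
  (forall u, p1 (iota a u) = iota a u) /\ right_fixed p2 a.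
Proof.
split=> [[y _ aE]|[h1 h2]].
  by split=> u; rewrite aE /= open_proj_idem.
exists (iota a); first exact: env_iota.
by apply/funext => u /=; rewrite h2 h1.
Qed.
Lemma X1P a : X iota idfun p2 a <-> right_fixed p2 a.
Proof.
split=> [[y _ aE]|h2].
  by move=> u; rewrite aE /= open_proj_idem.
exists (iota a); first exact: env_iota.
by apply/funext => u /=; rewrite h2.
Qed.

Lemma XsP x : Xs (fixed_ideal p2) (fixed_ideal p1) x <->
  usc x = 0 /\ X iota p1 p2 (uvec x).
Proof.
rewrite XP left_fixed//; split=> [[[x0 h2] [_ h1]]|[x0 [h1 h2]]]; split=> //.
by split=> //=; rewrite x0 rmorph0.
Qed.

Variable T : A -> A.
Hypotheses (T_maps : forall x : A, X iota p1 p2 x -> X iota idfun p2 (T x))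
  (T_linear : linear_on (X iota p1 p2) T) (T_local : local iota p1 p2 T).

Lemma local_mul_eq0 a b : X iota p1 p2 a -> right_fixed p2 b ->
  right_fixed p2 (astar b) -> amul a b = 0 -> amul (T a) b = 0.
Proof.
move=> Xa hb hb' ab.
suff : amul (T a) (amul b (astar b)) = 0.
  move=> h; apply: jn_inj; apply: star_eq0'; rewrite -jn_star -jnM astarM.
  by rewrite amulA -[amul (amul _ b) _]amulA h amul0l.
set c := amul b (astar b); have pc : positive c by exists (astar b); rewrite astarK.
have [q oq hq] := range_projection rep pc.
have p2c u : p2 (iota c u) = iota c u.
  apply: (left_fixed hp2 c).2 => v; rewrite /c astarM astarK !(ioM rep); congr iota; exact: hb'.
have Vp u : closure (range (iota c)) u -> p2 u = u.
  have [_ [C C0 hC]] : linear p2 /\ exists2 C : R, 0 < C & forall v : U, rn (p2 v) <= C * rn v.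
    by apply/bounded_opP; case: hp2 => /strong_closureP[].
  move=> /closure_rn hu; apply/subr0_eq/rn_small => e e0.
  have C1 : 0 < C + 1 by lra.
  have [_ [v _ <-] uv] := hu _ (divr_gt0 e0 C1).
  have -> : p2 u - u = p2 (u - iota c v) - (u - iota c v).
    by rewrite (linB (open_proj_linear hp2)) p2c opprB addrA subrK.
  rewrite (le_trans (rnD _ _))// rnN; have := hC (u - iota c v).
  by move: uv; rewrite ltr_pdivlMr//; lra.
(* The projection [p2] is the identity on the closed range of [c], hence [q p2 = q], and the
   quadratic forms compare as the squares of the norms of [q (p2 u)] and [p2 u]. *)
have qp : op_le q p2.
  move=> u; have -> : p2 u = p2 (p2 u) by rewrite open_proj_idem.
  have -> : q u = q (q u) by rewrite -{1}(orth_proj_idem hq).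
  rewrite (orth_proj_sa hq) (open_proj_sa hp2) !dotpp lecR.
  have -> : q u = q (p2 u).
    apply: dotp_ext => w; rewrite !(orth_proj_sa hq) (open_proj_sa hp2) Vp//.
    exact: (op_in hq).
  by rewrite ler_pXn2r ?nnegrE ?rn_ge0//; exact: (op_le1 hq).
have zc : iota a \o q = cst 0.
  apply/funext => u /=; apply: rn_eq0; apply/le_anti; rewrite rn_ge0 andbT.
  apply/ler_addgt0Pl => e e0; rewrite addr0.
  have a1 : 0 < rn a + 1 by rewrite ltr_wpDl// rn_ge0.
  have [_ [v _ <-] uv] := (closure_rn _ _).1 (op_in hq u) _ (divr_gt0 e0 a1).
  have -> : iota a (q u) = iota a (q u - iota c v).
    rewrite (linB (io_linear rep a)) -(ioM rep) /c amulA ab amul0l (io0 rep) subr0//.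
  rewrite (le_trans (io_le rep _ _))//; move: uv; rewrite ltr_pdivlMr//.
  by have := rn_ge0 (q u - iota c v); set k := rn (_ - _); lra.
have := T_local oq qp Xa zc => h.
apply: io_inj => u; rewrite (ioM rep).
have -> : iota c u = q (iota c u).
  by rewrite (op_id hq)//; apply: subset_closure; exists u.
by have := congr1 (@^~ (iota c u)) h.
Qed.

Definition uni_map x : uni A := jn (T (uvec x)).

Lemma uni_local_map : local_map (fixed_ideal p2) (fixed_ideal p1) uni_map.
Proof.
split; [exact: fixed_left_ideal..| | |].
- move=> x Lx Sx; have [_ Xx] := (XsP x).1 (conj Lx Sx).
  by split=> //; apply/X1P/T_maps.
- move=> c x y Lx Sx Ly Sy; rewrite /uni_map -jnZ -jnD; congr jn.
  have [_ Xx] := (XsP x).1 (conj Lx Sx); have [_ Xy] := (XsP y).1 (conj Ly Sy).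
  exact: T_linear.
- move=> x b Lx Sx [b0 hb] [_ hb'] xb; have [x0 Xx] := (XsP x).1 (conj Lx Sx).
  rewrite /uni_map (usc_jn b0) -jnM (local_mul_eq0 Xx)// ?jn0//.
  by apply: jn_inj; rewrite jnM -!usc_jn.
Qed.

End Locality.

(** * Orthogonal ideals *)

Section Ideals.
Context {R : realType} {A : cstarType R}.
Implicit Types (a b x y : A) (c : R[i]) (d : uni A) (r t e C : R) (I J E : set A).

Lemma cid0 I : closed_ideal I -> I 0. Proof. by case=> [[]]. Qed.
Lemma cid_lin I c x y : closed_ideal I -> I x -> I y -> I (c *: x + y).
Proof. by case=> [[_ h] _ _]; exact: h. Qed.
Lemma cidZ I c x : closed_ideal I -> I x -> I (c *: x).
Proof. by move=> iI Ix; rewrite -[_ *: _]addr0; apply: cid_lin => //; exact: cid0. Qed.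
Lemma cidD I x y : closed_ideal I -> I x -> I y -> I (x + y).
Proof. by move=> iI Ix Iy; rewrite -(scale1r x); exact: cid_lin. Qed.
Lemma cidB I x y : closed_ideal I -> I x -> I y -> I (x - y).
Proof. by move=> iI Ix Iy; rewrite addrC -scaleN1r; exact: cid_lin. Qed.
Lemma cidl I a x : closed_ideal I -> I x -> I (amul a x).
Proof. by case=> _ _ h Ix; case: (h a x Ix). Qed.
Lemma cidr I a x : closed_ideal I -> I x -> I (amul x a).
Proof. by case=> _ _ h Ix; case: (h a x Ix). Qed.
Lemma cid_sum I (T : Type) (s : seq T) (F : T -> A) : closed_ideal I ->
  (forall i, I (F i)) -> I (\sum_(i <- s) F i).
Proof.
move=> iI IF; elim: s => [|i s IH]; first by rewrite big_nil; exact: cid0.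
by rewrite big_cons; apply: cidD.
Qed.
Lemma cid_closed I x : closed_ideal I ->
  (forall e, 0 < e -> exists2 y, I y & rn (x - y) < e) -> I x.
Proof. by case=> _ /closed_rn h _; exact: h. Qed.

Lemma ideal_gen_ideal E : closed_ideal (ideal_gen E).
Proof.
split.
- split=> [J [iJ _]|c x y hx hy J JE]; first exact: cid0.
  by apply: cid_lin; [case: JE|exact: hx|exact: hy].
- apply/closed_rn => x h J JE; apply: cid_closed; first by case: JE.
  by move=> e /h[y hy xy]; exists y => //; exact: hy.
- by move=> a x hx; split=> J JE; [apply: cidl|apply: cidr]; [case: JE|exact: hx|case: JE|exact: hx].
Qed.
Lemma ideal_gen_sub E x : E x -> ideal_gen E x.
Proof. by move=> Ex J [_]; apply. Qed.
Lemma ideal_gen_min E J : closed_ideal J -> E `<=` J -> ideal_gen E `<=` J.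
Proof. by move=> iJ EJ x; apply. Qed.

Lemma rn_star x : rn (astar x) = rn x.
Proof. by rewrite -!jn_nm jn_star nm_star. Qed.
Lemma astarB x y : astar (x - y) = astar x - astar y.
Proof. by rewrite -[- y]scaleN1r astarD astarZ rmorphN1 scaleN1r. Qed.
Lemma astar_eq0 x : amul (astar x) x = 0 -> x = 0.
Proof. by move=> h; apply: jn_inj; apply: star_eq0; rewrite -jn_star -jnM h. Qed.
Lemma astar_eq0' x : amul x (astar x) = 0 -> x = 0.
Proof. by move=> h; apply: jn_inj; apply: star_eq0'; rewrite -jn_star -jnM h. Qed.

Lemma ideal_gen_star E x : (forall a, E a -> E (astar a)) ->
  ideal_gen E x -> ideal_gen E (astar x).
Proof.
move=> Es; apply: (ideal_gen_min (J := [set x | ideal_gen E (astar x)])); last first.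
  by move=> a /Es; exact: ideal_gen_sub.
have iE := ideal_gen_ideal E; split.
- split=> [|c a b ha hb] /=; first by rewrite astar0; exact: (cid0 iE).
  by rewrite astarD astarZ; exact: (cid_lin _ iE).
- apply/closed_rn => a ha /=; apply: (cid_closed iE) => e /ha[b hb ab].
  by exists (astar b) => //; rewrite -astarB rn_star.
- by move=> a b hb /=; rewrite !astarM; split; [exact: (cidr _ iE)|exact: (cidl _ iE)].
Qed.

(** The middle factor ranges over the unitization, so the relation includes [x y = 0] and, for fixed
    [x], defines a closed two-sided ideal. Orthogonality of generators thus passes to the generated
    ideals. *)
Definition disjoint_from x y := forall d, jn x * d * jn y = 0.

Lemma act_jn d x : jn (act d x) = d * jn x.
Proof. by apply: uniE; rewrite /act /= ?mulr0// scale0r addr0. Qed.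

Lemma disjoint_ideal x : closed_ideal (disjoint_from x).
Proof.
split.
- split=> [d|c a b ha hb d]; first by rewrite jn0 mulr0.
  by rewrite jnD jnZ mulrDr -scalerAr ha hb scaler0 addr0.
- apply/closed_rn => y hy d; apply: nm_small => e e0.
  have K0 : 0 < nm (jn x * d) + 1 by rewrite ltr_wpDl// nm_ge0.
  have [z hz yz] := hy _ (divr_gt0 e0 K0).
  have -> : jn x * d * jn y = jn x * d * jn (y - z).
    by rewrite -scaleN1r jnD jnZ mulrDr -scalerAr hz scaler0 addr0.
  rewrite (le_trans (nmM _ _))// jn_nm; move: yz; rewrite ltr_pdivlMr//.
  by have := rn_ge0 (y - z); set p := rn _; set q := nm _; lra.
- move=> a y hy; split=> d; rewrite jnM !mulrA; last by rewrite hy mul0r.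
  by rewrite -[_ * d * _]mulrA hy.
Qed.
Lemma disjoint_star x y : disjoint_from x y -> disjoint_from (astar y) (astar x).
Proof.
move=> h d; rewrite !jn_star -[RHS](@star0 _ (uni A)) -(h (star d)) !starM starK.
by rewrite mulrA.
Qed.

Lemma disjoint_ideals E F : (forall a, E a -> E (astar a)) ->
  (forall a, F a -> F (astar a)) ->
  (forall a b, E a -> F b -> disjoint_from a b) ->
  forall a b, ideal_gen E a -> ideal_gen F b -> disjoint_from a b.
Proof.
move=> Es Fs EF a b Ea Fb.
have h1 x y : E x -> ideal_gen F y -> disjoint_from x y.
  move=> Ex; apply: ideal_gen_min; first exact: disjoint_ideal.
  by move=> z; exact: EF.
have h2 x : ideal_gen E x -> disjoint_from (astar b) x.
  apply: ideal_gen_min; first exact: disjoint_ideal.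
  move=> z Ez; rewrite -[z]astarK; apply: disjoint_star; apply: h1 => //; exact: Es.
rewrite -[a]astarK -[b]astarK; apply: disjoint_star; apply: h2.
exact: ideal_gen_star.
Qed.
Lemma disjoint_amul a b : disjoint_from a b -> amul a b = 0.
Proof. by move=> h; apply: jn_inj; rewrite jnM -[jn a]mulr1. Qed.

(** * Finite sums of orthogonal ideals *)

Section OrthogonalSum.
Variables (m : nat) (I_ : 'I_m -> set A).
Hypotheses (iI : forall i, closed_ideal (I_ i))
  (orth : forall i j a b, i != j -> I_ i a -> I_ j b -> amul a (astar b) = 0).

Definition sumset (S_ : 'I_m -> set A) : set A :=
  [set \sum_(i < m) x i | x in [set x : 'I_m -> A | forall i, S_ i (x i)]].

(** Orthogonality gives [x_i * star s = x_i * star x_i] for the sum [s], so the square of the norm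
    of [x_i] is at most the product of the two norms. Closedness of the sum and uniqueness of
    components both rest on this. *)
Lemma rn_component (x : 'I_m -> A) i : (forall j, I_ j (x j)) ->
  rn (x i) <= rn (\sum_(j < m) x j).
Proof.
move=> Ix; set s := \sum_(j < m) _.
have E : amul (x i) (astar s) = amul (x i) (astar (x i)).
  rewrite (big_morph (fun y => amul (x i) (astar y)) (id1 := 0) (op1 := +%R))//; first last.
  - by rewrite astar0 amul0r.
  - by move=> a b; rewrite astarD amulDr.
  rewrite (bigD1 i)//= big1 ?addr0// => j ji.
  by apply: (@orth i j) => //; rewrite eq_sym.
have := rn_ge0 (x i); rewrite le_eqVlt => /orP[/eqP <-|x0]; first exact: rn_ge0.
rewrite -(ler_pM2l x0) -expr2 -{1}(rn_star (x i)) -rn_cstar astarK -E.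
by rewrite (le_trans (rn_amul _ _))// rn_star.
Qed.

Lemma sumset_ideal : closed_ideal (sumset I_).
Proof.
split.
- split=> [|c _ _ [x Ix <-] [y Iy <-]].
    by exists (fun=> 0); [move=> i; exact: cid0|rewrite big1].
  exists (fun i => c *: x i + y i); first by move=> i; apply: cid_lin.
  by rewrite big_split /= scaler_sumr.
- apply/closed_rn => y hy.
  have /choice[u hu] : forall n : nat, exists x : 'I_m -> A, (forall i, I_ i (x i)) /\
      rn (y - \sum_(i < m) x i) < n.+1%:R^-1.
    by move=> n; have [|_ [x Ix <-] yx] := hy n.+1%:R^-1; [|exists x].
  have hd e : 0 < e -> exists N, forall p q, (N <= p)%N -> (N <= q)%N ->
      forall i, rn (u p i - u q i) < e.
    move=> e0; have [N hN] := invS_small (divr_gt0 e0 (ltr0Sn _ 1)).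
    exists N => p q Np Nq i; have [Ip hp] := hu p; have [Iq hq] := hu q.
    apply: le_lt_trans (_ : rn (\sum_(j < m) (u p j - u q j)) < _).
      by apply: (rn_component (x := fun j => u p j - u q j)) => j; apply: cidB.
    rewrite sumrB -(subrK y (\sum_(i < m) u p i)) -addrA.
    rewrite (le_lt_trans (rnD _ _))// [ltRHS](splitr e) rnB ltrD//.
      exact: lt_trans hp (hN _ Np).
    exact: lt_trans hq (hN _ Nq).
  have /choice[l hl] : forall i, exists l, rlim (fun n => u n i) l.
    move=> i; apply: rn_complete => e /hd[N hN]; exists N => p q Np Nq; exact: hN.
  exists l; first move=> i.
    apply: cid_closed => // e e0; have [N hN] := hl i e e0.
    by exists (u N i); [have [] := hu N|rewrite rnB hN].
  apply/subr0_eq/rn_small => e e0.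
  have [N hN] := invS_small (divr_gt0 e0 (ltr0Sn _ 1)).
  have m1 : (0 : R) < m%:R + 1 by rewrite ltr_wpDl.
  have /choice[M hM] : forall i, exists M, forall n, (M <= n)%N -> rn (u n i - l i) < e / 2 / (m%:R + 1).
    by move=> i; apply: hl; rewrite !divr_gt0.
  pose n := maxn N (\max_(i < m) M i); have [_ hn] := hu n.
  rewrite rnB -(subrK (\sum_(i < m) u n i) y) -addrA (le_trans (rnD _ _))// [leRHS](splitr e).
  rewrite lerD//; first by rewrite ltW// (lt_trans hn)// hN// leq_maxl.
  rewrite -sumrB.
  have : rn (\sum_(i < m) (u n i - l i)) <= \sum_(i < m) (e / 2 / (m%:R + 1)).
    elim/big_rec2: _ => [|i p q _ pq]; first by rewrite rn0.
    rewrite (le_trans (rnD _ _))// lerD// ltW// hM// leq_max.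
    by rewrite (leq_bigmax i) orbT.
  move=> h; apply: le_trans h _; rewrite sumr_const card_ord -[leLHS]mulr_natr.
  rewrite -mulrA ler_piMr ?divr_ge0 ?ltW// [ltLHS]mulrC ltr_pdivrMr// mul1r ltrDl//.
- move=> a _ [x Ix <-]; split.
    exists (fun i => amul a (x i)); first by move=> i; apply: cidl.
    by rewrite (big_morph (amul a) (fun x y => amulDr a x y) (amul0r a)).
  exists (fun i => amul (x i) a); first by move=> i; apply: cidr.
  by rewrite (big_morph (amul^~ a) (fun x y => amulDl x y a) (amul0l a)).
Qed.
End OrthogonalSum.
End Ideals.

(** * Minimal projections *)

Section MinimalProjection.
Context {R : realType} {A : cstarType R} {U : hilbertType R}.
Variable iota : A -> U -> U.
Hypothesis univ : universal iota.
Let rep : representation iota := univ.1.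
Variable e : A.
Hypotheses (se : astar e = e) (ee : amul e e = e) (e0 : e <> 0)
  (me : forall a, exists c, amul (amul e a) e = c *: e).
Implicit Types (a b c d : A) (u v w : U) (l : R[i]) (r t C N : R).

(** The coordinate on the one-dimensional corner [e A e], which is the state attached to the minimal
    projection. *)
Definition corner a : R[i] := sval (cid (me a)).
Lemma cornerE a : amul (amul e a) e = corner a *: e.
Proof. by rewrite /corner; case: cid. Qed.
Lemma corner_uniq a l : amul (amul e a) e = l *: e -> corner a = l.
Proof.
rewrite cornerE => /eqP; rewrite -subr_eq0 -scalerBl scaler_eq0 subr_eq0.
by case/orP => [/eqP//|/eqP].
Qed.
Lemma jn_proj : proj (jn e).
Proof. by split; rewrite /sa -?jn_star -?jnM ?se ?ee. Qed.
Lemma jn_neq0 : jn e <> 0.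
Proof. by move=> h; apply: e0; apply: jn_inj. Qed.
Lemma rn_proj : rn e = 1.
Proof. by rewrite -jn_nm; apply: nm_proj jn_proj jn_neq0. Qed.
Lemma corner_col c : amul c e = c -> amul (astar c) c = corner (amul (astar c) c) *: e.
Proof.
move=> ce; rewrite -cornerE; move: (congr1 (@astar _ _) ce); rewrite astarM se => ec.
by rewrite amulA ec -amulA ce.
Qed.
Lemma corner_sqr a : corner (amul (astar a) a) = (rn (amul a e) ^+ 2)%:C.
Proof.
have E : jn (astar (amul a e)) * star (jn (astar (amul a e))) =
    corner (amul (astar a) a) *: jn e.
  by rewrite -jn_star astarK -jnM astarM se -jnZ -cornerE !amulA.
by rewrite (proj_scalar jn_proj jn_neq0 E) jn_nm rn_star.
Qed.

Lemma corner_state : state corner.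
Proof.
split.
- move=> l a b; apply: corner_uniq.
  by rewrite amulDr amulZr amulDl amulZl !cornerE scalerA scalerDl.
- by move=> a; rewrite corner_sqr lecR sqr_ge0.
- move=> a; rewrite rnE (ge0_ReE (normr_ge0 (corner a))) lecR.
  have <- : rn (corner a *: e) = complex.Re `|corner a| by rewrite rnZ rn_proj mulr1.
  rewrite -cornerE (le_trans (rn_amul _ _))// rn_proj mulr1.
  by rewrite (le_trans (rn_amul _ _))// rn_proj mul1r.
- move=> r r1; exists e; first by rewrite rnE rn_proj.
  by rewrite (@corner_uniq e 1) ?normr1// ee ee scale1r.
Qed.

(** The universal representation implements every state by a vector; applying [e] moves this vector
    into the range of [e] without changing the functional. *)
Lemma corner_vector : exists h, iota e h = h /\ forall a, dotp (iota a h) h = corner a.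
Proof.
have [_ [xi [hxi _ _ _]]] := univ; set x := xi corner.
exists (iota e x); split; first by rewrite -(ioM rep) ee.
move=> a; rewrite -(io_star' rep) se -!(ioM rep) (hxi _ corner_state).
apply: corner_uniq; rewrite amulA.
by rewrite !amulA ee -[amul _ e in LHS]amulA ee cornerE.
Qed.

Variable h : U.
Hypotheses (eh : iota e h = h) (hh : forall a, dotp (iota a h) h = corner a).

Lemma dotp_col a b : dotp (iota a h) (iota b h) = corner (amul (astar b) a).
Proof. by rewrite -hh (ioM rep) -(io_star' rep). Qed.
Lemma rn_col c : rn (iota c h) = rn (amul c e).
Proof.
apply/eqP; rewrite -(eqrXn2 (isT : (0 < 2)%N)) ?rn_ge0//; apply/eqP/Cr_inj.
by rewrite -dotpp dotp_col corner_sqr.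
Qed.
Lemma io_col c : iota c h = iota (amul c e) h.
Proof. by rewrite (ioM rep) eh. Qed.

Definition orbit : set U := range (iota^~ h).

Lemma orbit_subspace : subspace_of orbit.
Proof.
split; first by exists 0 => //; exact: io0.
by move=> l _ _ [a _ <-] [b _ <-]; exists (l *: a + b) => //; exact: io_lin.
Qed.
(** On columns [c = c e] the map sending [c] to [iota c h] is isometric by [rn_col], so the
    completeness of [A] makes the orbit itself complete. *)
Lemma orbit_closed : closed orbit.
Proof.
apply/closed_rn => v hv.
have /choice[u hu] : forall n : nat, exists c, amul c e = c /\ rn (v - iota c h) < n.+1%:R^-1.
  move=> n; have [|_ [c _ <-] vc] := hv n.+1%:R^-1; first by [].
  by exists (amul c e); rewrite -amulA ee -io_col.
have [|c uc] := @rn_complete _ A u.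
  move=> t t0; have [N hN] := invS_small (divr_gt0 t0 (ltr0Sn _ 1)).
  exists N => p q Np Nq; have [ep hp] := hu p; have [eq hq] := hu q.
  have -> : rn (u p - u q) = rn (iota (u p - u q) h).
    by rewrite rn_col -scaleN1r amulDl amulZl ep eq.
  rewrite (ioB rep) -(subrK v (iota (u p) h)) -addrA.
  rewrite (le_lt_trans (rnD _ _))// [ltRHS](splitr t) rnB ltrD//.
    exact: lt_trans hp (hN _ Np).
  exact: lt_trans hq (hN _ Nq).
exists c => //; apply/esym/subr0_eq/rn_small => t t0.
have [N hN] := invS_small (divr_gt0 t0 (ltr0Sn _ 1)).
have h1 : 0 < 2 * (rn h + 1) by rewrite mulr_gt0// ltr_wpDl// rn_ge0.
have [M hM] := uc _ (divr_gt0 t0 h1).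
pose n := maxn N M; have [_ hn] := hu n.
have -> : v - iota c h = (v - iota (u n) h) + iota (u n - c) h.
  by rewrite (ioB rep) addrA subrK.
rewrite (le_trans (rnD _ _))// [leRHS](splitr t) lerD//.
  by rewrite ltW// (lt_trans hn)// hN// leq_maxl.
rewrite (le_trans (io_le rep _ _))//; have := hM n (leq_maxr _ _).
rewrite ltr_pdivlMr//; set p := rn (_ - _); have := rn_ge0 h.
have : 0 <= p by exact: rn_ge0.
by lra.
Qed.
Definition col_space : csubspace U := CSubspace orbit_subspace orbit_closed.
Notation H := (subhilbert col_space).

Definition invariant (S : U -> U) := forall v, orbit v -> orbit (S v).
(** The value [0] is a default for vectors whose image leaves the orbit; elements of [env_vN] leave
    the orbit invariant, so it never occurs for them. *)
Definition restr (S : U -> U) (x : H) : H :=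
  if pselect (cspace col_space (S (sv x))) is left p then SubHilbert p else 0.
Lemma sv_restr S x : invariant S -> sv (restr S x) = S (sv x).
Proof.
move=> iS; rewrite /restr; case: pselect => // hx.
by case: hx; apply: iS; exact: (svP x).
Qed.
Lemma io_invariant a : invariant (iota a).
Proof. by move=> _ [b _ <-]; exists (amul a b) => //; rewrite (ioM rep). Qed.
Lemma env_invariant S : env_vN iota S -> invariant S.
Proof.
move=> /strong_closureP[bS hS] v Vv; apply: (closed_rn _).1 orbit_closed _ _ => t t0.
have [_ [a _ <-] ha] := hS [:: v] t t0.
exists (iota a v); first exact: io_invariant.
by apply: ha; rewrite inE.
Qed.

Lemma restr_bounded S : invariant S -> bounded_op S -> bounded_op (restr S).
Proof.
move=> iS /bounded_opP[lS [C C0 hC]]; apply/bounded_opP; split.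
  by move=> l x y; apply: sv_inj; rewrite svD svZ !sv_restr// svD svZ lS.
by exists C => // x; rewrite -!rn_sv sv_restr.
Qed.

(** Restriction to an invariant subspace respects the algebraic operations, and strong convergence,
    being tested vector by vector, passes to the subspace. *)
Lemma restr_normal : normal_extension iota (restr \o iota) restr.
Proof.
have eI := env_invariant; split=> //; split.
- by move=> S ES; apply: restr_bounded; [exact: eI|case: ES].
- move=> l S T /eI iS /eI iT; apply/funext => x; apply: sv_inj.
  have -> : (l *: restr S + restr T) x = l *: restr S x + restr T x by [].
  rewrite svD svZ !sv_restr//.
  by move=> v Vv; apply: orbit_subspace.2; [exact: iS|exact: iT].
- move=> S T /eI iS /eI iT; apply/funext => x; apply: sv_inj => /=.
  by rewrite !sv_restr// => v Vv; apply: iS; exact: iT.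
- by move=> S T /eI iS /eI iT ST x y; rewrite -!dotp_sv !sv_restr.
- move=> I le S T dir ES _ _ ET /(strong_limP _ _ dir) h1.
  apply/(strong_limP _ _ dir) => x t /(h1 (sv x))[i hi]; exists i => j /hi.
  by rewrite -rn_sv svD svN /= !sv_restr//; exact: eI.
Qed.

Notation pi := (restr \o iota).
Lemma sv_pi a x : sv (pi a x) = iota a (sv x).
Proof. by rewrite /= sv_restr//; exact: io_invariant. Qed.

Lemma pi_rep : representation pi.
Proof.
split.
- by move=> a; apply: restr_bounded; [exact: io_invariant|exact: io_bounded].
- move=> l a b; apply/funext => x; apply: sv_inj.
  have -> : (l *: pi a + pi b) x = l *: pi a x + pi b x by [].
  by rewrite svD svZ !sv_pi (io_lin rep).
- by move=> a b; apply/funext => x; apply: sv_inj; rewrite /= !sv_pi (ioM rep).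
- by move=> a x y; rewrite -!dotp_sv !sv_pi (io_star rep).
Qed.

Lemma orbit_h : orbit h. Proof. by exists e. Qed.
Definition cyc : H := @SubHilbert _ _ col_space h orbit_h.

Lemma pi_e x : pi e x = dotp x cyc *: cyc.
Proof.
apply: sv_inj; rewrite sv_pi svZ -dotp_sv /=; have [a _ <-] := svP x.
rewrite hh io_col -(ioM rep) amulA cornerE (ioZ rep) eh//.
Qed.
Lemma dotp_cyc : dotp cyc cyc = 1.
Proof. by rewrite -dotp_sv /= -{1}eh hh (@corner_uniq e 1)// ee ee scale1r. Qed.

(** [pi e] is the rank one projection onto [cyc]. A nonzero invariant subspace contains a vector not
    orthogonal to [cyc], hence [cyc] itself, whose orbit is the whole space. *)
Lemma pi_irr : irreducible pi.
Proof.
split; first exact: pi_rep.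
  exists cyc; apply/eqP => h0; have := dotp_cyc; rewrite h0 dotp0l => /eqP.
  by rewrite eq_sym oner_eq0.
move=> V sV cV iV; have [[x [Vx x0]]|hV] := pselect (exists x, V x /\ x <> 0); last first.
  left; apply/seteqP; split=> [x Vx|_ ->]; last exact: sV.1.
  by apply: contrapT => x0; apply: hV; exists x.
right; apply/seteqP; split=> // y _.
have [a ha] : exists a, dotp (pi a x) cyc <> 0.
  apply: contrapT => no; apply: x0; apply: sv_inj; apply: dotpp_eq0.
  have [a _ aE] := svP x; rewrite -{2}aE -(io_star' rep) -sv_pi.
  apply: contrapT => h0; apply: no; exists (astar a); by rewrite -dotp_sv.
have Vh : V cyc.
  have -> : cyc = (dotp (pi a x) cyc)^-1 *: pi e (pi a x).
    by rewrite pi_e scalerA mulVf ?scale1r//; apply/eqP.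
  by apply: subspZ => //; exact/(iV e)/(iV a).
have [b _ bE] := svP y; have -> : y = pi b cyc by apply: sv_inj; rewrite sv_pi.
exact: (iV b).
Qed.
Lemma pi_D a b x : pi (a + b) x = pi a x + pi b x.
Proof. by apply: sv_inj; rewrite svD !sv_pi (ioD rep). Qed.
Lemma pi_Z l a x : pi (l *: a) x = l *: pi a x.
Proof. by apply: sv_inj; rewrite svZ !sv_pi (ioZ rep). Qed.
Lemma pi_B a b x : pi (a - b) x = pi a x - pi b x.
Proof. by apply: sv_inj; rewrite svD svN !sv_pi (ioB rep). Qed.
Lemma pi_M a b x : pi (amul a b) x = pi a (pi b x).
Proof. by apply: sv_inj; rewrite !sv_pi (ioM rep). Qed.
Lemma pi_le a x : rn (pi a x) <= rn a * rn x.
Proof. by rewrite -!rn_sv sv_pi; exact: io_le. Qed.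
Lemma pi_linear a : linear (pi a).
Proof. by case: (restr_bounded (@io_invariant a) (io_bounded rep a)). Qed.

Notation J := (ideal_gen [set e]).

(** The elements represented by totally bounded operators form a closed ideal, and it contains [e]
    because [pi e] has rank one. *)
Lemma pi_compact a : J a -> compact_op (pi a).
Proof.
have bp b : bounded_op (pi b) by case: pi_rep.
suff : J `<=` [set a | tot_bounded (pi a)].
  by move=> sJ Ja; apply/compact_opP; split; [exact: bp|exact: sJ].
apply: ideal_gen_min; last first.
  move=> _ ->; apply: (tot_bounded_rank1 (v := cyc)) => x; first by exists (dotp x cyc); exact: pi_e.
  by rewrite (le_trans (pi_le _ _))// rn_proj mul1r.
split.
- split=> [|l b c hb hc].
    move=> t t0; exists [:: 0] => x _; exists 0; first by rewrite inE.
    rewrite subr0 (_ : pi 0 x = 0) ?rn0 ?ltW//.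
    by apply: sv_inj; rewrite sv_pi (io0 rep).
  rewrite /mkset; have -> : pi (l *: b + c) = (fun x => l *: pi b x + pi c x).
    by apply/funext => x; rewrite pi_D pi_Z.
  apply: tot_boundedD hc.
  apply: (tot_bounded_compl (S := fun y => l *: y) (C := complex.Re `|l| + 1)) hb.
  - by move=> x y; rewrite scalerBr.
  - by rewrite ltr_wpDl// cabs_ge0.
  - by move=> x; rewrite rnZ ler_wpM2r ?rn_ge0// lerDl.
- apply/closed_rn => b hb; apply: tot_bounded_lim => t /hb[c hc bc].
  exists (pi c) => // x x1; rewrite -pi_B (le_trans (pi_le _ _))//.
  rewrite (le_trans _ (ltW bc))// ler_piMr ?rn_ge0//.
- move=> b c hc.
  have b1 : 0 < rn b + 1 by rewrite ltr_wpDl// rn_ge0.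
  have hb x : rn (pi b x) <= (rn b + 1) * rn x.
    by rewrite (le_trans (pi_le _ _))// ler_wpM2r ?rn_ge0// lerDl.
  rewrite /mkset; split.
    have -> : pi (amul b c) = pi b \o pi c by apply/funext => x; exact: pi_M.
    by apply: (tot_bounded_compl _ b1 hb hc) => x y; rewrite (linB (pi_linear b)).
  have -> : pi (amul c b) = pi c \o pi b by apply/funext => x; exact: pi_M.
  by apply: (tot_bounded_compr _ b1 hb hc) => l x; rewrite (linZ (pi_linear c)).
Qed.

Lemma gen_star a : J a -> J (astar a).
Proof. by apply: ideal_gen_star => _ ->. Qed.
Lemma gen_e : J e. Proof. exact: ideal_gen_sub. Qed.
Lemma gen_col c : amul c e = c -> J c.
Proof. by move=> <-; apply: (cidl _ (ideal_gen_ideal _)); exact: gen_e. Qed.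

(** An element killing the orbit of [h] satisfies [a d e = 0] for all [d], so it is disjoint from
    the ideal generated by [e]. This ideal contains its adjoint, whence [a * astar a = 0]. *)
Lemma pi_inj a : J a -> (forall x, pi a x = 0) -> a = 0.
Proof.
move=> Ja ha; apply: astar_eq0'; apply: disjoint_amul.
have : J (astar a) by exact: gen_star.
apply: ideal_gen_min; first exact: disjoint_ideal.
move=> _ -> d; rewrite -mulrA -act_jn -jnM.
set g := act d e; suff -> : amul a g = 0 by exact: jn0.
have ge : amul g e = g by apply: jn_inj; rewrite jnM /g act_jn -mulrA -jnM ee.
apply: rn_eq0; have -> : amul a g = amul (amul a g) e by rewrite -amulA ge.
rewrite -rn_col (ioM rep).
have gh : orbit (iota g h) by exists g.
by have := congr1 (@sv _ _ _) (ha (@SubHilbert _ _ col_space _ gh)); rewrite sv_pi /= => ->; rewrite rn0.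
Qed.

Definition col_sum (zs : seq (A * A)) : A := \sum_(z <- zs) amul z.1 (astar z.2).
Definition cols (zs : seq (A * A)) := forall z : A * A, z \in zs ->
  amul z.1 e = z.1 /\ amul z.2 e = z.2.

Lemma gen_col_sum zs : cols zs -> J (col_sum zs).
Proof.
elim: zs => [|z zs IH] hz; rewrite /col_sum ?big_nil ?big_cons.
  exact: (cid0 (ideal_gen_ideal _)).
apply: (cidD (ideal_gen_ideal _)).
  by apply: (cidr _ (ideal_gen_ideal _)); apply: gen_col; case: (hz z); rewrite ?inE ?eqxx.
by apply: IH => y yz; apply: hz; rewrite inE yz orbT.
Qed.

(** The operator bound on [H] is a bound for left multiplication on columns, since these are
    isometric to [H]. For [m = col_sum zs] the element [astar m * m] is again a sum of columns times
    adjoints of columns, so [power_trick] converts the bound into a norm bound in [A]. *)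
Lemma pi_norm zs N : cols zs -> 0 <= N ->
  (forall x, rn (pi (col_sum zs) x) <= N * rn x) -> rn (col_sum zs) <= N.
Proof.
set m := col_sum zs => hz N0 hm.
have hm' x : rn (pi (astar m) x) <= N * rn x.
  have := rn_ge0 (pi (astar m) x); rewrite le_eqVlt => /orP[/eqP <-|p0].
    by rewrite mulr_ge0// rn_ge0.
  rewrite -(ler_pM2l p0) -expr2.
  have -> : rn (pi (astar m) x) ^+ 2 = complex.Re `|dotp (pi m (pi (astar m) x)) x|.
    have [_ _ _ ->] := pi_rep.
    by rewrite dotpp normcC ger0_norm// sqr_ge0.
  rewrite (le_trans (cauchy_schwarz _ _))// mulrA [_ * N]mulrC.
  have hmx := hm (pi (astar m) x).
  have hmx2 := ler_wpM2r (rn_ge0 x) hmx.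
  exact: hmx2.
have hc c : amul c e = c -> rn (amul (amul (astar m) m) c) <= N ^+ 2 * rn c.
  move=> ce; have E b : rn (amul b c) = rn (iota b (iota c h)).
    by rewrite -(ioM rep) rn_col -amulA ce.
  have Oc : orbit (iota c h) by exists c.
  pose x : H := @SubHilbert _ _ col_space _ Oc.
  have -> : rn c = rn x by rewrite -rn_sv /= rn_col ce.
  rewrite E -[iota c h]/(sv x) -sv_pi rn_sv pi_M expr2 -mulrA.
  by rewrite (le_trans (hm' _))// ler_wpM2l.
pose P z := exists c, amul c e = c /\ z = jn c.
have h2 : nm (jn (amul (astar m) m)) <= N ^+ 2.
  apply: (@power_trick R (uni A) P _ _ [seq (jn (amul (astar m) z.1), jn z.2) | z <- zs]).
  - by rewrite /sa -jn_star astarM astarK.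
  - exact: sqr_ge0.
  - rewrite big_map -[in LHS]/(col_sum zs) /col_sum.
    rewrite (big_morph (amul (astar m)) (fun x y => amulDr _ x y) (amul0r _)).
    rewrite (big_morph (@jn _ _) (@jnD _ A) (@jn0 _ A)); apply: eq_bigr => z _.
    by rewrite /= -jn_star -jnM amulA.
  - move=> _ /mapP[z zz ->] /=; exists (amul (astar m) z.1).
    by split=> //; have [h1 _] := hz _ zz; rewrite -amulA h1.
  - move=> _ [c [ce ->]]; rewrite -jnM; split.
      by exists (amul (amul (astar m) m) c); rewrite -amulA ce.
    by rewrite !jn_nm; exact: hc.
move: h2; rewrite jn_nm rn_cstar ler_pXn2r// ?nnegrE ?rn_ge0//.
Qed.

Lemma rank_sum_pi (s : seq (H * H)) : exists2 zs, cols zs &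
  forall x, pi (col_sum zs) x = rank_sum s x.
Proof.
elim: s => [|[y z] s [zs hz IH]].
  exists [::] => // x; rewrite /col_sum /rank_sum !big_nil.
  by apply: sv_inj; rewrite sv_pi (io0 rep).
have [c _ cE] := svP y; have [d _ dE] := svP z.
exists ((amul d e, amul c e) :: zs) => [p|x].
  rewrite inE => /orP[/eqP -> /=|/hz//]; by rewrite -!amulA ee.
rewrite /col_sum /rank_sum !big_cons -/(col_sum _) -/(rank_sum _ _) pi_D IH; congr (_ + _).
have -> : amul (amul d e) (astar (amul c e)) = amul d (amul e (astar c)).
  by rewrite astarM se -amulA [amul e (amul e _)]amulA ee.
rewrite pi_M pi_M pi_e (linZ (pi_linear _)); congr (_ *: _).
  rewrite -!dotp_sv sv_pi (io_star' rep) /= cE//.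
by apply: sv_inj; rewrite sv_pi /= dE.
Qed.

(** Finite rank approximants of [K] lift to sums of columns. By [pi_norm] the lifts form a Cauchy
    sequence in [A], and its limit is the preimage. *)
Lemma pi_surj K : compact_op K -> exists2 a, J a & pi a = K.
Proof.
move=> cK; have [bK _] := (compact_opP K).1 cK.
have [lK _] := bK.
have appr t : 0 < t -> exists2 zs, cols zs & forall x, rn (K x - pi (col_sum zs) x) <= t * rn x.
  move=> t0; have [s hs] := compact_op_approx cK t0; have [zs hz E] := rank_sum_pi s.
  exists zs => // x; have := rn_ge0 x; rewrite le_eqVlt => /orP[/eqP x0|x0].
    by rewrite (rn_eq0 (esym x0)) (lin0 lK) (lin0 (pi_linear _)) subr0 rn0 mulr0.
  have := hs ((rn x)^-1%:C *: x); rewrite rnZr gtr0_norm ?invr_gt0// mulVf ?gt_eqF// => /(_ (lexx _)).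
  rewrite -E (linZ lK) (linZ (pi_linear _)) -scalerBr rnZr gtr0_norm ?invr_gt0//.
  by rewrite ler_pdivrMl// mulrC.
have /choice[u hu] : forall n : nat, exists zs, cols zs /\
    forall x, rn (K x - pi (col_sum zs) x) <= n.+1%:R^-1 * rn x.
  by move=> n; have [|zs hz h1] := appr n.+1%:R^-1; [|exists zs].
pose m n := col_sum (u n).
have [|a ma] := @rn_complete _ A m.
  move=> t t0; have [N hN] := invS_small (divr_gt0 t0 (ltr0Sn _ 1)).
  exists N => p q Np Nq; have [up hp] := hu p; have [uq hq] := hu q.
  pose zs := u p ++ [seq (- z.1, z.2) | z <- u q].
  have E : col_sum zs = m p - m q.
    rewrite /col_sum big_cat big_map /m /col_sum -sumrN; congr (_ + _).
    by apply: eq_bigr => z _; rewrite /= -[- z.1]scaleN1r amulZl scaleN1r.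
  have czs : cols zs.
    move=> z; rewrite mem_cat => /orP[/up//|/mapP[y /uq[y1 y2] ->] /=]; split=> //.
    by rewrite /= -scaleN1r amulZl y1.
  rewrite -E; apply: (@le_lt_trans _ _ (p.+1%:R^-1 + q.+1%:R^-1)).
    apply: pi_norm => // x.
    rewrite E pi_B -(subrK (K x) (pi (m p) x)) -addrA mulrDl.
    have hp' := hp x; rewrite rnB in hp'.
    exact: le_trans (rnD _ _) (lerD hp' (hq x)).
  by rewrite [ltRHS](splitr t) ltrD// hN.
have iJ := ideal_gen_ideal [set e].
exists a.
  apply: (cid_closed iJ) => t t0; have [N hN] := ma t t0.
  exists (m N); last by rewrite rnB hN.
  by have [? _] := hu N; exact: gen_col_sum.
apply/funext => x; apply/esym/subr0_eq/rn_small => t t0.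
have x1 : 0 < rn x + 1 by rewrite ltr_wpDl// rn_ge0.
have t1 : 0 < t / 2 / (rn x + 1) by rewrite !divr_gt0.
have [N hN] := invS_small t1; have [M hM] := ma _ t1.
pose n := maxn N M; have [_ hn] := hu n.
have -> : K x - pi a x = (K x - pi (m n) x) + pi (m n - a) x by rewrite pi_B addrA subrK.
have h1 := hn x; have h2 := pi_le (m n - a) x.
have h3 := hM n (leq_maxr _ _); have h4 := hN n (leq_maxl _ _).
rewrite ltr_pdivlMr// in h3; rewrite ltr_pdivlMr// in h4.
apply: le_trans (rnD _ _) _; have x0 := rn_ge0 x; have p0 := rn_ge0 (m n - a).
have k0 : 0 < n.+1%:R^-1 :> R by rewrite invr_gt0.
move: h1 h2 h3 h4 x0 p0 k0; set k := n.+1%:R^-1; set p := rn (m n - a); rewrite -/(m n); lra.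
Qed.

Lemma pi_bij : set_bij J (@compact_op R H) pi.
Proof.
split.
- by move=> a; exact: pi_compact.
- move=> a b; rewrite !inE => Ja Jb ab; apply/subr0_eq/pi_inj.
    exact: (cidB (ideal_gen_ideal _)).
  by move=> x; rewrite pi_B ab subrr.
- by move=> K /pi_surj[a Ja <-]; exists a.
Qed.
(* e is minimal, so every operator of A** is compressed to a scalar multiple of e. *)
Lemma env_corner S c u : env_vN iota S -> amul c e = c ->
  iota (astar c) (S (iota c u)) = dotp (S (iota c h)) (iota c h) *: iota e u.
Proof.
move=> /strong_closureP[bS hS] ce; apply/subr0_eq/rn_small => t t0.
set w := iota c u; set y := iota c h; set v := iota e u.
have K0 : 0 < rn c + rn y * rn v + 1.
  by rewrite ltr_wpDl// addr_ge0 ?mulr_ge0 ?rn_ge0.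
have [_ [a _ <-] ha] := hS [:: w; y] _ (divr_gt0 t0 K0).
have hw : rn (S w - iota a w) < t / (rn c + rn y * rn v + 1).
  by apply: ha; rewrite inE eqxx.
have hy : rn (S y - iota a y) < t / (rn c + rn y * rn v + 1).
  by apply: ha; rewrite !inE eqxx orbT.
have E : iota (astar c) (iota a w) = dotp (iota a y) y *: v.
  rewrite /w /y /v -!(ioM rep) dotp_col -(ioZ rep); congr iota.
  have ec : amul e (astar c) = astar c by rewrite -{2}ce astarM se.
  by rewrite -cornerE !amulA ec -[amul _ e in RHS]amulA ce.
have -> : iota (astar c) (S w) - dotp (S y) y *: v =
    iota (astar c) (S w - iota a w) + dotp (iota a y - S y) y *: v.
  rewrite (linB (io_linear rep _)) E dotpBl scalerBl addrA subrK//.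
have h1 := io_le rep (astar c) (S w - iota a w); rewrite rn_star in h1.
have h2 := cauchy_schwarz (iota a y - S y) y; rewrite rnB in h2.
have h3 : rn (dotp (iota a y - S y) y *: v) <= rn (S y - iota a y) * rn y * rn v.
  by rewrite rnZ ler_wpM2r// rn_ge0.
apply: le_trans (rnD _ _) _; apply: le_trans (lerD h1 h3) _.
rewrite ltr_pdivlMr// in hw; rewrite ltr_pdivlMr// in hy.
have c0 := rn_ge0 c; have yv0 : 0 <= rn y * rn v by rewrite mulr_ge0 ?rn_ge0.
move: hw hy (rn_ge0 (S w - iota a w)) (rn_ge0 (S y - iota a y)).
set p := rn (S w - _); set q := rn (S y - _); rewrite -mulrA.
move: c0 yv0; set m := rn y * rn v; set n := rn c => n0 m0 h4 h5 p0 q0.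
have [pq|pq] := leP p q.
  have : n * p <= n * q by rewrite ler_wpM2l.
  lra.
have : q * m <= p * m by rewrite ler_wpM2r// ltW.
lra.
Qed.

(** By [env_corner] the compression [c^* p c] is a scalar multiple of [e], and the scalar is read
    off at [h]. If [p] fixes [c h], it agrees with [c^* c], so [(1 - p) c u] has norm zero for every
    [u]. Vectors fixed by [p] thus correspond to columns fixed by [p]. *)
Lemma fixed_col p c u : open_projection iota p -> amul c e = c ->
  p (iota c h) = iota c h -> p (iota c u) = iota c u.
Proof.
move=> op ce ph; have Ep : env_vN iota p by case: op.
have := env_corner u Ep ce; rewrite ph => h1.
have h2 := env_corner u (env_iota rep 0) ce.
have h3 : iota (astar c) (iota c u) = dotp (iota c h) (iota c h) *: iota e u.
  by rewrite dotp_col -(ioM rep) {1}(corner_col ce) (ioZ rep).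
set w := iota c u in h1 h3 *; apply/esym/subr0_eq/dotpp_eq0.
have h4 : dotp (w - p w) w = 0.
  have : iota (astar c) (w - p w) = 0 by rewrite (linB (io_linear rep _)) h3 h1 subrr.
  by rewrite {2}/w -(io_star' rep) => ->; rewrite dotp0l.
rewrite dotpBr h4 -(open_proj_sa op) (linB (open_proj_linear op)).
by rewrite (open_proj_idem op) subrr dotp0l subrr.
Qed.

Lemma columnP (v : H) : exists c, amul c e = c /\ iota c h = sv v.
Proof.
by have [c _ cE] := svP v; exists (amul c e); rewrite -amulA ee -io_col.
Qed.
Definition column (v : H) : A := sval (cid (columnP v)).
Lemma column_e (v : H) : amul (column v) e = column v.
Proof. by rewrite /column; case: cid => c []. Qed.
Lemma column_h (v : H) : iota (column v) h = sv v.
Proof. by rewrite /column; case: cid => c []. Qed.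
Lemma column_uniq (v : H) c : amul c e = c -> iota c h = sv v -> column v = c.
Proof.
move=> ce ch; apply/subr0_eq/rn_eq0.
have <- : amul (column v - c) e = column v - c.
  by rewrite -scaleN1r amulDl amulZl column_e ce.
by rewrite -rn_col (ioB rep) column_h ch subrr rn0.
Qed.

Variables (p : U -> U) (T : A -> A).
Hypothesis hp : open_projection iota p.
Hypothesis T_lin : forall l a b, amul a e = a -> amul b e = b ->
  (forall u, p (iota a u) = iota a u) -> (forall u, p (iota b u) = iota b u) ->
  T (l *: a + b) = l *: T a + T b.

Lemma tmap_subproof (v : H) : cspace col_space (iota (T (column v)) h).
Proof. by exists (T (column v)). Qed.
(** [T] transported along the identification of [H] with the columns [A e]. Defined on all of [H],
    it is linear only where the columns belong to the domain on which [T] is linear. *)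
Definition tmap (v : H) : H := SubHilbert (tmap_subproof v).

Lemma tmap_linear : linear_on (range (restr p)) tmap.
Proof.
have fixed x : range (restr p) x -> forall u, p (iota (column x) u) = iota (column x) u.
  move=> [y _ <-] u; apply: fixed_col => //; first exact: column_e.
  have ip : invariant p by apply: env_invariant; case: hp.
  by rewrite column_h sv_restr ?(open_proj_idem hp).
move=> l x y /fixed fx /fixed fy; apply: sv_inj; rewrite svD svZ /=.
rewrite -(io_lin rep) -T_lin ?column_e//; congr (iota (T _) h).
apply: column_uniq; first by rewrite amulDl amulZl !column_e.
by rewrite svD svZ (io_lin rep) !column_h.
Qed.

Lemma pi_tmap x : (forall c, amul c e = c -> T (amul x c) = amul (T x) c) ->
  pi (T x) = tmap \o pi x.
Proof.
move=> Tx; apply/funext => v; apply: sv_inj; rewrite sv_pi /=.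
have -> : column (restr (iota x) v) = amul x (column v).
  apply: column_uniq; first by rewrite -amulA column_e.
  by rewrite (ioM rep) column_h -sv_pi.
by rewrite Tx ?column_e// (ioM rep) column_h.
Qed.
End MinimalProjection.

(** * The continuous part *)

Section ContinuousPart.
Context {R : realType} {A : cstarType R} {U : hilbertType R}.
Variable iota : A -> U -> U.
Hypothesis rep : representation iota.
Implicit Types (a b c x y : A) (u v w : U) (l : R[i]) (e d : R) (g : seq (A * U)).
Variables (F A0 : set A) (T : A -> A) (C : R).
(** By the last clause [c] vanishes on the orthogonal complement of the closed span of the ranges of
    [F], where the limit operator will be zero as well. *)
Definition multiplier c := [/\ A0 c, rn c <= C &
  forall w, (forall x u, F x -> dotp w (iota x u) = 0) -> iota c w = 0].
Hypothesis approx : forall (xs : seq A) e, (forall x, x \in xs -> F x) -> 0 < e ->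
  exists2 c, multiplier c & forall x, x \in xs -> rn (amul c x - T x) <= e.
Hypothesis C0 : 0 <= C.

Lemma rn_tri u v w : rn (u - v) <= rn (w - u) + rn (w - v).
Proof.
rewrite (rnB w u); have -> : u - v = (u - w) + (w - v) by rewrite addrA subrK.
exact: rnD.
Qed.

Definition gsum g : U := \sum_(z <- g) iota z.1 z.2.
Definition gmap g : U := \sum_(z <- g) iota (T z.1) z.2.
Definition supp_in g := forall z : A * U, z \in g -> F z.1.
Definition gscale l g : seq (A * U) := [seq (z.1, l *: z.2) | z <- g].

Lemma gsum_lin l g g' : gsum (gscale l g ++ g') = l *: gsum g + gsum g'.
Proof.
rewrite /gsum big_cat big_map scaler_sumr; congr (_ + _).
by apply: eq_bigr => z _; rewrite (linZ (io_linear rep _)).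
Qed.
Lemma gmap_lin l g g' : gmap (gscale l g ++ g') = l *: gmap g + gmap g'.
Proof.
rewrite /gmap big_cat big_map scaler_sumr; congr (_ + _).
by apply: eq_bigr => z _; rewrite (linZ (io_linear rep _)).
Qed.
Lemma supp_in_lin l g g' : supp_in g -> supp_in g' -> supp_in (gscale l g ++ g').
Proof.
by move=> hg hg' z; rewrite mem_cat => /orP[/mapP[y /hg Fy -> //]|/hg'].
Qed.

Lemma gmap_approx (gg : seq (seq (A * U))) e : (forall g, g \in gg -> supp_in g) -> 0 < e ->
  exists2 c, multiplier c & forall g, g \in gg -> rn (gmap g - iota c (gsum g)) <= e.
Proof.
move=> Fg e0; pose K := \sum_(g <- gg) \sum_(z <- g) rn z.2.
have s0 g : 0 <= \sum_(z <- g) rn z.2 by apply: sumr_ge0 => z _; exact: rn_ge0.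
have K0 : 0 <= K by apply: sumr_ge0 => g _; exact: s0.
have K1 : 0 < K + 1 by lra.
have [|c mc hc] := @approx (flatten [seq [seq z.1 | z <- g] | g <- gg]) _ _ (divr_gt0 e0 K1).
  by move=> x /flatten_mapP[g gg' /mapP[z zg ->]]; apply: Fg zg.
exists c => // g ggg.
have le1 : rn (gmap g - iota c (gsum g)) <= e / (K + 1) * \sum_(z <- g) rn z.2.
  have {}hc z : z \in g -> rn (amul c z.1 - T z.1) <= e / (K + 1).
    by move=> zg; apply: hc; apply/flatten_mapP; exists g => //; exact: map_f.
  rewrite /gmap /gsum (lin_sum (io_linear rep c)) -sumrB mulr_sumr.
  elim: g {ggg} hc => [|z g IH] hc; first by rewrite !big_nil rn0.
  rewrite !big_cons (le_trans (rnD _ _))// lerD//; last first.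
    by apply: IH => y yg; apply: hc; rewrite inE yg orbT.
  rewrite rnB -(ioM rep) -(ioB rep) (le_trans (io_le rep _ _))// ler_wpM2r ?rn_ge0//.
  by apply: hc; rewrite inE eqxx.
apply: le_trans le1 _; have sK : \sum_(z <- g) rn z.2 <= K.
  rewrite /K (big_rem g)//= lerDl sumr_ge0//.
rewrite mulrAC ler_pdivrMr// ler_wpM2l ?ltW//; lra.
Qed.

(** A multiplier sends [gsum g] nearly to [gmap g] and has norm at most [C]. In particular the rule
    sending [gsum g] to [gmap g] is well defined and bounded by [C]. *)
Lemma gmap_le g : supp_in g -> rn (gmap g) <= C * rn (gsum g).
Proof.
move=> Fg; apply/ler_addgt0Pr => e e0.
have [|c [_ cC _] /(_ g)] := @gmap_approx [:: g] e _ e0.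
  by move=> g'; rewrite inE => /eqP ->.
rewrite inE eqxx => /(_ isT) hc.
rewrite -(subrK (iota c (gsum g)) (gmap g)) (le_trans (rnD _ _))// addrC lerD//.
by rewrite (le_trans (io_le rep _ _))// ler_wpM2r ?rn_ge0.
Qed.

Definition span_closure : set U := closure (gsum @` supp_in).
Lemma span_subspace : subspace_of span_closure.
Proof.
split; first by apply: subset_closure; exists [::] => //; rewrite /gsum big_nil.
move=> l u v /closure_rn hu /closure_rn hv; apply/closure_rn => e e0.
have l0 : 0 < complex.Re `|l| + 1 by rewrite ltr_wpDl// cabs_ge0.
have [_ [g Fg <-] ug] := hu _ (divr_gt0 (divr_gt0 e0 (ltr0Sn _ 1)) l0).
have [_ [g' Fg' <-] vg] := hv _ (divr_gt0 e0 (ltr0Sn _ 1)).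
exists (gsum (gscale l g ++ g')); first by exists (gscale l g ++ g') => //; exact: supp_in_lin.
rewrite gsum_lin opprD addrACA -scalerBr (le_lt_trans (rnD _ _))// rnZ.
rewrite ltr_pdivlMr// in ug; have p0 := rn_ge0 (u - gsum g).
have k0 := cabs_ge0 l; move: ug vg p0 k0.
by set p := rn (u - _); set q := rn (v - _); set k := complex.Re `|l|; lra.
Qed.

(** The bounded rule from [gsum g] to [gmap g] is extended to the closed span and by zero to its
    complement. Finitely many vectors are approximated at once by a single multiplier, which places
    the extension in the strong closure of the image of [A0]. *)
Lemma continuous_part : exists t0, bidual_of iota A0 t0 /\
  forall x, F x -> iota (T x) = t0 \o iota x.
Proof.
have [q hq] := orth_proj_ex span_subspace (@closed_closure _ _).
have approxq u d : 0 < d -> exists2 g, supp_in g & rn (q u - gsum g) < d.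
  by move=> d0; have [_ [g Fg <-] ?] := (closure_rn _ _).1 (op_in hq u) d d0; exists g.
have diff g g' : supp_in g -> supp_in g' ->
    rn (gmap g - gmap g') <= C * rn (gsum g - gsum g').
  move=> Fg Fg'; have := gmap_le (supp_in_lin (l := -1) Fg' Fg).
  by rewrite gmap_lin gsum_lin !scaleN1r ![- _ + _]addrC.
(* [t u] is the limit of [gmap g] along finite sums with [gsum g] tending to [q u]; the estimate
   [near] below makes it independent of the chosen sums. *)
have /choice[t ht] : forall u, exists w, forall d, 0 < d ->
    exists g, [/\ supp_in g, rn (q u - gsum g) < d & rn (w - gmap g) < d].
  move=> u; have /choice[g hg] : forall n : nat, exists g, supp_in g /\ rn (q u - gsum g) < n.+1%:R^-1.
    by move=> n; have [|g Fg ug] := approxq u n.+1%:R^-1; [|exists g].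
  have C1 : 0 < C + 1 by rewrite ltr_wpDl.
  have [|w hw] := @rn_complete _ U (gmap \o g).
    move=> d d0; have [N hN] := invS_small (divr_gt0 (divr_gt0 d0 (ltr0Sn _ 1)) C1).
    exists N => m n Nm Nn; have [Fm hm] := hg m; have [Fn hn] := hg n.
    apply: le_lt_trans (diff _ _ Fm Fn) _.
    have h1 : rn (gsum (g m) - gsum (g n)) <= rn (q u - gsum (g m)) + rn (q u - gsum (g n)).
      exact: rn_tri.
    have h2 := lt_trans hm (hN _ Nm); have h3 := lt_trans hn (hN _ Nn).
    rewrite ltr_pdivlMr// in h2; rewrite ltr_pdivlMr// in h3.
    have h4 := ler_wpM2l C0 h1; apply: le_lt_trans h4 _.
    move: h2 h3 (rn_ge0 (q u - gsum (g m))) (rn_ge0 (q u - gsum (g n))); clear.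
    by lra.
  exists w => d d0; have [N hN] := hw d d0; have [M hM] := invS_small d0.
  have [Fn hn] := hg (maxn N M); exists (g (maxn N M)); split=> //.
    by rewrite (lt_trans hn)// hM// leq_maxr.
  by rewrite rnB hN// leq_maxl.
have near u g : supp_in g -> rn (t u - gmap g) <= C * rn (q u - gsum g).
  move=> Fg; apply/ler_addgt0Pr => e e0.
  have C1 : 0 < C + 1 by rewrite ltr_wpDl.
  have [g' [Fg' h1 h2]] := ht u _ (divr_gt0 e0 C1).
  have h3 := diff _ _ Fg' Fg.
  have h4 : rn (gsum g' - gsum g) <= rn (q u - gsum g') + rn (q u - gsum g).
    exact: rn_tri.
  have h5 := ler_wpM2l C0 h4.
  rewrite ltr_pdivlMr// in h1; rewrite ltr_pdivlMr// in h2.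
  rewrite -(subrK (gmap g') (t u)) -addrA; apply: le_trans (rnD _ _) _.
  have h6 : C * rn (q u - gsum g') + rn (t u - gmap g') <= e.
    have [le|lt] := leP (rn (q u - gsum g')) (rn (t u - gmap g')).
      by have := ler_wpM2l C0 le; lra.
    by lra.
  by lra.
have tlin : linear t.
  move=> l u v; apply/subr0_eq/rn_small => e e0.
  have k0 := cabs_ge0 l; set k := complex.Re `|l| in k0.
  have K0 : 0 < (C + 1) * (k + 1) by rewrite mulr_gt0// ltr_wpDl.
  have [g [Fg h1 h2]] := ht u _ (divr_gt0 e0 K0).
  have [g' [Fg' h3 h4]] := ht v _ (divr_gt0 e0 K0).
  have Fl := supp_in_lin (l := l) Fg Fg'; have h5 := near (l *: u + v) _ Fl.
  rewrite gmap_lin gsum_lin in h5.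
  have qE : q (l *: u + v) - (l *: gsum g + gsum g') = l *: (q u - gsum g) + (q v - gsum g').
    by rewrite (op_lin hq) opprD addrACA -scalerBr.
  rewrite qE in h5.
  have h6 := rnD (l *: (q u - gsum g)) (q v - gsum g'); rewrite rnZ -/k in h6.
  have h7 := rnD (l *: (t u - gmap g)) (t v - gmap g'); rewrite rnZ -/k in h7.
  have -> : t (l *: u + v) - (l *: t u + t v) =
      (t (l *: u + v) - (l *: gmap g + gmap g')) - (l *: (t u - gmap g) + (t v - gmap g')).
    have -> : l *: (t u - gmap g) + (t v - gmap g') = (l *: t u + t v) - (l *: gmap g + gmap g').
      by rewrite scalerBr addrACA -opprD.
    by rewrite opprB addrA subrK.
  apply: le_trans (rnD _ _) _; rewrite rnN.
  have h8 := ler_wpM2l C0 h6.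
  set d := e / _ in h1 h2 h3 h4.
  have dE : (C + 1) * (k + 1) * d = e by rewrite /d mulrC divfK ?gt_eqF.
  have d0 : 0 < d by rewrite divr_gt0.
  have := ler_wpM2l k0 (ltW h1); have := ler_wpM2l k0 (ltW h2).
  have := ler_wpM2l C0 (ler_wpM2l k0 (ltW h1)); have := ler_wpM2l C0 (ltW h3).
  by lra.
have tle u : rn (t u) <= C * rn u.
  have := near u [::] (fun z => _); rewrite /gmap /gsum !big_nil !subr0 => h.
  by rewrite (le_trans (h _))// ler_wpM2l//; exact: (op_le1 hq).
exists t; split; last first.
  move=> x Fx; apply/funext => u; apply/esym/subr0_eq/rn_eq0.
  have Fg : supp_in [:: (x, u)] by move=> z; rewrite inE => /eqP ->.
  have := near (iota x u) _ Fg; rewrite /gmap /gsum !big_seq1 /= (op_id hq).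
    by rewrite subrr rn0 mulr0 => h; apply/le_anti; rewrite h rn_ge0.
  by apply: subset_closure; exists [:: (x, u)] => //; rewrite /gsum big_seq1.
apply/strong_closureP; split.
  apply/bounded_opP; split=> //; exists (C + 1); first by rewrite ltr_wpDl.
  by move=> u; rewrite (le_trans (tle u))// ler_wpM2r ?rn_ge0// lerDl.
move=> us e e0.
have C1 : 0 < 4 * (C + 1) by rewrite mulr_gt0// ltr_wpDl.
have /choice[G hG] : forall u, exists g, supp_in g /\ rn (q u - gsum g) < e / (4 * (C + 1)).
  by move=> u; have [g Fg ug] := approxq u _ (divr_gt0 e0 C1); exists g.
have [|c [Ac cC cw] hc] := @gmap_approx [seq G u | u <- us] _ _ (divr_gt0 e0 (ltr0Sn _ 3)).
  by move=> g /mapP[u _ ->]; have [] := hG u.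
exists (iota c); first by exists c.
move=> u uus; have [Fg ug] := hG u.
have h1 := near u _ Fg; have h2 := hc _ (map_f G uus).
have h3 : rn (iota c (gsum (G u) - q u)) <= C * rn (q u - gsum (G u)).
  by rewrite rnB (le_trans (io_le rep _ _))// ler_wpM2r ?rn_ge0.
have cu : iota c u = iota c (q u).
  apply/subr0_eq; rewrite -(linB (io_linear rep c)); apply: cw => x v Fx.
  apply: (op_orth hq); apply: subset_closure; exists [:: (x, v)]; last by rewrite /gsum big_seq1.
  by move=> z; rewrite inE => /eqP ->.
have -> : t u - iota c u = (t u - gmap (G u)) + ((gmap (G u) - iota c (gsum (G u))) +
    iota c (gsum (G u) - q u)).
  by rewrite (linB (io_linear rep c)) cu !addrA !subrK.
apply: le_lt_trans (rnD _ _) _; apply: le_lt_trans (lerD h1 (le_trans (rnD _ _) (lerD h2 h3))) _.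
rewrite ltr_pdivlMr// in ug; have p0 := rn_ge0 (q u - gsum (G u)).
move: ug p0 e0 C0; clear; set p := rn _; lra.
Qed.
End ContinuousPart.

(** * The decomposition *)

(** All data of one summand [K(H_i)] are bundled, so that they can be selected for every index by
    one use of choice. *)
Record atom_rep (R : realType) (A : cstarType R) (U : hilbertType R)
    (iota : A -> U -> U) (p : U -> U) (T : A -> A) (e : A) := AtomRep {
  atom_space : hilbertType R;
  atom_pi : A -> atom_space -> atom_space;
  atom_rho : (U -> U) -> atom_space -> atom_space;
  atom_map : atom_space -> atom_space;
  atom_irr : irreducible atom_pi;
  atom_bij : set_bij (ideal_gen [set e]) (@compact_op R atom_space) atom_pi;
  atom_normal : normal_extension iota atom_pi atom_rho;
  atom_linear : linear_on (range (atom_rho p)) atom_map;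
  atom_mapE : forall x, (forall c, amul c e = c -> T (amul x c) = amul (T x) c) ->
    atom_pi (T x) = atom_map \o atom_pi x }.

Section Assembly.
Context {R : realType} {A : cstarType R} {U : hilbertType R}.
Variable iota : A -> U -> U.
Hypothesis univ : universal iota.
Let rep : representation iota := univ.1.
Variables p1 p2 : U -> U.
Hypotheses (hp1 : open_projection iota p1) (hp2 : open_projection iota p2).
Notation Xp := (X iota p1 p2).

Variable T : A -> A.
Hypotheses (T_maps : forall x : A, Xp x -> X iota idfun p2 (T x))
  (T_linear : linear_on Xp T) (T_local : local iota p1 p2 T).
Notation L := (fixed_ideal iota p2).
Notation S := (fixed_ideal iota p1).
Notation T' := (uni_map T).
Let lT : local_map L S T' := uni_local_map univ hp1 hp2 T_maps T_linear T_local.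
Implicit Types (a b c x : A) (l : R[i]) (d f : uni A).

Lemma X_jn a : Xp a <-> Xs L S (jn a).
Proof. by rewrite (XsP univ hp1 hp2); split=> [|[]]. Qed.
Lemma X_uvec d : Xs L S d -> Xp (uvec d) /\ jn (uvec d) = d.
Proof. by move=> /(XsP univ hp1 hp2)[d0 Xd]; split=> //; rewrite -usc_jn. Qed.
Lemma X_lin l a b : Xp a -> Xp b -> Xp (l *: a + b).
Proof. by rewrite !X_jn jnD jnZ => ha hb; apply: (XsD lT) => //; apply: (XsZ lT). Qed.
Lemma X_0 : Xp 0. Proof. by rewrite X_jn jn0; exact: (Xs0 lT). Qed.
Lemma X_D a b : Xp a -> Xp b -> Xp (a + b).
Proof. by move=> Xa; rewrite -(scale1r a); exact: X_lin. Qed.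
Lemma local0 : T 0 = 0. Proof. by apply: jn_inj; exact: (T0 lT). Qed.

Lemma local_sum I (s : seq I) (x : I -> A) : (forall i, Xp (x i)) ->
  Xp (\sum_(i <- s) x i) /\ T (\sum_(i <- s) x i) = \sum_(i <- s) T (x i).
Proof.
move=> Xx; elim: s => [|i s [IH1 IH2]]; first by rewrite !big_nil local0; split; [exact: X_0|].
rewrite !big_cons; split; first exact: X_D.
by rewrite -IH2 -{1}(scale1r (x i)) T_linear// scale1r.
Qed.

Lemma minproj_atom f : minproj L S T' f -> [/\ jn (uvec f) = f,
  [/\ astar (uvec f) = uvec f, amul (uvec f) (uvec f) = uvec f & uvec f <> 0],
  right_fixed iota p2 (uvec f) &
  forall a, exists l, amul (amul (uvec f) a) (uvec f) = l *: uvec f].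
Proof.
move=> [[sf ff] [[[f0 hf] _] _] nf hm].
have fE : jn (uvec f) = f by rewrite -usc_jn.
split=> //; first split.
- by apply: jn_inj; rewrite jn_star fE.
- by apply: jn_inj; rewrite jnM fE.
- by move=> u0; apply: nf; rewrite -fE u0 jn0.
- move=> a; have [l fl] := hm (jn a); exists l.
  by apply: jn_inj; rewrite !jnM jnZ fE.
Qed.

Lemma atom_rep_exists e : minproj L S T' (jn e) -> exists _ : atom_rep iota p1 T e, True.
Proof.
move=> /minproj_atom[_ [se ee e0] fe me].
have [h [eh hh]] := corner_vector univ se ee e0 me.
have T_lin l a b : amul a e = a -> amul b e = b ->
    (forall u, p1 (iota a u) = iota a u) -> (forall u, p1 (iota b u) = iota b u) ->
    T (l *: a + b) = l *: T a + T b.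
  move=> ae be ha hb; apply: T_linear; apply/(XP univ hp1 hp2); split=> // u.
    by rewrite -ae !(ioM rep); congr iota; exact: fe.
  by rewrite -be !(ioM rep); congr iota; exact: fe.
exists (AtomRep (pi_irr univ se ee e0 eh hh) (pi_bij univ se ee e0 eh hh)
  (restr_normal univ se ee e0 eh hh) (tmap_linear hp1 T_lin)
  (fun x => @pi_tmap _ _ _ _ univ _ se ee e0 _ _ eh hh T x)) => //.
Qed.

Variables (s r : seq (uni A)) (C : R).
Hypotheses (os : orth_family L S T' s) (s_unit : forall d, Kid L S T' d -> d * psum s = d)
  (ir : inequivalent L S T' r)
  (sr : forall f, f \in s -> exists e d : uni A, e \in r /\ f = d * e * star d)
  (C0 : 0 <= C) (T_bound : forall d, Xs L S d -> d * psum s = 0 -> nm (T' d) <= C * nm d).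
Let k := psum s.
Let Kk : Kid L S T' k. Proof. exact: (psum_K lT). Qed.
Let Bk : B2 L k := Kk.1.

Lemma unit_left d : Kid L S T' d -> k * d = d.
Proof.
move=> Kd; rewrite -[LHS]starK starM (psum_sa os) (s_unit (K_star lT Kd)).
exact: starK.
Qed.
Lemma unit_central d : B2 L d -> d * k = k * d.
Proof.
move=> Bd; rewrite -[LHS](unit_left (K_left lT Kk Bd)).
by rewrite mulrA s_unit//; exact: K_right.
Qed.

(** The element [b = (star d) d f e] lies in [Kid], because [e] does, and is therefore fixed by [k]
    on the left; but [k * star d = 0]. So [b = 0], and [d f e] vanishes by the C*-identity. The
    middle factor [f] is arbitrary, which is what disjointness from a block asks for. *)
Lemma off_unit d f e : Xs L S d -> d * k = 0 -> Kid L S T' e -> d * f * e = 0.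
Proof.
move=> [Ld _] dk Ke; apply: star_eq0.
pose b := star d * d * f * e.
have Bd : B2 L (star d * d) by exact: (B2_star lT).
have Kb : Kid L S T' b.
  split; first by apply: (B2_mid lT) => //; case: Ke.
  by move=> j Jj; rewrite /b -mulrA (Ke.2 _ Jj) mulr0.
have kd : k * star d = 0 by rewrite -[LHS]starK starM starK (psum_sa os) dk star0.
have b0 : b = 0 by rewrite -(unit_left Kb) /b !mulrA kd !mul0r.
by rewrite !starM -!mulrA (_ : star d * _ = b) ?b0 ?mulr0// /b !mulrA.
Qed.

Lemma rep_minproj f : f \in r -> minproj L S T' f.
Proof.
elim: r ir => //= g t IH [mg _ it]; rewrite inE => /orP[/eqP ->//|]; exact: IH.
Qed.
Lemma rep_nth i j d : (i < size r)%N -> (j < size r)%N -> i != j ->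
  nth 0 r i * d * nth 0 r j = 0.
Proof.
have lt t i' j' d' : inequivalent L S T' t -> (i' < j' < size t)%N ->
    nth 0 t j' * d' * nth 0 t i' = 0.
  elim: t i' j' => [|g t IH] i' j'; first by rewrite andbF.
  case: i' j' => [|i'] [|j'] //= [_ hg it] jt; first by rewrite hg// mem_nth.
  exact: IH.
move=> ri rj; rewrite neq_ltn => /orP[ij|ij]; last by apply: lt => //; rewrite ij.
have m n : (n < size r)%N -> star (nth 0 r n) = nth 0 r n.
  by move=> rn_; have [[sa_ _] _ _ _] := rep_minproj (mem_nth 0 rn_).
transitivity (star (nth 0 r j * star d * nth 0 r i)); last by rewrite lt ?star0 ?ij.
by rewrite !starM starK !m// mulrA.
Qed.

Definition atom (i : 'I_(size r)) : A := uvec (nth 0 r i).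
Definition block i : set A := ideal_gen [set atom i].
(** Taking the annihilator of the blocks makes this a closed ideal at once; on [X] membership
    amounts to [x k = 0]. *)
Definition block0 : set A := [set a | ideal_gen Xp a /\
  forall i b, block i b -> amul a b = 0].
Definition blocks (i : 'I_(size r).+1) : set A :=
  if unlift ord0 i is Some j then block j else block0.

Lemma atom_minproj (i : 'I_(size r)) : minproj L S T' (nth 0 r i).
Proof. exact: rep_minproj (mem_nth 0 (ltn_ord i)). Qed.
Lemma jn_atom i : jn (atom i) = nth 0 r i.
Proof. by case: (minproj_atom (atom_minproj i)). Qed.
Lemma block_ideal i : closed_ideal (block i).
Proof. exact: ideal_gen_ideal. Qed.
Lemma block_star i a : block i a -> block i (astar a).
Proof.
by apply: ideal_gen_star => _ ->; have [_ [-> _ _] _ _] := minproj_atom (atom_minproj i).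
Qed.
Lemma block_atom i : block i (atom i). Proof. exact: ideal_gen_sub. Qed.

Lemma block_disjoint i j a b : i != j -> block i a -> block j b -> disjoint_from a b.
Proof.
move=> ij; apply: disjoint_ideals => [_ ->|_ ->|_ _ -> -> d].
- by have [_ [-> _ _] _ _] := minproj_atom (atom_minproj i).
- by have [_ [-> _ _] _ _] := minproj_atom (atom_minproj j).
- by rewrite !jn_atom rep_nth.
Qed.

Lemma block0_ideal : closed_ideal block0.
Proof.
have iX := ideal_gen_ideal Xp; split.
- split; first by split=> [|i b _]; [exact: (cid0 iX)|rewrite amul0l].
  move=> l a b [Ia ha] [Ib hb]; split; first exact: (cid_lin _ iX).
  by move=> i c bc; rewrite amulDl amulZl (ha i)// (hb i)// scaler0 addr0.
- apply/closed_rn => a h; split.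
    by apply: (cid_closed iX) => t /h[b [Ib _] ab]; exists b.
  move=> i b bb; apply: rn_small => t t0.
  have b1 : 0 < rn b + 1 by rewrite ltr_wpDl// rn_ge0.
  have [c [_ hc] ac] := h _ (divr_gt0 t0 b1).
  have -> : amul a b = amul (a - c) b by rewrite -scaleN1r amulDl amulZl (hc i)// scaler0 addr0.
  rewrite ltr_pdivlMr// in ac; apply: le_trans (rn_amul _ _) _.
  by have := rn_ge0 (a - c); lra.
- move=> a x [Ix hx]; split; split.
  + exact: (cidl _ iX).
  + by move=> i b bb; rewrite -amulA (hx i)// amul0r.
  + exact: (cidr _ iX).
  + by move=> i b bb; rewrite -amulA (hx i)//; exact: (cidl _ (block_ideal i)).
Qed.
Lemma blocks_ideal i : closed_ideal (blocks i).
Proof. by rewrite /blocks; case: unlift => [j|]; [exact: block_ideal|exact: block0_ideal]. Qed.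

Lemma blocks_orth i j a b : i != j -> blocks i a -> blocks j b -> amul a (astar b) = 0.
Proof.
rewrite /blocks; case: unliftP => [i'|] ->; case: unliftP => [j'|] -> //.
- move=> ij ha hb; apply: disjoint_amul; apply: block_disjoint ha (block_star hb).
  by apply: contraNN ij => /eqP ->.
- move=> _ ha [_ hb]; rewrite -[LHS]astarK astarM astarK (hb i') ?astar0//.
  exact: block_star.
- by move=> _ [_ ha] /block_star; exact: ha.
Qed.

Lemma scale_atom d i : block i (act d (atom i)).
Proof.
have [_ [_ ee _] _ _] := minproj_atom (atom_minproj i).
suff -> : act d (atom i) = amul (act d (atom i)) (atom i).
  by apply: (cidl _ (block_ideal i)); exact: block_atom.
by apply: jn_inj; rewrite jnM !act_jn -mulrA -jnM ee.
Qed.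
Lemma family_block f : f \in s -> jn (uvec f) = f /\ exists i, block i (uvec f).
Proof.
move=> fs; have [fE _ _ _] := minproj_atom (orth_minproj os fs); split=> //.
have [e [d [er fd]]] := sr fs.
have i : (index e r < size r)%N by rewrite index_mem.
exists (Ordinal i); have eE : nth 0 r (Ordinal i) = e by rewrite /= nth_index.
suff -> : uvec f = amul (act d (atom (Ordinal i))) (astar (act d (atom (Ordinal i)))).
  by apply: (cidr _ (block_ideal _)); exact: scale_atom.
apply: jn_inj; rewrite fE jnM jn_star act_jn jn_atom eE fd starM.
have [[se ee] _ _ _] := rep_minproj er.
by rewrite se !mulrA -[d * e * e]mulrA ee.
Qed.

Lemma off_block0 x : Xp x -> jn x * k = 0 -> block0 x.
Proof.
move=> Xx xk; split; first exact: ideal_gen_sub.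
move=> i b bb; apply: disjoint_amul; move: bb; apply: ideal_gen_min; first exact: disjoint_ideal.
move=> _ -> d; rewrite jn_atom; apply: off_unit => //; first by apply/X_jn.
by case: (atom_minproj i).
Qed.

Lemma family_mul x f : Xp x -> f \in s -> Xp (amul x (uvec f)).
Proof.
move=> Xx fs; rewrite X_jn jnM (family_block fs).1; apply: (XsL lT); first by apply/X_jn.
by have [_ [[]]] := orth_minproj os fs.
Qed.

Lemma unit_sum x : jn x * k = jn (\sum_(f <- s) amul x (uvec f)).
Proof.
rewrite (big_morph (@jn _ _) (@jnD _ A) (@jn0 _ A)) /k /psum mulr_sumr.
by apply: eq_big_seq => f fs; rewrite jnM (family_block fs).1.
Qed.

Lemma block0_off x : block0 x -> jn x * k = 0.
Proof.
move=> [_ hx]; rewrite unit_sum big_seq big1 ?jn0// => f /family_block[_ [i bf]].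
exact: hx bf.
Qed.

Lemma X_off x : Xp x -> Xp (x - \sum_(f <- s) amul x (uvec f)) /\
  block0 (x - \sum_(f <- s) amul x (uvec f)).
Proof.
move=> Xx; set y := \sum_(f <- s) _.
have Xy : Xp y.
  by rewrite /y big_seq; elim/big_ind: _ => [|a b|f fs]; [exact: X_0|exact: X_D|exact: family_mul].
have Xxy : Xp (x - y) by rewrite addrC -scaleN1r; exact: X_lin.
split=> //; apply: off_block0 => //.
rewrite addrC -scaleN1r jnD jnZ scaleN1r mulrDl mulNr -unit_sum -mulrA s_unit//.
by rewrite addNr.
Qed.

Lemma sumset_D m (S_ : 'I_m -> set A) a b :
  (forall i x y, S_ i x -> S_ i y -> S_ i (x + y)) ->
  sumset S_ a -> sumset S_ b -> sumset S_ (a + b).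
Proof.
move=> SD [x Sx <-] [y Sy <-]; exists (fun i => x i + y i); last by rewrite big_split.
by move=> i; apply: SD.
Qed.
Lemma sumset_single m (S_ : 'I_m -> set A) i a : (forall j, S_ j 0) -> S_ i a ->
  sumset S_ a.
Proof.
move=> S0 Sa; exists (fun j => if j == i then a else 0).
  by move=> j /=; case: eqP => // ->.
by rewrite (bigD1 i)//= eqxx big1 ?addr0// => j /negbTE ->.
Qed.

Lemma blocks_lift i : blocks (lift ord0 i) = block i.
Proof. by rewrite /blocks liftK. Qed.
Lemma blocks_0 : blocks ord0 = block0.
Proof. by rewrite /blocks unlift_none. Qed.

Lemma X_split x : Xp x -> sumset (fun i => Xp `&` blocks i) x.
Proof.
move=> Xx; have [X1 b1] := X_off Xx.
have SD i a b : (Xp `&` blocks i) a -> (Xp `&` blocks i) b -> (Xp `&` blocks i) (a + b).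
  by move=> [? ?] [? ?]; split; [exact: X_D|exact: (cidD (blocks_ideal i))].
have S0 i : (Xp `&` blocks i) 0 by split; [exact: X_0|exact: (cid0 (blocks_ideal i))].
rewrite -(subrK (\sum_(f <- s) amul x (uvec f)) x); apply: sumset_D => //.
  by apply: (@sumset_single _ _ ord0) => //; rewrite blocks_0.
rewrite big_seq; elim/big_ind: _ => [|a b|f fs]; first exact: (@sumset_single _ _ ord0).
  exact: sumset_D.
have [_ [i bf]] := family_block fs.
apply: (@sumset_single _ _ (lift ord0 i)) => //; rewrite blocks_lift; split.
  exact: family_mul.
exact: (cidl _ (block_ideal i)).
Qed.

(** Some [x] in [X] has [y = x e] nonzero by [K_nontrivial], and [astar y * y] is a nonzero multiple
    of the minimal projection [e]. *)
Lemma block_sub i : block i `<=` ideal_gen Xp.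
Proof.
have iX := ideal_gen_ideal Xp; apply: ideal_gen_min => // _ ->.
have mp := atom_minproj i; have [_ [_ ee _] _ me] := minproj_atom mp.
have [_ Ke n0 _] := mp; have [d Xd de] := K_nontrivial lT Ke n0.
have [Xx xE] := X_uvec Xd; set x := uvec d in Xx xE.
pose y := amul x (atom i); have [l yy] := me (amul (astar x) x).
have se : astar (atom i) = atom i by have [_ [? _ _] _ _] := minproj_atom mp.
have yl : amul (astar y) y = l *: atom i by rewrite /y astarM se -yy !amulA.
have l0 : l != 0.
  apply/eqP => l0; apply: de; rewrite -xE -jn_atom -jnM -/y (_ : y = 0) ?jn0//.
  by apply: astar_eq0; rewrite yl l0 scale0r.
have -> : atom i = l^-1 *: amul (astar y) y by rewrite yl scalerA mulVf// scale1r.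
apply: (cidZ _ iX); apply: (cidl _ iX); apply: (cidr _ iX); exact: ideal_gen_sub.
Qed.
Lemma blocks_sub i : blocks i `<=` ideal_gen Xp.
Proof. by rewrite /blocks; case: unlift => [j|]; [exact: block_sub|move=> a []]. Qed.

Lemma blocks_independent (x : 'I_(size r).+1 -> A) : (forall i, blocks i (x i)) ->
  \sum_(i < (size r).+1) x i = 0 -> forall i, x i = 0.
Proof.
move=> hx x0 i; apply: rn_eq0; apply/le_anti; rewrite rn_ge0 andbT.
by have := rn_component blocks_orth i hx; rewrite x0 rn0.
Qed.

Lemma ideal_direct_sum : direct_sum (ideal_gen Xp) blocks.
Proof.
split; last exact: blocks_independent.
apply/seteqP; split=> [|_ [x hx <-]].
  apply: ideal_gen_min; first exact: (sumset_ideal blocks_ideal blocks_orth).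
  by move=> x /X_split[y hy <-]; exists y => // i; case: (hy i).
apply: (cid_sum _ (ideal_gen_ideal Xp)) => i; exact: blocks_sub (hx i).
Qed.
Lemma X_direct_sum : direct_sum Xp (fun i => Xp `&` blocks i).
Proof.
split; last by move=> x hx; apply: blocks_independent => i; case: (hx i).
apply/seteqP; split=> [x /X_split//|_ [x hx <-]].
by apply: (local_sum _ _).1 => i; case: (hx i).
Qed.

(** The difference [y = x - x k] lies both in the block and in its annihilator [block0], so
    [y * astar y = 0]. *)
Lemma block_unit i x : Xp x -> block i x -> jn x * k = jn x.
Proof.
move=> Xx bx; have [_ [_ hy]] := X_off Xx.
set y := _ - _ in hy.
have by_ : block i y.
  have yE : y = x - amul x (uvec k).
    congr (_ - _); apply: jn_inj; rewrite -unit_sum jnM -(usc_jn (x := k))//.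
    by case: Bk => [[]].
  by rewrite yE; apply: (cidB (block_ideal i)) => //; apply: (cidr _ (block_ideal i)).
have y0 : y = 0 by apply: astar_eq0'; apply: (hy i); exact: block_star.
by rewrite unit_sum; move/subr0_eq: y0 => <-.
Qed.

Lemma T_unit i x : Xp x -> block i x -> T' (jn x) = T' (jn x) * k.
Proof.
move=> Xx bx; rewrite -{1}(block_unit Xx bx) (TM lT)//; first by apply/X_jn.
  by case: Bk.
by case: Bk.
Qed.

(** Since [T x = T x * k], the image is a sum of terms [T x * f]. A projection [f] from another
    block gives [T (x f) = 0], and one from block [i] keeps the term in the block. *)
Lemma T_block i x : Xp x -> block i x -> block i (T x).
Proof.
move=> Xx bx.
have -> : T x = \sum_(f <- s) amul (T x) (uvec f).
  by apply: jn_inj; rewrite -unit_sum; exact: T_unit bx.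
rewrite big_seq; elim/big_ind: _ => [|a b|f fs]; first exact: (cid0 (block_ideal i)).
  exact: (cidD (block_ideal i)).
have [fE [j bf]] := family_block fs.
have [ij|ij] := eqVneq i j.
  by apply: (cidl _ (block_ideal i)); rewrite ij.
have -> : amul (T x) (uvec f) = 0; last exact: (cid0 (block_ideal i)).
have [_ [[Lf Lf'] _] _ _] := orth_minproj os fs.
apply: jn_inj; rewrite jnM fE -[jn (T x)]/(T' (jn x)) -(TM lT)//; last by apply/X_jn.
by rewrite -fE -jnM (disjoint_amul (block_disjoint ij bx bf)) jn0 (T0 lT).
Qed.

(** A column [c] lies in [L], but its adjoint may not, so the module property does not apply to [c]
    itself. It applies to [k * c], which lies in [B2], and both [x] and [T x] absorb [k]. *)
Lemma T_col i x c : Xp x -> block i x -> amul c (atom i) = c ->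
  T (amul x c) = amul (T x) c.
Proof.
move=> Xx bx ce; pose b := k * jn c.
have Bb : B2 L b.
  have -> : b = k * jn c * jn (atom i) by rewrite /b -mulrA -jnM ce.
  by rewrite jn_atom; apply: (B2_mid lT) => //; case: (atom_minproj i) => _ [].
have Xj : Xs L S (jn x) by apply/X_jn.
have E : jn (amul x c) = jn x * b by rewrite jnM /b mulrA (block_unit Xx bx).
apply: jn_inj; rewrite jnM -[LHS]/(T' (jn (amul x c))) E (TM lT Xj Bb.1 Bb.2).
by rewrite /b mulrA -(T_unit Xx bx).
Qed.

Lemma X0_block0 d : X0 L S k d -> [/\ Xp (uvec d), block0 (uvec d) & jn (uvec d) = d].
Proof.
move=> [/X_uvec[Xd dE] dk]; split=> //; apply: off_block0 => //.
by rewrite dE.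
Qed.
Lemma block0_X0 x : Xp x -> block0 x -> X0 L S k (jn x).
Proof. by move=> Xx bx; split; [apply/X_jn|exact: block0_off]. Qed.

Lemma act_ideal I d x : closed_ideal I -> I x -> I (act d x).
Proof. by move=> iI Ix; apply: (cid_lin _ iI) => //; exact: (cidl _ iI). Qed.

Lemma T_block0 x : Xp x -> block0 x -> block0 (T x).
Proof.
move=> Xx bx; apply: (cid_closed block0_ideal) => e e0.
have [d hd] := T_closure lT unit_central C0 T_bound (block0_X0 Xx bx) (divr_gt0 e0 (ltr0Sn _ 1)).
exists (act d x); first exact: act_ideal block0_ideal bx.
rewrite -jn_nm -scaleN1r jnD jnZ scaleN1r act_jn (le_lt_trans hd)//.
by rewrite ltr_pdivrMr// ltr_pMr// ltr1n.
Qed.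

(** The approximant is found in the unitization, but all factors of its terms come from [A], so the
    sum can be formed in [A]. Each term ends in the adjoint of an element of [X] in [block0], which
    kills every vector orthogonal to the ranges of such elements. *)
Lemma block0_multiplier (xs : seq A) (e : R) :
  (forall x, x \in xs -> (Xp `&` block0) x) -> 0 < e ->
  exists2 c, multiplier iota (Xp `&` block0) block0 C c &
    forall x, x \in xs -> rn (amul c x - T x) <= e.
Proof.
move=> hxs e0.
have [|c [zs [cE Xz cC hc]]] := approx_multiplier lT unit_central C0 T_bound (xs := map (@jn _ _) xs) _ e0.
  by move=> d /mapP[x /hxs[Xx bx] ->]; exact: block0_X0.
pose c' := \sum_(z <- zs) amul (T (uvec z.1)) (astar (uvec z.2)).
have c'E : jn c' = c.
  rewrite cE (big_morph (@jn _ _) (@jnD _ A) (@jn0 _ A)); apply: eq_big_seq => z zz.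
  have [_ /X0_block0[_ _ zE]] := Xz _ zz.
  by rewrite jnM jn_star zE.
exists c'; last first.
  move=> x xxs; rewrite -jn_nm -scaleN1r jnD jnZ scaleN1r jnM c'E.
  by apply: hc; exact: map_f.
split.
- rewrite /c' big_seq; elim/big_ind: _ => [|a b|z zz]; first exact: (cid0 block0_ideal).
    exact: (cidD block0_ideal).
  have [/X0_block0[X1 b1 _] _] := Xz _ zz.
  by apply: (cidr _ block0_ideal); exact: T_block0.
- by rewrite -jn_nm c'E.
- move=> w hw; rewrite /c' (io_sum rep) big_seq big1// => z zz.
  have [_ /X0_block0[X2 b2 _]] := Xz _ zz.
  rewrite (ioM rep) (_ : iota (astar _) w = 0) ?(lin0 (io_linear rep _))//.
  by apply: dotpp_eq0; rewrite (io_star' rep) hw.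
Qed.

End Assembly.

Local Close Scope complex_scope.

Theorem corollary5p3 (R : realType) (A : cstarType R)
    (U : hilbertType R) (iota : A -> U -> U) (iota_univ : universal iota)
    (p1 p2 : U -> U)
    (p1_open : open_projection iota p1) (p2_open : open_projection iota p2)
    (T : A -> A)
    (T_maps : forall x, X iota p1 p2 x -> X iota idfun p2 (T x))
    (T_linear : linear_on (X iota p1 p2) T)
    (T_local : local iota p1 p2 T) :
  exists (n : nat) (A_ : 'I_n.+1 -> set A) (H : 'I_n -> hilbertType R)
    (pi : forall i : 'I_n, A -> H i -> H i)
    (rho : forall i : 'I_n, (U -> U) -> H i -> H i)
    (t0 : U -> U) (t : forall i : 'I_n, H i -> H i),
    ((forall i, closed_ideal (A_ i)) /\
     direct_sum (ideal_gen (X iota p1 p2)) A_ /\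
     direct_sum (X iota p1 p2) (fun i => X iota p1 p2 `&` A_ i)) /\
    (forall i : 'I_n,
       [/\ irreducible (pi i),
           set_bij (A_ (lift ord0 i)) (@compact_op R (H i)) (pi i),
           normal_extension iota (pi i) (rho i)
         & linear_on (range (rho i p1)) (t i)]) /\
    bidual_of iota (A_ ord0) t0 /\
    forall x : 'I_n.+1 -> A, (forall i, (X iota p1 p2 `&` A_ i) (x i)) ->
      exists y : 'I_n.+1 -> A,
        [/\ forall i, A_ i (y i),
            T (\sum_(i < n.+1) x i) = \sum_(i < n.+1) y i,
            iota (y ord0) = t0 \o iota (x ord0)
          & forall i : 'I_n,
              pi i (y (lift ord0 i)) = t i \o pi i (x (lift ord0 i))].
Proof.
have lT := uni_local_map iota_univ p1_open p2_open T_maps T_linear T_local.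
have [s os s_unit] := K_unit lT.
have [r ir sr] := representatives (fun f fs => orth_minproj os fs).
have [C C0 T_bound] := bounded_off lT os s_unit.
pose B := @blocks _ _ _ iota p1 p2 r.
have hrep (i : 'I_(size r)) : exists _ : atom_rep iota p1 T (atom i), True.
  apply: (atom_rep_exists iota_univ p1_open p2_open T_linear).
  by rewrite (jn_atom ir); exact: (atom_minproj ir).
pose a i := projT1 (cid (hrep i)).
have approx := block0_multiplier iota_univ p1_open p2_open T_maps T_linear
  T_local os s_unit ir sr C0 T_bound.
have [t0 [ht0 t0E]] := continuous_part iota_univ.1 approx C0.
exists (size r), B, (fun i => atom_space (a i)), (fun i => @atom_pi _ _ _ _ _ _ _ (a i)),
  (fun i => @atom_rho _ _ _ _ _ _ _ (a i)), t0, (fun i => @atom_map _ _ _ _ _ _ _ (a i)).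
split.
  split; first exact: blocks_ideal.
  split; first exact: (ideal_direct_sum iota_univ p1_open p2_open T_maps T_linear
    T_local os s_unit ir sr).
  exact: (X_direct_sum iota_univ p1_open p2_open T_maps T_linear T_local os s_unit ir sr).
split.
  move=> i; split; [exact: atom_irr| |exact: atom_normal|exact: atom_linear].
  by rewrite /B blocks_lift; exact: atom_bij.
split; first by rewrite /B blocks_0.
(* [T] maps each summand of [X] into the corresponding ideal, so the components of the image are the
   images of the components. *)
move=> x hx; exists (fun i => T (x i)); split.
- move=> i; have [Xx] := hx i; rewrite /B /blocks; case: unlift => [j|] bx.
    exact: (T_block iota_univ p1_open p2_open T_maps T_linear T_local os s_unit ir sr).
  exact: (T_block0 iota_univ p1_open p2_open T_maps T_linear T_local os s_unit ir sr
    C0 T_bound).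
- apply: (local_sum iota_univ p1_open p2_open T_maps T_linear T_local _ _).2 => i.
  by case: (hx i).
- by apply: t0E; have := hx ord0; rewrite /B blocks_0.
- move=> i; apply: atom_mapE => c ce; have [Xx] := hx (lift ord0 i).
  rewrite /B blocks_lift => bx.
  exact: (T_col iota_univ p1_open p2_open T_maps T_linear T_local os s_unit ir sr Xx bx).
Qed.
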